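(* Let $p\in\{13,17\}$. Then the P-EF 3-fold $W_P^p$ of genus $p$ is embedded in $\mathbb{P}^p$ (by the morphism induced by the invariant quadrics, described in the context) and its ideal is generated by quadrics. Furthermore, $W_P^p$ has five non-similar singular points (i.e. the five points are not similar), with the following configuration: they can be labelled $P_1,\dots,P_5$ so that $P_5$ is associated with each of $P_1,P_2,P_3,P_4$, and no two of $P_1,P_2,P_3,P_4$ are associated. Moreover, four of these five points are quadruple points, whose tangent cone is a cone over a Veronese surface. If $p=13$, the last point is a quintuple point, whose tangent cone is a cone over the union of five planes; if $p=17$, the last point is a sextuple point, whose tangent cone is a cone over the union of four planes and a quadric surface.
   Context: We work over $\mathbb{C}$. Two distinct singular points of a threefold $W\subset\mathbb{P}^p$ are associated if the line joining them is contained in $W$. The configuration of the singular points is the graph recording which pairs are associated. The singular points of $W$ are similar if they have the same multiplicity, they have the same tangent cone (up to linear isomorphism), and there is an $m$ such that each of them is associated with exactly $m$ others. $W_P^{17}$: let $P\subset\mathbb{P}^8$ be the image of $\mathbb{P}^1\times\mathbb{P}^1$ via $[u_0:u_1]\times[v_0:v_1]\mapsto[y_{i,j}]_{0\le i,j\le2}$, $y_{i,j}=u_0^iu_1^{2-i}v_0^jv_1^{2-j}$. View $\mathbb{P}^8$ as the hyperplane $\{x=0\}$ of $\mathbb{P}^9$ with coordinates $y_{i,j}$ ($0\le i,j\le 2$) and $x$, and let $V\subset\mathbb{P}^9$ be the cone over $P$ whose vertex $v$ is the point with all $y_{i,j}=0$. The involution $x\mapsto-x$, $y_{i,j}\mapsto(-1)^{i+j}y_{i,j}$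 of $\mathbb{P}^9$ restricts to an involution $\tau$ of $V$ with five fixed points, and $W_P^{17}:=V/\tau$. The quotient map is given by the restriction to $V$ of the linear system of the quadrics $q_1(y_{0,0},y_{0,2},y_{1,1},y_{2,0},y_{2,2})+q_2(y_{0,1},y_{1,0},y_{1,2},y_{2,1},x)=0$, with $q_1,q_2$ quadratic forms. This restricted system induces a morphism from $V$ to $\mathbb{P}^{17}$ whose coordinates are $y_{1,1}^2$, $y_{0,0}^2$, $y_{0,2}^2$, $y_{2,0}^2$, $y_{2,2}^2$, $x^2$, $y_{0,1}^2$, $y_{1,0}^2$, $y_{1,2}^2$, $y_{2,1}^2$, $y_{0,1}x$, $y_{1,0}x$, $y_{1,2}x$, $y_{2,1}x$, $y_{0,0}y_{1,1}$, $y_{0,2}y_{1,1}$, $y_{2,0}y_{1,1}$, $y_{2,2}y_{1,1}$. $W_P^{13}$: let $S_6\subset\mathbb{P}^6_{[x_0:\dots:x_6]}$ be the smooth sextic Del Pezzo surface given by the closure of the image of $\mathbb{P}^2$ via $[u_0:u_1:u_2]\mapsto[u_1^2u_2:u_1u_2^2:u_0^2u_2:u_0u_2^2:u_0^2u_1:u_0u_1^2:u_0u_1u_2]$. View $\mathbb{P}^6$ as the hyperplane $\{y=0\}$ of $\mathbb{P}^7_{[x_0:\dots:x_6:y]}$, and let $V\subset\mathbb{P}^7$ be the cone over $S_6$ with vertex $v=[0:\dots:0:1]$. The involution $[x_0:\dots:x_6:y]\mapsto[x_2:x_4:x_0:x_5:x_1:x_3:x_6:-y]$ of $\mathbb{P}^7$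 restricts to an involution $\tau$ of $V$ with five fixed points, and $W_P^{13}:=V/\tau$. The quotient map is given by the restriction to $V$ of the linear system of the quadrics $q_1(x_0+x_2,x_1+x_4,x_3+x_5,x_6)+q_2(x_0-x_2,x_1-x_4,x_3-x_5,y)=0$, with $q_1,q_2$ quadratic forms. This restricted system induces a morphism from $V$ to $\mathbb{P}^{13}$ whose coordinates are $x_6^2$, $x_0^2+x_2^2$, $x_1^2+x_4^2$, $x_3^2+x_5^2$, $(x_0+x_2)x_6$, $(x_1+x_4)x_6$, $(x_3+x_5)x_6$, $x_0x_1+x_2x_4$, $x_2x_3+x_0x_5$, $x_1x_3+x_4x_5$, $(x_0-x_2)y$, $(x_1-x_4)y$, $(x_3-x_5)y$, $y^2$. The five singular points of $W_P^p$ are the images of the five fixed points of $\tau$. *)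

(* Defs.v *)
From HB Require Import structures.
From mathcomp Require Import all_boot all_order all_algebra.
From mathcomp Require Import classical_sets reals complex mpoly.

Set Implicit Arguments.
Unset Strict Implicit.
Unset Printing Implicit Defensive.

Import GRing.Theory.
Local Open Scope ring_scope.

(* A point of P^n is a nonzero row vector of length n+1, two vectors being     *)
(* the same point when they have the same row space, (u == v)%MS; a point w    *)
(* is on the line joining u and v when (w <= u + v)%MS. A subset of P^n is the *)
(* set of all the nonzero vectors representing its points. A polynomial F is   *)
(* evaluated at w : 'rV_n as F.@[w 0], since w 0 : 'I_n -> K.                  *)

Definition entry (K : fieldType) n (v : 'rV[K]_n.+1) (k : nat) : K :=
  v 0 (inord k).

Section Projective.
Variable K : fieldType.

Definition vanishing_ideal n (X : set 'rV[K]_n) : set {mpoly K[n]} :=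
  fun F => forall w, X w -> F.@[w 0] = 0.

Definition zariski_closure n (X : set 'rV[K]_n) : set 'rV[K]_n :=
  fun w => w != 0 /\ forall F, vanishing_ideal X F -> F.@[w 0] = 0.

Definition zariski_closed n (X : set 'rV[K]_n) : Prop :=
  forall w, X w <-> zariski_closure X w.

Definition zariski_open_in n (X U : set 'rV[K]_n) : Prop :=
  exists S : set {mpoly K[n]},
    (forall F, S F -> exists d, F \is d.-homog) /\
    (forall w, U w <-> X w /\ exists F, S F /\ F.@[w 0] != 0).

Definition saturated n (X : set 'rV[K]_n) : Prop :=
  (forall w, X w -> w != 0) /\
  (forall w w' : 'rV[K]_n, (w == w')%MS -> X w -> X w').

Definition well_defined n (f : 'rV[K]_n -> K) : Prop :=
  forall w w' : 'rV[K]_n, (w == w')%MS -> f w = f w'.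

(* The neighbourhood of u on which f = F / G is taken to be principal; as the  *)
(* principal open sets form a basis, this is no restriction.                   *)
Definition regular_on n (U : set 'rV[K]_n) (f : 'rV[K]_n -> K) : Prop :=
  forall u, U u -> exists d F G,
    [/\ F \is d.-homog, G \is d.-homog, G.@[u 0] != 0 &
        forall w, U w -> G.@[w 0] != 0 -> f w = F.@[w 0] / G.@[w 0]].

Definition ideal_gen n (S : set {mpoly K[n]}) : set {mpoly K[n]} :=
  fun F => exists s : seq ({mpoly K[n]} * {mpoly K[n]}),
    (forall gq, gq \in s -> S gq.2) /\ F = \sum_(gq <- s) gq.1 * gq.2.

Definition generated_by_quadrics n (I : set {mpoly K[n]}) : Prop :=
  exists S : set {mpoly K[n]},
    (forall Q, S Q -> Q \is 2.-homog) /\ (forall F, I F <-> ideal_gen S F).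

Definition proj_cone n (X : set 'rV[K]_n) (v : 'rV[K]_n) : set 'rV[K]_n :=
  fun w => w != 0 /\ exists2 y, X y & (w <= y + v)%MS.

Definition poly_map m n (q : n.-tuple {mpoly K[m]}) (v : 'rV[K]_m) : 'rV[K]_n :=
  \row_(k < n) (tnth q k).@[v 0].

Definition image_of m n (V : set 'rV[K]_m) (q : n.-tuple {mpoly K[m]}) :
    set 'rV[K]_n :=
  fun w => w != 0 /\ exists2 v, V v & (w == poly_map q v)%MS.

(* The forms q induce a morphism V -> P^(n-1) which factors through a closed   *)
(* embedding of V/tau. Here V/tau is the ringed space with the quotient        *)
(* topology whose regular functions are the tau-invariant regular functions    *)
(* of V, i.e. those of the form f \o phi by [qe_fibres]. Since phi maps V onto *)
(* its image W, the fields say that V/tau -> W is an isomorphism and that W    *)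
(* is closed.                                                                  *)
Record quotient_embedding m n (V : set 'rV[K]_m) (tau : 'rV[K]_m -> 'rV[K]_m)
    (q : n.-tuple {mpoly K[m]}) : Prop := QuotientEmbedding {
  qe_stable : forall v, V v -> V (tau v);
  qe_homog : exists d, forall k, tnth q k \is d.-homog;
  qe_base_point_free : forall v, V v -> poly_map q v != 0;
  qe_closed : zariski_closed (image_of V q);
  qe_fibres : forall v v', V v -> V v' ->
    (poly_map q v == poly_map q v')%MS <-> (v' == v)%MS \/ (v' == tau v)%MS;
  qe_topology : forall U : set 'rV[K]_n, saturated U ->
    (forall w, U w -> image_of V q w) ->
    (zariski_open_in (image_of V q) U <->
     zariski_open_in V (fun v => V v /\ U (poly_map q v)));
  qe_functions : forall (U : set 'rV[K]_n) (f : 'rV[K]_n -> K),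
    zariski_open_in (image_of V q) U -> well_defined f ->
    (regular_on U f <->
     regular_on (fun v => V v /\ U (poly_map q v)) (fun v => f (poly_map q v)))
}.

End Projective.

Section LocalGeometry.
Variables (K : fieldType) (p : nat).
Implicit Types (X : set 'rV[K]_p.+1) (w : 'rV[K]_p.+1).

(* Affine coordinates on P^p centred at w: z stands for the point w + z',      *)
(* where z' is z with a zero inserted at a position i such that w 0 i != 0.    *)
(* They identify the tangent space of P^p at w with 'rV_p.                     *)
Definition pivot w : 'I_p.+1 := odflt ord0 [pick i | w 0 i != 0].

Definition chart w (z : 'rV[K]_p) : 'rV[K]_p.+1 :=
  \row_k (w 0 k + (if unlift (pivot w) k is Some j then z 0 j else 0)).

Definition chart_ideal X w : set {mpoly K[p]} :=
  fun g => forall z, X (chart w z) -> g.@[z 0] = 0.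

Definition order_ge (k : nat) : set {mpoly K[p]} :=
  fun g => forall m, m \in msupp g -> (k <= mdeg m)%N.

Definition initial_form (g f : {mpoly K[p]}) : Prop :=
  exists d, f \is d.-homog /\ order_ge d.+1 (g - f).

(* The tangent cone is the subscheme of 'rV_p defined by this ideal.           *)
Definition tangent_cone X w : set {mpoly K[p]} :=
  ideal_gen (fun f => exists2 g, chart_ideal X w g & initial_form g f).

Definition tangent_space X w : set 'rV[K]_p :=
  fun z => forall g, chart_ideal X w g -> \sum_(j < p) g@_(U_(j)) * z 0 j = 0.

(* d is the dimension of X *)
Definition singular_point (d : nat) X w : Prop :=
  X w /\ ~ (exists2 L : 'M[K]_p, \rank L = d &
            forall z, tangent_space X w z <-> (z <= L)%MS).

Definition quotient_dim (J : set {mpoly K[p]}) (h : nat) : Prop :=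
  exists B : h.-tuple {mpoly K[p]}, forall G, exists! c : 'rV[K]_h,
    J (G - \sum_(i < h) c 0 i *: tnth B i).

(* O / m^k, for O the local ring of X at w, is K[z] / (chart_ideal + (z)^k),   *)
(* and its dimension is a polynomial in k for k large, with leading term       *)
(* e / d! * k ^ d for d the dimension of X and e the multiplicity.             *)
Definition multiplicity (d : nat) X w (e : nat) : Prop :=
  exists chi : {poly rat},
    [/\ (0 < e)%N, size chi = d.+1, lead_coef chi = e%:R / d`!%:R &
        exists k0, forall k, (k0 <= k)%N -> exists2 h, chi.[k%:R] = h%:R &
          quotient_dim
            (fun G => exists2 g, chart_ideal X w g & order_ge k (G - g)) h].

Definition associated X (u v : 'rV[K]_p.+1) : Prop :=
  ~~ (u == v)%MS /\ forall w, w != 0 -> (w <= u + v)%MS -> X w.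

(* f as a function of the coordinates z *m A *)
Definition linear_change (A : 'M[K]_p) (f : {mpoly K[p]}) : {mpoly K[p]} :=
  f \mPo [tuple \sum_(i < p) A i j *: 'X_i | j < p].

Definition linearly_isomorphic (J1 J2 : set {mpoly K[p]}) : Prop :=
  exists2 A : 'M[K]_p, A \in unitmx &
    forall f, J1 f <-> J2 (linear_change A f).

Definition similar_points (d : nat) X r (P : 'I_r -> 'rV[K]_p.+1) : Prop :=
  [/\ exists e, forall i, multiplicity d X (P i) e,
      forall i j, linearly_isomorphic (tangent_cone X (P i))
                                      (tangent_cone X (P j)) &
      exists m, forall i, exists2 A : {set 'I_r}, #|A| = m &
        forall j, j \in A <-> associated X (P i) (P j)].

End LocalGeometry.

Section Cones.
Variables (K : fieldType) (p : nat).

(* The subscheme of affine space defined by J is the (reduced) affine cone     *)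
(* over the projective set S.                                                  *)
Definition is_cone_over (J : set {mpoly K[p]}) (S : set 'rV[K]_p) : Prop :=
  forall f, J f <-> vanishing_ideal S f.

Definition veronese (t : 'rV[K]_3) : 'rV[K]_6 :=
  let t0 := entry t 0 in let t1 := entry t 1 in let t2 := entry t 2 in
  \row_(k < 6) [:: t0 ^+ 2; t0 * t1; t0 * t2; t1 ^+ 2; t1 * t2; t2 ^+ 2]`_k.

Definition veronese_surface (B : 'M[K]_(6, p)) : set 'rV[K]_p :=
  fun w => w != 0 /\ exists2 t, t != 0 & (w == veronese t *m B)%MS.

(* the projective plane spanned by the rows of L *)
Definition plane (L : 'M[K]_(3, p)) : set 'rV[K]_p :=
  fun w => w != 0 /\ (w <= L)%MS.

Definition distinct_planes r (L : 'I_r -> 'M[K]_(3, p)) : Prop :=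
  (forall i, row_free (L i)) /\ (forall i j, (L i == L j)%MS -> i = j).

(* the quadric surface q = 0 in the projective 3-space spanned by the rows of B *)
Definition quadric_surface (B : 'M[K]_(4, p)) (q : {mpoly K[4]}) :
    set 'rV[K]_p :=
  fun w => w != 0 /\ exists2 t : 'rV[K]_4, q.@[t 0] = 0 & w = t *m B.

Definition irreducible_quadric (q : {mpoly K[4]}) : Prop :=
  q \is 2.-homog /\
  forall l1 l2, l1 \is 1.-homog -> l2 \is 1.-homog -> q <> l1 * l2.

Definition cone_over_veronese (J : set {mpoly K[p]}) : Prop :=
  exists2 B : 'M[K]_(6, p), row_free B & is_cone_over J (veronese_surface B).

Definition cone_over_five_planes (J : set {mpoly K[p]}) : Prop :=
  exists2 L : 'I_5 -> 'M[K]_(3, p), distinct_planes L &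
    is_cone_over J (fun w => exists i, plane (L i) w).

Definition cone_over_four_planes_quadric (J : set {mpoly K[p]}) : Prop :=
  exists (L : 'I_4 -> 'M[K]_(3, p)) (B : 'M[K]_(4, p)) (q : {mpoly K[4]}),
    [/\ distinct_planes L, row_free B, irreducible_quadric q &
        is_cone_over J
          (fun w => (exists i, plane (L i) w) \/ quadric_surface B q w)].

End Cones.

Section Threefolds.
Variable K : fieldType.

(* Coordinates of P^9: y_{i,j} has index 3 * i + j and x has index 9.          *)
Definition segre22 (u v : 'rV[K]_2) : 'rV[K]_10 :=
  let y i j := u 0 0 ^+ i * u 0 1 ^+ (2 - i) * (v 0 0 ^+ j * v 0 1 ^+ (2 - j)) in
  \row_(k < 10) (if (k < 9)%N then y (k %/ 3)%N (k %% 3)%N else 0).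

Definition surfaceP : set 'rV[K]_10 :=
  fun w => w != 0 /\
    exists u v, [/\ u != 0, v != 0 & (w == segre22 u v)%MS].

Definition V17 : set 'rV[K]_10 := proj_cone surfaceP (delta_mx 0 ord_max).

Definition tau17 (w : 'rV[K]_10) : 'rV[K]_10 :=
  \row_(k < 10) (if (k < 9)%N then (-1) ^+ (k %/ 3 + k %% 3) * w 0 k
                 else - w 0 k).

Definition y17 (i j : nat) : {mpoly K[10]} := 'X_(inord (3 * i + j)).
Local Notation y := y17.

Definition quadrics17 : 18.-tuple {mpoly K[10]} :=
  let x : {mpoly K[10]} := 'X_(inord 9) in
  [tuple y 1 1 ^+ 2; y 0 0 ^+ 2; y 0 2 ^+ 2; y 2 0 ^+ 2; y 2 2 ^+ 2; x ^+ 2;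
         y 0 1 ^+ 2; y 1 0 ^+ 2; y 1 2 ^+ 2; y 2 1 ^+ 2;
         y 0 1 * x; y 1 0 * x; y 1 2 * x; y 2 1 * x;
         y 0 0 * y 1 1; y 0 2 * y 1 1; y 2 0 * y 1 1; y 2 2 * y 1 1].

(* Coordinates of P^7: x_k has index k for k <= 6 and y has index 7.           *)
Definition cubics6 (u : 'rV[K]_3) : 'rV[K]_8 :=
  let u0 := entry u 0 in let u1 := entry u 1 in let u2 := entry u 2 in
  \row_(k < 8) [:: u1 ^+ 2 * u2; u1 * u2 ^+ 2; u0 ^+ 2 * u2; u0 * u2 ^+ 2;
                   u0 ^+ 2 * u1; u0 * u1 ^+ 2; u0 * u1 * u2; 0]`_k.

Definition surfaceS6 : set 'rV[K]_8 :=
  zariski_closure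
    (fun w => w != 0 /\ exists2 u, cubics6 u != 0 & (w == cubics6 u)%MS).

Definition V13 : set 'rV[K]_8 := proj_cone surfaceS6 (delta_mx 0 ord_max).

Definition tau13 (w : 'rV[K]_8) : 'rV[K]_8 :=
  let x := entry w in
  \row_(k < 8) [:: x 2%N; x 4%N; x 0%N; x 5%N; x 1%N; x 3%N; x 6%N; - x 7%N]`_k.

Definition x13 (k : nat) : {mpoly K[8]} := 'X_(inord k).
Local Notation x := x13.

Definition quadrics13 : 14.-tuple {mpoly K[8]} :=
  let y : {mpoly K[8]} := 'X_(inord 7) in
  [tuple x 6 ^+ 2; x 0 ^+ 2 + x 2 ^+ 2; x 1 ^+ 2 + x 4 ^+ 2;
         x 3 ^+ 2 + x 5 ^+ 2;
         (x 0 + x 2) * x 6; (x 1 + x 4) * x 6; (x 3 + x 5) * x 6;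
         x 0 * x 1 + x 2 * x 4; x 2 * x 3 + x 0 * x 5; x 1 * x 3 + x 4 * x 5;
         (x 0 - x 2) * y; (x 1 - x 4) * y; (x 3 - x 5) * y; y ^+ 2].

End Threefolds.

Variant EF_case := P13 | P17.

Definition genus (c : EF_case) : nat :=
  match c with P13 => 13 | P17 => 17 end.

Definition cone_dim (c : EF_case) : nat :=
  match c with P13 => 8 | P17 => 10 end.

Definition cone (K : fieldType) (c : EF_case) : set 'rV[K]_(cone_dim c) :=
  match c with P13 => @V13 K | P17 => @V17 K end.
Arguments cone : clear implicits.

Definition involution (K : fieldType) (c : EF_case) :
    'rV[K]_(cone_dim c) -> 'rV[K]_(cone_dim c) :=
  match c with P13 => @tau13 K | P17 => @tau17 K end.
Arguments involution : clear implicits.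

Definition quadrics (K : fieldType) (c : EF_case) :
    (genus c).+1.-tuple {mpoly K[cone_dim c]} :=
  match c with P13 => quadrics13 K | P17 => quadrics17 K end.

Definition EF_threefold (K : fieldType) (c : EF_case) :
    set 'rV[K]_(genus c).+1 :=
  image_of (cone K c) (quadrics K c).
Arguments EF_threefold : clear implicits.

(* Main.v *)
Require Import Defs.
From HB Require Import structures.
From mathcomp Require Import all_boot all_order all_algebra.
From mathcomp Require Import classical_sets reals complex mpoly boolp ssrcomplements.
From mathcomp Require Import ring zify.

Set Implicit Arguments.
Unset Strict Implicit.
Unset Printing Implicit Defensive.

Import GRing.Theory Num.Theory.
Local Open Scope ring_scope.

(** In suitable coordinates of the ambient space the involution [tau] of the cone
    [V] is diagonal with entries 1 and -1, and [V] is the cone over a toric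
    surface. The proof treats this general situation and then inserts the two
    surfaces.

    The quotient. On [V] the products of two coordinates of equal sign are linear
    combinations of the given invariant quadrics, which are linearly independent
    ([invariant_quadrics]). A monomial of even degree in the coordinates of each
    sign is therefore, pair by pair, a product of linear forms in the quadrics,
    and modulo the quadrics through the image [W] the pairing does not matter. As
    the ideal of [V] is generated by quadrics, so is that of [W]
    ([quotient_ideal]). The pairs also give the rest of the embedding: the values
    of the products form symmetric matrices of rank one, so [W] is closed; the
    products determine the coordinates of each sign up to a sign, so the fibres
    are the orbits; and every form that is even in this sense descends, which
    yields the topology and the functions ([quotient_is_embedding]).

    The cones. [V] is defined by the quadratic relations between monomials of
    equal weight. They generate its ideal, because they reduce every monomial to
    one supported on a cell of a triangulation of the polygon, and such a monomial
    is determined by its weight ([toric_ideal]).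

    The singular points. Where a coordinate of each sign is nonzero, the quotient
    is etale and [W] is smooth ([free_point_smooth]). The remaining points of [V]
    are the five fixed points. At the image of such a point, quadrics through [W]
    with independent linear parts confine the tangent cone to a linear space, and
    quadrics without linear part give equations in this space. Conversely an
    initial form vanishes on the leading direction of every polynomial arc on [W]
    through the point ([arc_initial_form]). The two bounds agree
    ([adapted_cone]), since the ideal of the cone in question is generated by these
    equations and the leading directions are dense in it. The multiplicity is read
    off the Hilbert function of the cone ([multiplicity_of_hilbert]). Two kinds of
    cones occur: the cone over the Veronese surface, which is itself a quotient as
    above, and the cone over a surface and four planes meeting it in lines
    ([four_planes_generated]), where the surface is a quadric or a plane.

    The configuration. Four of the fixed points have even coordinates only, the
    vertex of [V] has an odd one only, and [V] contains the lines joining it to the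
    others; as a form in even and odd coordinates has no mixed terms, these lines
    are mapped to lines. On the line joining the images of two even points the
    products of coordinates would have rank two ([not_associated]). So one point is
    associated with four others and the others with one. *)

(** * Polynomial identities and ideals *)

Section PolynomialTools.
Variable K : numFieldType.

(** Kronecker's substitution: for large b the exponents sum m_i b^i of the
    monomials of a polynomial are distinct, so evaluating at x_i = t^(b^i)
    turns it into a univariate polynomial with the same coefficients. *)
Lemma kronecker_inj n b (m m' : 'I_n -> nat) :
  (forall i, m i < b)%N -> (forall i, m' i < b)%N ->
  (\sum_i m i * b ^ i = \sum_i m' i * b ^ i)%N -> m =1 m'.
Proof.
elim: n m m' => [|n IH] m m' hm hm' ; first by move=> _ [].
rewrite !big_ord_recl /= !muln1.
have tail (x : 'I_n.+1 -> nat) :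
  (\sum_(i < n) x (lift ord0 i) * b ^ bump 0 i =
   b * \sum_(i < n) x (lift ord0 i) * b ^ i)%N.
  rewrite big_distrr /=; apply: eq_bigr => i _.
  by rewrite /bump /= add1n expnS mulnCA.
rewrite !tail => E.
have b_gt0 : (0 < b)%N by apply: leq_ltn_trans (hm ord0).
have E0 : m ord0 = m' ord0.
  have := congr1 (modn^~ b) E.
  by rewrite ![(_ + b * _)%N]addnC ![(b * _)%N]mulnC !modnMDl !modn_small.
have E1 := IH _ _ (fun i => hm (lift ord0 i)) (fun i => hm' (lift ord0 i)).
move=> i; have [j ->|->] := unliftP ord0 i; last exact: E0.
apply: E1; apply/eqP; rewrite -(eqn_pmul2l b_gt0); apply/eqP.
by move: E; rewrite E0 => /addnI.
Qed.

Lemma poly_eval_eq0 (P : {poly K}) : (forall t, P.[t] = 0) -> P = 0.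
Proof.
move=> P0; apply/eqP/negPn/negP => nzP.
have := @max_poly_roots K P [seq i%:R | i <- iota 0 (size P)] nzP.
rewrite size_map size_iota ltnn => H; suff: false by []; apply: H.
  by apply/allP => x _; rewrite /root P0.
by rewrite map_inj_uniq ?iota_uniq // => i j /eqP; rewrite eqr_nat => /eqP.
Qed.

Lemma mpoly_eval_eq0 n (F : {mpoly K[n]}) :
  (forall v : 'rV[K]_n, F.@[v 0] = 0) -> F = 0.
Proof.
move=> F0; apply/mpolyP => m0; rewrite mcoeff0.
have [m0F|/memN_msupp_eq0 //] := boolP (m0 \in msupp F).
pose b := (msize F).+1; pose k (m : 'X_{1..n}) := (\sum_(i < n) m i * b ^ i)%N.
pose P : {poly K} := \sum_(m <- msupp F) F@_m *: 'X^(k m).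
have small m : m \in msupp F -> forall i, (m i < b)%N.
  move=> /msize_mdeg_lt mF i; rewrite /b ltnS; apply: leq_trans (ltnW mF).
  by rewrite mdegE (bigD1 i) //= leq_addr.
have P0 : P = 0.
  apply: poly_eval_eq0 => t.
  rewrite -(F0 (\row_i t ^+ (b ^ i))) mevalE horner_sum; apply: eq_bigr => m _.
  rewrite hornerZ hornerXn /k expr_sum; congr (_ * _); apply: eq_bigr => i _.
  by rewrite mxE -exprM mulnC.
have := congr1 (fun p : {poly K} => p`_(k m0)) P0.
rewrite coef0 coef_sum (bigD1_seq m0) //= ?msupp_uniq // coefZ coefXn eqxx mulr1.
rewrite big_seq_cond big1 ?addr0 // => m /andP[mF nm].
rewrite coefZ coefXn; case: eqP => [E|]; last by rewrite mulr0.
case/eqP: nm; apply/mnmP => i; apply/esym; move: i.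
by apply: (kronecker_inj (b := b)) => //; exact: small.
Qed.

Lemma mpoly_eval_inj n (F G : {mpoly K[n]}) :
  (forall v : 'rV[K]_n, F.@[v 0] = G.@[v 0]) -> F = G.
Proof.
move=> E; apply/eqP; rewrite -subr_eq0; apply/eqP; apply: mpoly_eval_eq0 => v.
by rewrite mevalB E subrr.
Qed.

(** Since [F * G] vanishes everywhere and the polynomial ring is a domain. *)
Lemma mpoly_eval_dense n (F G : {mpoly K[n]}) : G != 0 ->
  (forall v : 'rV[K]_n, G.@[v 0] != 0 -> F.@[v 0] = 0) -> F = 0.
Proof.
move=> nzG FG; apply/eqP; have : F * G == 0.
  apply/eqP/mpoly_eval_eq0 => v; rewrite mevalM.
  by have [->|/FG ->] := eqVneq G.@[v 0] 0; rewrite ?mulr0 ?mul0r.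
by rewrite mulf_eq0 (negPf nzG) orbF.
Qed.

Lemma mpoly_ring_ind n (P : {mpoly K[n]} -> Prop) :
  (forall c, P c%:MP) -> (forall i, P 'X_i) ->
  (forall F G, P F -> P G -> P (F + G)) ->
  (forall F G, P F -> P G -> P (F * G)) -> forall F, P F.
Proof.
move=> PC PX PD PM F; rewrite (mpolyE F).
have P0 : P 0 by rewrite -mpolyC0.
elim/big_rec: _ => // m G _ PG; apply: (PD) PG.
rewrite -mul_mpolyC; apply: (PM) => //; rewrite mpolyXE_id.
elim/big_rec: _ => [|i G' _ PG']; first by rewrite -mpolyC1.
by apply: (PM) PG'; elim: (m i) => [|k IH]; rewrite ?expr0 -?mpolyC1 // exprS; apply: (PM).
Qed.

(** ** Linear maps given on monomials *)

Definition lext n (A : lmodType K) (psi : 'X_{1..n} -> A) (F : {mpoly K[n]}) : A :=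
  \sum_(m <- msupp F) F@_m *: psi m.

Lemma lextwE n (A : lmodType K) (psi : 'X_{1..n} -> A) F k :
  (msize F <= k)%N -> lext psi F = \sum_(m : 'X_{1..n < k}) F@_m *: psi m.
Proof.
move=> le_pk; rewrite /lext (big_mksub 'X_{1..n < k}) ?msupp_uniq //=.
  rewrite big_rmcond //= => i; move/memN_msupp_eq0 ->.
  by rewrite scale0r.
by move=> m /msize_mdeg_lt /leq_trans; apply.
Qed.

Lemma lextD n (A : lmodType K) (psi : 'X_{1..n} -> A) F G :
  lext psi (F + G) = lext psi F + lext psi G.
Proof.
pose k := maxn (msize (F + G)) (maxn (msize F) (msize G)).
rewrite !(@lextwE _ _ _ _ k) /k ?leq_maxl // -?big_split /=.
- by apply: eq_bigr => m _; rewrite mcoeffD scalerDl.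
- by rewrite !leq_max leqnn !orbT.
- by rewrite !leq_max leqnn !orbT.
Qed.

Lemma lextZ n (A : lmodType K) (psi : 'X_{1..n} -> A) c F :
  lext psi (c *: F) = c *: lext psi F.
Proof.
rewrite (@lextwE _ _ _ (c *: F) (msize F)) ?msizeZ_le //.
rewrite (@lextwE _ _ _ F (msize F)) // scaler_sumr.
by apply: eq_bigr => m _; rewrite mcoeffZ scalerA.
Qed.

Lemma lextX n (A : lmodType K) (psi : 'X_{1..n} -> A) m :
  lext psi 'X_[m] = psi m.
Proof. by rewrite /lext msuppX big_seq1 mcoeffX eqxx scale1r. Qed.

Lemma lext0 n (A : lmodType K) (psi : 'X_{1..n} -> A) : lext psi 0 = 0.
Proof. by rewrite /lext msupp0 big_nil. Qed.

Lemma lext_sum n (A : lmodType K) (psi : 'X_{1..n} -> A) I (r : seq I) P F :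
  lext psi (\sum_(i <- r | P i) F i) = \sum_(i <- r | P i) lext psi (F i).
Proof. by apply: (big_morph _ (lextD psi)); exact: lext0. Qed.

(** ** Ideals *)

Section IdealGen.
Variables (n : nat) (S : set {mpoly K[n]}).
Implicit Types F G : {mpoly K[n]}.

Lemma ideal_gen0 : ideal_gen S 0.
Proof. by exists [::]; rewrite big_nil. Qed.

Lemma ideal_genD F G : ideal_gen S F -> ideal_gen S G -> ideal_gen S (F + G).
Proof.
move=> [s [hs ->]] [s' [hs' ->]]; exists (s ++ s'); rewrite big_cat; split=> //.
by move=> gq; rewrite mem_cat => /orP[/hs|/hs'].
Qed.

Lemma ideal_genM F G : ideal_gen S G -> ideal_gen S (F * G).
Proof.
move=> [s [hs ->]]; exists [seq (F * gq.1, gq.2) | gq <- s]; split.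
  by move=> _ /mapP[gq /hs ? ->].
by rewrite big_map big_distrr; apply: eq_bigr => gq _ /=; rewrite mulrA.
Qed.

Lemma ideal_gen1 F : S F -> ideal_gen S F.
Proof.
move=> SF; exists [:: (1, F)]; rewrite big_seq1 mul1r; split=> //.
by move=> gq; rewrite inE => /eqP ->.
Qed.

Lemma ideal_genZ c F : ideal_gen S F -> ideal_gen S (c *: F).
Proof. by rewrite -mul_mpolyC; exact: ideal_genM. Qed.

Lemma ideal_genN F : ideal_gen S F -> ideal_gen S (- F).
Proof. by rewrite -scaleN1r; exact: ideal_genZ. Qed.

Lemma ideal_genB F G : ideal_gen S F -> ideal_gen S G -> ideal_gen S (F - G).
Proof. by move=> hF hG; apply: ideal_genD => //; apply: ideal_genN. Qed.

Lemma ideal_gen_sum I (r : seq I) (P : pred I) (F : I -> {mpoly K[n]}) :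
  (forall i, P i -> ideal_gen S (F i)) -> ideal_gen S (\sum_(i <- r | P i) F i).
Proof.
move=> hF; elim/big_ind: _ => //; first exact: ideal_gen0.
exact: ideal_genD.
Qed.

Lemma ideal_gen_min (J : set {mpoly K[n]}) :
  J 0 -> (forall F G, J F -> J G -> J (F + G)) ->
  (forall F G, J G -> J (F * G)) -> (forall F, S F -> J F) ->
  forall F, ideal_gen S F -> J F.
Proof.
move=> J0 JD JM JS F [s [hs ->]]; rewrite big_seq.
by elim/big_ind: _ => // gq /hs Sq; apply: JM; apply: JS.
Qed.

End IdealGen.

Lemma ideal_gen_comp n k (S : set {mpoly K[k]}) (F : {mpoly K[n]})
    (x x' : n.-tuple {mpoly K[k]}) :
  (forall i, ideal_gen S (tnth x i - tnth x' i)) ->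
  ideal_gen S ((F \mPo x) - (F \mPo x')).
Proof.
move=> hx; elim/mpoly_ring_ind: F => [c|i|F G hF hG|F G hF hG].
- by rewrite !comp_mpolyC subrr; exact: ideal_gen0.
- by rewrite !comp_mpolyXU -!tnth_nth.
- by rewrite !comp_mpolyD opprD addrACA; exact: ideal_genD.
rewrite !rmorphM /=.
have -> (a b c d : {mpoly K[k]}) : a * b - c * d = b * (a - c) + c * (b - d) by ring.
by apply: ideal_genD; apply: ideal_genM.
Qed.

(** ** Homogeneous forms *)

Lemma dhomog_eval n d (F : {mpoly K[n]}) c (v : 'rV[K]_n) :
  F \is d.-homog -> F.@[(c *: v) 0] = c ^+ d * F.@[v 0].
Proof.
move/dhomogP => hF; rewrite !mevalE big_distrr /= big_seq [RHS]big_seq.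
apply: eq_bigr => m mF; rewrite mulrCA; congr (_ * _).
rewrite -(hF _ mF) /= mdegE -prodrXr -big_split.
by apply: eq_bigr => i _; rewrite mxE exprMn.
Qed.

Lemma dhomog_meval0 n d (F : {mpoly K[n]}) :
  (0 < d)%N -> F \is d.-homog -> F.@[(0 : 'rV[K]_n) 0] = 0.
Proof.
by move=> d_gt0 /(@dhomog_eval _ _ _ 0 0); rewrite scaler0 expr0n gtn_eqF // mul0r.
Qed.

Lemma dhomog_comp n k d e (F : {mpoly K[n]}) (x : n.-tuple {mpoly K[k]}) :
  (forall i, tnth x i \is d.-homog) -> F \is e.-homog ->
  F \mPo x \is (d * e)%N.-homog.
Proof.
move=> hx /dhomogP hF; rewrite comp_mpolyEX big_seq; apply: rpred_sum => m /hF /= <-.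
apply: rpredZ; rewrite comp_mpolyX mdegE big_distrr /=.
elim/big_rec2: _ => [|i e' G _ hG]; first exact: dhomog1.
by apply: dhomogM => //; apply: dhomogMn.
Qed.

Definition lsubst n k (A : 'M[K]_(k, n)) (F : {mpoly K[n]}) : {mpoly K[k]} :=
  F \mPo [tuple \sum_(i < k) A i j *: 'X_i | j < n].

Lemma lin_homog k (c : 'I_k -> K) : \sum_(i < k) c i *: 'X_i \is 1.-homog.
Proof.
by apply: rpred_sum => i _; apply: rpredZ; rewrite dhomogX /= mdeg1.
Qed.

Lemma lin_eval k (c : 'I_k -> K) (v : 'I_k -> K) :
  (\sum_(i < k) c i *: 'X_i).@[v] = \sum_(i < k) c i * v i.
Proof. by rewrite raddf_sum; apply: eq_bigr => i _; rewrite /= mevalZ mevalXU. Qed.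

Lemma lsubst_eval n k (A : 'M[K]_(k, n)) F (z : 'rV[K]_k) :
  (lsubst A F).@[z 0] = F.@[(z *m A) 0].
Proof.
rewrite comp_mpoly_meval; apply: meval_eq => j.
by rewrite tnth_mktuple lin_eval mxE; apply: eq_bigr => i _; rewrite mulrC.
Qed.

Lemma lsubst0 n k (A : 'M[K]_(k, n)) : lsubst A 0 = 0.
Proof. exact: comp_mpoly0. Qed.

Lemma lsubstD n k (A : 'M[K]_(k, n)) F G : lsubst A (F + G) = lsubst A F + lsubst A G.
Proof. exact: comp_mpolyD. Qed.

Lemma lsubstM n k (A : 'M[K]_(k, n)) F G : lsubst A (F * G) = lsubst A F * lsubst A G.
Proof. by rewrite /lsubst rmorphM. Qed.

Lemma lsubst_linear n k (A : 'M[K]_(k, n)) : linear (lsubst A : {mpoly K[n]} -> {mpoly K[k]}).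
Proof. by move=> c F G; rewrite lsubstD /lsubst comp_mpolyZ. Qed.

Lemma lsubst_homog n k (A : 'M[K]_(k, n)) d F :
  F \is d.-homog -> lsubst A F \is d.-homog.
Proof.
move=> hF; rewrite -[d]mul1n; apply: dhomog_comp => // j.
by rewrite tnth_mktuple lin_homog.
Qed.

Lemma linear_form n (F : {mpoly K[n]}) :
  F \is 1.-homog -> F = \sum_(i < n) F@_U_(i) *: 'X_i.
Proof.
move=> hF; apply/mpolyP => m; rewrite raddf_sum /=.
under eq_bigr do rewrite mcoeffZ mcoeffX.
have [/mdeg1P[j /eqP ->]|md] := boolP (mdeg m == 1%N).
  rewrite (bigD1 j) //= eqxx mulr1 big1 ?addr0 // => i ij.
  by rewrite eq_mnm1 (negPf ij) mulr0.
rewrite (dhomog_nemf_coeff hF md) big1 // => i _.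
by case: eqP => [E|]; rewrite ?mulr0 //; rewrite -E mdeg1 eqxx in md.
Qed.

Lemma mdeg2P n (m : 'X_{1..n}) :
  mdeg m = 2%N -> exists i j, m = (U_(i) + U_(j))%MM.
Proof.
move=> md; have [i mi] : exists i, m i != 0%N.
  apply/existsP; rewrite -negb_forall; apply/negP => /forallP m0.
  by move: md; rewrite mdegE big1 // => i _; apply/eqP.
have E : m = (m - U_(i) + U_(i))%MM by rewrite submK // lep1mP.
have /eqP/mdeg1P[j /eqP Ej] : mdeg (m - U_(i)) = 1%N.
  by move: md; rewrite {1}E mdegD mdeg1 addn1 => -[].
by exists j, i; rewrite E Ej.
Qed.

Lemma quadratic_form n (F : {mpoly K[n]}) : F \is 2.-homog ->
  exists g : 'M[K]_n, F = \sum_i \sum_j g i j *: ('X_i * 'X_j).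
Proof.
move=> /dhomogP hF; rewrite (mpolyE F) big_seq.
elim/big_ind: _ => [|F1 F2 [g1 ->] [g2 ->]|m /hF /= /mdeg2P[a [b ->]]].
- exists 0; rewrite big1 // => i _; rewrite big1 // => j _; by rewrite mxE scale0r.
- exists (g1 + g2); rewrite -big_split; apply: eq_bigr => i _.
  by rewrite -big_split; apply: eq_bigr => j _; rewrite mxE scalerDl.
exists (F@_(U_(a) + U_(b)) *: delta_mx a b).
rewrite (bigD1 a) //= (bigD1 b) //= !mxE !eqxx mulr1 mpolyXD.
rewrite !big1 ?addr0 // => [i ia|j jb].
  by rewrite big1 // => j _; rewrite !mxE (negPf ia) mulr0 scale0r.
by rewrite !mxE (negPf jb) andbF mulr0 scale0r.
Qed.

Lemma quadratic_eval n (g : 'M[K]_n) (v : 'I_n -> K) :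
  (\sum_i \sum_j g i j *: ('X_i * 'X_j)).@[v] = \sum_i \sum_j g i j * (v i * v j).
Proof.
rewrite raddf_sum; apply: eq_bigr => i _; rewrite raddf_sum; apply: eq_bigr => j _.
by rewrite /= mevalZ mevalM !mevalXU.
Qed.

(** A polynomial that vanishes on a coordinate hyperplane is divisible by the
    coordinate: substituting 0 for that coordinate changes it by a multiple. *)
Lemma divide_coordinate n (F : {mpoly K[n]}) (i : 'I_n) :
  (forall v : 'rV[K]_n, v 0 i = 0 -> F.@[v 0] = 0) -> exists G, F = 'X_i * G.
Proof.
move=> F0.
have F00 : F \mPo [tuple if j == i then 0 else 'X_j | j < n] = 0.
  apply: mpoly_eval_eq0 => v; rewrite comp_mpoly_meval.
  rewrite -(F0 (\row_j if j == i then 0 else v 0 j)) ?mxE ?eqxx //.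
  apply: meval_eq => j; rewrite mxE tnth_mktuple; case: eqP => _.
    by rewrite meval0.
  by rewrite mevalXU.
have : ideal_gen (fun G => G = 'X_i) F.
  rewrite -(comp_mpoly_id F) -[X in ideal_gen _ X]subr0 -F00.
  apply: ideal_gen_comp => j; rewrite !tnth_mktuple; case: eqP => [->|_].
    by rewrite subr0; apply: ideal_gen1.
  by rewrite subrr; apply: ideal_gen0.
apply: (ideal_gen_min (J := fun F => exists G, F = 'X_i * G)) => [|F1 F2 [G1 ->] [G2 ->]|F1 F2 [G ->]|_ ->].
- by exists 0; rewrite mulr0.
- by exists (G1 + G2); rewrite mulrDr.
- by exists (F1 * G); rewrite mulrCA.
by exists 1; rewrite mulr1.
Qed.

Lemma div_coordinate n d (F : {mpoly K[n]}) (i : 'I_n) : F \is d.-homog ->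
  (forall v : 'rV[K]_n, v 0 i = 0 -> F.@[v 0] = 0) ->
  exists2 G, (if d is d'.+1 then G \is d'.-homog else G == 0) & F = 'X_i * G.
Proof.
move=> hF /divide_coordinate[G E].
have GM m : G@_m = F@_(m + U_(i)) by rewrite E mulrC [(m + _)%MM]addmC mcoeffMX.
case: d hF => [|d] hF; exists G => //; last first.
  apply/dhomogP => m; rewrite mcoeff_msupp GM -mcoeff_msupp => /(dhomog_mf hF) /=.
  by rewrite mdegD mdeg1 addn1 => -[].
apply/eqP/mpolyP => m; rewrite GM mcoeff0; apply: (dhomog_nemf_coeff hF).
by rewrite /= mdegD mdeg1 addn1.
Qed.

(** ** Directional derivatives *)

Definition ddir n (F : {mpoly K[n]}) (v u : 'I_n -> K) : K :=
  \sum_(i < n) (F^`M(i)).@[v] * u i.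

Lemma ddirD n (F G : {mpoly K[n]}) v u : ddir (F + G) v u = ddir F v u + ddir G v u.
Proof.
by rewrite /ddir -big_split; apply: eq_bigr => i _; rewrite mderivD mevalD mulrDl.
Qed.

Lemma ddirM n (F G : {mpoly K[n]}) v u :
  ddir (F * G) v u = ddir F v u * G.@[v] + F.@[v] * ddir G v u.
Proof.
rewrite /ddir mulr_suml mulr_sumr -big_split; apply: eq_bigr => i _ /=.
by rewrite mderivM mevalD !mevalM mulrDl !mulrA; congr (_ + _); rewrite mulrAC.
Qed.

Lemma ddirC n c v u : ddir (c%:MP : {mpoly K[n]}) v u = 0.
Proof. by rewrite /ddir big1 // => i _; rewrite mderivC meval0 mul0r. Qed.

Lemma ddirX n (i : 'I_n) v u : ddir 'X_i v u = u i.
Proof.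
rewrite /ddir (bigD1 i) //= mderivX mnm1E eqxx -[X in (X - _)%MM]add0m addmK.
rewrite mpolyX0 scale1r meval1 mul1r big1 ?addr0 // => j ji.
by rewrite mderivX mnm1E eq_sym (negPf ji) scale0r meval0 mul0r.
Qed.

Lemma ddirZ n c (F : {mpoly K[n]}) v u : ddir (c *: F) v u = c * ddir F v u.
Proof. by rewrite -mul_mpolyC ddirM ddirC mevalC mul0r add0r. Qed.

Lemma ddirB n (F G : {mpoly K[n]}) v u : ddir (F - G) v u = ddir F v u - ddir G v u.
Proof. by rewrite ddirD -scaleN1r ddirZ mulN1r. Qed.

Lemma ddir0 n v u : ddir (0 : {mpoly K[n]}) v u = 0.
Proof. by rewrite -(subrr 0) ddirB subrr. Qed.

Lemma ddir_sum n I (r : seq I) (P : pred I) (F : I -> {mpoly K[n]}) v u :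
  ddir (\sum_(i <- r | P i) F i) v u = \sum_(i <- r | P i) ddir (F i) v u.
Proof.
by apply: (big_morph (fun F => ddir F v u)) => [F1 F2|]; rewrite ?ddirD ?ddir0.
Qed.

Lemma ddir_lin n (c : 'I_n -> K) v u :
  ddir (\sum_i c i *: 'X_i) v u = \sum_i c i * u i.
Proof. by rewrite ddir_sum; apply: eq_bigr => i _; rewrite ddirZ ddirX. Qed.

Lemma ddir_quadratic n (g : 'M[K]_n) v u :
  ddir (\sum_i \sum_j g i j *: ('X_i * 'X_j)) v u =
  \sum_i \sum_j g i j * (u i * v j + v i * u j).
Proof.
rewrite ddir_sum; apply: eq_bigr => i _; rewrite ddir_sum; apply: eq_bigr => j _.
by rewrite ddirZ ddirM !ddirX !mevalXU.
Qed.

Lemma ddir_lsubst n k (A : 'M[K]_(k, n)) (F : {mpoly K[n]}) (v u : 'rV[K]_k) :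
  ddir (lsubst A F) (v 0) (u 0) = ddir F ((v *m A) 0) ((u *m A) 0).
Proof.
elim/mpoly_ring_ind: F => [c|i|F G hF hG|F G hF hG].
- by rewrite /lsubst comp_mpolyC !ddirC.
- rewrite /lsubst comp_mpolyXU -tnth_nth tnth_mktuple ddir_lin ddirX mxE.
  by apply: eq_bigr => j _; rewrite mulrC.
- by rewrite /lsubst comp_mpolyD !ddirD -!/(lsubst A _) hF hG.
by rewrite /lsubst rmorphM /= !ddirM -!/(lsubst A _) hF hG !lsubst_eval.
Qed.

(** The chain rule along a polynomial arc. *)
Lemma arc_deriv n (F : {mpoly K[n]}) (A : 'I_n -> {poly K}) :
  exists P : {poly K}, (forall t, P.[t] = F.@[fun i => (A i).[t]]) /\
    P^`().[0] = ddir F (fun i => (A i).[0]) (fun i => (A i)^`().[0]).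
Proof.
elim/mpoly_ring_ind: F => [c|i|F G [P [hP dP]] [Q [hQ dQ]]|F G [P [hP dP]] [Q [hQ dQ]]].
- exists c%:P; rewrite derivC horner0 ddirC; split=> // t.
  by rewrite hornerC mevalC.
- by exists (A i); rewrite ddirX; split=> // t; rewrite mevalXU.
- exists (P + Q); rewrite derivD hornerD dP dQ ddirD; split=> // t.
  by rewrite hornerD mevalD hP hQ.
exists (P * Q); rewrite derivM hornerD !hornerM dP dQ ddirM hP hQ; split=> // t.
by rewrite hornerM mevalM hP hQ.
Qed.

(** ** Points of projective space *)

Lemma eqrVP n (u v : 'rV[K]_n) :
  reflect (exists2 c, c != 0 & u = c *: v) (u == v)%MS.
Proof.
apply: (iffP andP) => [[/sub_rVP[c ->] h]|[c c0 ->]]; last first.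
  split; apply/sub_rVP; first by exists c.
  by exists c^-1; rewrite scalerA mulVf // scale1r.
have [c0|c0] := eqVneq c 0; last by exists c.
move: h; rewrite c0 scale0r => /sub_rVP[d ->]; rewrite scaler0.
by exists 1; rewrite ?oner_eq0 ?scaler0.
Qed.

End PolynomialTools.

(** * Quotients of a projective variety by a diagonal involution *)

(** The entries y_i of [v *m M] are coordinates on which [tau] acts by the signs
    [neg i]; [l a b] are the coefficients of a linear form in the quadrics [q]
    that restricts to y_a y_b on [V]. *)
Record invariant_quadrics (K : numClosedFieldType) m n (V : set 'rV[K]_m)
    (tau : 'rV[K]_m -> 'rV[K]_m) (q : n.-tuple {mpoly K[m]})
    (M : 'M[K]_m) (neg : pred 'I_m) (l : 'I_m -> 'I_m -> 'rV[K]_n) : Prop :=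
  InvariantQuadrics {
  iq_unit : M \in unitmx;
  iq_nz : forall v, V v -> v != 0;
  iq_scale : forall v c, V v -> c != 0 -> V (c *: v);
  iq_closed : forall v : 'rV[K]_m, v != 0 ->
    (forall Q, Q \is 2.-homog -> vanishing_ideal V Q -> Q.@[v 0] = 0) -> V v;
  iq_ideal : forall F, vanishing_ideal V F ->
    ideal_gen (fun Q => Q \is 2.-homog /\ vanishing_ideal V Q) F;
  iq_tau : forall v i, (tau v *m M) 0 i = (-1) ^+ neg i * (v *m M) 0 i;
  iq_stable : forall v, V v -> V (tau v);
  iq_homog : forall k, tnth q k \is 2.-homog;
  iq_inv : forall k v, (tnth q k).@[(tau v) 0] = (tnth q k).@[v 0];
  iq_lift : forall a b, neg a = neg b -> forall v, V v ->
    \sum_k l a b 0 k * (tnth q k).@[v 0] = (v *m M) 0 a * (v *m M) 0 b;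
  iq_indep : forall c : 'rV[K]_n,
    (forall v, V v -> \sum_k c 0 k * (tnth q k).@[v 0] = 0) -> c = 0
}.

Section InvariantQuotient.
Variables (K : numClosedFieldType) (m n : nat) (V : set 'rV[K]_m).
Variables (tau : 'rV[K]_m -> 'rV[K]_m) (q : n.-tuple {mpoly K[m]}).
Variables (M : 'M[K]_m) (neg : pred 'I_m) (l : 'I_m -> 'I_m -> 'rV[K]_n).
Hypothesis data : invariant_quadrics V tau q M neg l.

Local Notation phi := (poly_map q).
Local Notation y v i := ((v *m M) 0 i).
Local Notation W := (image_of V q).
Local Notation I := (vanishing_ideal W).
Local Notation D := (ideal_gen (fun Q => Q \is 2.-homog /\ I Q)).

Let L a b : {mpoly K[n]} := \sum_k l a b 0 k *: 'X_k.

Lemma phiE v k : phi v 0 k = (tnth q k).@[v 0].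
Proof. by rewrite mxE. Qed.

Lemma phiZ c v : phi (c *: v) = c ^+ 2 *: phi v.
Proof.
by apply/rowP => k; rewrite phiE [RHS]mxE phiE (dhomog_eval _ _ (iq_homog data k)).
Qed.

Lemma liftE v a b : V v -> neg a = neg b -> (L a b).@[phi v 0] = y v a * y v b.
Proof.
move=> Vv ab; rewrite lin_eval -(iq_lift data ab Vv).
by apply: eq_bigr => k _; rewrite phiE.
Qed.

Lemma y_eq0 (v : 'rV[K]_m) : (forall i, y v i = 0) -> v = 0.
Proof.
move=> y0; rewrite -(mulmxK (iq_unit data) v).
suff -> : v *m M = 0 by rewrite mul0mx.
by apply/rowP => i; rewrite y0 mxE.
Qed.

Lemma phi_neq0 v : V v -> phi v != 0.
Proof.
move=> Vv; apply/eqP => phi0; have /eqP[] := iq_nz data Vv.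
apply: y_eq0 => i; apply/eqP; rewrite -sqrf_eq0 expr2 -(liftE Vv (erefl (neg i))).
by rewrite phi0 (dhomog_meval0 _ (lin_homog _)).
Qed.

Lemma imageP w : W w <-> exists2 v, V v & w = phi v.
Proof.
split=> [[_ [v Vv /eqrVP[c c0 ->]]]|[v Vv ->]]; last first.
  by split; [exact: phi_neq0 | exists v => //; apply/eqrVP; exists 1; rewrite ?oner_eq0 ?scale1r].
exists (sqrtC c *: v); last by rewrite phiZ sqrtCK.
by apply: (iq_scale data) => //; rewrite sqrtC_eq0.
Qed.

Lemma vanishingP F : I F <-> forall v, V v -> F.@[phi v 0] = 0.
Proof.
split=> [IF v Vv|h w /imageP[v Vv ->]]; last exact: h.
by apply: IF; apply/imageP; exists v.
Qed.

Lemma linear_vanishing F : F \is 1.-homog -> I F -> F = 0.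
Proof.
move=> hF /vanishingP IF; rewrite (linear_form hF).
suff E : (\row_k F@_U_(k)) = 0 :> 'rV[K]_n.
  apply: big1 => k _; have := congr1 (fun r : 'rV[K]_n => r 0 k) E.
  by rewrite !mxE => ->; rewrite scale0r.
apply: (iq_indep data) => v Vv; rewrite -[RHS](IF v Vv) [in RHS](linear_form hF).
by rewrite lin_eval; apply: eq_bigr => k _; rewrite !mxE.
Qed.

Lemma quadric_in_D Q : Q \is 2.-homog -> (forall v, V v -> Q.@[phi v 0] = 0) -> D Q.
Proof. by move=> hQ IQ; apply: ideal_gen1; split=> //; apply/vanishingP. Qed.

Lemma liftLL a b c d : L a b * L c d \is 2.-homog.
Proof. by apply: (@dhomogM _ _ _ 1 _ 1); apply: lin_homog. Qed.

(** Both products restrict to y_a y_b y_c y_d on [V]. *)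
Lemma lift_exchange a b c d : neg a = neg b -> neg a = neg c -> neg a = neg d ->
  D (L a b * L c d - L a c * L b d).
Proof.
move=> ab ac ad; apply: quadric_in_D; first by rewrite rpredB ?liftLL.
move=> v Vv; rewrite mevalB !mevalM !liftE // -?ab -?ac //.
by ring.
Qed.

Lemma liftC a b : neg a = neg b -> L a b = L b a.
Proof.
move=> ab; apply/eqP; rewrite -subr_eq0; apply/eqP; apply: linear_vanishing.
  by rewrite rpredB ?lin_homog.
by apply/vanishingP => v Vv; rewrite mevalB !liftE // mulrC subrr.
Qed.

(** ** Lifting monomials of even parity *)

(** For a word with letters of a single sign this is a form on the target whose
    restriction to [V] is the product of the letters. *)
Fixpoint pair_prod (s : seq 'I_m) : {mpoly K[n]} :=
  if s is a :: b :: s' then L a b * pair_prod s' else 1.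

Lemma pair_prod_adj e s1 a b s2 :
  all (fun i => neg i == e) (s1 ++ a :: b :: s2) -> ~~ odd (size (s1 ++ s2)) ->
  D (pair_prod (s1 ++ a :: b :: s2) - pair_prod (s1 ++ b :: a :: s2)).
Proof.
have [k] := ubnP (size s1); elim: k s1 => // k IH [|c [|d s1]] /=.
- move=> _ /and3P[/eqP ha /eqP hb _] _.
  by rewrite (@liftC a b) ?ha // subrr; exact: ideal_gen0.
- clear IH; case: s2 => [|d s2] //= _ /and5P[/eqP hc /eqP ha /eqP hb /eqP hd _] _.
  rewrite !mulrA -mulrBl mulrC; apply: ideal_genM.
  by apply: lift_exchange; rewrite ?hc ?ha ?hb ?hd.
rewrite !ltnS negbK => hk /and3P[_ _ hs] os.
by rewrite -mulrBr; apply: ideal_genM; apply: IH => //; apply: ltnW.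
Qed.

(** Modulo the quadrics through [W] the lift of a word does not depend on the
    order of its letters: exchanging letters of two pairs is a quadratic
    relation between products of coordinates. *)
Lemma pair_prod_perm e s t : perm_eq s t ->
  all (fun i => neg i == e) s -> ~~ odd (size s) -> D (pair_prod s - pair_prod t).
Proof.
pose E s t := forall s0, all (fun i => neg i == e) (s0 ++ s) ->
  ~~ odd (size (s0 ++ s)) -> D (pair_prod (s0 ++ s) - pair_prod (s0 ++ t)).
have E_cons a s1 t1 : E s1 t1 -> E (a :: s1) (a :: t1).
  by move=> h s0; rewrite -!cat_rcons; apply: h.
have E_trans s1 s2 s3 : perm_eq s1 s2 -> E s1 s2 -> E s2 s3 -> E s1 s3.
  move=> p12 h12 h23 s0 ha hs; rewrite -(subrKA (pair_prod (s0 ++ s2))).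
  have p : perm_eq (s0 ++ s1) (s0 ++ s2) by rewrite perm_cat2l.
  apply: ideal_genD; [exact: h12 | apply: h23].
    by rewrite -(perm_all _ p).
  by rewrite -(perm_size p).
have E_refl s1 : E s1 s1 by move=> s0 _ _; rewrite subrr; exact: ideal_gen0.
have E_move a t1 t2 : E (a :: t1 ++ t2) (t1 ++ a :: t2).
  elim: t1 => [|b t1 IH] /=; first exact: E_refl.
  apply: (E_trans _ (b :: a :: t1 ++ t2)); last exact: E_cons.
    by rewrite (perm_catCA [:: a] [:: b]).
  move=> s0 h1 h2; apply: pair_prod_adj h1 _.
  by move: h2; rewrite !(size_cat s0) /= !addnS /= negbK.
suff Est : perm_eq s t -> E s t by move=> /Est /(_ [::]).
elim: s t => [|a s IH] t; first by rewrite perm_sym => /perm_nilP ->.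
move=> p; have /path.splitPr hst : a \in t by rewrite -(perm_mem p) mem_head.
case: hst p => t1 t2 p.
apply: (E_trans _ (a :: t1 ++ t2)); last exact: E_move.
  by apply: (perm_trans p); rewrite -cat1s perm_catCA.
apply/E_cons/IH; rewrite -(perm_cons a); apply: (perm_trans p).
by rewrite -cat1s perm_catCA.
Qed.

Definition pos_word (mm : 'X_{1..m}) := [seq i <- m2s mm | ~~ neg i].
Definition neg_word (mm : 'X_{1..m}) := [seq i <- m2s mm | neg i].

(** A monomial of odd degree in the coordinates of one sign is no function on the
    quotient; the value 0 makes the lift of forms a linear section of the
    pullback. *)
Definition lift_monomial (mm : 'X_{1..m}) : {mpoly K[n]} :=
  if odd (size (pos_word mm)) || odd (size (neg_word mm)) then 0
  else pair_prod (pos_word mm) * pair_prod (neg_word mm).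

Lemma count_m2s (mm : 'X_{1..m}) i : count_mem i (m2s mm) = mm i.
Proof. by rewrite -[in RHS](s2mK mm) /s2m mnmE. Qed.

Lemma m2sD (m1 m2 : 'X_{1..m}) : perm_eq (m2s (m1 + m2)) (m2s m1 ++ m2s m2).
Proof. by apply/allP => i _; rewrite /= count_cat !count_m2s mnmDE. Qed.

Lemma m2s1 i : m2s (U_(i) : 'X_{1..m}) = [:: i].
Proof.
apply/perm_small_eq => //; apply/allP => j _.
by rewrite /= count_m2s mnm1E addn0.
Qed.

Lemma m2s2 a b (mm : 'X_{1..m}) : perm_eq (m2s (U_(a) + U_(b) + mm)) [:: a, b & m2s mm].
Proof.
apply: (perm_trans (m2sD _ _)); rewrite -[_ :: _]/([:: a; b] ++ m2s mm) perm_cat2r.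
by apply: (perm_trans (m2sD _ _)); rewrite !m2s1.
Qed.

Lemma pos_wordP mm : all (fun i => neg i == false) (pos_word mm).
Proof. by apply/allP => i; rewrite mem_filter => /andP[/negbTE ->]. Qed.

Lemma neg_wordP mm : all (fun i => neg i == true) (neg_word mm).
Proof. by apply/allP => i; rewrite mem_filter => /andP[->]. Qed.

Lemma lift_monomial_pair a b mm : neg a = neg b ->
  D (lift_monomial (U_(a) + U_(b) + mm) - L a b * lift_monomial mm).
Proof.
move=> ab; have pw := perm_filter (fun i => ~~ neg i) (m2s2 a b mm).
have nw := perm_filter neg (m2s2 a b mm).
rewrite /lift_monomial -/(pos_word _) -/(neg_word _) in pw nw *.
have ha := pos_wordP (U_(a) + U_(b) + mm); have hb := neg_wordP (U_(a) + U_(b) + mm).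
rewrite (perm_size pw) (perm_size nw); case E : (neg a) ab pw nw => /esym ab pw nw /=;
  rewrite /= ?E ?ab /= -?/(pos_word mm) -?/(neg_word mm) in pw nw *; rewrite ?negbK.
  case: ifPn => [_|]; first by rewrite mulr0 subr0; exact: ideal_gen0.
  rewrite negb_or => /andP[h1 h2].
  have h1' : ~~ odd (size (pos_word (U_(a) + U_(b) + mm))) by rewrite (perm_size pw).
  have h2' : ~~ odd (size (neg_word (U_(a) + U_(b) + mm))) by rewrite (perm_size nw) /= negbK.
  have := pair_prod_perm pw ha h1'; have := pair_prod_perm nw hb h2' => /=.
  set A := pair_prod _; set B := pair_prod _; set A' := pair_prod _; set B' := pair_prod _.
  move=> hA hB; have -> : A' * A - L a b * (B' * B) = A' * (A - L a b * B) + (L a b * B) * (A' - B') by ring.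
  by apply: ideal_genD; apply: ideal_genM.
case: ifPn => [_|]; first by rewrite mulr0 subr0; exact: ideal_gen0.
rewrite negb_or => /andP[h1 h2].
have h1' : ~~ odd (size (pos_word (U_(a) + U_(b) + mm))) by rewrite (perm_size pw) /= negbK.
have h2' : ~~ odd (size (neg_word (U_(a) + U_(b) + mm))) by rewrite (perm_size nw).
have := pair_prod_perm pw ha h1'; have := pair_prod_perm nw hb h2' => /=.
set A := pair_prod _; set B := pair_prod _; set A' := pair_prod _; set B' := pair_prod _.
move=> hA hB; have -> : A' * A - L a b * (B' * B) = A * (A' - L a b * B') + (L a b * B') * (A - B) by ring.
by apply: ideal_genD; apply: ideal_genM.
Qed.


Lemma size_pos_word a b mm :
  size (pos_word (U_(a) + U_(b) + mm)) = (~~ neg a + (~~ neg b + size (pos_word mm)))%N.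
Proof.
rewrite (perm_size (perm_filter (fun i => ~~ neg i) (m2s2 a b mm))) /=.
by case: (neg a) => /=; case: (neg b).
Qed.

Lemma size_neg_word a b mm :
  size (neg_word (U_(a) + U_(b) + mm)) = (neg a + (neg b + size (neg_word mm)))%N.
Proof.
rewrite (perm_size (perm_filter neg (m2s2 a b mm))) /=.
by case: (neg a) => /=; case: (neg b).
Qed.

Lemma lift_monomial0 mm : odd (size (pos_word mm)) || odd (size (neg_word mm)) ->
  lift_monomial mm = 0.
Proof. by rewrite /lift_monomial => ->. Qed.

Definition lift_form := lext lift_monomial.

Definition even_part (g : 'M[K]_m) : 'M[K]_m :=
  \matrix_(i, j) if neg i == neg j then g i j else 0.
Definition odd_part (g : 'M[K]_m) : 'M[K]_m :=
  \matrix_(i, j) if neg i == neg j then 0 else g i j.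

Lemma parity_split (g : 'M[K]_m) (x : 'I_m -> 'I_m -> K) :
  \sum_i \sum_j g i j * x i j =
  \sum_i \sum_j even_part g i j * x i j + \sum_i \sum_j odd_part g i j * x i j.
Proof.
rewrite -big_split; apply: eq_bigr => i _; rewrite -big_split; apply: eq_bigr => j _ /=.
by rewrite !mxE; case: eqP => _; rewrite mul0r ?addr0 ?add0r.
Qed.

Lemma parity_sign (g : 'M[K]_m) v :
  \sum_i \sum_j g i j * (y (tau v) i * y (tau v) j) =
  \sum_i \sum_j even_part g i j * (y v i * y v j) -
  \sum_i \sum_j odd_part g i j * (y v i * y v j).
Proof.
rewrite -sumrB; apply: eq_bigr => i _; rewrite -sumrB; apply: eq_bigr => j _ /=.
rewrite !(iq_tau data) [even_part _ _ _]mxE [odd_part _ _ _]mxE.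
by case: (neg i); case: (neg j) => /=; rewrite ?expr0 ?expr1; ring.
Qed.

(** The two eigencomponents of a quadric through [V] are quadrics through [V],
    as [V] is stable under the involution. *)
Lemma parity_vanishing (g : 'M[K]_m) :
  (forall v, V v -> \sum_i \sum_j g i j * (y v i * y v j) = 0) ->
  forall v, V v -> \sum_i \sum_j even_part g i j * (y v i * y v j) = 0 /\
                   \sum_i \sum_j odd_part g i j * (y v i * y v j) = 0.
Proof.
move=> h v Vv; have h1 := h _ Vv; have h2 := h _ (iq_stable data Vv).
rewrite parity_split in h1; rewrite parity_sign in h2.
set A := \sum_i _ in h1 h2 *; set B := \sum_i _ in h1 h2 *.
have A0 : A *+ 2 = 0 by rewrite -[RHS]addr0 -{1}h1 -h2; ring.
have {}A0 : A = 0 by apply/eqP; move/eqP: A0; rewrite mulrn_eq0.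
by split=> //; rewrite -[RHS]h1 A0 add0r.
Qed.

Lemma even_lift_sum (g : 'M[K]_m) v : V v ->
  (\sum_i \sum_j even_part g i j *: L i j).@[phi v 0] =
  \sum_i \sum_j even_part g i j * (y v i * y v j).
Proof.
move=> Vv; rewrite raddf_sum; apply: eq_bigr => i _; rewrite raddf_sum.
apply: eq_bigr => j _ /=; rewrite mevalZ mxE; case: eqP => [ij|]; last by rewrite !mul0r.
by rewrite liftE.
Qed.

Lemma even_lift_homog (g : 'M[K]_m) :
  \sum_i \sum_j even_part g i j *: L i j \is 1.-homog.
Proof. by do 2!apply: rpred_sum => ? _; apply: rpredZ; apply: lin_homog. Qed.

Lemma even_lift_eq0 (g : 'M[K]_m) :
  (forall v, V v -> \sum_i \sum_j even_part g i j * (y v i * y v j) = 0) ->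
  \sum_i \sum_j even_part g i j *: L i j = 0.
Proof.
move=> h; apply: linear_vanishing; first exact: even_lift_homog.
by apply/vanishingP => v Vv; rewrite even_lift_sum ?h.
Qed.

(** A mixed product of coordinates becomes liftable once multiplied by one more
    coordinate [i] of even sign and one more coordinate [j] of odd sign. *)
Definition mixed_lift (g : 'M[K]_m) i j : {mpoly K[n]} :=
  \sum_a \sum_b odd_part g a b *:
    (L (if neg a then b else a) i * L (if neg a then a else b) j).

Lemma mixed_lift_homog g i j : mixed_lift g i j \is 2.-homog.
Proof. by do 2!apply: rpred_sum => ? _; apply: rpredZ; apply: liftLL. Qed.

Lemma mixed_lift_eval g i j v : V v -> ~~ neg i -> neg j ->
  (mixed_lift g i j).@[phi v 0] =
  y v i * y v j * \sum_a \sum_b odd_part g a b * (y v a * y v b).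
Proof.
move=> Vv ni nj; rewrite raddf_sum mulr_sumr; apply: eq_bigr => a _.
rewrite raddf_sum mulr_sumr; apply: eq_bigr => b _ /=; rewrite mevalZ mxE.
case: eqP => [|ab]; first by rewrite !mul0r mulr0.
move: ab ni; case na : (neg a); case nb : (neg b) => // _ /negPf ni.
  by rewrite mevalM !liftE ?na ?nb ?ni ?nj //; ring.
by rewrite mevalM !liftE ?na ?nb ?ni ?nj //; ring.
Qed.

Lemma even_lift_congr (g : 'M[K]_m) mm :
  D (\sum_i \sum_j even_part g i j *: lift_monomial (U_(i) + U_(j) + mm) -
     (\sum_i \sum_j even_part g i j *: L i j) * lift_monomial mm).
Proof.
rewrite mulr_suml -sumrB; apply: ideal_gen_sum => i _.
rewrite mulr_suml -sumrB; apply: ideal_gen_sum => j _; rewrite -scalerAl -scalerBr.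
rewrite mxE; case: eqP => [ij|_]; last by rewrite scale0r; exact: ideal_gen0.
by apply: ideal_genZ; apply: lift_monomial_pair.
Qed.

Lemma mem_word i mm : i \in m2s mm ->
  exists mm' : 'X_{1..m}, mm = (U_(i) + mm')%MM.
Proof.
move=> hi; exists (mm - U_(i))%MM; rewrite addmC submK // lep1mP -count_m2s.
by rewrite -lt0n -has_count has_pred1.
Qed.

(** A quadric through [V] without products of equal sign is multiplied here by
    a letter of each sign; pairing these letters with its variables gives a
    quadric through [W]. *)
Lemma odd_lift_congr (g : 'M[K]_m) mm :
  (forall v, V v -> \sum_i \sum_j odd_part g i j * (y v i * y v j) = 0) ->
  odd (size (pos_word mm)) -> odd (size (neg_word mm)) ->
  D (\sum_i \sum_j odd_part g i j *: lift_monomial (U_(i) + U_(j) + mm)).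
Proof.
move=> g0 op on.
have [i hi] : exists i, i \in pos_word mm.
  by case: (pos_word mm) op => // i s _; exists i; rewrite mem_head.
have [j hj] : exists j, j \in neg_word mm.
  by case: (neg_word mm) on => // j s _; exists j; rewrite mem_head.
move: hi hj; rewrite !mem_filter => /andP[ni hi] /andP[nj hj].
have [m1 E1] := mem_word hi.
have [m2 E2] : exists m2, m1 = (U_(j) + m2)%MM.
  apply: mem_word; move: hj; rewrite E1 (perm_mem (m2sD _ _)) mem_cat m2s1 inE.
  by case/orP => // /eqP ji; rewrite -ji nj in ni.
have Q0 : D (mixed_lift g i j).
  apply: quadric_in_D; first exact: mixed_lift_homog.
  by move=> v Vv; rewrite mixed_lift_eval // g0 // mulr0.
suff h : D (\sum_i \sum_j odd_part g i j *: lift_monomial (U_(i) + U_(j) + mm) -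
            lift_monomial m2 * mixed_lift g i j).
  by rewrite -[X in D X](subrK (lift_monomial m2 * mixed_lift g i j)); apply: ideal_genD => //; apply: ideal_genM.
rewrite mulr_sumr -sumrB; apply: ideal_gen_sum => a _.
rewrite mulr_sumr -sumrB; apply: ideal_gen_sum => b _.
rewrite -scalerAr -scalerBr mxE; case: eqP => [_|ab].
  by rewrite scale0r; exact: ideal_gen0.
apply: ideal_genZ; rewrite E1 E2.
set p := if neg a then b else a; set r := if neg a then a else b.
have [np nr] : neg p = false /\ neg r = true.
  by move: ab; rewrite /p /r; case na : (neg a); case nb : (neg b).
have -> : (U_(a) + U_(b) + (U_(i) + (U_(j) + m2)) = U_(p) + U_(i) + (U_(r) + U_(j) + m2))%MM.
  apply/mnmP => c; rewrite !mnmDE /p /r; case: (neg a); lia.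
rewrite -(subrKA (L p i * lift_monomial (U_(r) + U_(j) + m2))); apply: ideal_genD.
  by apply: lift_monomial_pair; rewrite np (negPf ni).
rewrite [lift_monomial m2 * _]mulrC -mulrA -mulrBr; apply: ideal_genM.
by apply: lift_monomial_pair; rewrite nr nj.
Qed.

Lemma lift_quadraticX (g : 'M[K]_m) mm :
  lift_form ((\sum_i \sum_j g i j *: ('X_i * 'X_j)) * 'X_[mm]) =
  \sum_i \sum_j g i j *: lift_monomial (U_(i) + U_(j) + mm).
Proof.
rewrite mulr_suml /lift_form lext_sum; apply: eq_bigr => i _.
rewrite mulr_suml lext_sum; apply: eq_bigr => j _.
by rewrite -scalerAl lextZ -!mpolyXD lextX.
Qed.

Lemma lift_quadric_monomial (g : 'M[K]_m) mm :
  (forall v, V v -> \sum_i \sum_j g i j * (y v i * y v j) = 0) ->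
  D (\sum_i \sum_j g i j *: lift_monomial (U_(i) + U_(j) + mm)).
Proof.
move=> g0.
have gp v (Vv : V v) := (parity_vanishing g0 Vv).1.
have gm v (Vv : V v) := (parity_vanishing g0 Vv).2.
have -> : \sum_i \sum_j g i j *: lift_monomial (U_(i) + U_(j) + mm) =
  \sum_i \sum_j even_part g i j *: lift_monomial (U_(i) + U_(j) + mm) +
  \sum_i \sum_j odd_part g i j *: lift_monomial (U_(i) + U_(j) + mm).
  rewrite -big_split; apply: eq_bigr => i _; rewrite -big_split; apply: eq_bigr => j _ /=.
  by rewrite !mxE; case: eqP => _; rewrite scale0r ?addr0 ?add0r.
apply: ideal_genD.
  rewrite -[X in D X](subrK ((\sum_i \sum_j even_part g i j *: L i j) * lift_monomial mm)).
  apply: ideal_genD; first exact: even_lift_congr.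
  by rewrite even_lift_eq0 // mul0r; exact: ideal_gen0.
have [/andP[h1 h2]|h] := boolP (odd (size (pos_word mm)) && odd (size (neg_word mm))).
  exact: odd_lift_congr.
apply: ideal_gen_sum => i _; apply: ideal_gen_sum => j _; rewrite mxE.
case: eqP => [_|ij]; first by rewrite scale0r; exact: ideal_gen0.
rewrite lift_monomial0 ?scaler0; first exact: ideal_gen0.
rewrite size_pos_word size_neg_word !oddD; move: ij h.
by case: (neg i); case: (neg j) => //= _; case: odd => //=; case: odd.
Qed.

Lemma vanishing_coordinates (F : {mpoly K[m]}) :
  (forall v, V v -> F.@[(v *m M) 0] = 0) ->
  ideal_gen (fun G => G \is 2.-homog /\ forall v, V v -> G.@[(v *m M) 0] = 0) F.
Proof.
move=> F0; have FE (G : {mpoly K[m]}) : lsubst (invmx M) (lsubst M G) = G.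
  by apply: mpoly_eval_inj => v; rewrite !lsubst_eval mulmxKV ?(iq_unit data).
have h : vanishing_ideal V (lsubst M F) by move=> v Vv; rewrite lsubst_eval F0.
rewrite -(FE F); move: (iq_ideal data h).
apply: (ideal_gen_min (J := fun F => ideal_gen _ (lsubst (invmx M) F))).
- by rewrite lsubst0; exact: ideal_gen0.
- by move=> F1 F2 h1 h2; rewrite lsubstD; apply: ideal_genD.
- by move=> F1 F2 h2; rewrite lsubstM; apply: ideal_genM.
move=> G [hG G0]; apply: ideal_gen1; split; first exact: lsubst_homog.
by move=> v Vv; rewrite lsubst_eval mulmxK ?(iq_unit data) ?G0.
Qed.

(** The ideal of [V] is generated by quadrics, and multiples of these by monomials
    lift to multiples of quadrics through [W]. *)
Lemma lift_vanishing (F : {mpoly K[m]}) :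
  (forall v, V v -> F.@[(v *m M) 0] = 0) -> D (lift_form F).
Proof.
move=> /vanishing_coordinates; elim=> s [hs ->]; rewrite /lift_form lext_sum big_seq.
apply: ideal_gen_sum => gq /hs[hq q0]; move: (gq.1) => G.
have [g Eg] := quadratic_form hq; rewrite (mpolyE G) mulr_suml lext_sum.
apply: ideal_gen_sum => mm _; rewrite -scalerAl lextZ mulrC; apply: ideal_genZ.
rewrite Eg -/lift_form lift_quadraticX; apply: lift_quadric_monomial => v Vv.
by rewrite -quadratic_eval -Eg q0.
Qed.

(** ** The ideal of the quotient *)

Let qy k : {mpoly K[m]} := lsubst (invmx M) (tnth q k).

Lemma qyE k : exists g : 'M[K]_m,
  qy k = \sum_i \sum_j even_part g i j *: ('X_i * 'X_j) /\
  (forall v, phi v 0 k = \sum_i \sum_j even_part g i j * (y v i * y v j)).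
Proof.
have [g Eg] := quadratic_form (lsubst_homog (invmx M) (iq_homog data k)).
have E v : phi v 0 k = \sum_i \sum_j g i j * (y v i * y v j).
  by rewrite -quadratic_eval -Eg lsubst_eval mulmxK ?(iq_unit data) ?phiE.
have E' v : phi v 0 k = \sum_i \sum_j even_part g i j * (y v i * y v j).
  have := E (tau v); rewrite phiE (iq_inv data) -phiE parity_sign.
  have := E v; rewrite (parity_split g); set A := \sum_i _; set B := \sum_i _ => h1 h2.
  have B0 : B *+ 2 = 0 by rewrite -(subrr (phi v 0 k)) {1}h1 h2; ring.
  have {}B0 : B = 0 by apply/eqP; move/eqP: B0; rewrite mulrn_eq0.
  by rewrite h1 B0 addr0.
exists g; split=> //; apply: mpoly_eval_inj => v; rewrite quadratic_eval lsubst_eval.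
have := E' (v *m invmx M); rewrite phiE => ->.
by rewrite mulmxKV ?(iq_unit data).
Qed.

Lemma coordinate_lift k g :
  (forall v, phi v 0 k = \sum_i \sum_j even_part g i j * (y v i * y v j)) ->
  'X_k = \sum_i \sum_j even_part g i j *: L i j.
Proof.
move=> h; apply/eqP; rewrite -subr_eq0; apply/eqP; apply: linear_vanishing.
  by rewrite rpredB ?even_lift_homog // dhomogX /= mdeg1.
by apply/vanishingP => v Vv; rewrite mevalB mevalXU even_lift_sum // h subrr.
Qed.

Lemma lift_pullback (F : {mpoly K[n]}) :
  D (lift_form (F \mPo [tuple qy k | k < n]) - F).
Proof.
have step k G : D (lift_form (qy k * G) - 'X_k * lift_form G).
  have [g [Eg hg]] := qyE k; rewrite (mpolyE G) mulr_sumr /lift_form !lext_sum.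
  rewrite mulr_sumr -sumrB; apply: ideal_gen_sum => mm _.
  rewrite -scalerAr !lextZ -scalerAr -scalerBr lextX; apply: ideal_genZ.
  rewrite Eg -/lift_form lift_quadraticX (coordinate_lift hg).
  exact: even_lift_congr.
rewrite [X in _ - X](mpolyE F) [X in X \mPo _](mpolyE F) raddf_sum /lift_form lext_sum -sumrB.
apply: ideal_gen_sum => mm _ /=; rewrite comp_mpolyZ lextZ -scalerBr; apply: ideal_genZ.
rewrite comp_mpolyX mpolyXE_id -/lift_form.
elim/big_rec2: _ => [|k G G' _ hG].
  rewrite -mpolyX0 /lift_form lextX /lift_monomial /pos_word /neg_word.
  suff -> : m2s (0%MM : 'X_{1..m}) = [::] by rewrite /= mulr1 subrr; exact: ideal_gen0.
  by apply/size0nil; rewrite size_m2s mdeg0.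
rewrite tnth_mktuple; elim: (mm k) => [|e IH]; first by rewrite !expr0 !mul1r.
rewrite !exprS -!mulrA -(subrKA ('X_k * lift_form (qy k ^+ e * G'))).
apply: ideal_genD; first exact: step.
by rewrite -mulrBr; apply: ideal_genM.
Qed.

(** A form [F] on the target is congruent to the lift of its pullback, because each
    variable is; if [F] vanishes on [W], then its pullback vanishes on [V]. *)
Theorem quotient_ideal F : I F <-> D F.
Proof.
split=> [IF|]; last first.
  apply: (ideal_gen_min (J := I)) => [|G H hG hH|G H hH|Q []//].
  - by move=> w _; rewrite meval0.
  - by move=> w Ww; rewrite mevalD hG // hH // addr0.
  - by move=> w Ww; rewrite mevalM hH // mulr0.
rewrite -[F](subKr (lift_form (F \mPo [tuple qy k | k < n]))).
apply: ideal_genB; last exact: lift_pullback.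
apply: lift_vanishing => v Vv; rewrite comp_mpoly_meval.
rewrite -[RHS](proj1 (vanishingP F) IF v Vv); apply: meval_eq => k.
by rewrite tnth_mktuple lsubst_eval mulmxK ?(iq_unit data) ?phiE.
Qed.


(** ** Even forms on [V] descend *)

Lemma prod_word (x : 'I_m -> K) mm : \prod_(i <- m2s mm) x i = \prod_i x i ^+ mm i.
Proof.
under [RHS]eq_bigr => i _ do rewrite -count_m2s.
elim: (m2s mm) => [|a s IH]; first by rewrite big_nil big1.
rewrite big_cons IH [RHS](bigD1 a) //= [in LHS](bigD1 a) //= eqxx exprS -!mulrA.
congr (_ * (_ * _)); apply: eq_bigr => i ia.
by rewrite eq_sym (negPf ia).
Qed.

Lemma prod_parity (x : 'I_m -> K) mm :
  \prod_(i <- pos_word mm) x i * \prod_(i <- neg_word mm) x i = \prod_i x i ^+ mm i.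
Proof.
by rewrite -prod_word /pos_word /neg_word !big_filter [RHS](bigID (fun i => neg i)) /= mulrC.
Qed.

Lemma pair_prod_eval e s v : V v -> all (fun i => neg i == e) s -> ~~ odd (size s) ->
  (pair_prod s).@[phi v 0] = \prod_(i <- s) y v i.
Proof.
move=> Vv; have [k] := ubnP (size s); elim: k s => // k IH [|a [|b s]] //=.
  by rewrite big_nil meval1.
rewrite !ltnS negbK => hk /and3P[/eqP ha /eqP hb hs] os.
rewrite mevalM liftE // ?ha ?hb // IH //; last exact: ltnW.
by rewrite !big_cons mulrA.
Qed.

Lemma pair_prod_homog s : pair_prod s \is ((size s)./2).-homog.
Proof.
have [k] := ubnP (size s); elim: k s => // k IH [|a [|b s]] /=; try by rewrite dhomog1.
rewrite !ltnS => hk; apply: (@dhomogM _ _ _ 1) => //; first exact: lin_homog.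
by apply: IH; apply: ltnW.
Qed.

(** [G] plus its conjugate consists of the monomials of even degree in the
    coordinates of each sign, which are products of pairs of equal sign. *)
Lemma even_form_descends d (G : {mpoly K[m]}) : G \is (d.*2).-homog ->
  exists2 F : {mpoly K[n]}, F \is d.-homog &
    forall v, V v -> F.@[phi v 0] = G.@[v 0] + G.@[(tau v) 0].
Proof.
move=> hG; pose Gy := lsubst (invmx M) G.
have hGy : Gy \is (d.*2).-homog by exact: lsubst_homog.
have GE (v : 'rV[K]_m) : G.@[v 0] = Gy.@[(v *m M) 0] by rewrite lsubst_eval mulmxK ?(iq_unit data).
have hw mm : mm \in msupp Gy -> (size (pos_word mm) + size (neg_word mm) = d.*2)%N.
  move=> /(dhomog_mf hGy) /= <-; rewrite -size_m2s /pos_word /neg_word !size_filter.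
  by rewrite addnC -(count_predC neg).
exists (2 *: lift_form Gy).
  rewrite rpredZ // /lift_form /lext big_seq; apply: rpred_sum => mm hm.
  apply: rpredZ; rewrite /lift_monomial; case: ifPn => [_|]; first exact: rpred0.
  rewrite negb_or => /andP[h1 h2].
  have -> : d = ((size (pos_word mm))./2 + (size (neg_word mm))./2)%N.
    by have := congr1 half (hw _ hm); rewrite doubleK halfD (negPf h1) /= add0n => <-.
  by apply: dhomogM; apply: pair_prod_homog.
move=> v Vv; rewrite !GE mevalZ /lift_form /lext raddf_sum !mevalE /= mulr_sumr -big_split.
rewrite big_seq [RHS]big_seq; apply: eq_bigr => mm hm; rewrite mevalZ.
have par : odd (size (pos_word mm)) = odd (size (neg_word mm)).
  by have := congr1 odd (hw _ hm); rewrite oddD odd_double; do 2!case: odd.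
have sgn : \prod_i y (tau v) i ^+ mm i =
    (-1) ^+ odd (size (neg_word mm)) * \prod_i y v i ^+ mm i.
  rewrite -!prod_word; under eq_bigr => i _ do rewrite (iq_tau data).
  rewrite big_split /=; congr (_ * _); rewrite signr_odd size_filter.
  by elim: (m2s mm) => [|a s IH]; rewrite ?big_nil ?big_cons //= IH exprD.
rewrite sgn /lift_monomial par orbb; case: ifPn => [_|h].
  by rewrite meval0 !mulr0 /=; ring.
rewrite mevalM (pair_prod_eval Vv (pos_wordP _)) ?par //.
rewrite (pair_prod_eval Vv (neg_wordP _)) // prod_parity expr0 mul1r.
by rewrite mulr_natl; exact: mulr2n.
Qed.

(** ** The quotient map *)

Lemma phi_tau v : phi (tau v) = phi v.
Proof. by apply/rowP => k; rewrite !phiE (iq_inv data). Qed.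

Lemma tau_invol v : tau (tau v) = v.
Proof.
rewrite -[LHS](mulmxK (iq_unit data)) -[RHS](mulmxK (iq_unit data)); congr (_ *m _).
by apply/rowP => i; rewrite !(iq_tau data) mulrA -expr2 sqrr_sign mul1r.
Qed.

Let T : 'M[K]_m := M *m diag_mx (\row_i (-1) ^+ neg i) *m invmx M.

Lemma tauE v : tau v = v *m T.
Proof.
rewrite -[LHS](mulmxK (iq_unit data)) /T !mulmxA; congr (_ *m _).
apply/rowP => i; rewrite (iq_tau data) mul_mx_diag !mxE /= [RHS]mulrC.
by congr (_ * _); rewrite mxE.
Qed.

(** If [G] vanishes at [tau v], the invariant form comes from [G^2] plus its conjugate,
    otherwise from the product of [G] with its conjugate. *)
Lemma separating_form d (G : {mpoly K[m]}) v : V v -> G \is d.-homog -> G.@[v 0] != 0 ->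
  exists2 F : {mpoly K[n]}, F \is d.-homog & F.@[phi v 0] != 0 /\
    forall v', V v' -> G.@[v' 0] = 0 -> G.@[(tau v') 0] = 0 -> F.@[phi v' 0] = 0.
Proof.
move=> Vv hG Gv; have [G0|Gt] := eqVneq G.@[(tau v) 0] 0.
  have hGG : G * G \is (d.*2).-homog by rewrite -addnn; apply: dhomogM.
  have [F hF FE] := even_form_descends hGG; exists F => //; split.
    by rewrite FE // !mevalM G0 mulr0 addr0 mulf_neq0.
  by move=> v' Vv' h1 h2; rewrite FE // !mevalM h1 h2 mulr0 addr0.
have hGG : G * lsubst T G \is (d.*2).-homog.
  by rewrite -addnn; apply: dhomogM => //; apply: lsubst_homog.
have [F hF FE] := even_form_descends hGG; exists F => //; split.
  rewrite FE // !mevalM !lsubst_eval -!tauE tau_invol [X in _ + X]mulrC -mulr2n.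
  by rewrite mulrn_eq0 /= mulf_neq0.
by move=> v' Vv' h1 h2; rewrite FE // !mevalM !lsubst_eval -!tauE h1 h2 mul0r mul0r addr0.
Qed.

Lemma comp_phi (F : {mpoly K[n]}) (v : 'rV[K]_m) : (F \mPo q).@[v 0] = F.@[phi v 0].
Proof. by rewrite comp_mpoly_meval; apply: meval_eq => k; rewrite phiE. Qed.

Lemma comp_q_homog d (F : {mpoly K[n]}) : F \is d.-homog -> F \mPo q \is (2 * d)%N.-homog.
Proof. by apply: dhomog_comp => k; exact: (iq_homog data). Qed.

(** Open sets pull back; conversely the forms defining an invariant open set are
    replaced by invariant ones. *)
Lemma quotient_topology (U : set 'rV[K]_n) : (forall w, U w -> W w) ->
  zariski_open_in W U <-> zariski_open_in V (fun v => V v /\ U (phi v)).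
Proof.
move=> UW; split=> [[S [hS SU]]|[S [hS SU]]].
  exists (fun G => exists2 F, S F & G = F \mPo q); split.
    by move=> _ [F /hS[d hF] ->]; exists (2 * d)%N; apply: comp_q_homog.
  move=> v; split=> [[Vv /SU[_ [F [SF Fv]]]]|[Vv [_ [[F SF ->] Fv]]]].
    by split=> //; exists (F \mPo q); split; [exists F | rewrite comp_phi].
  split=> //; apply/SU; split; first by apply/imageP; exists v.
  by exists F; rewrite -comp_phi.
exists (fun F => (exists d, F \is d.-homog) /\
  forall v, V v -> ~ U (phi v) -> F.@[phi v 0] = 0); split; first by move=> F [].
move=> w; split=> [Uw|[/imageP[v Vv ->] [F [[_ F0] Fw]]]]; last first.
  by apply: contrapT => nU; rewrite F0 ?eqxx in Fw.
split; first exact: UW.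
have /imageP[v Vv Ew] := UW _ Uw; rewrite Ew in Uw *.
have [_ [G [SG Gv]]] : V v /\ exists F, S F /\ F.@[v 0] != 0 by apply/SU.
have [d hG] := hS _ SG; have [F hF [Fv F0]] := separating_form Vv hG Gv.
exists F; split=> //; split; first by exists d.
have G0 v' : V v' -> ~ U (phi v') -> G.@[v' 0] = 0.
  move=> Vv' nU; apply: contrapT => /eqP Gv'; apply: nU.
  by have [] : V v' /\ U (phi v') by apply/SU; split=> //; exists G.
move=> v' Vv' nU; apply: F0 => //; apply: G0 => //.
by apply: (iq_stable data). by rewrite phi_tau.
Qed.

(** An invariant function F / G on [V] is also (F G + conjugate) / (G^2 + conjugate)
    and (F tau(G) + conjugate) / (2 G tau(G)); at each point one of these two
    denominators is nonzero. *)
Lemma quotient_regular (U : set 'rV[K]_n) (f : 'rV[K]_n -> K) :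
  zariski_open_in W U ->
  (regular_on U f <->
   regular_on (fun v => V v /\ U (phi v)) (fun v => f (phi v))).
Proof.
move=> [S [_ SU]]; have UW w : U w -> W w by move/SU => [].
split=> [reg v [Vv Uv]|reg w Uw].
  have [d [F [G [hF hG Gv FG]]]] := reg _ Uv.
  exists (2 * d)%N, (F \mPo q), (G \mPo q); rewrite !comp_phi.
  split=> //; [exact: comp_q_homog | exact: comp_q_homog |].
  by move=> v' [_ Uv'] Gv'; rewrite !comp_phi in Gv' *; apply: FG.
have /imageP[v Vv Ew] := UW _ Uw; rewrite Ew in Uw *.
have [d [F [G [hF hG Gv FG]]]] := reg _ (conj Vv Uw).
have Uorb v' : V v' -> U (phi v') -> V (tau v') /\ U (phi (tau v')).
  by move=> Vv' Uv'; rewrite phi_tau; split=> //; apply: (iq_stable data).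
(* both denominators below are the restriction of an invariant form *)
have [G0|Gt] := eqVneq G.@[(tau v) 0] 0.
  have hGG : G * G \is (d.*2).-homog by rewrite -addnn; apply: dhomogM.
  have hFG : F * G \is (d.*2).-homog by rewrite -addnn; apply: dhomogM.
  have [H hH HE] := even_form_descends hGG; have [N hN NE] := even_form_descends hFG.
  exists d, N, H; split=> //; first by rewrite HE // !mevalM G0 mulr0 addr0 mulf_neq0.
  have fGG v' : V v' /\ U (phi v') -> f (phi v') * (G * G).@[v' 0] = (F * G).@[v' 0].
    move=> h; rewrite !mevalM; have [->|Gv'] := eqVneq G.@[v' 0] 0; first by rewrite !mulr0.
    by rewrite FG // mulrA divfK.
  move=> w' Uw'; have /imageP[v' Vv' Ew'] := UW _ Uw'; rewrite Ew' in Uw' * => Hv'.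
  rewrite {}HE // {}NE // in Hv' *.
  have E1 := fGG _ (conj Vv' Uw'); have E2 := fGG _ (Uorb _ Vv' Uw').
  rewrite phi_tau in E2.
  by apply: (canRL (mulfK Hv')); rewrite mulrDr E1 E2.
have hGG : G * lsubst T G \is (d.*2).-homog.
  by rewrite -addnn; apply: dhomogM => //; apply: lsubst_homog.
have hFG : F * lsubst T G \is (d.*2).-homog.
  by rewrite -addnn; apply: dhomogM => //; apply: lsubst_homog.
have [H hH HE] := even_form_descends hGG; have [N hN NE] := even_form_descends hFG.
have {}HE v' : V v' -> H.@[phi v' 0] = G.@[v' 0] * G.@[(tau v') 0] *+ 2.
  by move=> Vv'; rewrite HE // !mevalM !lsubst_eval -!tauE tau_invol mulr2n [X in _ + X]mulrC.
have {}NE v' : V v' ->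
    N.@[phi v' 0] = F.@[v' 0] * G.@[(tau v') 0] + F.@[(tau v') 0] * G.@[v' 0].
  by move=> Vv'; rewrite NE // !mevalM !lsubst_eval -!tauE tau_invol.
exists d, N, H; split=> //; first by rewrite HE // mulrn_eq0 mulf_neq0.
move=> w' Uw'; have /imageP[v' Vv' Ew'] := UW _ Uw'; rewrite Ew' in Uw' * => Hv'.
rewrite {}HE // {}NE // in Hv' *.
have /andP[G1 G2] : (G.@[v' 0] != 0) && (G.@[(tau v') 0] != 0).
  by rewrite -negb_or -mulf_eq0; move: Hv'; rewrite mulrn_eq0.
have E1 := FG _ (conj Vv' Uw') G1; have E2 := FG _ (Uorb _ Vv' Uw') G2.
rewrite phi_tau in E2; apply: (canRL (mulfK Hv')).
rewrite mulr2n mulrDr {1}E1 E2; by field; rewrite G1 G2.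
Qed.

(** A symmetric matrix of rank at most one over a closed field is x^T x. *)
Lemma rank_one (C : pred 'I_m) (Z : 'I_m -> 'I_m -> K) :
  (forall a b, C a -> C b -> Z a b = Z b a) ->
  (forall a b c d, C a -> C b -> C c -> C d -> Z a b * Z c d = Z a c * Z b d) ->
  exists x : 'I_m -> K, forall a b, C a -> C b -> x a * x b = Z a b.
Proof.
move=> ZC ZE; have [/existsP[a /andP[Ca Za]]|h] := boolP [exists a, C a && (Z a a != 0)].
  pose s := sqrtC (Z a a); have s0 : s != 0 by rewrite sqrtC_eq0.
  exists (fun b => Z a b / s) => b c Cb Cc.
  have -> : Z a b / s * (Z a c / s) = Z a b * Z a c / s ^+ 2 by field.
  have -> : Z a b * Z a c = Z b c * Z a a by rewrite (ZE b) // (ZC b) // [RHS]mulrC (ZC c) // mulrC.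
  by rewrite sqrtCK mulfK.
have Z0 b : C b -> Z b b = 0.
  by move=> Cb; move: h; rewrite negb_exists => /forallP/(_ b); rewrite Cb negbK => /eqP.
exists (fun=> 0) => a b Ca Cb; rewrite mul0r; apply/esym/eqP.
by rewrite -sqrf_eq0 expr2 -ZE // Z0 // mul0r.
Qed.

(** At a point in the closure of the image the values of the forms [L a b] are two
    symmetric matrices of rank at most one, hence the products of the
    coordinates of a vector [v]; the equations of the image force [v] into [V]. *)
Lemma quotient_closed : zariski_closed W.
Proof.
move=> w; split=> [Ww|[w0 hw]].
  by split; [have /imageP[v Vv ->] := Ww; exact: phi_neq0 | move=> F; apply].
have hL a b c d : neg a = neg b -> neg a = neg c -> neg a = neg d ->
    (L a b).@[w 0] * (L c d).@[w 0] = (L a c).@[w 0] * (L b d).@[w 0].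
  move=> ab ac ad; apply/eqP; rewrite -subr_eq0 -!mevalM -mevalB; apply/eqP/hw.
  by apply/quotient_ideal; apply: lift_exchange.
have hC a b : neg a = neg b -> (L a b).@[w 0] = (L b a).@[w 0].
  by move=> ab; rewrite liftC.
have [a b|a b c d|x hx] := @rank_one (fun i => ~~ neg i) (fun a b => (L a b).@[w 0]).
- by move=> /negPf na /negPf nb; apply: hC; rewrite na nb.
- by move=> /negPf na /negPf nb /negPf nc /negPf nd; apply: hL; rewrite na.
have [a b|a b c d|x' hx'] := @rank_one neg (fun a b => (L a b).@[w 0]).
- by move=> na nb; apply: hC; rewrite na nb.
- by move=> na nb nc nd; apply: hL; rewrite na.
pose u : 'rV[K]_m := \row_i (if neg i then x' i else x i).
pose v := u *m invmx M.
have yv i : y v i = if neg i then x' i else x i by rewrite mulmxKV ?(iq_unit data) ?mxE.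
have yE a b : neg a = neg b -> y v a * y v b = (L a b).@[w 0].
  rewrite !yv; case na : (neg a) => /esym nb; rewrite nb; first exact: hx'.
  by apply: hx; rewrite ?na ?nb.
have phiv : phi v = w.
  apply/rowP => k; have [g [_ hg]] := qyE k; rewrite hg.
  rewrite -[RHS](mevalXU (w 0) k) (coordinate_lift hg) raddf_sum; apply: eq_bigr => i _.
  rewrite raddf_sum; apply: eq_bigr => j _ /=; rewrite mevalZ mxE.
  by case: eqP => [ij|]; rewrite ?mul0r // yE.
have v0 : v != 0.
  apply: contraNneq w0 => v0; rewrite -phiv v0 -(scale0r (0 : 'rV[K]_m)) phiZ.
  by rewrite expr0n scale0r.
apply/imageP; exists v => //; apply: (iq_closed data v0) => Q hQ Q0.
have [g Eg] := quadratic_form (lsubst_homog (invmx M) hQ).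
have QE (v' : 'rV[K]_m) : Q.@[v' 0] = \sum_i \sum_j g i j * (y v' i * y v' j).
  by rewrite -quadratic_eval -Eg lsubst_eval mulmxK ?(iq_unit data).
have g0 (v' : 'rV[K]_m) : V v' -> \sum_i \sum_j g i j * (y v' i * y v' j) = 0 by move=> /Q0; rewrite QE.
have gp v' Vv' := (parity_vanishing g0 (v := v') Vv').1.
have gm v' Vv' := (parity_vanishing g0 (v := v') Vv').2.
rewrite QE parity_split.
have -> : \sum_i \sum_j even_part g i j * (y v i * y v j) = 0.
  have E0 : (\sum_i \sum_j even_part g i j *: L i j).@[w 0] = 0.
    by rewrite even_lift_eq0 // meval0.
  rewrite -[RHS]E0 raddf_sum; apply: eq_bigr => i _.
  rewrite raddf_sum; apply: eq_bigr => j _ /=; rewrite mevalZ mxE.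
  by case: eqP => [ij|]; rewrite ?mul0r // yE.
rewrite add0r; apply/eqP/negPn/negP => nz.
(* one even and one odd coordinate are nonzero since the mixed part is *)
have mixed i j : ~~ neg i -> neg j -> y v i * y v j = 0.
  move=> ni nj; have : (mixed_lift g i j).@[w 0] = 0.
    apply: hw; apply/vanishingP => v' Vv'.
    by rewrite mixed_lift_eval // gm // mulr0.
  have -> : (mixed_lift g i j).@[w 0] =
      y v i * y v j * \sum_a \sum_b odd_part g a b * (y v a * y v b).
    rewrite raddf_sum mulr_sumr; apply: eq_bigr => a _.
    rewrite raddf_sum mulr_sumr; apply: eq_bigr => b _ /=; rewrite mevalZ mxE.
    case: eqP => [|ab]; first by rewrite !mul0r mulr0.
    move: ab ni; case na : (neg a); case nb : (neg b) => // _ /negPf ni.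
      by rewrite mevalM -!yE ?na ?nb ?ni ?nj //; ring.
    by rewrite mevalM -!yE ?na ?nb ?ni ?nj //; ring.
  by move/eqP; rewrite mulf_eq0 (negPf nz) orbF => /eqP.
case/eqP: nz; apply: big1 => a _; apply: big1 => b _; rewrite mxE.
case: eqP => [_|]; first by rewrite mul0r.
case na : (neg a); case nb : (neg b) => // _.
  by rewrite [y v a * _]mulrC mixed ?nb ?mulr0.
by rewrite mixed ?na ?mulr0.
Qed.

Lemma common_sign (C : pred 'I_m) (x x' : 'I_m -> K) :
  (forall a b, C a -> C b -> x a * x b = x' a * x' b) ->
  exists b : bool, forall a, C a -> x a = (-1) ^+ b * x' a.
Proof.
move=> h; have [/existsP[a /andP[Ca xa]]|h0] := boolP [exists a, C a && (x' a != 0)].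
  have /eqP : (x a) ^+ 2 = (x' a) ^+ 2 by rewrite !expr2 h.
  rewrite eqf_sqr => xx; pose s := x a != x' a.
  have xs : x a = (-1) ^+ s * x' a.
    by rewrite /s; case: eqP xx => [-> _|_ /= /eqP ->]; rewrite ?expr0 ?mul1r ?mulN1r.
  exists s => b Cb; have xa' : x a != 0 by rewrite xs mulf_neq0 ?signr_eq0.
  by apply: (mulfI xa'); rewrite h // xs mulrACA -expr2 sqrr_sign mul1r.
have x0 b : C b -> x' b = 0.
  by move=> Cb; move: h0; rewrite negb_exists => /forallP/(_ b); rewrite Cb negbK => /eqP.
exists false => a Ca; rewrite x0 // mulr0; apply/eqP.
by rewrite -sqrf_eq0 expr2 h // x0 // mul0r.
Qed.

Lemma y_inj (v v' : 'rV[K]_m) : (forall i, y v i = y v' i) -> v = v'.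
Proof.
move=> h; apply/eqP; rewrite -subr_eq0; apply/eqP/y_eq0 => i.
by rewrite mulmxBl !mxE; move: (h i); rewrite !mxE => ->; rewrite subrr.
Qed.

Lemma yZ c (v : 'rV[K]_m) i : y (c *: v) i = c * y v i.
Proof. by rewrite -scalemxAl mxE. Qed.

(** The products determine the coordinates of each sign up to a common sign. *)
Lemma quotient_fibres v v' : V v -> V v' ->
  (phi v == phi v')%MS <-> (v' == v)%MS \/ (v' == tau v)%MS.
Proof.
move=> Vv Vv'; split=> [/eqrVP[c c0 E]|]; last first.
  case=> /eqrVP[c c0 ->]; rewrite phiZ ?phi_tau; apply/eqrVP; exists (c ^- 2);
    by rewrite ?invr_eq0 ?expf_neq0 // scalerA mulVf ?expf_neq0 // scale1r.
pose r := sqrtC c; have r0 : r != 0 by rewrite sqrtC_eq0.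
have Vr : V (r *: v') by apply: (iq_scale data).
have {}E : phi v = phi (r *: v') by rewrite phiZ sqrtCK.
have yy a b : neg a = neg b -> y v a * y v b = y (r *: v') a * y (r *: v') b.
  by move=> ab; rewrite -!liftE // E.
have [a b na nb|s hs] := @common_sign (fun i => ~~ neg i) (fun i => y v i) (fun i => y (r *: v') i).
  by apply: yy; rewrite (negPf na) (negPf nb).
have [a b na nb|s' hs'] := @common_sign neg (fun i => y v i) (fun i => y (r *: v') i).
  by apply: yy; rewrite na nb.
have sr : (-1) ^+ s / r != 0 :> K by rewrite mulf_neq0 ?signr_eq0 ?invr_eq0.
have [ss|ss] := eqVneq s s'; [left|right]; apply/eqrVP; exists ((-1) ^+ s / r) => //;
  apply: y_inj => i; rewrite yZ ?(iq_tau data).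
  have -> : y v i = (-1) ^+ s * y (r *: v') i.
    by case ni : (neg i); [rewrite ss hs' | rewrite hs ?ni].
  by rewrite yZ mulrACA -expr2 sqrr_sign mul1r mulKf.
have -> : (-1) ^+ neg i * y v i = (-1) ^+ s * y (r *: v') i.
  case ni : (neg i); last by rewrite expr0 mul1r hs ?ni.
  by rewrite hs' // mulrA -signr_addb; move: ss; case: (s); case: (s').
by rewrite yZ mulrACA -expr2 sqrr_sign mul1r mulKf.
Qed.

Theorem quotient_is_embedding : quotient_embedding V tau q.
Proof.
split.
- exact: (iq_stable data).
- by exists 2%N; exact: (iq_homog data).
- exact: phi_neq0.
- exact: quotient_closed.
- exact: quotient_fibres.
- by move=> U _ UW; apply: quotient_topology.
- by move=> U f UW _; apply: quotient_regular.
Qed.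

Theorem quotient_ideal_quadrics : generated_by_quadrics I.
Proof.
by exists (fun Q => Q \is 2.-homog /\ I Q); split=> [Q []|F] //; apply: quotient_ideal.
Qed.

(** ** Tangent vectors at a point outside the fixed locus *)

Lemma ddir_vanishing_coord (G : 'M[K]_m) (v v' : 'rV[K]_m) :
  ddir (lsubst M (\sum_i \sum_j G i j *: ('X_i * 'X_j))) (v 0) (v' 0) =
  \sum_i \sum_j G i j * (y v' i * y v j + y v i * y v' j).
Proof. by rewrite ddir_lsubst ddir_quadratic. Qed.

Section FreePoint.
Variables (v : 'rV[K]_m) (a0 b0 : 'I_m).
Hypotheses (Vv : V v) (na0 : ~~ neg a0) (ya0 : y v a0 != 0) (nb0 : neg b0) (yb0 : y v b0 != 0).

(** The quotient map is unramified: a tangent vector is recovered from the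
    derivatives of the products of a fixed nonzero coordinate of each sign. *)
Lemma tangent_inj (v' : 'rV[K]_m) :
  (forall G, G \is 2.-homog -> vanishing_ideal V G -> ddir G (v 0) (v' 0) = 0) ->
  (forall k, ddir (tnth q k) (v 0) (v' 0) = 0) -> v' = 0.
Proof.
move=> hG hq; have dyy a b : neg a = neg b -> y v' a * y v b + y v a * y v' b = 0.
  move=> ab; pose G := \sum_k l a b 0 k *: tnth q k - lsubst M ('X_a * 'X_b).
  have : ddir G (v 0) (v' 0) = 0.
    apply: hG => [|u Vu].
      rewrite rpredB //; first by apply: rpred_sum => k _; rewrite rpredZ // (iq_homog data).
      by apply: lsubst_homog; rewrite -mpolyXD dhomogX /= mdegD !mdeg1.
    rewrite mevalB lsubst_eval mevalM !mevalXU -(iq_lift data ab Vu) raddf_sum /=.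
    by apply/eqP; rewrite subr_eq0; apply/eqP/eq_bigr => k _; rewrite mevalZ.
  rewrite ddirB ddir_sum big1 => [|k _]; last by rewrite ddirZ hq mulr0.
  by rewrite sub0r ddir_lsubst ddirM !ddirX !mevalXU => /eqP; rewrite oppr_eq0 => /eqP.
have base a : y v a != 0 -> y v' a = 0.
  move=> ya; have /eqP := dyy a a (erefl _); rewrite [X in _ + X]mulrC -mulr2n mulrn_eq0 /=.
  by rewrite mulf_eq0 (negPf ya) orbF => /eqP.
apply: y_eq0 => i; case ni : (neg i).
  have /eqP := dyy i b0 (etrans ni (esym nb0)); rewrite (base b0) // mulr0 addr0.
  by rewrite mulf_eq0 (negPf yb0) orbF => /eqP.
have /eqP := dyy i a0 (etrans ni (esym (negPf na0))); rewrite (base a0) // mulr0 addr0.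
by rewrite mulf_eq0 (negPf ya0) orbF => /eqP.
Qed.

(** [z] prescribes the derivatives of the products of coordinates of equal sign;
    dividing by a nonzero coordinate of each sign gives [v'], and the quadrics
    through [W] make it tangent to [V]. *)
Lemma tangent_lift (z : 'rV[K]_n) :
  (forall Q, Q \is 2.-homog -> I Q -> ddir Q (phi v 0) (z 0) = 0) ->
  exists v' : 'rV[K]_m, (forall k, z 0 k = ddir (tnth q k) (v 0) (v' 0)) /\
    forall G, G \is 2.-homog -> vanishing_ideal V G -> ddir G (v 0) (v' 0) = 0.
Proof.
move=> hz; pose Z a b := ddir (L a b) (phi v 0) (z 0).
pose c i := if neg i then b0 else a0.
have nc i : neg (c i) = neg i by rewrite /c; case ni : (neg i) => //; apply: negPf.
have yc i : y v (c i) != 0 by rewrite /c; case: ifP.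
have cc i : c (c i) = c i by rewrite {1}/c nc.
have cE i j : neg i = neg j -> c i = c j by rewrite /c => ->.
pose x i := Z (c i) (c i) / (y v (c i) *+ 2).
pose x' i := (Z (c i) i - y v i * x i) / y v (c i).
have ZC a b : neg a = neg b -> Z a b = Z b a by move=> ab; rewrite /Z liftC.
have LE a b : neg a = neg b -> (L a b).@[phi v 0] = y v a * y v b.
  by move=> ab; apply: liftE.
have ZE a b d e : neg a = neg b -> neg a = neg d -> neg a = neg e ->
   Z a b * (y v d * y v e) + (y v a * y v b) * Z d e =
   Z a d * (y v b * y v e) + (y v a * y v d) * Z b e.
  move=> ab ad ae; have : ddir (L a b * L d e - L a d * L b e) (phi v 0) (z 0) = 0.
    apply: hz; first by rewrite rpredB ?liftLL.
    by apply/quotient_ideal; apply: lift_exchange.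
  rewrite ddirB !ddirM !LE -?ab -?ad // -/(Z _ _) -/(Z _ _) -/(Z _ _) -/(Z _ _).
  by move/eqP; rewrite subr_eq0 => /eqP.
have two_neq0 : 2%:R != 0 :> K by rewrite pnatr_eq0.
have Zx a b : neg a = neg b -> Z a b = x' a * y v b + y v a * x' b.
  move=> ab; have := ZE (c a) (c a) a b (erefl _) (nc a) (etrans (nc a) ab).
  rewrite /x' /x -(cE _ _ ab); have := yc a; set s := y v (c a) => s0 E.
  apply: (mulfI (mulf_neq0 s0 s0)).
  have -> : s * s * Z a b = Z (c a) a * (s * y v b) + s * y v a * Z (c a) b - Z (c a) (c a) * (y v a * y v b).
    by rewrite -E; ring.
  by field; rewrite s0 ?two_neq0.
pose v' : 'rV[K]_m := (\row_i x' i) *m invmx M.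
have yv' i : y v' i = x' i by rewrite mulmxKV ?(iq_unit data) ?mxE.
have Zy a b : neg a = neg b -> Z a b = y v' a * y v b + y v a * y v' b.
  by move=> ab; rewrite Zx // !yv'.
have evenE (g : 'M[K]_m) : \sum_i \sum_j even_part g i j * (y v' i * y v j + y v i * y v' j) =
    ddir (\sum_i \sum_j even_part g i j *: L i j) (phi v 0) (z 0).
  rewrite ddir_sum; apply: eq_bigr => i _; rewrite ddir_sum; apply: eq_bigr => j _.
  rewrite ddirZ mxE; case: eqP => [ij|]; last by rewrite !mul0r.
  by rewrite -Zy.
exists v'; split=> [k|G hG G0].
  have [g [Eg hg]] := qyE k.
  have qE : tnth q k = lsubst M (\sum_i \sum_j even_part g i j *: ('X_i * 'X_j)).
    by apply: mpoly_eval_inj => u; rewrite -Eg !lsubst_eval mulmxK ?(iq_unit data).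
  by rewrite qE ddir_vanishing_coord evenE -(coordinate_lift hg) ddirX.
have [g Eg] := quadratic_form (lsubst_homog (invmx M) hG).
have GE : G = lsubst M (\sum_i \sum_j g i j *: ('X_i * 'X_j)).
  by apply: mpoly_eval_inj => u; rewrite -Eg !lsubst_eval mulmxK ?(iq_unit data).
have g0 (u : 'rV[K]_m) : V u -> \sum_i \sum_j g i j * (y u i * y u j) = 0.
  by move=> Vu; rewrite -quadratic_eval -lsubst_eval -GE G0.
have gp u Vu := (parity_vanishing g0 (v := u) Vu).1.
have gm u Vu := (parity_vanishing g0 (v := u) Vu).2.
rewrite GE ddir_vanishing_coord parity_split evenE even_lift_eq0 // ddir0 add0r.
have : ddir (mixed_lift g a0 b0) (phi v 0) (z 0) = 0.
  apply: hz; first exact: mixed_lift_homog.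
  by apply/vanishingP => u Vu; rewrite mixed_lift_eval // gm // mulr0.
have -> : ddir (mixed_lift g a0 b0) (phi v 0) (z 0) =
   y v a0 * y v b0 * \sum_a \sum_b odd_part g a b * (y v' a * y v b + y v a * y v' b) +
   (y v' a0 * y v b0 + y v a0 * y v' b0) * \sum_a \sum_b odd_part g a b * (y v a * y v b).
  rewrite ddir_sum !mulr_sumr -big_split; apply: eq_bigr => a _.
  rewrite ddir_sum !mulr_sumr -big_split; apply: eq_bigr => b _ /=.
  rewrite ddirZ mxE; case: eqP => [|ab]; first by rewrite !mul0r !mulr0 addr0.
  move: ab (negPf na0); case na : (neg a); case nb : (neg b) => // _ ni.
    by rewrite ddirM -!/(Z _ _) !Zy ?LE ?na ?nb ?ni ?nb0 //; ring.
  by rewrite ddirM -!/(Z _ _) !Zy ?LE ?na ?nb ?ni ?nb0 //; ring.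
rewrite gm // mulr0 addr0 => /eqP; rewrite !mulf_eq0 (negPf ya0) (negPf yb0).
by move/eqP.
Qed.

End FreePoint.

End InvariantQuotient.

(** * Cones over toric surfaces *)

(** The surface has [n] coordinates, placed at the lattice points [tab]; the
    coordinate [n] is the one that is free on the cone. *)

Definition same_weight (n : nat) (tab : seq (nat * nat)) (i j i' j' : nat) : bool :=
  let p k := nth (0, 0)%N tab k in
  [&& ((i < n) + (j < n) == (i' < n) + (j' < n))%N,
      ((p i).1 + (p j).1 == (p i').1 + (p j').1)%N &
      ((p i).2 + (p j).2 == (p i').2 + (p j').2)%N].

(** [ex] gives the exponents of the coordinates in a chart of the surface around
    the vertex [i0], with the neighbouring points [i1] and [i2] as local
    coordinates; each further coordinate is expressed by a quadratic relation
    through coordinates of smaller exponents. *)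
Definition chart_ok n tab (ex : seq (nat * nat)) (i0 i1 i2 : nat) : bool :=
  let e k := nth (0, 0)%N ex k in
  let s k := ((e k).1 + (e k).2)%N in
  [&& (size ex <= n)%N,
      (i0 < n)%N, (i1 < n)%N, (i2 < n)%N,
      (e i0 == (0, 0)%N), (e i1 == (1, 0)%N), (e i2 == (0, 1)%N),
      all (fun k => [|| k == i0, k == i1, k == i2 |
        has (fun k1 => has (fun k2 => [&& same_weight n tab k i0 k1 k2,
          (s k1 < s k)%N & (s k2 < s k)%N]) (iota 0 n)) (iota 0 n)]) (iota 0 n) &
      all (fun i => all (fun j => all (fun i' => all (fun j' =>
        same_weight n tab i j i' j' ==>
        ((e i).1 + (e j).1 == (e i').1 + (e j').1)%N &&
        ((e i).2 + (e j).2 == (e i').2 + (e j').2)%N)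
        (iota 0 n.+1)) (iota 0 n.+1)) (iota 0 n.+1)) (iota 0 n.+1)].

(** Each pair outside [std] can be replaced by a pair of the same weight that is
    smaller for the measure [mu]. *)
Definition reduction_ok n tab (std : nat -> nat -> bool) (mu : nat -> nat) : bool :=
  all (fun i => all (fun j => std i j ||
    (i != j) && has (fun i' => has (fun j' => same_weight n tab i j i' j' &&
      (mu i' + mu j' < mu i + mu j)%N) (iota 0 n.+1)) (iota 0 n.+1))
    (iota 0 n.+1)) (iota 0 n.+1).

Lemma inord_lt n i : (i < n)%N -> @inord n i = i :> nat.
Proof. by move=> h; rewrite inordK // ltnW. Qed.

Section Toric.
Variables (K : numClosedFieldType) (n : nat) (tab : seq (nat * nat)).
Implicit Types (v u : 'rV[K]_n.+1).

Definition toric_relations (v : 'I_n.+1 -> K) :=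
  forall i j i' j' : 'I_n.+1, same_weight n tab i j i' j' -> v i * v j = v i' * v j'.

Definition toric_cone : set 'rV[K]_n.+1 := fun v => v != 0 /\ toric_relations (v 0).

Lemma toric_scale v c : toric_cone v -> c != 0 -> toric_cone (c *: v).
Proof.
move=> [v0 vr] c0; split=> [|i j i' j' /vr E]; first by rewrite scaler_eq0 negb_or c0.
by rewrite !mxE mulrACA E [RHS]mulrACA.
Qed.

Lemma binomial_vanishing (i j i' j' : 'I_n.+1) : same_weight n tab i j i' j' ->
  let Q : {mpoly K[n.+1]} := 'X_i * 'X_j - 'X_i' * 'X_j' in
  Q \is 2.-homog /\ vanishing_ideal toric_cone Q.
Proof.
move=> h Q; split; last by move=> v [_ /(_ _ _ _ _ h) E]; rewrite mevalB !mevalM !mevalXU E subrr.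
by rewrite rpredB // -mpolyXD dhomogX /= mdegD !mdeg1.
Qed.

Lemma toric_closed v : v != 0 ->
  (forall Q, Q \is 2.-homog -> vanishing_ideal toric_cone Q -> Q.@[v 0] = 0) -> toric_cone v.
Proof.
move=> v0 h; split=> // i j i' j' /binomial_vanishing[hQ Q0].
have := h _ hQ Q0; rewrite mevalB !mevalM !mevalXU => /eqP.
by rewrite subr_eq0 => /eqP.
Qed.

(** ** The ideal of a toric cone *)

Definition point_weight (k : nat) (i : nat) : nat :=
  nth 0%N [:: (k < n : nat)%N; (nth (0, 0)%N tab k).1; (nth (0, 0)%N tab k).2;
              (n <= k : nat)%N] i.

Definition wt (k : 'I_n.+1) : 'X_{1..4} := [multinom point_weight k i | i < 4].

Definition monomial_weight (mm : 'X_{1..n.+1}) : 'X_{1..4} := (\sum_i wt i *+ mm i)%MM.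

Lemma ord4P (P : 'I_4 -> Prop) :
  P (inord 0) -> P (inord 1) -> P (inord 2) -> P (inord 3) -> forall i, P i.
Proof.
move=> P0 P1 P2 P3 [[|[|[|[|i]]]] Hi] //.
- by have -> : Ordinal Hi = inord 0 by apply/val_inj; rewrite /= inordK.
- by have -> : Ordinal Hi = inord 1 by apply/val_inj; rewrite /= inordK.
- by have -> : Ordinal Hi = inord 2 by apply/val_inj; rewrite /= inordK.
- by have -> : Ordinal Hi = inord 3 by apply/val_inj; rewrite /= inordK.
Qed.

Lemma same_weight_cone (i j i' j' : nat) : same_weight n tab i j i' j' ->
  ((n <= i) + (n <= j) = (n <= i') + (n <= j'))%N.
Proof. by case/and3P => /eqP; do 4!case: ltnP => _. Qed.

Lemma same_weightP (i j i' j' : 'I_n.+1) :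
  same_weight n tab i j i' j' <-> (wt i + wt j = wt i' + wt j')%MM.
Proof.
split=> [h|/mnmP E].
  have h4 := same_weight_cone h; case/and3P: h => /eqP h1 /eqP h2 /eqP h3.
  by apply/mnmP; apply: ord4P; rewrite !mnmDE !mnmE /point_weight !inordK.
have {}E k : (k < 4)%N -> (point_weight i k + point_weight j k = point_weight i' k + point_weight j' k)%N.
  by move=> hk; have := E (inord k); rewrite !mnmDE !mnmE !inordK.
apply/and3P; split; apply/eqP; [exact: (E 0%N) | exact: (E 1%N) | exact: (E 2%N)].
Qed.

Lemma comp_wt mm :
  'X_[mm] \mPo [tuple 'X_[wt i] | i < n.+1] = 'X_[monomial_weight mm] :> {mpoly K[4]}.
Proof.
rewrite comp_mpolyX /monomial_weight -mprodXnE.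
by apply: eq_bigr => i _; rewrite tnth_mktuple.
Qed.

Lemma monomial_weightD m1 m2 :
  monomial_weight (m1 + m2) = (monomial_weight m1 + monomial_weight m2)%MM.
Proof.
rewrite /monomial_weight -big_split; apply: eq_bigr => i _ /=.
by apply/mnmP => k; rewrite !(mnmDE, mulmnE) mulnDr.
Qed.

Lemma monomial_weight1 i : monomial_weight U_(i) = wt i.
Proof.
rewrite /monomial_weight (bigD1 i) //= mnm1E eqxx mulm1n big1 ?addm0 // => j ji.
by rewrite mnm1E eq_sym (negPf ji) mulm0n.
Qed.

Section Ideal.
Variables (std : nat -> nat -> bool) (mu : nat -> nat).
Definition std_monomial (f : nat -> nat) :=
  forall i j, (i <= n)%N -> (j <= n)%N -> ~~ std i j -> f i = 0%N \/ f j = 0%N.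
Definition exponents (mm : 'X_{1..n.+1}) : nat -> nat := fun k => mm (inord k).

Hypothesis tab_size : (size tab <= n)%N.
Hypothesis red : reduction_ok n tab std mu.
Hypothesis std_uniq : forall mm mm' : 'X_{1..n.+1},
  std_monomial (exponents mm) -> std_monomial (exponents mm') ->
  monomial_weight mm = monomial_weight mm' -> mm = mm'.

Local Notation D := (ideal_gen (fun Q => Q \is 2.-homog /\ vanishing_ideal toric_cone Q)).

(** Rewriting with the binomial relations terminates since it decreases [mu]. *)
Lemma std_reduction mm : exists mm', std_monomial (exponents mm') /\
  monomial_weight mm' = monomial_weight mm /\ D ('X_[mm] - 'X_[mm']).
Proof.
pose M (mm : 'X_{1..n.+1}) := (\sum_(i < n.+1) mm i * mu i)%N.
have MD m1 m2 : M (m1 + m2)%MM = (M m1 + M m2)%N.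
  by rewrite /M -big_split; apply: eq_bigr => i _; rewrite mnmDE mulnDl.
have M1 i : M U_(i)%MM = mu i.
  rewrite /M (bigD1 i) //= mnm1E eqxx mul1n big1 ?addn0 // => j ji.
  by rewrite mnm1E eq_sym (negPf ji) mul0n.
have [k] := ubnP (M mm); elim: k mm => // k IH mm hk.
have [/existsP[i /existsP[j /and3P[nij mi mj]]]|h] :=
  boolP [exists i : 'I_n.+1, exists j : 'I_n.+1, [&& ~~ std i j, mm i != 0%N & mm j != 0%N]]; last first.
  exists mm; split; last by rewrite subrr; split=> //; exact: ideal_gen0.
  move=> i j hi hj nij; move: h; rewrite negb_exists => /forallP/(_ (inord i)).
  rewrite negb_exists => /forallP/(_ (inord j)); rewrite !inordK // nij /= negb_and !negbK.
  by case/orP => /eqP; [left | right].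
have mem_i : (i : nat) \in iota 0 n.+1 by rewrite mem_iota /= add0n.
have mem_j : (j : nat) \in iota 0 n.+1 by rewrite mem_iota /= add0n.
have := allP (allP red _ mem_i) _ mem_j; rewrite (negPf nij) orFb.
case/andP => ij /hasP[a ha /hasP[b hb /andP[sw lt]]].
move: ha hb; rewrite !mem_iota !add0n => ha hb.
pose i' := Ordinal ha; pose j' := Ordinal hb.
have [m0 Em] : exists m0, mm = (U_(i) + U_(j) + m0)%MM.
  exists (mm - (U_(i) + U_(j)))%MM; rewrite addmC submK //; apply/mnm_lepP => c.
  move: mi mj; rewrite mnmDE !mnm1E -!lt0n => mi mj.
  have [ic|ic] := eqVneq i c; have [jc|jc] := eqVneq j c => //=; rewrite -?ic -?jc //.
  by move: ij; rewrite ic jc eqxx.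
have wE : monomial_weight (U_(i') + U_(j') + m0) = monomial_weight mm.
  rewrite Em !monomial_weightD !monomial_weight1; congr (_ + _)%MM; apply/esym.
  exact/(@same_weightP i j i' j').
have [mm' [h1 [h2 h3]]] : exists mm', std_monomial (exponents mm') /\
    monomial_weight mm' = monomial_weight (U_(i') + U_(j') + m0) /\
    D ('X_[U_(i') + U_(j') + m0] - 'X_[mm']).
  apply: IH; move: hk; rewrite Em !MD !M1 /= => hk.
  by rewrite ltnS in hk; apply: leq_trans hk; rewrite ltn_add2r.
exists mm'; split=> //; split; first by rewrite h2.
rewrite -(subrKA 'X_[U_(i') + U_(j') + m0]); apply: ideal_genD => //.
rewrite Em !(mpolyXD _ _ m0) -mulrBl mulrC; apply: ideal_genM; apply: ideal_gen1.
by rewrite !mpolyXD; apply: binomial_vanishing.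
Qed.

Lemma wt_point (t : 'rV[K]_4) : toric_relations (fun k => 'X_[wt k].@[t 0]).
Proof.
by move=> i j i' j' /same_weightP E; rewrite -!mevalM -!mpolyXD E.
Qed.

(** Modulo the quadratic binomials [F] is a combination of standard monomials; these
    have distinct weights, so the coefficients of the combination are those of the
    parametrized polynomial. *)
Theorem toric_ideal_dense F : (forall t : 'rV[K]_4, F.@[fun k => 'X_[wt k].@[t 0]] = 0) -> D F.
Proof.
move=> F0; have F1 : F \mPo [tuple 'X_[wt i] | i < n.+1] = 0.
  apply: mpoly_eval_eq0 => t; rewrite comp_mpoly_meval -[RHS](F0 t).
  by apply: meval_eq => k; rewrite tnth_mktuple.
have /choice[nf hnf] := std_reduction.
pose G : {mpoly K[n.+1]} := \sum_(m <- msupp F) F@_m *: 'X_[nf m].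
have FG : D (F - G).
  rewrite [F in F - _]mpolyE -sumrB; apply: ideal_gen_sum => m _.
  by rewrite -scalerBr; apply: ideal_genZ; have [_ []] := hnf m.
suff G0 : G = 0 by move: FG; rewrite G0 subr0.
apply/mpolyP => m0; rewrite mcoeff0 raddf_sum /=.
have [/hasP[m1 _ /eqP E0]|h] := boolP (has (fun m => nf m == m0) (msupp F)); last first.
  rewrite big_seq big1 // => m hm; rewrite mcoeffZ mcoeffX.
  by move/hasPn: h => /(_ _ hm) /negPf ->; rewrite mulr0.
have E1 := congr1 (mcoeff (monomial_weight m0)) F1; rewrite mcoeff0 in E1.
rewrite -[RHS]E1 comp_mpolyEX raddf_sum /=; apply: eq_bigr => m _.
rewrite comp_wt !mcoeffZ !mcoeffX; congr (_ * (_ : bool)%:R).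
have [s1 [w1 _]] := hnf m1; have [s [w _]] := hnf m; rewrite -E0.
by apply/eqP/eqP => [<-|E]; [rewrite w | apply: std_uniq => //; rewrite w w1 E w1].
Qed.

Theorem toric_ideal F : vanishing_ideal toric_cone F -> D F.
Proof.
move=> F0; apply: toric_ideal_dense => t0.
have F1 : F \mPo [tuple 'X_[wt i] | i < n.+1] = 0.
  (* off the divisor where the last coordinate vanishes, the parametrized point is nonzero *)
  apply: (@mpoly_eval_dense _ _ _ ('X_(inord 3) : {mpoly K[4]})).
    by rewrite -msize_poly_eq0 msizeX.
  move=> t; rewrite mevalXU => t3; rewrite comp_mpoly_meval.
  rewrite -(F0 (\row_k 'X_[wt k].@[t 0])).
    by apply: meval_eq => k; rewrite mxE tnth_mktuple.
  split; last by move=> i j i' j' h; rewrite !mxE; apply: wt_point.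
  apply/eqP => /rowP/(_ ord_max); rewrite !mxE mevalX => /eqP.
  rewrite (bigD1 (inord 3)) //= big1 => [|i i3].
    by rewrite mnmE /point_weight leqnn inordK //= mulr1 expf_eq0 (negPf t3) andbF.
  rewrite mnmE /point_weight ltnn leqnn [nth (0, 0)%N _ _]nth_default //; case: i i3 => [[|[|[|[|i]]]] hi] //= i3.
  by case/eqP: i3; apply/val_inj; rewrite /= inordK.
by have := congr1 (fun G : {mpoly K[4]} => G.@[t0 0]) F1; rewrite meval0 comp_mpoly_meval => E;
   rewrite -[RHS]E; apply: meval_eq => k; rewrite tnth_mktuple.
Qed.

End Ideal.

(** ** Charts *)

Section Chart.
Variables (ex : seq (nat * nat)) (i0 i1 i2 : nat).
Hypothesis ok : chart_ok n tab ex i0 i1 i2.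
Local Notation e k := (nth (0, 0)%N ex k).

Definition chart_coord (A : comRingType) (la al be y : A) (k : nat) : A :=
  if (k < n)%N then la * al ^+ (e k).1 * be ^+ (e k).2 else y.

Lemma chart_okP :
  [/\ (size ex <= n)%N, [/\ (i0 < n)%N, (i1 < n)%N & (i2 < n)%N],
      [/\ e i0 = (0, 0)%N, e i1 = (1, 0)%N & e i2 = (0, 1)%N],
      forall k : 'I_n.+1, (k < n)%N -> [\/ k = inord i0, k = inord i1, k = inord i2 |
        exists k1 k2 : 'I_n.+1, [/\ same_weight n tab k i0 k1 k2, (k1 < n)%N, (k2 < n)%N,
          ((e k1).1 + (e k1).2 < (e k).1 + (e k).2)%N &
          ((e k2).1 + (e k2).2 < (e k).1 + (e k).2)%N]] &
      forall i j i' j' : 'I_n.+1, same_weight n tab i j i' j' ->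
        ((e i).1 + (e j).1 = (e i').1 + (e j').1)%N /\
        ((e i).2 + (e j).2 = (e i').2 + (e j').2)%N].
Proof.
case/and5P: ok => s1 l0 l1 l2 /and5P[/eqP e0 /eqP e1 /eqP e2 h1 h2]; split=> //.
  move=> k kn; have := allP h1 k; rewrite mem_iota /= add0n kn => /(_ isT).
  case/or4P => [/eqP <-|/eqP <-|/eqP <-|].
  - by apply: Or41; rewrite inord_val.
  - by apply: Or42; rewrite inord_val.
  - by apply: Or43; rewrite inord_val.
  case/hasP => k1; rewrite mem_iota /= add0n => k1n /hasP[k2].
  rewrite mem_iota /= add0n => k2n /and3P[a b c]; apply: Or44.
  by exists (inord k1), (inord k2); rewrite !inordK // ltnS ltnW.
move=> i j i' j' h; have I (k : 'I_n.+1) : (k : nat) \in iota 0 n.+1.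
  by rewrite mem_iota /= add0n.
have := allP (allP (allP (allP h2 _ (I i)) _ (I j)) _ (I i')) _ (I j').
by rewrite h => /andP[/eqP -> /eqP ->].
Qed.

Lemma chart_coordE (A : comRingType) (la al be y : A) k :
  chart_coord la al be y k =
  la ^+ (k < n) * y ^+ (n <= k) * al ^+ (e k).1 * be ^+ (e k).2.
Proof.
rewrite /chart_coord; case: ltnP => kn; rewrite ?expr0 ?expr1 ?mulr1 ?mul1r //.
have [sz _ _ _ _] := chart_okP.
by rewrite nth_default ?(leq_trans sz) // !expr0 !mulr1.
Qed.

Lemma chart_coord_relations (la al be y : K) :
  toric_relations (fun k => chart_coord la al be y k).
Proof.
have [_ _ _ _ hs] := chart_okP; move=> i j i' j' h.
have h4 := same_weight_cone h; have [h2 h3] := hs _ _ _ _ h.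
case/and3P: h => /eqP h1 _ _; rewrite !chart_coordE.
have E (x z a b : K) p q r s p' q' r' s' :
   x ^+ p * z ^+ q * a ^+ r * b ^+ s * (x ^+ p' * z ^+ q' * a ^+ r' * b ^+ s') =
   x ^+ (p + p') * z ^+ (q + q') * a ^+ (r + r') * b ^+ (s + s').
  by rewrite !exprD; ring.
by rewrite !E // h1 h4 h2 h3.
Qed.

(** By induction on the exponents, through the quadratic relations of the chart. *)
Lemma toric_chart (v : 'I_n.+1 -> K) : toric_relations v -> v (inord i0) != 0 ->
  forall k, v k = chart_coord (v (inord i0)) (v (inord i1) / v (inord i0))
                    (v (inord i2) / v (inord i0)) (v ord_max) k.
Proof.
have [_ [l0 l1 l2] [e0 e1 e2] hc hs] := chart_okP; move=> vr v0 k.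
have in_lt (i : nat) : (i < n)%N -> (@inord n i < n)%N by move=> h; rewrite inordK // ltnW.
have [s] := ubnP ((e k).1 + (e k).2)%N; elim: s k => // s IH k hk.
rewrite /chart_coord; have [kn|kn] := ltnP k n; last first.
  by congr v; apply/val_inj/eqP; rewrite /= eqn_leq kn -ltnS ltn_ord.
have [->|->|->|[k1 [k2 [sw k1n k2n s1 s2]]]] := hc _ kn.
- by rewrite inordK ?e0 ?expr0 ?mulr1 // ltnW.
- by rewrite inordK ?e1 /= ?expr0 ?expr1 ?mulr1 1?mulrC ?divfK // ltnW.
- by rewrite inordK ?e2 /= ?expr0 ?expr1 ?mulr1 1?mulrC ?divfK // ltnW.
have sw' : same_weight n tab k (inord i0 : 'I_n.+1) k1 k2 by rewrite inordK // ltnW.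
apply: (mulIf v0); rewrite (vr _ _ _ _ sw') (IH k1) ?(IH k2); first last.
- exact: leq_trans s1 _.
- exact: leq_trans s2 _.
have [E1 E2] := hs _ _ _ _ sw'; rewrite inordK ?e0 ?addn0 in E1 E2; last by rewrite ltnW.
by rewrite /chart_coord k1n k2n E1 E2 !exprD; ring.
Qed.

(** The binomial relations determine a tangent vector from its components along
    the vertex, the two neighbouring points and the cone direction. *)
Lemma chart_tangent_eq0 (v u : 'I_n.+1 -> K) : v (inord i0) != 0 ->
  (forall i j i' j' : 'I_n.+1, same_weight n tab i j i' j' ->
     u i * v j + v i * u j = u i' * v j' + v i' * u j') ->
  u (inord i0) = 0 -> u (inord i1) = 0 -> u (inord i2) = 0 -> u ord_max = 0 ->
  forall k, u k = 0.
Proof.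
have [_ [l0 l1 l2] _ hc _] := chart_okP; move=> v0 ur u0 u1 u2 u3 k.
have [s] := ubnP ((e k).1 + (e k).2)%N; elim: s k => // s IH k hk.
have [kn|kn] := ltnP k n; last first.
  by rewrite -[RHS]u3; congr u; apply/val_inj/eqP; rewrite /= eqn_leq kn -ltnS ltn_ord.
have [->|->|->|[k1 [k2 [sw k1n k2n s1 s2]]]] := hc _ kn => //.
have sw' : same_weight n tab k (inord i0 : 'I_n.+1) k1 k2 by rewrite inordK // ltnW.
have := ur _ _ _ _ sw'; rewrite u0 (IH k1) ?(IH k2); first last.
- exact: leq_trans s1 _.
- exact: leq_trans s2 _.
by rewrite !mulr0 mul0r !addr0 => /eqP; rewrite mulf_eq0 (negPf v0) orbF => /eqP.
Qed.

Section Tangent.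
Variables (la al be y : K).
Hypothesis la_neq0 : la != 0.

Definition chart_arc (d : 'rV[K]_4) (k : nat) : {poly K} :=
  chart_coord (la%:P + d 0 (inord 0) *: 'X) (al%:P + d 0 (inord 1) *: 'X)
              (be%:P + d 0 (inord 2) *: 'X) (y%:P + d 0 (inord 3) *: 'X) k.

Definition chart_jacobian : 'M[K]_(4, n.+1) :=
  \matrix_(r < 4, k < n.+1) (chart_arc (delta_mx 0 r) k)^`().[0].

Lemma chart_arcE d (k : nat) t : (chart_arc d k).[t] =
  chart_coord (la + d 0 (inord 0) * t) (al + d 0 (inord 1) * t)
              (be + d 0 (inord 2) * t) (y + d 0 (inord 3) * t) k.
Proof.
rewrite /chart_arc /chart_coord; case: ifP => _; by rewrite ?hornerM ?horner_exp !hornerE.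
Qed.

Lemma chart_arc_deriv (d : 'rV[K]_4) k : (chart_arc d k)^`().[0] =
  if (k < n)%N then
    d 0 (inord 0) * al ^+ (e k).1 * be ^+ (e k).2 +
    la * (d 0 (inord 1) * al ^+ (e k).1.-1 *+ (e k).1) * be ^+ (e k).2 +
    la * al ^+ (e k).1 * (d 0 (inord 2) * be ^+ (e k).2.-1 *+ (e k).2)
  else d 0 (inord 3).
Proof.
rewrite /chart_arc /chart_coord; case: ifP => _; rewrite ?derivM ?derivM ?derivXn_exp;
rewrite ?deriv_exp !(derivD, derivC, derivZ, derivX) !(hornerE, hornerMn, horner_exp) /=.
  by rewrite mulrDl.
by [].
Qed.

Lemma chart_jacobianE (d : 'rV[K]_4) k :
  (d *m chart_jacobian) 0 k = (chart_arc d k)^`().[0].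
Proof.
rewrite mxE !big_ord_recl big_ord0 addr0 !mxE.
have h0 : ord0 = inord 0 :> 'I_4 by apply/val_inj; rewrite /= inordK.
have h1 : lift ord0 ord0 = inord 1 :> 'I_4 by apply/val_inj; rewrite /= inordK.
have h2 : lift ord0 (lift ord0 ord0) = inord 2 :> 'I_4 by apply/val_inj; rewrite /= inordK.
have h3 : lift ord0 (lift ord0 (lift ord0 ord0)) = inord 3 :> 'I_4.
  by apply/val_inj; rewrite /= inordK.
rewrite h1 h2 h3 {1 2}h0 !chart_arc_deriv !mxE -!val_eqE /= !inordK //=.
case: ifP => _; rewrite ?mul0r ?mul0rn ?mulr0 ?mul0r ?mul1r ?addr0 ?add0r ?mulr1 //.
rewrite !(mul0r, mul0rn, mulr0, mul1r, addr0, add0r) -!mulrnAr.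
by move: (al ^+ _) (be ^+ _) (al ^+ _ *+ _) (be ^+ _ *+ _) => A B C E; ring.
Qed.

Lemma chart_arc_toric (d : 'rV[K]_4) t : la + d 0 (inord 0) * t != 0 ->
  toric_cone (\row_(k < n.+1) (chart_arc d k).[t]).
Proof.
have [_ [l0 l1 l2] [e0 e1 e2] hc hs] := chart_okP.
move=> nz; split=> [|i j i' j' h].
  apply/eqP => /rowP/(_ (inord i0)); rewrite !mxE chart_arcE /chart_coord (inord_lt l0).
  by rewrite l0 e0 !expr0 !mulr1; apply/eqP.
by rewrite !mxE !chart_arcE; apply: chart_coord_relations.
Qed.

Lemma chart_arc0 d (k : nat) : (chart_arc d k).[0] = chart_coord la al be y k.
Proof. by rewrite chart_arcE !mulr0 !addr0. Qed.

Let v : 'rV[K]_n.+1 := \row_k chart_coord la al be y k.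

Lemma chart_jacobian_tangent (d : 'rV[K]_4) G : vanishing_ideal toric_cone G ->
  ddir G (v 0) ((d *m chart_jacobian) 0) = 0.
Proof.
move=> G0; have [P [hP dP]] := arc_deriv G (fun k : 'I_n.+1 => chart_arc d k).
have -> : ddir G (v 0) ((d *m chart_jacobian) 0) = P^`().[0].
  rewrite dP /ddir; apply: eq_bigr => i _; rewrite chart_jacobianE; congr (_ * _).
  by apply: meval_eq => k; rewrite mxE chart_arc0.
suff -> : P = 0 by rewrite deriv0 horner0.
have : P * (la%:P + d 0 (inord 0) *: 'X) = 0.
  apply: poly_eval_eq0 => t; rewrite hornerM !hornerE.
  have [->|nz] := eqVneq (la + d 0 (inord 0) * t) 0; first by rewrite mulr0.
  rewrite hP (_ : meval _ _ = 0) ?mul0r // -(G0 _ (chart_arc_toric nz)).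
  by apply: meval_eq => k; rewrite mxE.
move/eqP; rewrite mulf_eq0 => /orP[/eqP -> //|/eqP E].
have := congr1 (fun p : {poly K} => p.[0]) E; rewrite !hornerE ?mulr0 ?addr0 => /eqP.
by rewrite (negPf la_neq0).
Qed.

Lemma chart_jacobian_free : row_free chart_jacobian.
Proof.
have [_ [l0 l1 l2] [e0 e1 e2] hc hs] := chart_okP.
rewrite -kermx_eq0; apply/eqP/row_matrixP => i; rewrite row0.
set d := row i _; have : d *m chart_jacobian = 0.
  by rewrite -row_mul mulmx_ker row0.
move=> dJ; have dk (k : nat) : (k <= n)%N -> (chart_arc d k)^`().[0] = 0.
  by move=> hk; rewrite -[k](@inordK n) // -chart_jacobianE dJ mxE.
have d0 : d 0 (inord 0) = 0.
  by have := dk i0 (ltnW l0); rewrite chart_arc_deriv l0 e0 /= !mulr0n !mulr0 mul0r !addr0 !mulr1.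
have d1 : d 0 (inord 1) = 0.
  have := dk i1 (ltnW l1); rewrite chart_arc_deriv l1 e1 /= d0 !mul0r !mulr0n !mulr0 add0r addr0.
  by rewrite !expr0 !mulr1 mulr1n => /eqP; rewrite mulf_eq0 (negPf la_neq0) => /eqP.
have d2 : d 0 (inord 2) = 0.
  have := dk i2 (ltnW l2); rewrite chart_arc_deriv l2 e2 /= d0 !mul0r !mulr0n !mulr0 mul0r !add0r.
  by rewrite !expr0 !mulr1 mulr1n => /eqP; rewrite mulf_eq0 (negPf la_neq0) => /eqP.
have d3 : d 0 (inord 3) = 0 by have := dk n (leqnn n); rewrite chart_arc_deriv ltnn.
by apply/rowP; apply: ord4P; rewrite [RHS]mxE.
Qed.

Lemma chart_tangent_sub (u : 'rV[K]_n.+1) :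
  (forall Q, Q \is 2.-homog -> vanishing_ideal toric_cone Q -> ddir Q (v 0) (u 0) = 0) ->
  (u <= chart_jacobian)%MS.
Proof.
have [_ [l0 l1 l2] [e0 e1 e2] hc hs] := chart_okP.
move=> hu; pose c0 := u 0 (inord i0).
pose d : 'rV[K]_4 := \row_r nth 0 [:: c0; (u 0 (inord i1) - c0 * al) / la;
   (u 0 (inord i2) - c0 * be) / la; u 0 ord_max] r.
have d_ r : (r < 4)%N -> d 0 (inord r) = nth 0 [:: c0; (u 0 (inord i1) - c0 * al) / la;
   (u 0 (inord i2) - c0 * be) / la; u 0 ord_max] r by move=> hr; rewrite mxE inordK.
suff -> : u = d *m chart_jacobian by exact: submxMl.
apply/eqP; rewrite -subr_eq0; apply/eqP/rowP => k; rewrite [RHS]mxE; move: k.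
have uw k : (u - d *m chart_jacobian) 0 k = u 0 k - (d *m chart_jacobian) 0 k.
  by rewrite mxE [X in _ + X]mxE.
have vi0 : v 0 (inord i0) != 0.
  by rewrite mxE /chart_coord (inord_lt l0) l0 e0 !expr0 !mulr1.
apply: (chart_tangent_eq0 vi0).
- move=> i j i' j' /binomial_vanishing[hQ Q0]; set Q := _ - _ in hQ Q0.
  have h1 := hu _ hQ Q0; have h2 := chart_jacobian_tangent d Q0.
  move: h1 h2; rewrite /Q !ddirB !ddirM !ddirX !mevalXU => h1 h2.
  rewrite !uw; have := congr2 (fun a b => a - b) h1 h2; rewrite subrr => h.
  apply/eqP; rewrite -subr_eq0; apply/eqP; rewrite -[RHS]h.
  by move: (_ *m _) => w; ring.
- by rewrite uw chart_jacobianE chart_arc_deriv (inord_lt l0) l0 e0 d_ //= !mulr0n !mulr0 mul0r !addr0 !mulr1 subrr.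
- rewrite uw chart_jacobianE chart_arc_deriv (inord_lt l1) l1 e1 !d_ //= !mulr0n !mulr0 !expr0 expr1 !mulr1 mulr1n addr0.
  by rewrite mulrC [la * _]mulrC divfK // -/c0; ring.
- rewrite uw chart_jacobianE chart_arc_deriv (inord_lt l2) l2 e2 !d_ //= !mulr0n !mulr0 !expr0 expr1 !mulr1 mulr1n.
  by rewrite mul0r addr0 [la * _]mulrC divfK // -/c0; ring.
by rewrite uw chart_jacobianE chart_arc_deriv /= ltnn d_ // subrr.
Qed.

End Tangent.

(** The velocities of the arcs obtained by moving the parameters of the chart
    linearly fill the space cut out by the derivatives of the binomials. *)
Theorem toric_tangent v : toric_cone v -> v 0 (inord i0) != 0 ->
  exists T : 'M[K]_(4, n.+1), [/\ row_free T,
    forall d : 'rV[K]_4, exists A : 'I_n.+1 -> {poly K}, [/\ forall k, (A k).[0] = v 0 k,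
      forall k, (A k)^`().[0] = (d *m T) 0 k &
      forall t, (A (inord i0)).[t] != 0 -> toric_cone (\row_k (A k).[t])],
    forall d : 'rV[K]_4, forall G, vanishing_ideal toric_cone G -> ddir G (v 0) ((d *m T) 0) = 0 &
    forall u : 'rV[K]_n.+1,
      (forall Q, Q \is 2.-homog -> vanishing_ideal toric_cone Q -> ddir Q (v 0) (u 0) = 0) ->
      (u <= T)%MS].
Proof.
have [_ [l0 l1 l2] [e0 e1 e2] hc hs] := chart_okP.
move=> [_ vr] v0; set la := v 0 (inord i0) in v0.
pose al := v 0 (inord i1) / la; pose be := v 0 (inord i2) / la; pose y := v 0 ord_max.
have vE : v = \row_k chart_coord la al be y k.
  by apply/rowP => k; rewrite mxE; apply: toric_chart.
exists (chart_jacobian la al be y); split.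
- exact: chart_jacobian_free.
- move=> d; exists (fun k : 'I_n.+1 => chart_arc la al be y d k); split.
  + by move=> k; rewrite chart_arc0 [in RHS]vE mxE.
  + by move=> k; rewrite chart_jacobianE.
  move=> t; rewrite (inord_lt l0) chart_arcE /chart_coord l0 e0 !expr0 !mulr1.
  exact: chart_arc_toric.
- by move=> d G G0; rewrite vE; apply: chart_jacobian_tangent.
by move=> u hu; rewrite vE in hu; apply: chart_tangent_sub hu.
Qed.

End Chart.
End Toric.

(** * Local geometry *)

Section LowOrder.
Variable K : numFieldType.

Lemma mcoeff_pihomog n d (F : {mpoly K[n]}) m :
  (pihomog mdeg d F)@_m = if mdeg m == d then F@_m else 0.
Proof.
rewrite pihomogE raddf_sum /= big_mkcond /=.
have [mF|mF] := boolP (m \in msupp F); last first.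
  rewrite (memN_msupp_eq0 mF) if_same big_seq_cond big1 // => m' /andP[h _].
  case: ifP => // _; rewrite mcoeffZ mcoeffX.
  by case: eqP h => [->|]; rewrite ?mulr0 // (negPf mF).
rewrite (bigD1_seq m) ?msupp_uniq //= mcoeffZ mcoeffX eqxx mulr1 big1 ?addr0 // => m' nm.
by case: ifP => // _; rewrite mcoeffZ mcoeffX (negPf nm) mulr0.
Qed.

Lemma meval_zero n (F : {mpoly K[n]}) : F.@[(0 : 'rV[K]_n) 0] = F@_0%MM.
Proof.
elim/mpoly_ring_ind: F => [c|i|F G hF hG|F G hF hG].
- by rewrite mevalC mcoeffC eqxx mulr1.
- by rewrite mevalXU mxE mcoeffX mnm1_eq0.
- by rewrite mevalD mcoeffD hF hG.
by rewrite mevalM rmorphM hF hG.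
Qed.

Lemma ddir_zero n (F : {mpoly K[n]}) (z : 'rV[K]_n) :
  ddir F ((0 : 'rV[K]_n) 0) (z 0) = \sum_j F@_U_(j) * z 0 j.
Proof.
apply: eq_bigr => j _; rewrite meval_zero mcoeff_deriv add0m mnm0E mulr1n.
by [].
Qed.

Lemma ddir_comp n k (F : {mpoly K[n]}) (x : n.-tuple {mpoly K[k]}) v u :
  ddir (F \mPo x) v u =
  ddir F (fun i => (tnth x i).@[v]) (fun i => ddir (tnth x i) v u).
Proof.
elim/mpoly_ring_ind: F => [c|i|F G hF hG|F G hF hG].
- by rewrite comp_mpolyC !ddirC.
- by rewrite comp_mpolyXU -tnth_nth ddirX.
- by rewrite comp_mpolyD !ddirD hF hG.
by rewrite rmorphM /= !ddirM hF hG !comp_mpoly_meval.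
Qed.

Lemma order_geD n k (F G : {mpoly K[n]}) : order_ge k F -> order_ge k G -> order_ge k (F + G).
Proof. by move=> hF hG m /msuppD_le; rewrite mem_cat => /orP[/hF|/hG]. Qed.

Lemma order_geP n k (F : {mpoly K[n]}) :
  order_ge k F <-> forall m, (mdeg m < k)%N -> F@_m = 0.
Proof.
split=> [h m mk|h m]; first by apply/memN_msupp_eq0/negP => /h; rewrite leqNgt mk.
by rewrite mcoeff_msupp leqNgt; apply: contra => /h ->.
Qed.

Lemma order_geZ n k c (F : {mpoly K[n]}) : order_ge k F -> order_ge k (c *: F).
Proof. by move=> /order_geP h; apply/order_geP => m /h; rewrite mcoeffZ => ->; rewrite mulr0. Qed.

Lemma order_geC n k (F G : {mpoly K[n]}) : order_ge k (F - G) -> order_ge k (G - F).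
Proof. by move=> h; rewrite -opprB -scaleN1r; apply: order_geZ. Qed.

Lemma order_geM n k d (F G : {mpoly K[n]}) :
  F \is d.-homog -> order_ge k G -> order_ge (d + k)%N (F * G).
Proof.
move=> /dhomogP hF hG m /msuppM_le /allpairsP[[m1 m2] /= [/hF /= <- /hG h ->]].
by rewrite mdegD leq_add2l.
Qed.

Lemma homog_order n d k (F : {mpoly K[n]}) : (k <= d)%N -> F \is d.-homog -> order_ge k F.
Proof. by move=> kd /dhomogP hF m /hF /= ->. Qed.

Lemma order_lead n k (F : {mpoly K[n]}) :
  order_ge k F -> order_ge k.+1 (F - pihomog mdeg k F).
Proof.
move=> /order_geP h; apply/order_geP => m; rewrite ltnS mcoeffB mcoeff_pihomog.
rewrite leq_eqVlt => /orP[->|mk]; first by rewrite subrr.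
by rewrite h // ltn_eqF // subr0.
Qed.

(** ** Relative dimension *)

(** [J] has codimension [h] in the space [A]: this is the form in which the
    length of the local rings below is defined. *)
Definition reldim (V : lmodType K) (A J : set V) (h : nat) : Prop :=
  exists B : h.-tuple V, (forall i, A (tnth B i)) /\
    forall G, A G -> exists! c : 'rV[K]_h, J (G - \sum_(i < h) c 0 i *: tnth B i).

Definition subspace (V : lmodType K) (A : set V) : Prop :=
  [/\ A 0, forall x y, A x -> A y -> A (x + y) & forall c x, A x -> A (c *: x)].

Lemma subspace_sum (V : lmodType K) (A : set V) h (c : 'I_h -> K) (B : 'I_h -> V) :
  subspace A -> (forall i, A (B i)) -> A (\sum_(i < h) c i *: B i).
Proof. by move=> [A0 AD AZ] hB; elim/big_ind: _ => // i _; apply: AZ. Qed.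

Lemma subspaceB (V : lmodType K) (A : set V) x y : subspace A -> A x -> A y -> A (x - y).
Proof. by move=> [_ AD AZ] hx hy; apply: AD => //; rewrite -scaleN1r; apply: AZ. Qed.

Lemma reldim_chain (V : lmodType K) (A J1 J2 : set V) h1 h2 :
  subspace J1 -> (forall x, J1 x -> A x) -> (forall x, J2 x -> J1 x) ->
  reldim A J1 h1 -> reldim J1 J2 h2 -> reldim A J2 (h1 + h2)%N.
Proof.
move=> sJ1 J1A J21 [B1 [AB1 h1P]] [B2 [AB2 h2P]]; exists [tuple of B1 ++ B2]; split.
  move=> i; rewrite -(splitK i); case: (split i) => j /=.
    by rewrite tnth_lshift.
  by rewrite tnth_rshift; apply: J1A.
have sumE (c : 'rV[K]_(h1 + h2)) : \sum_(i < h1 + h2) c 0 i *: tnth [tuple of B1 ++ B2] i =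
    \sum_(i < h1) lsubmx c 0 i *: tnth B1 i + \sum_(i < h2) rsubmx c 0 i *: tnth B2 i.
  rewrite big_split_ord; congr (_ + _); apply: eq_bigr => i _.
    by rewrite tnth_lshift mxE.
  by rewrite tnth_rshift mxE.
move=> G AG; have [c1 [hc1 u1]] := h1P _ AG; have [c2 [hc2 u2]] := h2P _ hc1.
exists (row_mx c1 c2); split.
  by rewrite sumE row_mxKl row_mxKr opprD addrA.
move=> c; rewrite sumE opprD addrA => hc.
have E1 : c1 = lsubmx c.
  apply: u1; rewrite -[X in J1 X](subrK (\sum_(i < h2) rsubmx c 0 i *: tnth B2 i)).
  by have [_ JD _] := sJ1; apply: JD; [exact: J21 | exact: subspace_sum].
have E2 : c2 = rsubmx c by apply: u2; rewrite E1.
by rewrite E1 E2 hsubmxK.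
Qed.

Lemma reldim_iso (V V' : lmodType K) (rho : V -> V') (A J : set V) (A' J' : set V') h :
  linear rho -> subspace A -> (forall x, A x -> A' (rho x)) ->
  (forall y, A' y -> exists2 x, A x & rho x = y) ->
  (forall x, A x -> J x <-> J' (rho x)) -> reldim A' J' h -> reldim A J h.
Proof.
move=> lin sA AA' lift JJ' [B' [AB' hP]].
have rho0 : rho 0 = 0.
  by have := lin 1 0 0; rewrite !scale1r addr0 -[LHS]addr0 => /addrI ->.
have /choice[f hf] i : exists x, A x /\ rho x = tnth B' i.
  by have [x Ax <-] := lift _ (AB' i); exists x.
exists [tuple f i | i < h]; split=> [i|G AG]; first by rewrite tnth_mktuple; case: (hf i).
have rho_sum (c : 'rV[K]_h) : rho (\sum_(i < h) c 0 i *: tnth [tuple f i | i < h] i) =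
    \sum_(i < h) c 0 i *: tnth B' i.
  elim/big_rec2: _ => [|i y x _ <-]; first exact: rho0.
  by rewrite lin tnth_mktuple (hf i).2.
have E (c : 'rV[K]_h) : J (G - \sum_(i < h) c 0 i *: tnth [tuple f i | i < h] i) <->
    J' (rho G - \sum_(i < h) c 0 i *: tnth B' i).
  rewrite JJ'; last first.
    apply: subspaceB => //; apply: subspace_sum => // i; rewrite tnth_mktuple.
    by case: (hf i).
  by rewrite addrC -scaleN1r lin rho_sum scaleN1r addrC.
have [c [hc uc]] := hP _ (AA' _ AG); exists c; split; first by apply/E.
by move=> c' /E; exact: uc.
Qed.

Lemma reldim_all (V : lmodType K) (A J : set V) : (forall x, A x -> J x) -> reldim A J 0.
Proof.
move=> AJ; exists [tuple]; split=> [[]//|G AG]; exists 0; split.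
  by rewrite big_ord0 subr0; apply: AJ.
by move=> c _; apply/rowP => -[].
Qed.

Lemma reldim_eq (V : lmodType K) (A J J' : set V) h :
  (forall x, J x <-> J' x) -> reldim A J h -> reldim A J' h.
Proof.
move=> E; have -> // : J = J'; apply: funext => x; apply: propext; exact: E.
Qed.

Lemma reldim_monomials n (s : seq 'X_{1..n}) : uniq s ->
  reldim (fun F : {mpoly K[n]} => {subset msupp F <= s}) (fun F => F = 0) (size s).
Proof.
move=> uniq_s; pose B := [tuple 'X_[nth 0%MM s i] : {mpoly K[n]} | i < size s].
exists B; split=> [i m|G hG].
  by rewrite tnth_mktuple msuppX inE => /eqP ->; rewrite mem_nth.
have coefB (c : 'rV[K]_(size s)) (i : 'I_(size s)) :
    (\sum_(j < size s) c 0 j *: tnth B j)@_(nth 0%MM s i) = c 0 i.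
  rewrite raddf_sum (bigD1 i) //= tnth_mktuple mcoeffZ mcoeffX eqxx mulr1.
  rewrite big1 ?addr0 // => j ji; rewrite tnth_mktuple mcoeffZ mcoeffX.
  by rewrite nth_uniq // (negPf (ji : (j : nat) != i)) mulr0.
exists (\row_i G@_(nth 0%MM s i)); split=> [|c Ec]; last first.
  by apply/rowP => i; rewrite mxE -(coefB c); congr mcoeff; apply/eqP; rewrite -subr_eq0 Ec.
apply/eqP; rewrite subr_eq0; apply/eqP/mpolyP => m.
have [ms|ms] := boolP (m \in s).
  have lt_m : (index m s < size s)%N by rewrite index_mem.
  have -> : m = nth 0%MM s (Ordinal lt_m) by rewrite nth_index.
  by rewrite coefB mxE.
rewrite memN_msupp_eq0; last by apply: contra ms => /hG.
rewrite raddf_sum big1 //= => i _.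
rewrite mcoeffZ tnth_mktuple mcoeffX; case: eqP => [E|]; last by rewrite mulr0.
by rewrite -E mem_nth in ms.
Qed.

Lemma reldim_forms n d :
  reldim (fun F : {mpoly K[n.+1]} => F \is d.-homog) (fun F => F = 0) 'C(d + n, d).
Proof.
rewrite -(size_basis n d); set s := (X in size X).
have -> : (fun F : {mpoly K[n.+1]} => is_true (F \is d.-homog)) =
    (fun F => {subset msupp F <= s}).
  apply: funext => F; apply: propext; split=> [/dhomogP h m /h /= /eqP|h].
    by rewrite basis_cover.
  by apply/dhomogP => m /h; rewrite -basis_cover => /eqP.
by apply: reldim_monomials; exact: uniq_basis.
Qed.

Lemma reldim_image (V V' : lmodType K) (nu : V' -> V) (A : set V) (A' : set V') h :
  linear nu -> injective nu -> (forall x, A x <-> exists2 y, A' y & x = nu y) ->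
  reldim A' (fun y => y = 0) h -> reldim A (fun x => x = 0) h.
Proof.
move=> lin inj AE [B [hB uB]].
pose mu : {linear V' -> V} := HB.pack nu (GRing.isLinear.Build K V' V *:%R nu lin).
exists [tuple mu (tnth B i) | i < h].
have sumE (c : 'rV[K]_h) : \sum_(i < h) c 0 i *: tnth [tuple mu (tnth B i) | i < h] i =
    mu (\sum_(i < h) c 0 i *: tnth B i).
  by rewrite linear_sum; apply: eq_bigr => i _; rewrite linearZ tnth_mktuple.
split=> [i|_ /AE[y Ay ->]]; first by apply/AE; exists (tnth B i); rewrite ?tnth_mktuple.
have [c [hc uc]] := uB _ Ay; exists c; split.
  by rewrite sumE -[nu y]/(mu y) -linearB hc linear0.
by move=> c'; rewrite sumE -[nu y]/(mu y) -linearB -(linear0 mu) => /inj; exact: uc.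
Qed.

Lemma homog_subspace n d : subspace (fun F : {mpoly K[n]} => F \is d.-homog).
Proof. by split=> [|F G hF hG|c F hF]; rewrite ?rpred0 ?rpredD ?rpredZ. Qed.

End LowOrder.

Section LocalCharts.
Variables (K : numClosedFieldType) (p : nat) (X : set 'rV[K]_p.+1) (w : 'rV[K]_p.+1).
Hypothesis X_scale : forall u c, X u -> c != 0 -> X (c *: u).
Hypotheses (w_neq0 : w != 0) (Xw : X w).

Local Notation i0 := (pivot w).

Lemma pivot_neq0 : w 0 i0 != 0.
Proof.
rewrite /pivot; case: pickP => [//|h]; case/eqP: w_neq0; apply/rowP => i.
by rewrite mxE; apply/eqP/negPn; rewrite h.
Qed.

Lemma chart_pivot z : chart w z 0 i0 = w 0 i0.
Proof. by rewrite mxE unlift_none addr0. Qed.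

Lemma chart_lift z j : chart w z 0 (lift i0 j) = w 0 (lift i0 j) + z 0 j.
Proof. by rewrite mxE liftK. Qed.

Lemma chart0 : chart w 0 = w.
Proof.
by apply/rowP => i; have [j ->|->] := unliftP i0 i; rewrite ?chart_pivot // chart_lift mxE addr0.
Qed.

(** The direction, in the coordinates centred at [w], of an arc in projective
    space through [w] with velocity [u]. *)
Definition chart_direction (u : 'rV[K]_p.+1) : 'rV[K]_p :=
  \row_j (u 0 (lift i0 j) - w 0 (lift i0 j) / w 0 i0 * u 0 i0).

(** Substituting an arc of order [e] into [r] gives, up to a power of the
    denominator [om], a multiple of t^(e k) if [r] has order at least [k]. *)
Lemma order_arc k (r : {mpoly K[p]}) (eta : 'I_p -> {poly K}) (om : {poly K}) e :
  order_ge k r -> forall N, (msize r <= N)%N -> exists R : {poly K}, forall t, om.[t] != 0 ->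
    r.@[fun j => t ^+ e * (eta j).[t] / om.[t]] * om.[t] ^+ N = t ^+ (e * k) * R.[t].
Proof.
move=> hr N hN.
exists (\sum_(m <- msupp r) r@_m *: ('X^(e * (mdeg m - k)) * (\prod_j eta j ^+ m j) * om ^+ (N - mdeg m))).
move=> t omt; rewrite mevalE horner_sum mulr_suml mulr_sumr big_seq [RHS]big_seq.
apply: eq_bigr => m mr; have km := hr _ mr; have mN := leq_trans (ltnW (msize_mdeg_lt mr)) hN.
rewrite hornerZ !hornerM !horner_exp hornerX horner_prod.
under eq_bigr => j _ do rewrite !exprMn.
rewrite !big_split /= -[LHS]mulrA [RHS]mulrCA; congr (_ * _).
under [X in _ = _ * (_ * X * _)]eq_bigr => j _ do rewrite horner_exp.
under [X in _ * X * _ = _]eq_bigr => j _ do rewrite exprVn.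
rewrite prodfV !prodrXr -mdegE -exprM.
rewrite -{1}(subnKC km) mulnDr exprD -{1}(subnK mN) [om.[t] ^+ (_ + _)]exprD.
set P := \prod_j _; have o : om.[t] ^+ mdeg m != 0 by rewrite expf_neq0.
by field.
Qed.

(** An initial form of a function on [X] vanishes on the leading direction of
    each arc on [X]: it is the leading coefficient along the arc. *)
Lemma arc_initial_form (A D : 'I_p.+1 -> {poly K}) e g f : (0 < e)%N ->
  (forall k, A k = (w 0 k)%:P + 'X^e * D k) ->
  (forall t, (A i0).[t] != 0 -> X (\row_k (A k).[t])) ->
  chart_ideal X w g -> initial_form g f ->
  f.@[(chart_direction (\row_k (D k).[0])) 0] = 0.
Proof.
move=> e0 AE XA gX [d [hf hr]]; have wi := pivot_neq0.
pose eta j := w 0 i0 *: D (lift i0 j) - w 0 (lift i0 j) *: D i0.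
pose om := A i0; pose r := g - f.
have om0 : om.[0] = w 0 i0 by rewrite /om AE !hornerE ?hornerXn expr0n gtn_eqF // mul0r addr0.
have gz t : om.[t] != 0 -> g.@[fun j => t ^+ e * (eta j).[t] / om.[t]] = 0.
  move=> omt; rewrite -(gX (\row_j (t ^+ e * (eta j).[t] / om.[t]))).
    by apply: meval_eq => j; rewrite mxE.
  suff -> : chart w (\row_j (t ^+ e * (eta j).[t] / om.[t])) =
            (w 0 i0 / om.[t]) *: \row_k (A k).[t].
    by apply: X_scale; [exact: XA | rewrite mulf_neq0 ?invr_eq0].
  apply/rowP => k; have [j ->|->] := unliftP i0 k; last first.
    by rewrite chart_pivot !mxE -/om divfK.
  rewrite chart_lift !mxE AE /eta !hornerE ?hornerXn.
  have -> : om.[t] = w 0 i0 + t ^+ e * (D i0).[t] by rewrite /om AE !hornerE ?hornerXn.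
  have omt' : w 0 i0 + t ^+ e * (D i0).[t] != 0 by move: omt; rewrite /om AE !hornerE ?hornerXn.
  by field.
pose N := (d + msize r)%N.
have [R hR] := @order_arc d.+1 r eta om e hr N (leq_addl _ _).
have [P [hP _]] := arc_deriv f eta.
have key : 'X * om * (P * om ^+ (N - d) + 'X^e * R) = 0.
  apply: poly_eval_eq0 => t; rewrite !hornerM hornerX.
  have [->|t0] := eqVneq t 0; first by rewrite !mul0r.
  have [->|omt] := eqVneq om.[t] 0; first by rewrite mulr0 mul0r.
  rewrite (_ : (_ + _).[t] = 0) ?mulr0 //.
  rewrite hornerD !hornerM hP !horner_exp ?hornerX ?hornerXn.
  have := hR t omt; rewrite /r mevalB gz // sub0r => E.
  have fE : f.@[fun j => t ^+ e * (eta j).[t] / om.[t]] =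
            (t ^+ e / om.[t]) ^+ d * f.@[fun j => (eta j).[t]].
    have := @dhomog_eval _ _ _ _ (t ^+ e / om.[t]) (\row_j (eta j).[t]) hf.
    rewrite (@meval_eq _ _ _ (fun j => t ^+ e * (eta j).[t] / om.[t])) => [->|j].
      by congr (_ * _); apply: meval_eq => j; rewrite mxE.
    by rewrite !mxE mulrAC.
  have te : t ^+ (e * d) != 0 by rewrite expf_neq0.
  have E2 : t ^+ (e * d) * (t ^+ e * R.[t]) = t ^+ (e * d.+1) * R.[t].
    by rewrite mulrA -exprD -mulnSr.
  apply: (mulfI te); rewrite mulr0 mulrDr E2 -E fE.
  rewrite expr_div_n -exprM /N addKn exprD.
  have o : om.[t] ^+ d != 0 by rewrite expf_neq0.
  move: (f.@[_]) (om.[t] ^+ d) (om.[t] ^+ msize r) (t ^+ (e * d)) o => a x y u x0.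
  by field.
have om_neq0 : om != 0.
  by apply: contraNneq wi => E; rewrite -om0 E horner0.
have {}key : P * om ^+ (N - d) + 'X^e * R = 0.
  by apply/eqP; move/eqP: key; rewrite !mulf_eq0 polyX_eq0 (negPf om_neq0).
have := congr1 (fun q : {poly K} => q.[0]) key.
rewrite horner0 hornerD !hornerM hP !horner_exp ?hornerX ?hornerXn om0 expr0n gtn_eqF //= mul0r addr0.
move/eqP; rewrite mulf_eq0 expf_eq0 (negPf wi) andbF orbF => /eqP E.
have := @dhomog_eval _ _ _ _ (w 0 i0) (chart_direction (\row_k (D k).[0])) hf.
rewrite (@meval_eq _ _ _ (fun j => (eta j).[0])) ?E => [/esym/eqP|j].
  by rewrite mulf_eq0 expf_eq0 (negPf wi) andbF => /eqP.
rewrite /eta !mxE !hornerE; by field.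
Qed.

Lemma arc_tangent (A D : 'I_p.+1 -> {poly K}) e : (0 < e)%N ->
  (forall k, A k = (w 0 k)%:P + 'X^e * D k) ->
  (forall t, (A i0).[t] != 0 -> X (\row_k (A k).[t])) ->
  tangent_space X w (chart_direction (\row_k (D k).[0])).
Proof.
move=> e0 AE XA g gX; rewrite -lin_eval.
apply: (arc_initial_form e0 AE XA gX); exists 1%N; split; first exact: lin_homog.
apply/order_geP => m; rewrite ltnS mcoeffB raddf_sum /=.
under eq_bigr do rewrite mcoeffZ mcoeffX.
rewrite leq_eqVlt ltnS leqn0 => /orP[/mdeg1P[j /eqP ->]|].
  rewrite (bigD1 j) //= eqxx mulr1 big1 ?addr0 ?subrr // => i ij.
  by rewrite eq_mnm1 (negPf ij) mulr0.
rewrite mdeg_eq0 => /eqP ->; rewrite big1 => [|i _]; last by rewrite mnm1_eq0 mulr0.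
by rewrite subr0 -meval_zero gX // chart0.
Qed.


(** ** Smooth and singular points *)

Definition insertion : 'M[K]_(p, p.+1) := \matrix_(j, k) (k == lift i0 j)%:R.

Lemma insertion_lift (z : 'rV[K]_p) j : (z *m insertion) 0 (lift i0 j) = z 0 j.
Proof.
rewrite mxE (bigD1 j) //= mxE eqxx mulr1 big1 ?addr0 // => i ij.
by rewrite mxE (inj_eq lift_inj) eq_sym (negPf ij) mulr0.
Qed.

Lemma insertion_pivot (z : 'rV[K]_p) : (z *m insertion) 0 i0 = 0.
Proof.
rewrite mxE big1 // => i _; rewrite mxE; have /negPf -> : i0 != lift i0 i by exact: neq_lift.
by rewrite mulr0.
Qed.

Lemma insertion_free : row_free insertion.
Proof.
rewrite -kermx_eq0; apply/eqP/row_matrixP => i; rewrite row0.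
have : row i (kermx insertion) *m insertion = 0 by rewrite -row_mul mulmx_ker row0.
by move=> E; apply/rowP => j; rewrite -insertion_lift E !mxE.
Qed.

Lemma tangent_ddir z Q : tangent_space X w z -> vanishing_ideal X Q ->
  ddir Q (w 0) ((z *m insertion) 0) = 0.
Proof.
move=> hz QX; pose c k : {mpoly K[p]} :=
  (w 0 k)%:MP + (if unlift i0 k is Some j then 'X_j else 0).
pose g := Q \mPo [tuple c k | k < p.+1].
have cE k (v : 'I_p -> K) : (c k).@[v] = w 0 k + (if unlift i0 k is Some j then v j else 0).
  by rewrite mevalD mevalC; case: unlift => [j|]; rewrite ?mevalXU ?meval0.
have gX : chart_ideal X w g.
  move=> z' hz'; rewrite comp_mpoly_meval -(QX _ hz'); apply: meval_eq => k.
  by rewrite tnth_mktuple cE mxE.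
rewrite -[RHS](hz g gX) -ddir_zero ddir_comp.
have -> : (fun i => (tnth [tuple c k | k < p.+1] i).@[(0 : 'rV[K]_p) 0]) = w 0.
  apply: funext => i; rewrite tnth_mktuple cE -{1}chart0 mxE.
  by case: unlift => [j|]; rewrite ?mxE !addr0.
congr ddir; apply: funext => k; rewrite tnth_mktuple ddirD ddirC add0r.
have [j ->|->] := unliftP i0 k; first by rewrite insertion_lift ddirX.
by rewrite insertion_pivot ddir0.
Qed.

(** The velocities at [w] of arcs in [X] fill the space [U], and the quadrics through
    [X] leave no others; the projective tangent space is thus of dimension 3. *)
Lemma smooth_point (U : 'M[K]_(4, p.+1)) : row_free U -> (w <= U)%MS ->
  (forall x : 'rV[K]_4, exists A D : 'I_p.+1 -> {poly K},
     [/\ forall k, A k = (w 0 k)%:P + 'X * D k, forall k, (D k).[0] = (x *m U) 0 k &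
         forall t, (A i0).[t] != 0 -> X (\row_k (A k).[t])]) ->
  (forall u : 'rV[K]_p.+1, (forall Q, Q \is 2.-homog -> vanishing_ideal X Q ->
     ddir Q (w 0) (u 0) = 0) -> (u <= U)%MS) ->
  ~ singular_point 3 X w.
Proof.
move=> fU wU arcs up [_ []]; have wi := pivot_neq0.
have TE z : tangent_space X w z <-> (z *m insertion <= U)%MS.
  split=> [hz|/submxP[x E]]; first by apply: up => Q _ QX; apply: tangent_ddir.
  have [A [D [AE DE XA]]] := arcs x.
  have -> : z = chart_direction (\row_k (D k).[0]).
    apply/rowP => j; rewrite !mxE !DE -E insertion_lift insertion_pivot.
    by rewrite mulr0 subr0.
  by apply: (@arc_tangent A D 1).
have [L0 E0] := submxP (capmxSr U insertion).
have fins : \rank insertion = p by apply/eqP; exact: insertion_free.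
have rk : \rank L0 = 3%N.
  rewrite -(mxrankMfree _ insertion_free) -E0.
  have := mxrank_sum_cap U insertion; rewrite fins (eqP fU).
  have : (p < \rank (U + insertion)%MS)%N.
    rewrite -[X in (X < _)%N]fins; apply: rank_ltmx; rewrite /ltmx addsmxSr.
    apply/negP => h; have : (w <= insertion)%MS by apply: submx_trans (submx_trans (addsmxSl _ _) h).
    by case/submxP => z wz; move: (insertion_pivot z) wi; rewrite -wz => ->; rewrite eqxx.
  have := rank_leq_col (U + insertion)%MS; lia.
exists <<L0>>%MS; first by rewrite genmxE.
move=> z; rewrite TE genmxE -(submxMfree _ _ insertion_free) -E0 sub_capmx.
by rewrite submxMl andbT.
Qed.

Lemma singular_of_directions h (B : 'M[K]_(h, p)) d : (d < h)%N -> row_free B ->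
  (forall i, tangent_space X w (row i B)) -> singular_point d X w.
Proof.
move=> dh fB hB; split=> // -[L rL TL].
have : (B <= L)%MS by apply/row_subP => i; apply/TL.
by move/mxrankS; rewrite rL (eqP fB) leqNgt dh.
Qed.

(** ** Tangent cones and multiplicities *)

Section TangentCone.
Variables (S : set 'rV[K]_p).
Hypothesis initial_vanishing :
  forall g f, chart_ideal X w g -> initial_form g f -> vanishing_ideal S f.

(** Equations in the tangent cone bound it from above, initial forms vanishing on
    [S] from below. *)
Lemma tangent_cone_is_cone_over (G : set {mpoly K[p]}) :
  (forall f, G f -> tangent_cone X w f) ->
  (forall f, vanishing_ideal S f -> ideal_gen G f) ->
  is_cone_over (tangent_cone X w) S.
Proof.
move=> hG SG f; split=> [|/SG].
  apply: (ideal_gen_min (J := vanishing_ideal S)) => [|F H hF hH|F H hH|F [g]].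
  - by move=> z _; rewrite meval0.
  - by move=> z hz; rewrite mevalD hF // hH // addr0.
  - by move=> z hz; rewrite mevalM hH // mulr0.
  - exact: initial_vanishing.
by apply: (ideal_gen_min (J := tangent_cone X w)) => [|F H|F H|//];
  [exact: ideal_gen0 | exact: ideal_genD | exact: ideal_genM].
Qed.

Hypothesis cone : is_cone_over (tangent_cone X w) S.

Definition neighbourhood_ideal k : set {mpoly K[p]} :=
  fun G => exists2 g, chart_ideal X w g & order_ge k (G - g).

Lemma neighbourhood_subspace k : subspace (neighbourhood_ideal k).
Proof.
split=> [|F G [f hf oF] [g hg oG]|c F [f hf oF]].
- exists 0; first by move=> z _; rewrite meval0.
  by rewrite subrr => m; rewrite msupp0.
- exists (f + g); last by rewrite opprD addrACA; apply: order_geD.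
  by move=> z hz; rewrite mevalD hf // hg // addr0.
exists (c *: f); last by rewrite -scalerBr; apply: order_geZ.
by move=> z hz; rewrite mevalZ hf // mulr0.
Qed.

Lemma neighbourhoodS k F : neighbourhood_ideal k.+1 F -> neighbourhood_ideal k F.
Proof. by move=> [g hg h]; exists g => // m /h /ltnW. Qed.

Lemma order_neighbourhood k F : order_ge k F -> neighbourhood_ideal k F.
Proof. by exists 0; rewrite ?subr0 // => z _; rewrite meval0. Qed.

(** A homogeneous element of the tangent cone ideal is a combination of initial
    forms of the same degree, hence agrees up to higher order with a function
    vanishing on [X]. *)
Lemma cone_neighbourhood k f :
  f \is k.-homog -> vanishing_ideal S f -> neighbourhood_ideal k.+1 f.
Proof.
move=> hf /cone [s [hs E]]; have [_ ND _] := neighbourhood_subspace k.+1.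
have -> : f = \sum_(gq <- s) pihomog mdeg k (gq.1 * gq.2).
  by rewrite -{1}(pihomog_dE hf) {1}E raddf_sum.
rewrite big_seq; elim/big_ind: _ => [|//|gq /hs[g hg [d [hq og]]]].
  by have [] := neighbourhood_subspace k.+1.
have -> : pihomog mdeg k (gq.1 * gq.2) =
    (if (d <= k)%N then pihomog mdeg (k - d) gq.1 else 0) * gq.2.
  have E1 e : pihomog mdeg e gq.1 * gq.2 \is (e + d).-homog.
    by apply: dhomogM => //; apply: pihomogP.
  rewrite {1}(pihomog_partitionE (leqnn (mmeasure mdeg gq.1))) mulr_suml raddf_sum /=.
  have [dk|dk] := leqP d k; last first.
    rewrite mul0r big1 // => e _; apply/mpolyP => m; rewrite mcoeff0 mcoeff_pihomog.
    case: eqP => // mk; apply: (dhomog_nemf_coeff (E1 e)); rewrite /= mk; lia.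
  have [km|km] := ltnP (k - d) (mmeasure mdeg gq.1).
    rewrite (bigD1 (Ordinal km)) //= big1 ?addr0 => [|e ek].
      by rewrite pihomog_dE // -{2}(subnK dk).
    apply/mpolyP => m; rewrite mcoeff0 mcoeff_pihomog; case: eqP => // mk.
    apply: (dhomog_nemf_coeff (E1 e)); rewrite /= mk; apply/eqP => ked.
    by case/eqP: ek; apply/val_inj; rewrite /= ked addnK.
  rewrite (_ : pihomog _ _ gq.1 = 0) ?mul0r.
    rewrite big1 // => e _; apply/mpolyP => m; rewrite mcoeff0 mcoeff_pihomog.
    case: eqP => // mk; apply: (dhomog_nemf_coeff (E1 e)); rewrite /= mk.
    by apply/eqP => ked; have := leq_trans (ltn_ord e) km; rewrite ked addnK ltnn.
  apply/mpolyP => m; rewrite mcoeff0 mcoeff_pihomog; case: eqP => // mk.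
  by apply: memN_msupp_eq0; apply: msize_mdeg_ge; rewrite mk.
case: ifP => [dk|_]; last by rewrite mul0r; have [] := neighbourhood_subspace k.+1.
exists (pihomog mdeg (k - d) gq.1 * g).
  by move=> z hz; rewrite mevalM hg // mulr0.
have -> : k.+1 = (k - d + d.+1)%N by rewrite addnS subnK.
rewrite -mulrBr; apply: order_geM; first exact: pihomogP.
exact: order_geC.
Qed.

(** The graded pieces of the local ring are the homogeneous pieces of the
    coordinate ring of the tangent cone. *)
Lemma neighbourhood_reldim (hf : nat -> nat) :
  (forall d, reldim (fun F => F \is d.-homog) (vanishing_ideal S) (hf d)) ->
  forall k, reldim (fun=> True) (neighbourhood_ideal k) (\sum_(d < k) hf d).
Proof.
move=> hS; elim=> [|k IH].
  by rewrite big_ord0; apply: reldim_all => F _; apply: order_neighbourhood.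
rewrite big_ord_recr /=.
apply: (reldim_chain (neighbourhood_subspace k) _ (@neighbourhoodS k) IH) => //.
have [B [hB uB]] := hS k; exists B; split.
  by move=> i; apply: order_neighbourhood; apply: homog_order (hB i).
have sumB (c : 'rV[K]_(hf k)) : \sum_i c 0 i *: tnth B i \is k.-homog.
  by apply: rpred_sum => i _; apply: rpredZ.
move=> G [g gX oG]; pose f := pihomog mdeg k (G - g).
have hfk : f \is k.-homog by exact: pihomogP.
have fG : neighbourhood_ideal k.+1 (G - f).
  by exists g => //; rewrite addrAC; apply: order_lead.
have [_ ND NZ] := neighbourhood_subspace k.+1.
have [c [hc uc]] := uB _ hfk; exists c; split.
  rewrite -(subrKA f); apply: ND => //; apply: cone_neighbourhood => //.
  by apply: rpredB; [exact: hfk | exact: sumB].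
move=> c' hc'; apply: uc.
have [g' g'X og] : neighbourhood_ideal k.+1 (f - \sum_i c' 0 i *: tnth B i).
  have -> : f - \sum_i c' 0 i *: tnth B i = (G - \sum_i c' 0 i *: tnth B i) + -1 *: (G - f).
    by rewrite scaleN1r; ring.
  by apply: ND => //; apply: NZ.
apply: (initial_vanishing g'X); exists k; split.
  by apply: rpredB; [exact: hfk | exact: sumB].
exact: order_geC.
Qed.

(** With e = 4, 5, 6 the Hilbert functions below all have the form
    (d + 1)(e d + 2) / 2, whose sum over d < k is k (k + 1) (e k + 3 - e) / 6. *)
Lemma multiplicity_of_hilbert (hf : nat -> nat) e : (0 < e)%N ->
  (forall d, reldim (fun F => F \is d.-homog) (vanishing_ideal S) (hf d)) ->
  (forall d, (2 * hf d = d.+1 * (e * d + 2))%N) -> multiplicity 3 X w e.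
Proof.
move=> e0 hS hfE.
pose chi : {poly rat} := 6%:R^-1 *: ('X * ('X + 1) * (e%:R *: 'X + (3%:R - e%:R)%:P)).
have s1 : size ('X + 1 : {poly rat}) = 2%N by rewrite size_addl ?size_polyX ?size_poly1.
have e_neq0 : e%:R != 0 :> rat by rewrite pnatr_eq0 -lt0n.
have s2 : size (e%:R *: 'X + (3%:R - e%:R)%:P : {poly rat}) = 2%N.
  rewrite size_addl ?size_scale ?size_polyX //.
  by apply: leq_ltn_trans (size_polyC_leq1 _) _.
have chi_neq0 : 'X * ('X + 1) * (e%:R *: 'X + (3%:R - e%:R)%:P) != 0 :> {poly rat}.
  by rewrite !mulf_neq0 ?polyX_eq0 // -size_poly_eq0 ?s1 ?s2.
exists chi; split=> //.
- rewrite size_scale // !size_mul ?s1 ?s2 ?size_polyX //.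
  + by rewrite polyX_eq0.
  + by rewrite -size_poly_eq0 s1.
  + by rewrite -size_poly_eq0 size_mul ?s1 ?size_polyX ?polyX_eq0 // -size_poly_eq0 s1.
  by rewrite -size_poly_eq0 s2.
- rewrite lead_coefZ !lead_coefM lead_coefX lead_coefDl ?size_polyX ?size_poly1 //.
  rewrite lead_coefX lead_coefDl ?size_scale ?size_polyX //; last first.
    by apply: leq_ltn_trans (size_polyC_leq1 _) _.
  by rewrite lead_coefZ lead_coefX !mulr1 mul1r mulrC.
exists 0%N => k _; exists (\sum_(d < k) hf d)%N; last first.
  have [B [_ hB]] := neighbourhood_reldim hS k.
  by exists B => G; apply: hB.
have two : 2%:R != 0 :> rat by [].
rewrite /chi hornerZ !hornerM !hornerD hornerZ !hornerX !hornerC.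
elim: k => [|k IH]; first by rewrite big_ord0 !mul0r mulr0.
rewrite big_ord_recr /= natrD -IH.
have -> : (hf k)%:R = k.+1%:R * (e%:R * k%:R + 2%:R) / 2%:R :> rat.
  by apply: (canRL (mulfK two)); rewrite -!natrM -natrD -natrM -hfE mulnC.
by rewrite -natr1; field.
Qed.

End TangentCone.

End LocalCharts.

(** Rescaling the representative of the centre rescales the local coordinates. *)
Lemma singular_scale (K : numClosedFieldType) p (X : set 'rV[K]_p.+1) w c d :
  (forall u b, X u -> b != 0 -> X (b *: u)) -> c != 0 ->
  singular_point d X w -> singular_point d X (c *: w).
Proof.
move=> XZ c0 [Xw nL]; split; first exact: XZ.
have piv : pivot (c *: w) = pivot w.
  rewrite /pivot; congr odflt; apply: eq_pick => i.
  by rewrite mxE mulf_eq0 (negPf c0).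
have chartZ z : chart (c *: w) (c *: z) = c *: chart w z.
  apply/rowP => k; rewrite !mxE piv mulrDr; congr (_ + _).
  by case: unlift => [j|]; rewrite ?mxE ?mulr0.
case=> L rL TL; apply: nL; exists L => // z; rewrite -TL; split=> hz g gX.
  have gX' : chart_ideal X w (lsubst c%:M g).
    by move=> z' hz'; rewrite lsubst_eval mul_mx_scalar gX // chartZ; apply: XZ.
  have := hz _ gX'; rewrite -!ddir_zero ddir_lsubst !mul_mx_scalar scaler0 !ddir_zero.
  under eq_bigr do rewrite mxE mulrCA.
  by rewrite -mulr_sumr => /eqP; rewrite mulf_eq0 (negPf c0) => /eqP.
have gX' : chart_ideal X (c *: w) (lsubst c^-1%:M g).
  move=> z' hz'; rewrite lsubst_eval mul_mx_scalar gX //.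
  rewrite -[chart w _](scalerK c0) -chartZ scalerA divff // scale1r.
  by apply: XZ; rewrite ?invr_eq0.
have := hz _ gX'; rewrite -!ddir_zero ddir_lsubst !mul_mx_scalar scaler0 !ddir_zero.
under eq_bigr do rewrite mxE mulrCA.
by rewrite -mulr_sumr => /eqP; rewrite mulf_eq0 invr_eq0 (negPf c0) => /eqP.
Qed.

(** * The tangent cones *)

Section VeroneseCone.
Variable K : numClosedFieldType.

Lemma cone_zero n (f : {mpoly K[n]}) (u : 'rV[K]_n) :
  (forall c, c != 0 -> f.@[(c *: u) 0] = 0) -> f.@[(0 : 'rV[K]_n) 0] = 0.
Proof.
move=> h; have [P [hP _]] := arc_deriv f (fun i => u 0 i *: 'X).
have : P * 'X = 0.
  apply: poly_eval_eq0 => t; rewrite hornerM hornerX.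
  have [->|t0] := eqVneq t 0; first by rewrite mulr0.
  rewrite hP (_ : meval _ _ = 0) ?mul0r // -(h t t0).
  by apply: meval_eq => i; rewrite mxE hornerZ hornerX mulrC.
move/eqP; rewrite mulf_eq0 polyX_eq0 orbF => /eqP P0.
have := hP 0; rewrite P0 horner0 => /esym E; rewrite -[RHS]E.
by apply: meval_eq => i; rewrite mxE hornerZ hornerX mulr0.
Qed.

Lemma lsubst_comp n k l (A : 'M[K]_(k, n)) (A' : 'M[K]_(l, k)) (F : {mpoly K[n]}) :
  lsubst A' (lsubst A F) = lsubst (A' *m A) F.
Proof. by apply: mpoly_eval_inj => v; rewrite !lsubst_eval mulmxA. Qed.

Lemma ideal_gen_lsubst n k (A : 'M[K]_(k, n)) (S : set {mpoly K[n]}) (S' : set {mpoly K[k]}) F :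
  (forall f, S f -> ideal_gen S' (lsubst A f)) -> ideal_gen S F -> ideal_gen S' (lsubst A F).
Proof.
move=> h; apply: (ideal_gen_min (J := fun F => ideal_gen S' (lsubst A F))); last exact: h.
- by rewrite lsubst0; exact: ideal_gen0.
- by move=> F1 F2 h1 h2; rewrite lsubstD; apply: ideal_genD.
- by move=> F1 F2 h2; rewrite lsubstM; apply: ideal_genM.
Qed.

(** Two linear substitutions are congruent modulo the differences of their
    components. *)
Lemma ideal_gen_lsubst_diff n k (A A' : 'M[K]_(k, n)) (S : set {mpoly K[k]}) F :
  (forall j, ideal_gen S (\sum_i (A i j - A' i j) *: 'X_i)) ->
  ideal_gen S (lsubst A F - lsubst A' F).
Proof.
move=> h; apply: ideal_gen_comp => j; rewrite !tnth_mktuple -sumrB.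
by under eq_bigr do rewrite -scalerBl; apply: h.
Qed.

Lemma lsubst1 n (F : {mpoly K[n]}) : lsubst 1%:M F = F.
Proof. by apply: mpoly_eval_inj => v; rewrite lsubst_eval mulmx1. Qed.

Lemma mpoly_eval_inj_nz n (F G : {mpoly K[n.+1]}) :
  (forall v : 'rV[K]_n.+1, v != 0 -> F.@[v 0] = G.@[v 0]) -> F = G.
Proof.
move=> h; apply/eqP; rewrite -subr_eq0; apply/eqP.
apply: (@mpoly_eval_dense _ _ _ ('X_ord0 : {mpoly K[n.+1]})).
  by rewrite -msize_poly_eq0 msizeX.
move=> v; rewrite mevalXU => v0; rewrite mevalB h ?subrr //.
by apply: contraNneq v0 => ->; rewrite mxE.
Qed.

(** ** Cones over the Veronese surface *)

Definition veronese_forms : 6.-tuple {mpoly K[3]} :=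
  let t i : {mpoly K[3]} := 'X_(inord i) in
  [tuple t 0%N ^+ 2; t 0%N * t 1%N; t 0%N * t 2%N; t 1%N ^+ 2; t 1%N * t 2%N; t 2%N ^+ 2].

Lemma veronese_formsE (t : 'rV[K]_3) : poly_map veronese_forms t = veronese t.
Proof.
apply/rowP => -[[|[|[|[|[|[|k]]]]]] hk] //; rewrite !mxE /= (tnth_nth 0) /=.
all: by rewrite ?expr2 ?mevalM ?mevalXU.
Qed.

Definition veronese_index (a b : 'I_3) : nat :=
  nth 0%N (nth [::] [:: [:: 0; 1; 2]; [:: 1; 3; 4]; [:: 2; 4; 5]] a) b.

Lemma ord3P (P : 'I_3 -> Prop) : P (inord 0) -> P (inord 1) -> P (inord 2) -> forall i, P i.
Proof.
move=> P0 P1 P2 [[|[|[|i]]] Hi] //.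
- by have -> : Ordinal Hi = inord 0 by apply/val_inj; rewrite /= inordK.
- by have -> : Ordinal Hi = inord 1 by apply/val_inj; rewrite /= inordK.
- by have -> : Ordinal Hi = inord 2 by apply/val_inj; rewrite /= inordK.
Qed.

(** The Veronese surface is the image of the plane under all quadratic forms: the
    quotient by the trivial involution. *)
Lemma veronese_data : invariant_quadrics (fun v : 'rV[K]_3 => v != 0) id veronese_forms 1%:M
  pred0 (fun a b => delta_mx 0 (inord (veronese_index a b))).
Proof.
split=> //.
- exact: unitmx1.
- by move=> v c v0 c0; rewrite scaler_eq0 negb_or c0.
- move=> F F0; suff -> : F = 0 by exact: ideal_gen0.
  apply: (@mpoly_eval_dense _ _ _ ('X_(inord 0) : {mpoly K[3]})).
    by rewrite -msize_poly_eq0 msizeX.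
  move=> v; rewrite mevalXU => v0; apply: F0.
  by apply: contraNneq v0 => ->; rewrite mxE.
- by move=> v i; rewrite mul1r.
- have h i j : ('X_i * 'X_j : {mpoly K[3]}) \is 2.-homog.
    by rewrite -mpolyXD dhomogX /= mdegD !mdeg1.
  by case=> [[|[|[|[|[|[|k]]]]]] hk] //; rewrite (tnth_nth 0) /= ?expr2 h.
- move=> a b _ v _; rewrite !mulmx1 (bigD1 (inord (veronese_index a b))) //= !mxE !eqxx mul1r.
  rewrite big1 ?addr0 => [|k kn]; last by rewrite !mxE (negPf kn) mul0r.
  move: a b; apply: ord3P; apply: ord3P; rewrite (tnth_nth 0) /veronese_index !inordK //=;
  by rewrite ?inordK //= ?expr2 mevalM !mevalXU // mulrC.
move=> c h.
have {}h (v : 'rV[K]_3) : v != 0 -> \sum_k c 0 k * veronese v 0 k = 0.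
  by move=> v0; rewrite -[RHS](h v v0); apply: eq_bigr => k _; rewrite -veronese_formsE [poly_map _ _ _ _]mxE.
pose v (x y z : K) : 'rV[K]_3 := \row_i [:: x; y; z]`_i.
have vE x y z : [/\ entry (v x y z) 0 = x, entry (v x y z) 1 = y & entry (v x y z) 2 = z].
  by rewrite /entry !mxE !inordK.
have v0 x y z : [|| x != 0, y != 0 | z != 0] -> v x y z != 0.
  have [e0 e1 e2] := vE x y z; apply: contraTneq => E.
  have x0 : x = 0 by rewrite -[LHS]e0 E /entry mxE.
  have y0 : y = 0 by rewrite -[LHS]e1 E /entry mxE.
  have z0 : z = 0 by rewrite -[LHS]e2 E /entry mxE.
  by rewrite x0 y0 z0 eqxx.
have hv x y z : [|| x != 0, y != 0 | z != 0] ->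
   c 0 (inord 0) * x ^+ 2 + c 0 (inord 1) * (x * y) + c 0 (inord 2) * (x * z) +
   c 0 (inord 3) * y ^+ 2 + c 0 (inord 4) * (y * z) + c 0 (inord 5) * z ^+ 2 = 0.
  move=> /v0 /h; rewrite !big_ord_recl big_ord0 addr0; have [e0 e1 e2] := vE x y z.
  rewrite /veronese !mxE /= e0 e1 e2 => <-; rewrite !addrA.
  by congr (_ + _ + _ + _ + _ + _); congr (c 0 _ * _); apply/val_inj; rewrite /= inordK.
have n1 := oner_neq0 K.
have c0 : c 0 (inord 0) = 0.
  by rewrite -[RHS](hv 1 0 0) ?n1 //; ring.
have c3 : c 0 (inord 3) = 0.
  by rewrite -[RHS](hv 0 1 0) ?n1 ?orbT //; ring.
have c5 : c 0 (inord 5) = 0.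
  by rewrite -[RHS](hv 0 0 1) ?n1 ?orbT //; ring.
have c1 : c 0 (inord 1) = 0.
  by rewrite -[RHS](hv 1 1 0) ?n1 // c0 c3; ring.
have c2 : c 0 (inord 2) = 0.
  by rewrite -[RHS](hv 1 0 1) ?n1 // c0 c5; ring.
have c4 : c 0 (inord 4) = 0.
  by rewrite -[RHS](hv 0 1 1) ?n1 ?orbT // c3 c5; ring.
apply/rowP => k; rewrite [RHS]mxE; case: k => [[|[|[|[|[|[|k]]]]]] hk] //.
- by rewrite -[RHS]c0; congr (c 0 _); apply/val_inj; rewrite /= inordK.
- by rewrite -[RHS]c1; congr (c 0 _); apply/val_inj; rewrite /= inordK.
- by rewrite -[RHS]c2; congr (c 0 _); apply/val_inj; rewrite /= inordK.
- by rewrite -[RHS]c3; congr (c 0 _); apply/val_inj; rewrite /= inordK.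
- by rewrite -[RHS]c4; congr (c 0 _); apply/val_inj; rewrite /= inordK.
by rewrite -[RHS]c5; congr (c 0 _); apply/val_inj; rewrite /= inordK.
Qed.

Lemma veroneseZ c (t : 'rV[K]_3) : veronese (c *: t) = c ^+ 2 *: veronese t.
Proof. by rewrite -!veronese_formsE (phiZ veronese_data). Qed.

Lemma veronese_neq0 (t : 'rV[K]_3) : t != 0 -> veronese t != 0.
Proof. by rewrite -veronese_formsE; exact: (phi_neq0 veronese_data). Qed.

Definition veronese_ideal (f : {mpoly K[6]}) : Prop :=
  forall t, t != 0 -> f.@[(veronese t) 0] = 0.

Lemma veronese_generated f :
  veronese_ideal f -> ideal_gen (fun Q => Q \is 2.-homog /\ veronese_ideal Q) f.
Proof.
have E F : vanishing_ideal (image_of (fun v : 'rV[K]_3 => v != 0) veronese_forms) F <->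
    veronese_ideal F.
  rewrite (vanishingP veronese_data).
  by split=> h t t0; have := h t t0; rewrite veronese_formsE.
move/E/(quotient_ideal veronese_data).
apply: (ideal_gen_min (J := ideal_gen _)) => [|F G|F G|Q [hQ /E QV]].
- exact: ideal_gen0.
- exact: ideal_genD.
- exact: ideal_genM.
by apply: ideal_gen1.
Qed.

(** Forms of degree d on the surface are the forms of degree 2 d on the plane. *)
Lemma veronese_hilbert d :
  reldim (fun F : {mpoly K[6]} => F \is d.-homog) veronese_ideal 'C(d.*2 + 2, d.*2).
Proof.
have xE f (t : 'rV[K]_3) : (f \mPo veronese_forms).@[t 0] = f.@[(veronese t) 0].
  by rewrite comp_mpoly_meval -veronese_formsE; apply: meval_eq => j; rewrite mxE.
apply: (@reldim_iso _ _ _ (comp_mpoly veronese_forms) _ _ (fun F => F \is (d.*2).-homog) (fun F => F = 0)).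
- exact: linearP.
- exact: homog_subspace.
- move=> f hf; rewrite -mul2n; apply: dhomog_comp hf => j.
  exact: (iq_homog veronese_data).
- move=> G hG; have [F hF FE] := even_form_descends veronese_data hG.
  exists (2^-1 *: F); first by apply: rpredZ.
  apply: mpoly_eval_inj_nz => t t0.
  rewrite comp_mpolyZ mevalZ xE -veronese_formsE FE //.
  by field.
- move=> f _; split=> [h|E t t0]; last by rewrite -xE E meval0.
  by apply: mpoly_eval_inj_nz => t t0; rewrite xE meval0 h.
exact: reldim_forms.
Qed.

End VeroneseCone.

Section ConeAndPlanes.
Variable K : numClosedFieldType.

(** ** Unions of a cone and of four planes *)

Section FourPlanes.
Variables (a : nat) (S0 : set 'rV[K]_a.+1) (G0 : set {mpoly K[a.+1]}).
Variables (N : 'I_4 -> 'M[K]_(2, a.+1)) (N' : 'I_4 -> 'M[K]_(a.+1, 2)).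
Hypothesis NN' : forall i, N i *m N' i = 1%:M.
Hypothesis S0_lines : forall i x, S0 (x *m N i).
Hypothesis S0_ideal : forall F, (forall o, S0 o -> F.@[o 0] = 0) -> ideal_gen G0 F.

Local Notation poly := {mpoly K[a.+1 + 4]}.
Local Notation o_ k := ('X_(lshift 4 k) : poly).
Local Notation c_ i := ('X_(rshift a.+1 i) : poly).

(** The cone over [S0] together with the planes spanned by the lines [N i] of
    [S0] and by the last four coordinate points. *)
Definition four_planes_ideal (f : poly) : Prop :=
  (forall o, S0 o -> f.@[(row_mx o 0) 0] = 0) /\
  forall i (x : 'rV[K]_2) (g : K), f.@[(row_mx (x *m N i) (g *: delta_mx 0 i)) 0] = 0.

(** Besides the equations of the cone over [S0]: distinct coordinates c_i, c_j do not
    occur together on a plane, and where c_i is nonzero the point lies over the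
    line [N i]. *)
Definition four_planes_gen (f : poly) : Prop :=
  [\/ exists2 F, G0 F & f = lsubst (col_mx 1%:M 0) F,
      exists i j, i != j /\ f = c_ i * c_ j |
      exists i (u : 'cV[K]_a.+1), N i *m u = 0 /\ f = c_ i * \sum_k u k 0 *: o_ k].

Definition planes_subst (g : 'I_a.+1 -> poly) (h : 'I_4 -> poly) : (a.+1 + 4).-tuple poly :=
  [tuple match split k with inl k1 => g k1 | inr k2 => h k2 end | k < a.+1 + 4].

Lemma planes_subst_l g h k : tnth (planes_subst g h) (lshift 4 k) = g k.
Proof. by rewrite tnth_mktuple (unsplitK (inl k)). Qed.

Lemma planes_subst_r g h k : tnth (planes_subst g h) (rshift a.+1 k) = h k.
Proof. by rewrite tnth_mktuple (unsplitK (inr k)). Qed.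

Lemma split_ind (P : 'I_(a.+1 + 4) -> Prop) :
  (forall k, P (lshift 4 k)) -> (forall k, P (rshift a.+1 k)) -> forall k, P k.
Proof. by move=> hl hr k; rewrite -(splitK k); case: (split k). Qed.

Lemma planes_subst_eval f g h (x : 'rV[K]_(a.+1 + 4)) :
  (f \mPo planes_subst g h).@[x 0] =
  f.@[(row_mx (\row_k (g k).@[x 0]) (\row_k (h k).@[x 0])) 0].
Proof.
rewrite comp_mpoly_meval; apply: meval_eq; apply: split_ind => k.
  by rewrite planes_subst_l row_mxEl mxE.
by rewrite planes_subst_r row_mxEr mxE.
Qed.

(** [P0] restricts polynomials to the cone over [S0], [P i] to its span with the
    [i]-th extra point, [R i] retracts onto the line [N i] in the base. *)
Let o0 k := o_ k.
Let P0 := planes_subst o0 (fun=> 0).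
Let P i := planes_subst o0 (fun j => if j == i then c_ i else 0).
Let R i := planes_subst (fun k => \sum_l (N' i *m N i) l k *: o_ l) (fun j => c_ j).
Let delta i (f : poly) : poly := (f \mPo P i) - (f \mPo P0).

Local Notation IG := (ideal_gen four_planes_gen).

Lemma delta_mul i f : exists h, delta i f = c_ i * h.
Proof.
have : ideal_gen (fun g => g = c_ i) (delta i f).
  apply: ideal_gen_comp; apply: split_ind => k.
    by rewrite !planes_subst_l subrr; exact: ideal_gen0.
  rewrite !planes_subst_r subr0; case: eqP => _; last exact: ideal_gen0.
  exact: ideal_gen1.
move/(ideal_gen_min (J := fun g => exists h, g = c_ i * h)); apply => [|F1 F2 [h1 ->] [h2 ->]|F1 F2 [h ->]|_ ->].
- by exists 0; rewrite mulr0.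
- by exists (h1 + h2); rewrite mulrDr.
- by exists (F1 * h); rewrite mulrCA.
by exists 1; rewrite mulr1.
Qed.

Lemma delta_mixed i j f g : i != j -> IG (delta i f * delta j g).
Proof.
move=> ij; have [h ->] := delta_mul i f; have [h' ->] := delta_mul j g.
rewrite mulrACA mulrC; apply: ideal_genM; apply: ideal_gen1; apply: Or32.
by exists i, j.
Qed.

Lemma decomposition_sum (A : comPzRingType) (x y x0 y0 s t : A) :
  (x - (x0 + s)) + (y - (y0 + t)) = x + y - (x0 + y0 + (s + t)).
Proof. by ring. Qed.

Lemma decomposition_delta (A : comPzRingType) (x y x0 y0 : A) :
  x * y - x0 * y0 = x0 * (y - y0) + y0 * (x - x0) + (x - x0) * (y - y0).
Proof. by ring. Qed.

Lemma decomposition_product (A : comPzRingType) (x y x0 y0 s t u : A) :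
  x * y - (x0 * y0 + (x0 * t + y0 * s + u)) =
  y * (x - (x0 + s)) + (x0 + s) * (y - (y0 + t)) + (s * t - u).
Proof. by ring. Qed.

(** Every polynomial is the sum of its restriction to the cone and of the corrections
    in the four extra directions, modulo the products c_i c_j: this is stable
    under sums and products. *)
Lemma delta_decomposition f : IG (f - ((f \mPo P0) + \sum_i delta i f)).
Proof.
elim/mpoly_ring_ind: f => [c|k|f g hf hg|f g hf hg].
- rewrite comp_mpolyC big1 => [|i _]; last by rewrite /delta !comp_mpolyC subrr.
  by rewrite addr0 subrr; exact: ideal_gen0.
- suff E : 'X_k = ('X_k \mPo P0) + \sum_i delta i 'X_k.
    by rewrite -E subrr; exact: ideal_gen0.
  rewrite /delta; under eq_bigr do rewrite !comp_mpolyXU -!tnth_nth.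
  rewrite comp_mpolyXU -tnth_nth; move: k; apply: split_ind => k.
    by rewrite planes_subst_l big1 ?addr0 // => i _; rewrite !planes_subst_l subrr.
  rewrite planes_subst_r add0r (bigD1 k) //= !planes_subst_r eqxx subr0 big1 ?addr0 // => i ik.
  by rewrite !planes_subst_r eq_sym (negPf ik) subrr.
- have -> : \sum_i delta i (f + g) = \sum_i delta i f + \sum_i delta i g.
    rewrite -big_split; apply: eq_bigr => i _ /=.
    by rewrite /delta !comp_mpolyD opprD addrACA.
  by rewrite comp_mpolyD -decomposition_sum; exact: (ideal_genD hf hg).
have dM i : delta i (f * g) =
    (f \mPo P0) * delta i g + (g \mPo P0) * delta i f + delta i f * delta i g.
  by rewrite /delta !rmorphM; apply: decomposition_delta.
rewrite rmorphM (eq_bigr _ (fun i _ => dM i)) !big_split -!mulr_sumr.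
rewrite decomposition_product.
apply: ideal_genD.
  by apply: ideal_genD; [exact: (ideal_genM _ hf) | exact: (ideal_genM _ hg)].
rewrite mulr_suml -sumrB; apply: ideal_gen_sum => i _.
rewrite mulr_sumr (bigD1 i) //= addrC addrK; apply: ideal_gen_sum => j ji.
by apply: delta_mixed; rewrite eq_sym.
Qed.

(** The correction is c_i h, and it vanishes on the plane over the line [N i]; so it
    is c_i times the difference of [h] and of its retract, which lies in the ideal
    of the line. *)
Lemma delta_ideal i f :
  (forall (x : 'rV[K]_2) (g : K), f.@[(row_mx (x *m N i) (g *: delta_mx 0 i)) 0] = 0) ->
  IG (delta i f).
Proof.
move=> hf; have R0 : delta i f \mPo R i = 0.
  apply: mpoly_eval_eq0 => x; rewrite /delta comp_mpolyB mevalB !comp_mpoly_meval.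
  have Rl k : (tnth (R i) (lshift 4 k)).@[x 0] = (lsubmx x *m N' i *m N i) 0 k.
    rewrite planes_subst_l raddf_sum -mulmxA mxE; apply: eq_bigr => l _.
    by rewrite /= mevalZ mevalXU mulrC [lsubmx _ _ _]mxE.
  have Rr k : (tnth (R i) (rshift a.+1 k)).@[x 0] = x 0 (rshift a.+1 k).
    by rewrite planes_subst_r mevalXU.
  have -> : f.@[fun k => (tnth (P i) k).@[fun k => (tnth (R i) k).@[x 0]]] = 0.
    rewrite -[RHS](hf (lsubmx x *m N' i) (x 0 (rshift a.+1 i))).
    apply: meval_eq; apply: split_ind => k.
      by rewrite planes_subst_l mevalXU row_mxEl Rl.
    rewrite planes_subst_r row_mxEr !mxE; case: eqP => _; rewrite ?meval0 ?mulr0 //.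
    by rewrite mevalXU Rr mulr1.
  have -> : f.@[fun k => (tnth P0 k).@[fun k => (tnth (R i) k).@[x 0]]] = 0.
    rewrite -[RHS](hf (lsubmx x *m N' i) 0).
    apply: meval_eq; apply: split_ind => k.
      by rewrite planes_subst_l mevalXU row_mxEl Rl.
    by rewrite planes_subst_r row_mxEr meval0 scale0r mxE.
  by rewrite subrr.
have [h Eh] := delta_mul i f.
have {}R0 : c_ i * (h \mPo R i) = 0.
  rewrite -R0 Eh rmorphM /=; congr (_ * _).
  by rewrite comp_mpolyXU -tnth_nth planes_subst_r.
rewrite Eh -[c_ i * h]subr0 -R0 -mulrBr -{1}(comp_mpoly_id h).
pose S g := IG (c_ i * g).
suff : S ((h \mPo [tuple 'X_k | k < a.+1 + 4]) - (h \mPo R i)) by [].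
have hS F : ideal_gen (fun g => exists u : 'cV[K]_a.+1, N i *m u = 0 /\ g = \sum_k u k 0 *: o_ k) F -> S F.
  move/(ideal_gen_min (J := S)); rewrite /S; apply => [|F1 F2 h1 h2|F1 F2 h2|_ [u [Nu ->]]].
  - by rewrite mulr0; exact: ideal_gen0.
  - by rewrite mulrDr; apply: ideal_genD.
  - by rewrite mulrCA; apply: ideal_genM.
  by apply: ideal_gen1; apply: Or33; exists i, u.
apply: hS; apply: ideal_gen_comp; apply: split_ind => k; rewrite tnth_mktuple.
  rewrite planes_subst_l; apply: ideal_gen1.
  exists (col k (1%:M - N' i *m N i)); split.
    by rewrite colE mulmxA mulmxBr mulmx1 mulmxA NN' mul1mx subrr mul0mx.
  under [RHS]eq_bigr do rewrite !mxE scalerBl.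
  rewrite sumrB; congr (_ - _); last by apply: eq_bigr => l _; rewrite mxE.
  rewrite (bigD1 k) //= eqxx scale1r big1 ?addr0 // => l lk.
  by rewrite (negPf lk) scale0r.
by rewrite planes_subst_r subrr; exact: ideal_gen0.
Qed.

Lemma four_planes_generated f : four_planes_ideal f -> IG f.
Proof.
move=> [h0 hi]; rewrite -[f](subrK ((f \mPo P0) + \sum_i delta i f)).
apply: ideal_genD; first exact: delta_decomposition.
apply: ideal_genD; last by apply: ideal_gen_sum => i _; apply: delta_ideal; exact: hi.
have -> : f \mPo P0 = lsubst (col_mx 1%:M 0) (lsubst (row_mx 1%:M 0) f).
  apply: mpoly_eval_inj => x; rewrite planes_subst_eval !lsubst_eval.
  have -> : x *m col_mx 1%:M 0 = lsubmx x.
    by rewrite -{1}(hsubmxK x) mul_row_col mulmx1 mulmx0 addr0.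
  rewrite mul_mx_row mulmx1 mulmx0; congr (f.@[_]); congr (row_mx _ _ 0).
    by apply/rowP => k; rewrite !mxE mevalXU.
  by apply/rowP => k; rewrite !mxE meval0.
apply: (ideal_gen_lsubst (S := G0)) => [F GF|].
  by apply: ideal_gen1; apply: Or31; exists F.
by apply: S0_ideal => o So; rewrite lsubst_eval mul_mx_row mulmx1 mulmx0 h0.
Qed.

(** Hilbert function: forms on the cone over [S0], and on each plane the
    multiples of its last coordinate. *)
Lemma four_planes_hilbert h0 d :
  reldim (fun F : {mpoly K[a.+1]} => F \is d.-homog) (fun F => forall o, S0 o -> F.@[o 0] = 0) h0 ->
  reldim (fun F : poly => F \is d.-homog) four_planes_ideal (h0 + 4 * 'C(d.+1, 2)).
Proof.
move=> H0.
pose J k (f : poly) := f \is d.-homog /\ (forall o, S0 o -> f.@[(row_mx o 0) 0] = 0) /\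
  forall i : 'I_4, (i < k)%N -> forall (x : 'rV[K]_2) (g : K),
    f.@[(row_mx (x *m N i) (g *: delta_mx 0 i)) 0] = 0.
have sJ k : subspace (J k).
  split=> [|f g [f1 [f2 f3]] [g1 [g2 g3]]|c f [f1 [f2 f3]]].
  - by split; [exact: rpred0 | split=> *; rewrite meval0].
  - split; first exact: rpredD.
    by split=> [o So|i ik x c]; rewrite mevalD ?f2 ?g2 ?f3 ?g3 ?addr0.
  split; first exact: rpredZ.
  by split=> [o So|i ik x c']; rewrite mevalZ ?f2 ?f3 ?mulr0.
have hJ0 : reldim (fun F : poly => F \is d.-homog) (J 0%N) h0.
  apply: (reldim_iso (@lsubst_linear K _ _ (row_mx 1%:M 0)) _ _ _ _ H0).
  - exact: homog_subspace.
  - by move=> f hf; apply: lsubst_homog.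
  - move=> F hF; exists (lsubst (col_mx 1%:M 0) F); first exact: lsubst_homog.
    by rewrite lsubst_comp mul_row_col mulmx1 mulmx0 addr0 lsubst1.
  move=> f hf; split=> [[_ [f2 _]] o So|f2].
    by rewrite lsubst_eval mul_mx_row mulmx1 mulmx0 f2.
  by split=> //; split=> // o /f2; rewrite lsubst_eval mul_mx_row mulmx1 mulmx0.
have hJS k : (k < 4)%N -> reldim (J k) (J k.+1) 'C(d.+1, 2).
  move=> k4; pose i := Ordinal k4.
  pose Pi : 'M[K]_(2 + 1, a.+1 + 4) := block_mx (N i) 0 0 (delta_mx 0 i).
  pose Qi : 'M[K]_(a.+1 + 4, 2 + 1) := block_mx (N' i) 0 0 (delta_mx i 0).
  have PiE (x : 'rV[K]_2) (g : 'rV[K]_1) : row_mx x g *m Pi = row_mx (x *m N i) (g 0 0 *: delta_mx 0 i).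
    rewrite mul_row_block !mulmx0 addr0 add0r; congr row_mx.
    by rewrite {1}[g]mx11_scalar mul_scalar_mx.
  have QiE (o : 'rV[K]_a.+1) (c : 'rV[K]_4) : row_mx o c *m Qi = row_mx (o *m N' i) (c 0 i)%:M.
    rewrite mul_row_block !mulmx0 addr0 add0r; congr row_mx.
    apply/rowP => j; rewrite ord1 !mxE eqxx mulr1n (bigD1 i) //= !mxE !eqxx mulr1.
    by rewrite big1 ?addr0 // => l li; rewrite mxE (negPf li) mulr0.
  have ZP : Pi *m Qi = 1%:M.
    rewrite mulmx_block !mulmx0 !mul0mx !addr0 add0r NN'.
    have -> : delta_mx 0 i *m delta_mx i 0 = 1%:M :> 'M[K]_1.
      by rewrite mul_delta_mx; apply/matrixP => u v; rewrite !ord1 !mxE.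
    by rewrite -scalar_mx_block.
  pose g3 : 'I_(2 + 1) := rshift 2 ord0.
  have step1 : reldim (fun F : {mpoly K[2 + 1]} => exists2 G,
      (if d is d'.+1 then G \is d'.-homog else G == 0) & F = 'X_g3 * G) (fun F => F = 0) 'C(d.+1, 2).
    case: d {H0 hJ0 J sJ} => [|d'].
      by rewrite bin_small //; apply: reldim_all => F [G /eqP -> ->]; rewrite mulr0.
    have -> : 'C(d'.+2, 2) = 'C(d' + 2, d') by rewrite -addn2 -bin_sub ?leq_addl // addnK.
    apply: (reldim_image (nu := *%R ('X_g3 : {mpoly K[2 + 1]})) (A' := fun G => G \is d'.-homog)) => [c F1 F2|F1 F2 /eqP||].
    + by rewrite mulrDr scalerAr.
    + rewrite -subr_eq0 -mulrBr mulf_eq0 -[_ == 0 in X in X || _]msize_poly_eq0 msizeX /=.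
      by rewrite subr_eq0 => /eqP.
    + by [].
    exact: (reldim_forms K 2 d').
  apply: (reldim_iso (@lsubst_linear K _ _ Pi) _ _ _ _ step1).
  - exact: sJ.
  - move=> f [hf [f2 f3]]; have hPf : lsubst Pi f \is d.-homog by exact: lsubst_homog.
    apply: (div_coordinate hPf) => v; rewrite -(hsubmxK v) row_mxEr => v0.
    rewrite lsubst_eval PiE v0 scale0r; exact/f2/S0_lines.
  - move=> _ [G hG ->]; exists ('X_(rshift a.+1 i) * lsubst Qi G); last first.
      rewrite lsubstM lsubst_comp ZP lsubst1; congr (_ * _).
      apply: mpoly_eval_inj => v; rewrite lsubst_eval !mevalXU -(hsubmxK v) PiE !row_mxEr.
      by rewrite !mxE !eqxx mulr1.
    split; last split.
    + case: (d) hG => [/eqP ->|d' hG]; first by rewrite lsubst0 mulr0 rpred0.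
      by apply: (@dhomogM _ _ _ 1 _ d'); [rewrite dhomogX /= mdeg1 | apply: lsubst_homog].
    + by move=> o So; rewrite mevalM mevalXU row_mxEr mxE mul0r.
    move=> j jk x g; rewrite mevalM mevalXU row_mxEr !mxE eqxx /=.
    case: eqP => [ij|_]; last by rewrite mulr0 mul0r.
    by move: jk; rewrite -ij ltnn.
  move=> f [hf [f2 f3]]; split=> [[_ [_ f3']]|E].
    apply: mpoly_eval_eq0 => v; rewrite lsubst_eval -(hsubmxK v) PiE.
    by apply: (f3' i).
  split=> //; split=> // j; rewrite ltnS leq_eqVlt => /orP[/eqP jk|jk x g]; last exact: f3.
  have -> : j = i by apply/val_inj.
  move=> x g; have := PiE x g%:M; rewrite !mxE eqxx mulr1n => <-.
  by rewrite -lsubst_eval E meval0.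
have : reldim (fun F : poly => F \is d.-homog) (J 4%N) (h0 + 4 * 'C(d.+1, 2)).
  have chain k : (k <= 4)%N -> reldim (fun F : poly => F \is d.-homog) (J k) (h0 + k * 'C(d.+1, 2)).
    elim: k => [|k IH] k4; first by rewrite mul0n addn0.
    rewrite mulSn [(_ + k * _)%N]addnC addnA.
    apply: (reldim_chain (sJ k) _ _ (IH (ltnW k4)) (hJS _ k4)) => f [hf [f2 f3]] //.
    by split=> //; split=> // j jk; apply: f3; apply: leq_trans jk _.
  exact: chain.
move=> [B [hB uB]]; exists B; split=> // G hG; have [c [[_ [c2 c3]] uc]] := uB G hG.
exists c; split; first by split=> // i; apply: c3.
move=> c' [c2' c3']; apply: uc; split; last by split=> // i _; apply: c3'.
by apply: rpredB => //; apply: rpred_sum => i _; apply: rpredZ.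
Qed.

End FourPlanes.

End ConeAndPlanes.

Section QuadricCone.
Variable K : numClosedFieldType.

(** ** The quadric cone *)

Definition quadric_form : {mpoly K[4]} :=
  'X_(inord 0) * 'X_(inord 3) - 'X_(inord 1) * 'X_(inord 2).

Definition quadric_cone : set 'rV[K]_4 := fun o => quadric_form.@[o 0] = 0.

Lemma quadric_formE (o : 'rV[K]_4) :
  quadric_form.@[o 0] = o 0 (inord 0) * o 0 (inord 3) - o 0 (inord 1) * o 0 (inord 2).
Proof. by rewrite mevalB !mevalM !mevalXU. Qed.


Lemma sum_ord4 (A : nmodType) (F : 'I_4 -> A) :
  \sum_i F i = F (inord 0) + F (inord 1) + F (inord 2) + F (inord 3).
Proof.
rewrite !big_ord_recl big_ord0 addr0 !addrA.
by congr (_ + _ + _ + _); congr F; apply/val_inj; rewrite /= inordK.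
Qed.

Lemma inord_neq n i j : (i <= n)%N -> (j <= n)%N -> i != j -> (inord i == inord j :> 'I_n.+1) = false.
Proof. by move=> hi hj /negPf ij; rewrite -val_eqE /= !inordK. Qed.

(** Comparing coefficients in a product of two linear forms. *)
Lemma quadric_form_irreducible : irreducible_quadric quadric_form.
Proof.
have h i j : ('X_i * 'X_j : {mpoly K[4]}) \is 2.-homog.
  by rewrite -mpolyXD dhomogX /= mdegD !mdeg1.
split=> [|l1 l2 /linear_form E1 /linear_form E2 E]; first exact: rpredB.
pose a i := l1@_(U_(inord i)); pose b i := l2@_(U_(inord i)).
have V (o : 'rV[K]_4) : let x i := o 0 (inord i) in
    x 0%N * x 3%N - x 1%N * x 2%N =
    (a 0%N * x 0%N + a 1%N * x 1%N + a 2%N * x 2%N + a 3%N * x 3%N) *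
    (b 0%N * x 0%N + b 1%N * x 1%N + b 2%N * x 2%N + b 3%N * x 3%N).
  move=> x; rewrite -quadric_formE E mevalM E1 E2 !raddf_sum !sum_ord4 /=.
  by rewrite !mevalZ !mevalXU.
have {}V x0 x1 x2 x3 :
    (a 0%N * x0 + a 1%N * x1 + a 2%N * x2 + a 3%N * x3) *
    (b 0%N * x0 + b 1%N * x1 + b 2%N * x2 + b 3%N * x3) - (x0 * x3 - x1 * x2) = 0.
  have := V (\row_i [:: x0; x1; x2; x3]`_i); rewrite /= !mxE !inordK // => ->.
  by rewrite subrr.
move: (a 0%N) (a 1%N) (a 2%N) (a 3%N) (b 0%N) (b 1%N) (b 2%N) (b 3%N) V.
move=> a0 a1 a2 a3 b0 b1 b2 b3 V; clear -V.
have e0 : a0 * b0 = 0 by rewrite -[RHS](V 1 0 0 0); ring.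
have e1 : a1 * b1 = 0 by rewrite -[RHS](V 0 1 0 0); ring.
have e2 : a2 * b2 = 0 by rewrite -[RHS](V 0 0 1 0); ring.
have e3 : a3 * b3 = 0 by rewrite -[RHS](V 0 0 0 1); ring.
have e01 : a0 * b1 + a1 * b0 = 0 by rewrite -[RHS](V 1 1 0 0); ring: e0 e1.
have e02 : a0 * b2 + a2 * b0 = 0 by rewrite -[RHS](V 1 0 1 0); ring: e0 e2.
have e03 : a0 * b3 + a3 * b0 = 1.
  by apply/eqP; rewrite -subr_eq0; apply/eqP; rewrite -[RHS](V 1 0 0 1); ring: e0 e3.
have e12 : a1 * b2 + a2 * b1 = -1.
  by apply/eqP; rewrite -subr_eq0; apply/eqP; rewrite -[RHS](V 0 1 1 0); ring: e1 e2.
have m1 : (-1 : K) != 0 by rewrite oppr_eq0 oner_eq0.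
move/eqP: e0; rewrite mulf_eq0 => /orP[]/eqP z0.
  have nb : b0 != 0.
    by apply: contra_eq_neq e03 => ->; rewrite z0 mul0r mulr0 addr0 eq_sym oner_eq0.
  have z1 : a1 = 0 by apply: (mulIf nb); rewrite mul0r -e01 z0 mul0r add0r.
  have z2 : a2 = 0 by apply: (mulIf nb); rewrite mul0r -e02 z0 mul0r add0r.
  by move/eqP: e12; rewrite z1 z2 !mul0r addr0 eq_sym (negPf m1).
have na : a0 != 0.
  by apply: contra_eq_neq e03 => ->; rewrite z0 mul0r mulr0 addr0 eq_sym oner_eq0.
have z1 : b1 = 0 by apply: (mulfI na); rewrite mulr0 -e01 z0 mulr0 addr0.
have z2 : b2 = 0 by apply: (mulfI na); rewrite mulr0 -e02 z0 mulr0 addr0.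
by move/eqP: e12; rewrite z1 z2 !mulr0 addr0 eq_sym (negPf m1).
Qed.

(** Modulo the quadric, multiplication by a power of the first coordinate
    eliminates the last one; and the first coordinate is not a zero divisor. *)
Lemma quadric_cone_ideal F :
  (forall o, quadric_cone o -> (forall i, o 0 i != 0) -> F.@[o 0] = 0) ->
  ideal_gen (fun f => f = quadric_form) F.
Proof.
pose X i : {mpoly K[4]} := 'X_(inord i).
pose s : 4.-tuple {mpoly K[4]} := [tuple if i == inord 3 then 0 else 'X_i | i < 4].
pose IQ := ideal_gen (fun f => f = quadric_form).
have elim : exists N G, G \mPo s = G /\ IQ (X 0%N ^+ N * F - G).
  elim/mpoly_ring_ind: F => [c|k|f g [N [G [GS hG]]] [N' [G' [GS' hG']]]|f g [N [G [GS hG]]] [N' [G' [GS' hG']]]].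
  - exists 0%N, c%:MP; split; first by rewrite comp_mpolyC.
    by rewrite mul1r subrr; exact: ideal_gen0.
  - have [->|k3] := eqVneq k (inord 3).
      exists 1%N, (X 1%N * X 2%N); split.
        rewrite rmorphM /= !comp_mpolyXU -!tnth_nth !tnth_mktuple.
        by rewrite !inord_neq.
      by rewrite expr1; apply: ideal_gen1.
    exists 0%N, 'X_k; split; first by rewrite comp_mpolyXU -tnth_nth tnth_mktuple (negPf k3).
    by rewrite mul1r subrr; exact: ideal_gen0.
  - exists (N + N')%N, (X 0%N ^+ N' * G + X 0%N ^+ N * G'); split.
      rewrite rmorphD !rmorphM !rmorphXn /= GS GS' comp_mpolyXU -tnth_nth tnth_mktuple.
      by rewrite inord_neq.
    have := ideal_genD (ideal_genM (X 0%N ^+ N') hG) (ideal_genM (X 0%N ^+ N) hG').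
    congr IQ; rewrite exprD; move: (X _ ^+ N) (X _ ^+ N') => x y; clear.
    by rewrite !mulrBr mulrDr !mulrA [y * x]mulrC addrACA -opprD.
  exists (N + N')%N, (G * G'); split; first by rewrite rmorphM /= GS GS'.
  have := ideal_genD (ideal_genM (X 0%N ^+ N' * g) hG) (ideal_genM G hG').
  congr IQ; rewrite exprD; move: (X _ ^+ N) (X _ ^+ N') => x y; clear.
  by rewrite !mulrBr addrA; congr (_ - _); rewrite addrAC -[LHS]addr0; ring.
move: elim => [N [G [GS hG]]] F0.
have G0 : G = 0.
  apply: (@mpoly_eval_dense _ _ _ (X 0%N * X 1%N * X 2%N)).
    by rewrite !mulf_neq0 // -msize_poly_eq0 msizeX.
  move=> v; rewrite !mevalM !mevalXU !mulf_eq0 !negb_or => /andP[/andP[v0 v1] v2].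
  pose o : 'rV[K]_4 := \row_i if i == inord 3 then v 0 (inord 1) * v 0 (inord 2) / v 0 (inord 0) else v 0 i.
  have So : quadric_cone o.
    by rewrite /quadric_cone quadric_formE !mxE eqxx !inord_neq //; field.
  have o0 i : o 0 i != 0.
    by move: i; apply: ord4P; rewrite !mxE ?eqxx ?inord_neq // ?mulf_neq0 ?invr_eq0.
  have : (X 0%N ^+ N * F - G).@[o 0] = 0.
    apply: (ideal_gen_min (J := fun f => f.@[o 0] = 0)) hG => [|f g hf hg|f g hg|f ->//].
    - by rewrite meval0.
    - by rewrite mevalD hf hg addr0.
    by rewrite mevalM hg mulr0.
  rewrite mevalB mevalM F0 // mulr0 sub0r => /eqP; rewrite oppr_eq0 => /eqP Go.
  rewrite -GS comp_mpoly_meval -Go -{2}GS comp_mpoly_meval; apply: meval_eq => i.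
  by rewrite tnth_mktuple; case: eqP => [_|/eqP i3]; rewrite ?meval0 // !mevalXU mxE (negPf i3).
move: hG; rewrite {G GS}G0 subr0.
elim: N F {F0} => [|N IH] F; first by rewrite expr0 mul1r.
rewrite exprSr -mulrA => /IH.
move/(ideal_gen_min (J := fun g => exists h, g = h * quadric_form)) => [|f g [h1 ->] [h2 ->]|f g [h ->]|f ->|h E].
- by exists 0; rewrite mul0r.
- by exists (h1 + h2); rewrite mulrDl.
- by exists (f * h); rewrite mulrA.
- by exists 1; rewrite mul1r.
have [h' E'] : exists h', h = X 0%N * h'.
  apply: divide_coordinate => v v0.
  pose c : 4.-tuple {mpoly K[4]} := [tuple if i == inord 0 then 0 else 'X_i | i < 4].
  have : (h \mPo c) * (X 1%N * X 2%N) = 0.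
    apply: mpoly_eval_eq0 => u; have := congr1 (fun f => (f \mPo c).@[u 0]) E.
    rewrite /quadric_form !(rmorphM, rmorphB) /= !comp_mpolyXU -!tnth_nth !tnth_mktuple.
    rewrite eqxx !inord_neq //= !meval0 !mul0r sub0r mulrN => /esym/eqP.
    by rewrite oppr_eq0 => /eqP.
  move/eqP; rewrite !mulf_eq0 -![X _ == 0]msize_poly_eq0 !msizeX !orbF => /eqP hc.
  have := congr1 (fun G : {mpoly K[4]} => G.@[v 0]) hc; rewrite /= comp_mpoly_meval meval0 => <-.
  apply: meval_eq => i.
  by rewrite tnth_mktuple; case: eqP => [->|_]; rewrite ?meval0 // mevalXU.
have X0 : X 0%N != 0 by rewrite -msize_poly_eq0 msizeX.
have -> : F = h' * quadric_form.
  by apply: (mulfI X0); rewrite mulrA -E' -E.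
by apply: ideal_genM; apply: ideal_gen1.
Qed.


Lemma prod_ord4 (A : comPzRingType) (F : 'I_4 -> A) :
  \prod_i F i = F (inord 0) * F (inord 1) * F (inord 2) * F (inord 3).
Proof.
rewrite !big_ord_recl big_ord0 mulr1 !mulrA.
by congr (_ * _ * _ * _); congr F; apply/val_inj; rewrite /= inordK.
Qed.

Definition multinom4 (s : seq nat) : 'X_{1..4} := [multinom nth 0%N s i | i < 4].

Lemma multinom4E s k : (k < 4)%N -> multinom4 s (inord k) = nth 0%N s k.
Proof. by move=> hk; rewrite mnmE inordK. Qed.

Lemma multinom4_eq (m m' : 'X_{1..4}) :
  (forall k, (k < 4)%N -> m (inord k) = m' (inord k)) -> m = m'.
Proof. by move=> h; apply/mnmP; apply: ord4P; apply: h. Qed.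

Lemma mdeg4 (m : 'X_{1..4}) : mdeg m = (m (inord 0) + m (inord 1) + m (inord 2) + m (inord 3))%N.
Proof. by rewrite mdegE sum_ord4. Qed.

(** Forms of degree d on the quadric are bihomogeneous of degree (d, d) on the
    product of two projective lines. *)
Lemma quadric_hilbert d :
  reldim (fun F : {mpoly K[4]} => F \is d.-homog)
    (fun F => forall o, quadric_cone o -> F.@[o 0] = 0) (d.+1 * d.+1).
Proof.
pose X i : {mpoly K[4]} := 'X_(inord i).
pose seg : 4.-tuple {mpoly K[4]} := [tuple X 0%N * X 2%N; X 0%N * X 3%N; X 1%N * X 2%N; X 1%N * X 3%N].
have segE F (v : 'rV[K]_4) : (F \mPo seg).@[v 0] =
    F.@[(\row_i [:: v 0 (inord 0) * v 0 (inord 2); v 0 (inord 0) * v 0 (inord 3);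
                    v 0 (inord 1) * v 0 (inord 2); v 0 (inord 1) * v 0 (inord 3)]`_i) 0].
  rewrite comp_mpoly_meval; apply: meval_eq; apply: ord4P;
  by rewrite mxE (tnth_nth 0) !inordK //= mevalM !mevalXU.
pose mono (m : 'X_{1..4}) := let m_ k := m (inord k) in
  multinom4 [:: m_ 0 + m_ 1; m_ 2 + m_ 3; m_ 0 + m_ 2; m_ 1 + m_ 3]%N.
have monoE m : 'X_[m] \mPo seg = 'X_[mono m].
  apply: mpoly_eval_inj => v; rewrite comp_mpoly_meval !mevalX !prod_ord4.
  rewrite !(tnth_nth 0) !inordK //= !multinom4E //= !mevalM !mevalXU.
  by rewrite !exprMn !exprD; ring.
pose bi i j := multinom4 [:: i; d - i; j; d - j]%N.
pose s := [seq bi i j | i <- iota 0 d.+1, j <- iota 0 d.+1].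
have us : uniq s.
  apply: allpairs_uniq; rewrite ?iota_uniq // => -[i j] [i' j'] _ _ /= E.
  have := congr1 (fun m : 'X_{1..4} => m (inord 0)) E.
  have := congr1 (fun m : 'X_{1..4} => m (inord 2)) E.
  by rewrite !multinom4E //= => -> ->.
have <- : size s = (d.+1 * d.+1)%N by rewrite size_allpairs !size_iota.
pose A' (F : {mpoly K[4]}) := {subset msupp F <= s}.
have A'0 : A' 0 by move=> m; rewrite msupp0.
have A'D F G : A' F -> A' G -> A' (F + G).
  by move=> hF hG m /msuppD_le; rewrite mem_cat => /orP[/hF|/hG].
have A'Z c F : A' F -> A' (c *: F) by move=> hF m /msuppZ_le /hF.
have in_s i j : (i <= d)%N -> (j <= d)%N -> bi i j \in s.
  by move=> hi hj; apply/allpairsP; exists (i, j); rewrite !mem_iota !add0n !ltnS.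
apply: (@reldim_iso _ _ _ (comp_mpoly seg) _ _ A' (fun F => F = 0)).
- exact: linearP.
- exact: homog_subspace.
- move=> F /dhomogP hF; rewrite comp_mpolyE; have := hF.
  elim: (msupp F : seq _) => [|m l IH] hl; first by rewrite big_nil.
  rewrite big_cons; apply: A'D; last by apply: IH => m' hm'; apply: hl; rewrite inE hm' orbT.
  have -> : F@_m *: \prod_(i < 4) tnth seg i ^+ m i = F@_m *: 'X_[mono m].
    by rewrite -monoE comp_mpolyX.
  apply: A'Z => m'; rewrite msuppX inE => /eqP ->.
  have := hl m (mem_head _ _); rewrite /= mdeg4 => md.
  have -> : mono m = bi (m (inord 0) + m (inord 1))%N (m (inord 0) + m (inord 2))%N.
    apply: multinom4_eq => -[|[|[|[|k]]]] // _; rewrite !multinom4E //=; lia.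
  apply: in_s; lia.
- move=> G hG; pose up (m : 'X_{1..4}) := let i := m (inord 0) in let j := m (inord 2) in
    multinom4 [:: minn i j; i - minn i j; j - minn i j; d - maxn i j]%N.
  have upE m : m \in msupp G -> mono (up m) = m /\ mdeg (up m) = d.
    move=> /hG /allpairsP[[i j] [hi hj ->]].
    move: hi hj; rewrite !mem_iota !add0n !ltnS /= => hi hj.
    split; first apply: multinom4_eq => k k4; rewrite ?mdeg4 /up !multinom4E //=; last by lia.
    case: k k4 => [|[|[|[|k]]]] //= _; lia.
  exists (\sum_(m <- msupp G) G@_m *: 'X_[up m]).
    rewrite big_seq; apply: rpred_sum => m /upE[_ dm]; apply: rpredZ.
    by rewrite dhomogX /= dm.
  rewrite raddf_sum [RHS]mpolyE !big_seq; apply: eq_bigr => m /upE[um _].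
  by rewrite /= comp_mpolyZ monoE um.
- move=> F _; split=> [h|E o].
    apply: mpoly_eval_eq0 => v; rewrite segE h //.
    by rewrite /quadric_cone quadric_formE !mxE !inordK //=; ring.
  rewrite /quadric_cone quadric_formE.
  pose x i : K := o 0 (inord i); rewrite -/(x 0%N) -/(x 1%N) -/(x 2%N) -/(x 3%N) => /eqP.
  rewrite subr_eq0 => /eqP Q0.
  suff [s0 [s1 [t0 [t1 [e0 e1 e2 e3]]]]] : exists s0 s1 t0 t1,
      [/\ x 0%N = s0 * t0, x 1%N = s0 * t1, x 2%N = s1 * t0 & x 3%N = s1 * t1].
    have := congr1 (fun G : {mpoly K[4]} => G.@[(\row_i [:: s0; s1; t0; t1]`_i : 'rV[K]_4) 0]) E.
    rewrite segE meval0 => <-.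
    apply: meval_eq; apply: ord4P; rewrite !mxE !inordK //=.
  have [x0|x0] := eqVneq (x 0%N) 0; last first.
    exists 1, (x 2%N / x 0%N), (x 0%N), (x 1%N); rewrite !mul1r divfK //; split=> //.
    by rewrite mulrAC [x 2%N * _]mulrC -Q0 mulrC mulKf.
  move/esym/eqP: Q0; rewrite x0 mul0r mulf_eq0 => /orP[]/eqP x1.
    by exists 0, 1, (x 2%N), (x 3%N); rewrite x1 !mul0r !mul1r.
  by exists (x 1%N), (x 3%N), 0, 1; rewrite x1 !mulr0 !mulr1.
exact: reldim_monomials.
Qed.

End QuadricCone.

(** ** Tangent cones in adapted coordinates *)

Section QuadricEquations.
Variables (K : numClosedFieldType) (p : nat) (X : set 'rV[K]_p.+1) (w : 'rV[K]_p.+1).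
Hypothesis X_scale : forall u c, X u -> c != 0 -> X (c *: u).
Hypotheses (w_neq0 : w != 0) (Xw : X w).

Local Notation i0 := (pivot w).
Local Notation ins := (insertion w).

Definition direction_mx : 'M[K]_(p.+1, p) :=
  \matrix_(k, j) ((k == lift i0 j)%:R - (k == i0)%:R * (w 0 (lift i0 j) / w 0 i0)).

Lemma directionE u : u *m direction_mx = chart_direction w u.
Proof.
apply/rowP => j; rewrite !mxE (bigD1 i0) //= (bigD1 (lift i0 j)) ?neq_lift //=; last first.
  by rewrite eq_sym neq_lift.
rewrite big1 => [|k /andP[k1 k2]]; last first.
  by rewrite mxE (negPf k1) (negPf k2) mul0r subrr mulr0.
rewrite !mxE !eqxx (negPf (neq_lift _ _)) [lift _ _ == _]eq_sym (negPf (neq_lift _ _)).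
by rewrite mul0r subr0 mul1r sub0r addr0 mulr1 mulrN addrC mulrC [w 0 _ / _ * _]mulrC.
Qed.

Lemma insertion_direction : ins *m direction_mx = 1%:M.
Proof.
apply/row_matrixP => i; rewrite row_mul directionE; apply/rowP => j.
rewrite rowE mxE insertion_lift insertion_pivot mulr0 subr0.
by rewrite row1 !mxE.
Qed.

Lemma direction_insertion u : u *m direction_mx *m ins = u - (u 0 i0 / w 0 i0) *: w.
Proof.
have wi := pivot_neq0 w_neq0.
rewrite directionE; apply/rowP => k; have [j ->|->] := unliftP i0 k.
  by rewrite insertion_lift !mxE; field.
by rewrite insertion_pivot !mxE divfK ?subrr.
Qed.

Lemma chartE z : chart w z = w + z *m ins.
Proof.
apply/rowP => k; rewrite [RHS]mxE; have [j ->|->] := unliftP i0 k.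
  by rewrite chart_lift insertion_lift.
by rewrite chart_pivot insertion_pivot addr0.
Qed.

Lemma quadric_expand n (Q : {mpoly K[n]}) (v u : 'rV[K]_n) : Q \is 2.-homog ->
  Q.@[(v + u) 0] = Q.@[v 0] + ddir Q (v 0) (u 0) + Q.@[u 0].
Proof.
move=> /quadratic_form[g ->]; rewrite !quadratic_eval ddir_quadratic -!big_split.
apply: eq_bigr => i _; rewrite -!big_split; apply: eq_bigr => j _ /=.
by rewrite !mxE; ring.
Qed.

Definition quadric_linear_part (Q : {mpoly K[p.+1]}) : {mpoly K[p]} :=
  \sum_i ddir Q (w 0) (row i ins 0) *: 'X_i.

Lemma linear_part_eval Q (z : 'rV[K]_p) :
  (quadric_linear_part Q).@[z 0] = ddir Q (w 0) ((z *m ins) 0).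
Proof.
rewrite lin_eval /ddir; under eq_bigr do rewrite mulr_suml.
rewrite exchange_big; apply: eq_bigr => k _; rewrite mxE mulr_sumr.
by apply: eq_bigr => i _; rewrite [row _ _ _ _]mxE; ring.
Qed.

Lemma quadric_chart Q : Q \is 2.-homog -> vanishing_ideal X Q ->
  chart_ideal X w (quadric_linear_part Q + lsubst ins Q).
Proof.
move=> hQ QX z Xz; have := QX _ Xz; rewrite chartE quadric_expand //.
by rewrite QX // add0r mevalD linear_part_eval lsubst_eval.
Qed.

Lemma tangent_linear Q : Q \is 2.-homog -> vanishing_ideal X Q ->
  tangent_cone X w (quadric_linear_part Q).
Proof.
move=> hQ QX; apply: ideal_gen1; exists (quadric_linear_part Q + lsubst ins Q).
  exact: quadric_chart.
exists 1%N; split; first exact: lin_homog.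
by rewrite addrAC subrr add0r; exact: homog_order (lsubst_homog _ hQ).
Qed.

Lemma tangent_quadric Q : Q \is 2.-homog -> vanishing_ideal X Q ->
  (forall u : 'rV[K]_p.+1, u 0 i0 = 0 -> ddir Q (w 0) (u 0) = 0) ->
  tangent_cone X w (lsubst ins Q).
Proof.
move=> hQ QX Q1; apply: ideal_gen1; exists (quadric_linear_part Q + lsubst ins Q).
  exact: quadric_chart.
have -> : quadric_linear_part Q = 0.
  by apply: mpoly_eval_eq0 => z; rewrite linear_part_eval Q1 // insertion_pivot.
rewrite add0r; exists 2%N; split; first exact: lsubst_homog.
by rewrite subrr => m; rewrite msupp0.
Qed.

(** The linear part of a function vanishing at [w], possibly zero, is an initial form. *)
Lemma linear_initial g : chart_ideal X w g ->
  initial_form g (\sum_(j < p) g@_(U_(j)) *: 'X_j).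
Proof.
move=> gX; exists 1%N; split; first exact: lin_homog.
apply/order_geP => m; rewrite ltnS mcoeffB raddf_sum /=.
under eq_bigr do rewrite mcoeffZ mcoeffX.
rewrite leq_eqVlt ltnS leqn0 => /orP[/mdeg1P[j /eqP ->]|].
  rewrite (bigD1 j) //= eqxx mulr1 big1 ?addr0 ?subrr // => i ij.
  by rewrite eq_mnm1 (negPf ij) mulr0.
rewrite mdeg_eq0 => /eqP ->; rewrite big1 => [|i _]; last by rewrite mnm1_eq0 mulr0.
by rewrite subr0 -meval_zero gX // chart0.
Qed.

(** [C'] reads off [n] coordinates near [w], in which [B'] parametrizes a
    linear space of directions; quadrics with invertible linear parts express
    the other coordinates. The tangent cone then lies in this linear space,
    where it has the ideal [J]. *)
Variables (n : nat) (B' : 'M[K]_(n, p.+1)) (C' : 'M[K]_(p.+1, n)).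
Variables (J G : set {mpoly K[n]}).
Hypotheses (BC' : B' *m C' = 1%:M) (wC' : w *m C' = 0).

Definition cone_basis : 'M[K]_(n, p) := B' *m direction_mx.
Local Notation B := cone_basis.
Local Notation C := (ins *m C').

Lemma cone_basis_left : B *m C = 1%:M.
Proof.
rewrite /B mulmxA -BC'; apply/row_matrixP => i; rewrite !row_mul direction_insertion.
by rewrite mulmxBl -scalemxAl wC' scaler0 subr0.
Qed.

Hypothesis adapted : forall k, exists Q, [/\ Q \is 2.-homog, vanishing_ideal X Q &
  forall u : 'rV[K]_p.+1, u 0 i0 = 0 ->
    ddir Q (w 0) (u 0) = u 0 k - (u *m C' *m B') 0 k].

Lemma tangent_adapted k : tangent_cone X w (\sum_i (ins i k - (C *m B') i k) *: 'X_i).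
Proof.
have [Q [hQ QX Q1]] := adapted k; have := tangent_linear hQ QX; congr (tangent_cone X w).
apply: eq_bigr => i _; rewrite Q1; last by rewrite rowE insertion_pivot.
by rewrite -row_mul -row_mul !mxE.
Qed.

(** The linear parts of the adapted quadrics identify each coordinate with its
    projection to the space of directions. *)
Lemma tangent_projection f : tangent_cone X w (f - lsubst (C *m B) f).
Proof.
rewrite -{1}[f]lsubst1; apply: ideal_gen_lsubst_diff => j.
have -> : \sum_i ((1%:M : 'M[K]_p) i j - (C *m B) i j) *: 'X_i =
    \sum_k direction_mx k j *: \sum_i (ins i k - (C *m B') i k) *: 'X_i :> {mpoly K[p]}.
  under [RHS]eq_bigr do rewrite scaler_sumr.
  rewrite exchange_big; apply: eq_bigr => i _ /=.
  under [RHS]eq_bigr do rewrite scalerA.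
  rewrite -scaler_suml; congr (_ *: _).
  rewrite -insertion_direction mulmxA !mxE -sumrB; apply: eq_bigr => k _.
  by rewrite mulrBr !(mulrC (direction_mx _ _)).
by apply: ideal_gen_sum => k _; apply: ideal_genZ; exact: tangent_adapted.
Qed.

Hypothesis equations : forall f, G f -> exists Q, [/\ Q \is 2.-homog, vanishing_ideal X Q,
  forall u : 'rV[K]_p.+1, u 0 i0 = 0 -> ddir Q (w 0) (u 0) = 0 &
  forall s : 'rV[K]_n, Q.@[(s *m B') 0] = f.@[s 0]].

Lemma tangent_equation f : G f -> tangent_cone X w (lsubst C f).
Proof.
move=> /equations[Q [hQ QX Q1 Qf]].
have -> : lsubst C f = lsubst (C *m B') Q.
  by apply: mpoly_eval_inj => v; rewrite !lsubst_eval [v *m (_ *m B')]mulmxA Qf.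
rewrite -[lsubst _ Q](subrK (lsubst ins Q)); apply: ideal_genD; last exact: tangent_quadric.
rewrite -opprB -mulN1r; apply: ideal_genM; apply: ideal_gen_lsubst_diff => k.
exact: tangent_adapted.
Qed.

Lemma arc_value (A D : 'I_p.+1 -> {poly K}) e (s : 'rV[K]_n) g f : (0 < e)%N ->
  (forall k, A k = (w 0 k)%:P + 'X^e * D k) ->
  (forall k, (D k).[0] = (s *m B') 0 k) ->
  (forall t, (A i0).[t] != 0 -> X (\row_k (A k).[t])) ->
  chart_ideal X w g -> initial_form g f -> f.@[(s *m B) 0] = 0.
Proof.
move=> e0 AE D0 XA gX fg; rewrite -(arc_initial_form X_scale w_neq0 e0 AE XA gX fg).
rewrite mulmxA directionE; congr (f.@[_ 0]); congr chart_direction.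
by apply/rowP => k; rewrite [RHS]mxE D0.
Qed.

Hypothesis initial_J : forall g f, chart_ideal X w g -> initial_form g f -> J (lsubst B f).
Hypothesis JG : forall f, J f -> ideal_gen G f.
Variable S : set 'rV[K]_p.
Hypothesis SJ : forall f, vanishing_ideal S f <-> J (lsubst B f).

Lemma adapted_initial g f : chart_ideal X w g -> initial_form g f -> vanishing_ideal S f.
Proof. by move=> gX fg; apply/SJ; apply: initial_J fg. Qed.

(** [tangent_equation] and [tangent_projection] bound the tangent cone from above by
    [G], the initial forms bound it from below. *)
Lemma adapted_cone : is_cone_over (tangent_cone X w) S.
Proof.
apply: (tangent_cone_is_cone_over adapted_initial (G := tangent_cone X w)) => // f /SJ/JG Gf.
apply: ideal_gen1; rewrite -[f](subrK (lsubst (C *m B) f)).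
apply: ideal_genD; first exact: tangent_projection.
by rewrite -lsubst_comp; apply: ideal_gen_lsubst Gf; exact: tangent_equation.
Qed.

Lemma adapted_multiplicity (hf : nat -> nat) e : (0 < e)%N ->
  (forall d, reldim (fun F : {mpoly K[n]} => F \is d.-homog) J (hf d)) ->
  (forall d, (2 * hf d = d.+1 * (e * d + 2))%N) -> multiplicity 3 X w e.
Proof.
move=> e0 hJ; apply: (multiplicity_of_hilbert w_neq0 adapted_initial adapted_cone e0) => d.
apply: (reldim_iso (@lsubst_linear K _ _ B) _ _ _ _ (hJ d)).
- exact: homog_subspace.
- by move=> f; apply: lsubst_homog.
- move=> f hf'; exists (lsubst C f); first exact: lsubst_homog.
  by rewrite lsubst_comp cone_basis_left lsubst1.
by move=> f _; exact: SJ.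
Qed.

Lemma cone_basis_free : row_free B.
Proof. by apply/row_freeP; exists C; exact: cone_basis_left. Qed.

Lemma cone_basis_inj (s s' : 'rV[K]_n) : s *m B = s' *m B -> s = s'.
Proof. by move/(congr1 (mulmx^~ C)); rewrite -![_ *m B *m _]mulmxA cone_basis_left !mulmx1. Qed.

End QuadricEquations.

(** ** Veronese cones *)

Section VeronesePoint.
Variables (K : numClosedFieldType) (p : nat) (X : set 'rV[K]_p.+1) (w : 'rV[K]_p.+1).
Hypothesis X_scale : forall u c, X u -> c != 0 -> X (c *: u).
Hypotheses (w_neq0 : w != 0) (Xw : X w).
Variables (B' : 'M[K]_(6, p.+1)) (C' : 'M[K]_(p.+1, 6)).
Hypotheses (BC' : B' *m C' = 1%:M) (wC' : w *m C' = 0).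
Hypothesis adapted : forall k, exists Q, [/\ Q \is 2.-homog, vanishing_ideal X Q &
  forall u : 'rV[K]_p.+1, u 0 (pivot w) = 0 ->
    ddir Q (w 0) (u 0) = u 0 k - (u *m C' *m B') 0 k].
Hypothesis veronese_coordinates : forall z, X z -> exists t, z *m C' = veronese t.
Hypothesis veronese_arcs : forall t : 'rV[K]_3, exists (e : nat) (A D : 'I_p.+1 -> {poly K}),
  [/\ (0 < e)%N, forall k, A k = (w 0 k)%:P + 'X^e * D k,
      forall k, (D k).[0] = (veronese t *m B') 0 k &
      forall s, (A (pivot w)).[s] != 0 -> X (\row_k (A k).[s])].

Local Notation B := (cone_basis w B').

Lemma veronese_initial g f : chart_ideal X w g -> initial_form g f ->
  veronese_ideal (lsubst B f).
Proof.
move=> gX fg t _; rewrite lsubst_eval; have [e [A [D [e0 AE D0 XA]]]] := veronese_arcs t.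
exact: (arc_value X_scale w_neq0 e0 AE D0 XA gX fg).
Qed.

Lemma veronese_equations f : f \is 2.-homog /\ veronese_ideal f ->
  exists Q, [/\ Q \is 2.-homog, vanishing_ideal X Q,
    forall u : 'rV[K]_p.+1, u 0 (pivot w) = 0 -> ddir Q (w 0) (u 0) = 0 &
    forall s : 'rV[K]_6, Q.@[(s *m B') 0] = f.@[s 0]].
Proof.
move=> [hf fV]; exists (lsubst C' f); split; first exact: lsubst_homog.
- move=> z /veronese_coordinates[t zt]; rewrite lsubst_eval zt.
  have [->|/fV //] := eqVneq t 0.
  by rewrite -(scale0r 0) veroneseZ expr0n scale0r (dhomog_meval0 _ hf).
- move=> u _; rewrite ddir_lsubst wC'; have [g ->] := quadratic_form hf.
  rewrite ddir_quadratic big1 // => i _; rewrite big1 // => j _.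
  by rewrite !mxE mulr0 mul0r addr0 mulr0.
by move=> s; rewrite lsubst_eval -mulmxA BC' mulmx1.
Qed.

Lemma veronese_surfaceP f :
  vanishing_ideal (veronese_surface B) f <-> veronese_ideal (lsubst B f).
Proof.
split=> [h t t0|h u [_ [t t0 /eqrVP[c c0 ->]]]].
  rewrite lsubst_eval; apply: h; split.
    apply: contra_neq (veronese_neq0 t0) => E.
    by apply: (cone_basis_inj w_neq0 BC' wC'); rewrite E mul0mx.
  by exists t => //; apply/eqrVP; exists 1; rewrite ?oner_eq0 ?scale1r.
rewrite scalemxAl; have -> : c *: veronese t = veronese (sqrtC c *: t).
  by rewrite veroneseZ sqrtCK.
by rewrite -lsubst_eval; apply: h; rewrite scaler_eq0 negb_or sqrtC_eq0 c0.
Qed.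

Lemma veronese_point_cone : cone_over_veronese (tangent_cone X w).
Proof.
exists B; first exact: (cone_basis_free w_neq0 BC' wC').
exact: (adapted_cone Xw adapted veronese_equations veronese_initial
  (@veronese_generated K) veronese_surfaceP).
Qed.

Lemma veronese_point_multiplicity : multiplicity 3 X w 4.
Proof.
apply: (adapted_multiplicity w_neq0 Xw BC' wC' adapted veronese_equations veronese_initial
  (@veronese_generated K) veronese_surfaceP _ (@veronese_hilbert K)) => // d.
have -> : 'C(d.*2 + 2, d.*2) = 'C(d.*2 + 2, 2) by rewrite -(bin_sub (leq_addl _ 2)) addnK.
by rewrite addn2 -mul_bin_diag bin1 /=; lia.
Qed.

Lemma veronese_point_singular : singular_point 3 X w.
Proof.
apply: (singular_of_directions Xw (B := B) _ (cone_basis_free w_neq0 BC' wC')) => // i g gX.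
pose a : 'rV[K]_6 := \row_i \sum_j g@_(U_(j)) * B i j.
suff /(congr1 (fun a : 'rV[K]_6 => a 0 i)) : a = 0.
  rewrite [LHS]mxE [RHS]mxE => E; rewrite -[RHS]E.
  by apply: eq_bigr => j _; rewrite [row _ _ _ _]mxE.
apply: (iq_indep (veronese_data K)) => t t0.
have := veronese_initial gX (linear_initial Xw gX) t0.
rewrite lsubst_eval lin_eval => E; rewrite -[RHS]E.
under eq_bigr => k _ do rewrite [a 0 k]mxE mulr_suml.
rewrite exchange_big; apply: eq_bigr => j _ /=.
rewrite [(_ *m B) 0 j]mxE mulr_sumr; apply: eq_bigr => k _.
by rewrite -veronese_formsE [poly_map _ _ _ _]mxE; ring.
Qed.

End VeronesePoint.

(** ** Unions of four planes and a surface *)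

Section FourPlanesPoint.
Variables (K : numClosedFieldType) (p : nat) (X : set 'rV[K]_p.+1) (w : 'rV[K]_p.+1).
Hypothesis X_scale : forall u c, X u -> c != 0 -> X (c *: u).
Hypotheses (w_neq0 : w != 0) (Xw : X w).
Variables (a : nat) (S0 : set 'rV[K]_a.+1) (G0 : set {mpoly K[a.+1]}).
Variables (N : 'I_4 -> 'M[K]_(2, a.+1)) (N' : 'I_4 -> 'M[K]_(a.+1, 2)).
Hypothesis NN' : forall i, N i *m N' i = 1%:M.
Hypothesis S0_lines : forall i x, S0 (x *m N i).
Variable S1 : set 'rV[K]_a.+1.
Hypothesis S1_ideal : forall F, (forall o, S1 o -> F.@[o 0] = 0) -> ideal_gen G0 F.
Hypothesis G0_vanish : forall F o, G0 F -> S0 o -> F.@[o 0] = 0.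
Hypothesis S10 : forall o, S1 o -> S0 o.

Variables (B' : 'M[K]_(a.+1 + 4, p.+1)) (C' : 'M[K]_(p.+1, a.+1 + 4)).
Hypotheses (BC' : B' *m C' = 1%:M) (wC' : w *m C' = 0).
Hypothesis adapted : forall k, exists Q, [/\ Q \is 2.-homog, vanishing_ideal X Q &
  forall u : 'rV[K]_p.+1, u 0 (pivot w) = 0 ->
    ddir Q (w 0) (u 0) = u 0 k - (u *m C' *m B') 0 k].

Let equation (f : 'rV[K]_(a.+1) -> 'rV[K]_4 -> K) := exists Q, [/\ Q \is 2.-homog,
  vanishing_ideal X Q, forall u : 'rV[K]_p.+1, u 0 (pivot w) = 0 -> ddir Q (w 0) (u 0) = 0 &
  forall o c, Q.@[(row_mx o c *m B') 0] = f o c].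

Hypothesis equations0 : forall F, G0 F -> equation (fun o _ => F.@[o 0]).
Hypothesis equations1 : forall i j, i != j -> equation (fun _ c => c 0 i * c 0 j).
Hypothesis equations2 : forall i (u : 'cV[K]_a.+1), N i *m u = 0 -> equation (fun o c => c 0 i * (o *m u) 0 0).

Let arc (s : 'rV[K]_(a.+1 + 4)) := exists (e : nat) (A D : 'I_p.+1 -> {poly K}),
  [/\ (0 < e)%N, forall k, A k = (w 0 k)%:P + 'X^e * D k,
      forall k, (D k).[0] = (s *m B') 0 k &
      forall t, (A (pivot w)).[t] != 0 -> X (\row_k (A k).[t])].

Hypothesis arcs1 : forall o, S1 o -> arc (row_mx o 0).
Hypothesis arcs2 : forall i (x : 'rV[K]_2) g, g != 0 ->
  arc (row_mx (x *m N i) (g *: delta_mx 0 i)).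

Local Notation B := (cone_basis w B').
Local Notation J := (four_planes_ideal S0 N).

Lemma arc_vanish s g f : arc s -> chart_ideal X w g -> initial_form g f ->
  (lsubst B f).@[s 0] = 0.
Proof.
move=> [e [A [D [e0 AE D0 XA]]]] gX fg; rewrite lsubst_eval.
exact: (arc_value X_scale w_neq0 e0 AE D0 XA gX fg).
Qed.

Lemma surface_dense F : (forall o, S1 o -> F.@[o 0] = 0) -> forall o, S0 o -> F.@[o 0] = 0.
Proof.
move=> /S1_ideal hF o So.
apply: (ideal_gen_min (J := fun f => f.@[o 0] = 0)) hF => [|f g hf hg|f g hg|f /G0_vanish -> //].
- by rewrite meval0.
- by rewrite mevalD hf hg addr0.
by rewrite mevalM hg mulr0.
Qed.

(** Arcs with leading direction outside the cone over [S0] are given for nonzero last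
    coordinate only; the remaining values follow by continuity. *)
Lemma four_planes_initial g f : chart_ideal X w g -> initial_form g f -> J (lsubst B f).
Proof.
move=> gX fg; split=> [o So|i x c].
  have {}So := surface_dense _ So.
  have E (o' : 'rV[K]_a.+1) : (lsubst (row_mx 1%:M 0) (lsubst B f)).@[o' 0] = (lsubst B f).@[(row_mx o' (0 : 'rV[K]_4)) 0].
    by rewrite lsubst_eval mul_mx_row mulmx1 mulmx0.
  rewrite -E; apply: So => o' S1o'.
  by rewrite lsubst_eval mul_mx_row mulmx1 mulmx0; exact: arc_vanish (arcs1 S1o') gX fg.
pose s c : 'rV[K]_(a.+1 + 4) := row_mx (x *m N i) (c *: delta_mx 0 i).
have [P [hP _]] := arc_deriv (lsubst B f)
  (fun k => (row_mx (x *m N i) 0 0 k)%:P + (row_mx 0 (delta_mx 0 i) : 'rV_(a.+1 + 4)) 0 k *: 'X).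
have {}hP c' : P.[c'] = (lsubst B f).@[s c' 0].
  rewrite hP; apply: meval_eq => k; rewrite hornerD hornerC hornerZ hornerX /s.
  move: k; apply: split_ind => k; first by rewrite !row_mxEl [X in _ + X * _]mxE mul0r addr0.
  by rewrite !row_mxEr !mxE add0r mulrC.
rewrite -/(s c) -hP; suff /eqP : P * 'X = 0.
  by rewrite mulf_eq0 polyX_eq0 orbF => /eqP ->; rewrite horner0.
apply: poly_eval_eq0 => c'; rewrite hornerM hornerX.
have [->|c0] := eqVneq c' 0; first by rewrite mulr0.
by rewrite hP (arc_vanish (arcs2 i x c0) gX fg) mul0r.
Qed.

Lemma four_planes_equations f : four_planes_gen G0 N f ->
  exists Q, [/\ Q \is 2.-homog, vanishing_ideal X Q,
    forall u : 'rV[K]_p.+1, u 0 (pivot w) = 0 -> ddir Q (w 0) (u 0) = 0 &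
    forall s : 'rV[K]_(a.+1 + 4), Q.@[(s *m B') 0] = f.@[s 0]].
Proof.
case=> [[F GF ->]|[i [j [ij ->]]]|[i [u [Nu ->]]]].
- have [Q [hQ QX Q1 Qf]] := equations0 GF; exists Q; split=> // s.
  rewrite -{1}(hsubmxK s) Qf lsubst_eval -[in RHS](hsubmxK s) mul_row_col.
  by rewrite mulmx1 mulmx0 addr0.
- have [Q [hQ QX Q1 Qf]] := equations1 ij; exists Q; split=> // s.
  by rewrite -{1}(hsubmxK s) Qf mevalM !mevalXU !mxE.
have [Q [hQ QX Q1 Qf]] := equations2 Nu; exists Q; split=> // s.
rewrite -{1}(hsubmxK s) Qf mevalM mevalXU !mxE; congr (_ * _).
by rewrite raddf_sum; apply: eq_bigr => k _; rewrite /= mevalZ mevalXU !mxE mulrC.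
Qed.

Lemma four_planes_gens f : J f -> ideal_gen (four_planes_gen G0 N) f.
Proof.
apply: four_planes_generated => // F FS; apply: S1_ideal => o /S10; exact: FS.
Qed.

Lemma four_planes_point_singular : singular_point 3 X w.
Proof.
have free : row_free (row_mx 0 1%:M *m B : 'M[K]_(4, p)).
  apply/row_freeP; exists ((insertion w *m C') *m col_mx 0 1%:M).
  by rewrite mulmxA -[_ *m B *m _]mulmxA (cone_basis_left w_neq0 BC' wC') mulmx1 mul_row_col mulmx0 mulmx1 add0r.
apply: (singular_of_directions Xw _ free) => // i g gX.
have [_ h] := four_planes_initial gX (linear_initial Xw gX).
have := h i 0 1; rewrite mul0mx scale1r lsubst_eval lin_eval => E; rewrite -[RHS]E.
apply: eq_bigr => j _; congr (_ * _).
have -> : row_mx 0 (delta_mx 0 i) = row i (row_mx 0 1%:M) :> 'rV[K]_(a.+1 + 4).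
  by rewrite row_row_mx row0 row1.
by rewrite row_mul.
Qed.

Section Surface.
Variable S : set 'rV[K]_p.
Hypothesis SJ : forall f, vanishing_ideal S f <-> J (lsubst B f).

Lemma four_planes_point_cone : is_cone_over (tangent_cone X w) S.
Proof.
exact: (adapted_cone Xw adapted four_planes_equations four_planes_initial
  four_planes_gens SJ).
Qed.

Lemma four_planes_point_multiplicity (h0 : nat -> nat) e : (0 < e)%N ->
  (forall d, reldim (fun F : {mpoly K[a.+1]} => F \is d.-homog)
     (fun F => forall o, S0 o -> F.@[o 0] = 0) (h0 d)) ->
  (forall d, (2 * (h0 d + 4 * 'C(d.+1, 2)) = d.+1 * (e * d + 2))%N) ->
  multiplicity 3 X w e.
Proof.
move=> e0 H0 hE.
apply: (adapted_multiplicity w_neq0 Xw BC' wC' adapted four_planes_equations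
  four_planes_initial four_planes_gens SJ e0 _ hE) => d.
by apply: four_planes_hilbert => //; exact: NN'.
Qed.

End Surface.

Definition plane_block i : 'M[K]_(2 + 1, a.+1 + 4) := block_mx (N i) 0 0 (delta_mx 0 i).

Lemma plane_block_left i :
  plane_block i *m (block_mx (N' i) 0 0 (delta_mx i 0) : 'M[K]_(a.+1 + 4, 2 + 1)) = 1%:M.
Proof.
rewrite /plane_block mulmx_block !mulmx0 !mul0mx !addr0 add0r NN'.
have -> : delta_mx 0 i *m delta_mx i 0 = 1%:M :> 'M[K]_1.
  by rewrite mul_delta_mx; apply/matrixP => u v; rewrite !ord1 !mxE.
by rewrite -scalar_mx_block.
Qed.

Definition plane_basis i : 'M[K]_(3, p) := plane_block i *m B.

Lemma plane_basisE i (x : 'rV[K]_2) (g : 'rV[K]_1) :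
  (row_mx x g : 'rV_(2 + 1)) *m plane_basis i = row_mx (x *m N i) (g 0 0 *: delta_mx 0 i) *m B.
Proof.
rewrite mulmxA mul_row_block !mulmx0 addr0 add0r; congr (row_mx _ _ *m _).
by rewrite {1}[g]mx11_scalar mul_scalar_mx.
Qed.

Lemma plane_basis_free i : row_free (plane_basis i).
Proof.
apply/row_freeP.
exists (insertion w *m C' *m (block_mx (N' i) 0 0 (delta_mx i 0) : 'M[K]_(a.+1 + 4, 2 + 1))).
rewrite mulmxA -[_ *m B *m _]mulmxA (cone_basis_left w_neq0 BC' wC') mulmx1.
exact: plane_block_left.
Qed.

Lemma plane_basis_delta i :
  (row_mx (0 : 'rV[K]_a.+1) (delta_mx 0 i : 'rV[K]_4) *m B <= plane_basis i)%MS.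
Proof.
have := plane_basisE i 0 1%:M; rewrite mul0mx mxE eqxx scale1r => <-.
exact: submxMl.
Qed.

Lemma plane_basis_inj i j : (plane_basis i == plane_basis j)%MS -> i = j.
Proof.
case/andP => ij _; have := submx_trans (plane_basis_delta i) ij.
case/submxP => y; rewrite -[y](@hsubmxK _ _ 2 1) plane_basisE.
move/(cone_basis_inj w_neq0 BC' wC')/eq_row_mx => [_ /(congr1 (fun v : 'rV[K]_4 => v 0 i))].
rewrite !mxE !eqxx /=; case: eqP => // _ /eqP.
by rewrite mulr0 oner_eq0.
Qed.

Lemma planes_ideal (S : set 'rV[K]_p) :
  (forall u, S u <-> (exists i, plane (plane_basis i) u) \/
                     (u != 0 /\ exists2 o, S0 o & u = row_mx o 0 *m B)) ->
  forall f, vanishing_ideal S f <-> J (lsubst B f).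
Proof.
move=> SE f; split=> [h|[h1 h2] u /SE[[i [u0 /submxP[y ->]]]|[_ [o So ->]]]]; last 2 first.
- rewrite -[y](@hsubmxK _ _ 2 1) plane_basisE -lsubst_eval; exact: h2.
- by rewrite -lsubst_eval; exact: h1.
have f0 : f.@[(0 : 'rV[K]_p) 0] = 0.
  have dn : row_mx 0 (delta_mx 0 ord0) *m B != 0 :> 'rV[K]_p.
    apply/eqP; rewrite -[RHS](mul0mx _ B) => /(cone_basis_inj w_neq0 BC' wC').
    rewrite -[X in _ = X]row_mx0 => /eq_row_mx [_ /(congr1 (fun v : 'rV[K]_4 => v 0 ord0))] /eqP.
    by rewrite !mxE eqxx oner_eq0.
  apply: (@cone_zero _ _ f (row_mx 0 (delta_mx 0 ord0) *m B)) => c c0.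
  apply: h; apply/SE; left; exists ord0; split; first by rewrite scaler_eq0 negb_or c0.
  by apply: scalemx_sub; exact: plane_basis_delta.
split=> [o So|i x g]; rewrite lsubst_eval.
  have [->//|u0] := eqVneq (row_mx o 0 *m B) 0.
  by apply: h; apply/SE; right; split=> //; exists o.
have [->//|u0] := eqVneq (row_mx (x *m N i) (g *: delta_mx 0 i) *m B) 0.
apply: h; apply/SE; left; exists i; split=> //.
by have := plane_basisE i x g%:M; rewrite mxE eqxx mulr1n => <-; exact: submxMl.
Qed.

End FourPlanesPoint.

(** * Quotients of toric cones *)

Lemma polynomial_tail (K : numFieldType) (P : {poly K}) :
  exists D : {poly K}, P = P.[0]%:P + 'X * D /\ D.[0] = P^`().[0].
Proof.
have /factor_theorem[D E] : root (P - P.[0]%:P) 0 by rewrite rootE !hornerE subrr.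
have {}E : P = P.[0]%:P + 'X * D by rewrite mulrC -[X in D * X]subr0 -E addrC subrK.
by exists D; split=> //; rewrite [in RHS]E derivD derivC derivM derivX !hornerE.
Qed.

Lemma same_refl (K : fieldType) n (u : 'rV[K]_n) : (u == u)%MS.
Proof. by rewrite submx_refl. Qed.

Lemma same_trans (K : fieldType) n (u v w : 'rV[K]_n) :
  (u == v)%MS -> (v == w)%MS -> (u == w)%MS.
Proof.
move=> /andP[uv vu] /andP[vw wv].
by rewrite (submx_trans uv vw) (submx_trans wv vu).
Qed.

Lemma same_opp (K : fieldType) n (u : 'rV[K]_n) : (- u == u)%MS.
Proof. by rewrite !eqmx_opp submx_refl. Qed.

Section ToricQuotient.
Variables (K : numClosedFieldType) (n p : nat) (tab : seq (nat * nat)).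
Local Notation V := (@toric_cone K n tab).
Variables (tau : 'rV[K]_n.+1 -> 'rV[K]_n.+1) (q : p.+1.-tuple {mpoly K[n.+1]}).
Variables (M : 'M[K]_n.+1) (neg : pred 'I_n.+1) (l : 'I_n.+1 -> 'I_n.+1 -> 'rV[K]_p.+1).
Hypothesis data : invariant_quadrics V tau q M neg l.

Local Notation phi := (poly_map q).
Local Notation y v i := ((v *m M) 0 i).
Local Notation W := (image_of V q).

Lemma image_scale u c : W u -> c != 0 -> W (c *: u).
Proof.
move=> [u0 [v Vv /eqrVP[b b0 uE]]] c0; split; first by rewrite scaler_eq0 negb_or c0.
by exists v => //; apply/eqrVP; exists (c * b); rewrite ?mulf_neq0 // uE scalerA.
Qed.

Lemma image_phi v : V v -> W (phi v).
Proof. by move=> Vv; apply/(imageP data); exists v. Qed.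

Definition quadrics_jacobian (v : 'rV[K]_n.+1) : 'M[K]_(n.+1, p.+1) :=
  \matrix_(i, k) ((tnth q k)^`M(i)).@[v 0].

Lemma quadrics_jacobianE (v u : 'rV[K]_n.+1) k :
  (u *m quadrics_jacobian v) 0 k = ddir (tnth q k) (v 0) (u 0).
Proof. by rewrite mxE; apply: eq_bigr => i _; rewrite mxE mulrC. Qed.

Lemma euler (Q : {mpoly K[n.+1]}) (v : 'rV[K]_n.+1) : Q \is 2.-homog ->
  ddir Q (v 0) (v 0) = 2 * Q.@[v 0].
Proof.
move=> /quadratic_form[g ->]; rewrite ddir_quadratic quadratic_eval mulr_sumr.
apply: eq_bigr => i _; rewrite mulr_sumr; apply: eq_bigr => j _; ring.
Qed.

(** At a point that is not fixed the quotient map is etale, and the tangent space of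
    the image is that of the toric cone. *)
Theorem free_point_smooth v a0 b0 ex i0 i1 i2 : V v ->
  ~~ neg a0 -> y v a0 != 0 -> neg b0 -> y v b0 != 0 ->
  chart_ok n tab ex i0 i1 i2 -> v 0 (inord i0) != 0 -> ~ singular_point 3 W (phi v).
Proof.
move=> Vv na ya nb yb ok v0.
have [T [fT arcs TV TU]] := toric_tangent ok Vv v0.
pose J := quadrics_jacobian v; pose U := T *m J.
have [e eT] : exists e, v = e *m T.
  by apply/submxP/TU => Q hQ QV; rewrite euler // QV // mulr0.
have eU : (2^-1 *: e) *m U = phi v.
  apply/rowP => k; rewrite /U mulmxA -scalemxAl -eT -scalemxAl mxE quadrics_jacobianE.
  by rewrite euler ?(iq_homog data) // phiE mulKf ?pnatr_eq0.
apply: (smooth_point image_scale (phi_neq0 data Vv) (image_phi Vv) (U := U)).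
- rewrite -kermx_eq0; apply/eqP/row_matrixP => i; rewrite row0.
  have dU : row i (kermx U) *m U = 0 by rewrite -row_mul mulmx_ker row0.
  have : row i (kermx U) *m T = 0.
    apply: (tangent_inj data na ya nb yb); first by move=> G _; apply: TV.
    by move=> k; rewrite -quadrics_jacobianE -mulmxA dU mxE.
  by move=> h; apply: (row_free_inj fT); rewrite h mul0mx.
- by rewrite -eU submxMl.
- move=> x; set w := phi v; pose c := - (x *m T) 0 (inord i0) / v 0 (inord i0).
  have [A [A0 A1 AV]] := arcs (x + (c / 2) *: e).
  have hP k : exists P : {poly K}, (forall t, P.[t] = (tnth q k).@[fun i => (A i).[t]]) /\
      P^`().[0] = ((x + (c / 2) *: e) *m U) 0 k.
    have [P [P0 P1]] := arc_deriv (tnth q k) A; exists P; split=> //.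
    rewrite P1 /U mulmxA quadrics_jacobianE; congr ddir; apply: funext => i.
      exact: A0.
    exact: A1.
  have {hP} /choice[P hP] := hP.
  pose a := (v 0 (inord i0))^-1 *: A (inord i0).
  have a0' : a.[0] = 1 by rewrite hornerZ A0 mulVf.
  have a1 : a^`().[0] = (v 0 (inord i0))^-1 * ((x + (c / 2) *: e) *m T) 0 (inord i0).
    by rewrite derivZ hornerZ A1.
  have aE t : a.[t] = (v 0 (inord i0))^-1 * (A (inord i0)).[t] by rewrite hornerZ.
  clearbody a.
  have /choice[D hD] k := polynomial_tail (P k * (a * a)).
  exists (fun k => P k * (a * a)), D; split=> [k|k|t].
  + rewrite {1}(hD k).1; congr (_%:P + _).
    by rewrite !hornerM a0' !mulr1 (hP k).1 phiE; apply: meval_eq => i; rewrite A0.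
  + rewrite (hD k).2 !derivM !hornerE a0' a1 (hP k).2 (hP k).1.
    rewrite (meval_eq _ A0) -phiE -/w.
    rewrite !mulmxDl -!scalemxAl -!eT.
    have -> : e *m U = 2 *: w by rewrite /w -eU -scalemxAl scalerA divff ?scale1r ?pnatr_eq0.
    rewrite /c; move: (x *m U) (x *m T) (w) => xU xT w'.
    by rewrite !mxE /=; field.
  rewrite !hornerM => ne0.
  have at0 : (A (inord i0)).[t] != 0.
    by apply: contraNneq ne0 => E; rewrite aE E !mulr0.
  have -> : \row_k (P k * (a * a)).[t] = (a.[t] * a.[t]) *: phi (\row_k (A k).[t]).
    apply/rowP => k; rewrite !mxE !hornerM mulrC (hP k).1; congr (_ * _).
    by apply: meval_eq => i; rewrite mxE.
  apply: image_scale; first exact/image_phi/AV.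
  by rewrite !mulf_neq0 // aE mulf_neq0 ?invr_eq0.
move=> u hu; have [v' [uE v'V]] := tangent_lift data Vv na ya nb yb hu.
have -> : u = v' *m J by apply/rowP => k; rewrite quadrics_jacobianE.
by apply: submxMr; apply: TU.
Qed.

(** ** Fixed points *)

Lemma fixed_pointP v : V v ->
  (tau v == v)%MS <-> (forall i, neg i -> y v i = 0) \/ (forall i, ~~ neg i -> y v i = 0).
Proof.
move=> Vv; split=> [/eqrVP[c c0 E]|[h|h]].
- have cE i : (-1) ^+ neg i * y v i = c * y v i.
    by rewrite -(iq_tau data) E -scalemxAl mxE.
  have [c1|c1] := eqVneq c 1; [left | right] => i ni; have := cE i.
    rewrite ni c1 mul1r expr1 mulN1r => /eqP; rewrite eq_sym -subr_eq0 opprK -mulr2n mulrn_eq0.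
    by move/eqP.
  rewrite (negPf ni) expr0 => /eqP; rewrite -subr_eq0 -mulrBl mulf_eq0 subr_eq0 eq_sym.
  by rewrite (negPf c1) => /eqP.
- apply/eqrVP; exists 1; rewrite ?oner_eq0 // scale1r; apply: (y_inj data) => i.
  rewrite (iq_tau data); case ni: (neg i); last by rewrite mul1r.
  by rewrite h // mulr0.
apply/eqrVP; exists (-1); rewrite ?oppr_eq0 ?oner_eq0 //; apply: (y_inj data) => i.
rewrite (iq_tau data) -scalemxAl [RHS]mxE; case ni: (neg i) => //.
by rewrite h ?ni // !mulr0.
Qed.

Lemma free_pointP v : V v -> ~ (tau v == v)%MS ->
  exists a b, [/\ ~~ neg a, y v a != 0, neg b & y v b != 0].
Proof.
move=> Vv /(fixed_pointP Vv) nf; apply: contra_notP nf => h.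
have [[a [na ya]]|ha] := pselect (exists a, ~~ neg a /\ y v a != 0).
  left=> b nb; apply/eqP/negP => yb; apply: h; exists a, b; split=> //.
  exact/negP.
right=> a na; apply/eqP/negP => ya; apply: ha; exists a; split=> //; exact/negP.
Qed.

(** A form in the even and in the odd coordinates has no mixed terms. *)
Lemma phi_orthogonal v v' a b : tau v = v -> tau v' = - v' ->
  phi (a *: v + b *: v') = a ^+ 2 *: phi v + b ^+ 2 *: phi v'.
Proof.
move=> tv tv'; apply/rowP => k; rewrite !mxE.
have hq := iq_homog data k.
have E c : (tnth q k).@[(v + c *: v') 0] =
    (tnth q k).@[v 0] + c * ddir (tnth q k) (v 0) (v' 0) + c ^+ 2 * (tnth q k).@[v' 0].
  rewrite quadric_expand // (dhomog_eval _ _ hq); congr (_ + _ + _).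
  by rewrite /ddir mulr_sumr; apply: eq_bigr => i _; rewrite mxE mulrCA.
have d0 : ddir (tnth q k) (v 0) (v' 0) = 0.
  have tauD : tau (v + 1 *: v') = v + (-1) *: v'.
    have yD c i : y (v + c *: v') i = y v i + c * y v' i.
      by rewrite mulmxDl -scalemxAl mxE [X in _ + X]mxE.
    apply: (y_inj data) => i; rewrite (iq_tau data) !yD mulrDr -(iq_tau data) tv mul1r.
    by rewrite -(iq_tau data) tv' mulNmx [X in _ + X]mxE mulN1r.
  have := iq_inv data k (v + 1 *: v'); rewrite tauD !E => /eqP.
  rewrite -subr_eq0 => /eqP e; apply/eqP.
  have two : (-2 : K) != 0 by rewrite oppr_eq0 pnatr_eq0.
  rewrite -(mulrI_eq0 _ (mulfI two)); apply/eqP; rewrite -[RHS]e; ring.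
have [->|a0] := eqVneq a 0.
  by rewrite expr0n !scale0r add0r mul0r add0r (dhomog_eval _ _ hq).
have -> : a *: v + b *: v' = a *: (v + (b / a) *: v').
  by rewrite scalerDr scalerA mulrC divfK.
by rewrite (dhomog_eval _ _ hq) E d0; field.
Qed.

(** The points a^2 phi v + b^2 phi v' are all the points of the line, as every
    scalar is a square. *)
Lemma associated_orthogonal v v' : V v -> V v' -> tau v = v -> tau v' = - v' ->
  (forall a b, (a != 0) || (b != 0) -> V (a *: v + b *: v')) ->
  associated W (phi v') (phi v).
Proof.
move=> Vv Vv' tv tv' hV; split.
  apply/negP => /(quotient_fibres data Vv' Vv) h.
  have {h} : (v == v')%MS by case: h => //; rewrite tv' => /same_trans; apply; exact: same_opp.
  case/eqrVP => c c0 E; have := hV 1 (- c); rewrite oner_eq0 => /(_ isT).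
  by rewrite scale1r scaleNr -E subrr => -[]; rewrite eqxx.
move=> w w0 /sub_addsmxP[[x1 x2] /= E].
have [b bE] : exists b, x1 0 0 = b ^+ 2 by exists (sqrtC (x1 0 0)); rewrite sqrtCK.
have [a aE] : exists a, x2 0 0 = a ^+ 2 by exists (sqrtC (x2 0 0)); rewrite sqrtCK.
have wE : w = phi (a *: v + b *: v').
  rewrite phi_orthogonal // E addrC [x1]mx11_scalar [x2]mx11_scalar !mul_scalar_mx.
  by rewrite aE bE.
rewrite wE; apply/image_phi/hV; apply: contraNT w0; rewrite negb_or !negbK.
by case/andP => /eqP a0 /eqP b0; rewrite wE phi_orthogonal // a0 b0 !expr0n !scale0r addr0.
Qed.

(** On the line joining the images of two fixed points of the same sign, the
    products of coordinates would form a matrix of rank two. *)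
Lemma not_associated v v' : V v -> V v' ->
  (forall i, neg i -> y v i = 0) -> (forall i, neg i -> y v' i = 0) ->
  ~~ (v == v')%MS -> ~ associated W (phi v) (phi v').
Proof.
move=> Vv Vv' ev ev' ne [nass h].
have s0 : phi v + phi v' != 0.
  apply: contra nass; rewrite addr_eq0 => /eqP ->; apply/eqrVP.
  by exists (-1); rewrite ?oppr_eq0 ?oner_eq0 ?scaleN1r.
have /(imageP data)[u Vu uE] : W (phi v + phi v').
  by apply: h => //; apply: addmx_sub_adds.
have yy a b : ~~ neg a -> ~~ neg b -> y u a * y u b = y v a * y v b + y v' a * y v' b.
  move=> /negPf na /negPf nb; have ab : neg a = neg b by rewrite na nb.
  rewrite -!(iq_lift data ab) // -big_split; apply: eq_bigr => k _ /=.
  by rewrite -!phiE -uE mxE mulrDr.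
have minor a b : y v a * y v' b = y v b * y v' a.
  case na: (neg a); first by rewrite (ev a na) (ev' a na) mul0r mulr0.
  case nb: (neg b); first by rewrite (ev b nb) (ev' b nb) mul0r mulr0.
  have hab : (y v a * y v' b - y v b * y v' a) ^+ 2 = 0.
    have e1 := yy a a (negbT na) (negbT na); have e2 := yy b b (negbT nb) (negbT nb).
    have e3 := yy a b (negbT na) (negbT nb).
    transitivity ((y v a * y v a + y v' a * y v' a) * (y v b * y v b + y v' b * y v' b) -
       (y v a * y v b + y v' a * y v' b) ^+ 2); first by ring.
    by rewrite -e1 -e2 -e3; ring.
  by move/eqP: hab; rewrite sqrf_eq0 subr_eq0 => /eqP.
have [i yi] : exists i, y v i != 0.
  apply: contrapT => hy; case/eqP: (iq_nz data Vv).
  apply: (y_inj data) => i; rewrite mul0mx [RHS]mxE; apply/eqP/negPn/negP => yi.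
  by apply: hy; exists i.
have E : v' = (y v' i / y v i) *: v.
  apply: (y_inj data) => j; rewrite -scalemxAl [RHS]mxE.
  by rewrite mulrAC -mulrA [y v' i * _]mulrC; apply: (mulfI yi); rewrite mulrA minor; field.
case/negP: ne; apply/eqrVP; have c0 : y v' i / y v i != 0.
  by apply: contraNneq (iq_nz data Vv') => c0; rewrite E c0 scale0r.
by exists (y v' i / y v i)^-1; rewrite ?invr_eq0 // {2}E scalerK.
Qed.

Section FivePoints.
Variable v_ : 'I_5 -> 'rV[K]_n.+1.
Hypothesis Vv_ : forall i, V (v_ i).
Hypothesis even_v_ : forall i, i != ord_max -> tau (v_ i) = v_ i.
Hypothesis odd_v_ : tau (v_ ord_max) = - v_ ord_max.
Hypothesis join_v_ : forall i a b, i != ord_max -> (a != 0) || (b != 0) ->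
  V (a *: v_ i + b *: v_ ord_max).
Hypothesis distinct_v_ : forall i j, (v_ i == v_ j)%MS -> i = j.
Hypothesis fixed_v_ : forall v, V v ->
  (forall i, neg i -> y v i = 0) \/ (forall i, ~~ neg i -> y v i = 0) ->
  exists i, (v == v_ i)%MS.
Hypothesis charts : forall v, V v -> (exists i, ~~ neg i /\ y v i != 0) ->
  exists ex i0 i1 i2, chart_ok n tab ex i0 i1 i2 /\ v 0 (inord i0) != 0.
Hypothesis singular_v_ : forall i, singular_point 3 W (phi (v_ i)).

Lemma fixed_v i : (tau (v_ i) == v_ i)%MS.
Proof.
have [->|/even_v_ ->] := eqVneq i ord_max; last exact: same_refl.
by rewrite odd_v_; apply/eqrVP; exists (-1); rewrite ?oppr_eq0 ?oner_eq0 ?scaleN1r.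
Qed.

Lemma phi_same v v' : V v -> (v == v')%MS -> (phi v == phi v')%MS.
Proof.
move=> Vv /eqrVP[c c0 E]; apply/eqrVP; exists (c ^+ 2); first by rewrite expf_neq0.
by rewrite E (phiZ data).
Qed.

Lemma five_points_distinct i j : (phi (v_ i) == phi (v_ j))%MS -> i = j.
Proof.
move/(quotient_fibres data (Vv_ i) (Vv_ j)) => h; apply/esym/distinct_v_.
by case: h => // /same_trans; apply; exact: fixed_v.
Qed.

Lemma five_points_fixed w : singular_point 3 W w <->
  w != 0 /\ exists v, [/\ V v, (tau v == v)%MS & (w == phi v)%MS].
Proof.
split=> [sw|[w0 [v [Vv fv wv]]]].
  have [[w0 _] _] := sw; have /(imageP data)[v Vv wv] := sw.1; split=> //.
  exists v; split=> //; last by rewrite wv; apply/eqrVP; exists 1; rewrite ?oner_eq0 ?scale1r.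
  apply/negPn/negP => /negP nf; have [a [b [na ya nb yb]]] := free_pointP Vv nf.
  have [ex [i0 [i1 [i2 [ok v0]]]]] : exists ex i0 i1 i2, chart_ok n tab ex i0 i1 i2 /\ v 0 (inord i0) != 0.
    by apply: charts => //; exists a.
  by apply: (free_point_smooth Vv na ya nb yb ok v0); rewrite -wv.
have [i /eqrVP[c c0 vi]] := fixed_v_ Vv (proj1 (fixed_pointP Vv) fv).
case/eqrVP: wv => b b0 ->; rewrite vi (phiZ data) scalerA.
apply: singular_scale; first exact: image_scale; last exact: singular_v_.
by rewrite mulf_neq0 // expf_neq0.
Qed.

Lemma five_points_singular w : singular_point 3 W w <->
  w != 0 /\ exists i, (w == phi (v_ i))%MS.
Proof.
rewrite five_points_fixed; split=> -[w0 [v h]]; split=> //; last first.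
  by exists (v_ v); split=> //; exact: fixed_v.
have [Vv fv wv] := h; have [i vi] := fixed_v_ Vv (proj1 (fixed_pointP Vv) fv).
by exists i; apply: same_trans wv _; exact: phi_same.
Qed.

Lemma five_points_associated i : i != ord_max -> associated W (phi (v_ ord_max)) (phi (v_ i)).
Proof.
move=> im; apply: associated_orthogonal => //; first exact: even_v_.
by move=> a b ab; apply: join_v_.
Qed.

Lemma five_points_not_associated i j : i != ord_max -> j != ord_max ->
  ~ associated W (phi (v_ i)) (phi (v_ j)).
Proof.
have ev k : k != ord_max -> forall i, neg i -> y (v_ k) i = 0.
  move=> km i' ni; have := iq_tau data (v_ k) i'; rewrite even_v_ // ni expr1 mulN1r => /eqP.
  by rewrite -subr_eq0 opprK -mulr2n mulrn_eq0 => /eqP.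
move=> im jm; have [->|ij] := eqVneq i j.
  by move=> [/negP ne _]; apply: ne; exact: same_refl.
apply: not_associated => //; [exact: ev | exact: ev|].
by apply: contra ij => /distinct_v_ ->.
Qed.

(** The last point is associated with four points, each other one with at most one. *)
Lemma five_points_not_similar : ~ similar_points 3 W (fun i => phi (v_ i)).
Proof.
move=> [_ _ [m hm]].
have m4 : m = 4%N.
  have [A <- hA] := hm ord_max.
  have -> : A = [set~ ord_max].
    apply/setP => j; rewrite !inE; apply/idP/idP => [/hA[ne _]|jm].
      by apply: contraNneq ne => ->; apply/eqrVP; exists 1; rewrite ?oner_eq0 ?scale1r.
    by apply/hA; apply: five_points_associated.
  by rewrite cardsC1 card_ord.
have [A mA hA] := hm ord0.
have : A \subset [set ord_max].
  apply/fintype.subsetP => j /hA aj; rewrite inE; apply/negPn/negP => jm.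
  exact: (five_points_not_associated _ jm aj).
by move/subset_leq_card; rewrite mA m4 cards1.
Qed.

Theorem five_points (C : ('I_5 -> 'rV[K]_p.+1) -> Prop) : C (fun i => phi (v_ i)) ->
  quotient_embedding V tau q /\ generated_by_quadrics (vanishing_ideal W) /\
  exists P : 'I_5 -> 'rV[K]_p.+1,
    (forall i j, (P i == P j)%MS -> i = j) /\
    (forall w, singular_point 3 W w <-> w != 0 /\ exists i, (w == P i)%MS) /\
    (forall w, singular_point 3 W w <->
       w != 0 /\ exists v, [/\ V v, (tau v == v)%MS & (w == phi v)%MS]) /\
    ~ similar_points 3 W P /\
    (forall i, i != ord_max -> associated W (P ord_max) (P i)) /\
    (forall i j, i != ord_max -> j != ord_max -> ~ associated W (P i) (P j)) /\ C P.
Proof.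
move=> CP; split; first exact: (quotient_is_embedding data).
split; first exact: (quotient_ideal_quadrics data).
exists (fun i => phi (v_ i)); split; first exact: five_points_distinct.
split; first exact: five_points_singular.
split; first exact: five_points_fixed.
split; first exact: five_points_not_similar.
split; first exact: five_points_associated.
by split=> // i j; apply: five_points_not_associated.
Qed.

End FivePoints.

End ToricQuotient.

(** * Computations with lattice points *)

Lemma allnP n (P : nat -> bool) i : all P (iota 0 n) -> (i < n)%N -> P i.
Proof. by move=> /allP h hi; apply: h; rewrite mem_iota. Qed.

Fixpoint bitseqs (n : nat) : seq (seq bool) :=
  if n is n'.+1 then [seq b :: s | b <- [:: true; false], s <- bitseqs n'] else [:: [::]].

Lemma mem_bitseqs (s : seq bool) : s \in bitseqs (size s).
Proof.
by elim: s => [//|b s IH]; apply/allpairsP; exists (b, s); split=> //; case: b.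
Qed.

(** The standard pairs are the edges of a triangulation by the [cells], if each
    set of lattice points without a nonstandard pair is contained in a cell. *)
Definition cells_ok (n : nat) (std : nat -> nat -> bool) (cells : seq (seq nat)) : bool :=
  all (fun s => all (fun i => all (fun j =>
         std i j || nth false s i || nth false s j) (iota 0 n)) (iota 0 n) ==>
       has (fun c => all (fun k => (k \in c) || nth false s k) (iota 0 n)) cells) (bitseqs n).

Lemma std_cell n std cells (f : nat -> nat) : cells_ok n std cells ->
  std_monomial n std f ->
  exists2 c, c \in cells & all (fun k => (k \in c) || (f k == 0)%N) (iota 0 n).
Proof.
move=> /allP ok hf; pose s := [seq f k == 0%N | k <- iota 0 n].
have sE k : (k < n)%N -> nth false s k = (f k == 0%N).
  by move=> kn; rewrite (nth_map 0%N) ?size_iota // nth_iota.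
have : s \in bitseqs n by have := mem_bitseqs s; rewrite size_map size_iota.
move/ok/implyP => /(_ _)/hasP[|c cc hc]; last first.
  exists c => //; apply/allP => k; rewrite mem_iota /= add0n => kn.
  by rewrite -sE //; apply: (allP hc); rewrite mem_iota.
apply/allP => i; rewrite mem_iota /= add0n => ni; apply/allP => j; rewrite mem_iota /= add0n => nj.
rewrite !sE //; have [//|/(hf _ _ (ltnW ni) (ltnW nj)) [->|->]] := boolP (std i j).
  by rewrite eqxx.
by rewrite eqxx orbT.
Qed.

Section ToricLists.
Variables (K : numClosedFieldType) (n : nat) (tab : seq (nat * nat)).

Lemma monomial_weightE (mm : 'X_{1..n.+1}) k : (k < 4)%N ->
  monomial_weight tab mm (inord k) =
  \sum_(i <- iota 0 n.+1) point_weight n tab i k * exponents mm i.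
Proof.
move=> k4; rewrite /monomial_weight mnm_sumE.
have -> : iota 0 n.+1 = index_iota 0 n.+1 by rewrite /index_iota subn0.
rewrite big_mkord; apply: eq_bigr => i _.
by rewrite mulmnE mnmE inordK // /exponents inord_val.
Qed.

Lemma exponents_inj (mm mm' : 'X_{1..n.+1}) :
  all (fun k => exponents mm k == exponents mm' k) (iota 0 n.+1) -> mm = mm'.
Proof.
move=> h; apply/mnmP => i; have /eqP := allnP h (ltn_ord i).
by rewrite /exponents inord_val.
Qed.

Definition list_weight (s : seq nat) : seq nat :=
  [seq sumn [seq point_weight n tab k i | k <- s] | i <- iota 0 4].

Variables (std : nat -> nat -> bool) (mu : nat -> nat).
Hypothesis red : reduction_ok n tab std mu.
Hypothesis std_uniq : forall mm mm' : 'X_{1..n.+1},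
  std_monomial n std (exponents mm) -> std_monomial n std (exponents mm') ->
  monomial_weight tab mm = monomial_weight tab mm' -> mm = mm'.

(** Products of coordinates of any degree are reduced to standard monomials, which
    are determined by their weight. *)
Lemma toric_products (v : 'rV[K]_n.+1) (s s' : seq nat) : toric_cone tab v ->
  all (fun k => k <= n)%N s -> all (fun k => k <= n)%N s' ->
  list_weight s = list_weight s' ->
  \prod_(k <- s) v 0 (inord k) = \prod_(k <- s') v 0 (inord k).
Proof.
move=> Vv sn sn' E.
pose mon (s : seq nat) : 'X_{1..n.+1} := (\sum_(k <- s) U_(inord k))%MM.
have monE t : ('X_[mon t] : {mpoly K[n.+1]}).@[v 0] = \prod_(k <- t) v 0 (inord k).
  elim: t => [|k t IH]; first by rewrite /mon !big_nil mpolyX0 meval1.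
  by rewrite /mon !big_cons mpolyXD mevalM mevalXU -/(mon t) IH.
have wE t : all (fun k => k <= n)%N t -> forall i, (i < 4)%N ->
    monomial_weight tab (mon t) (inord i) = nth 0%N (list_weight t) i.
  move=> ht i i4; rewrite (nth_map 0%N) ?size_iota // nth_iota // add0n.
  elim: t ht => [_|k t IH /= /andP[kn ht]].
    by rewrite /mon big_nil /monomial_weight mnm_sumE big1 // => j _; rewrite mnm0E mulm0n mnm0E.
  rewrite /mon big_cons monomial_weightD monomial_weight1 mnmDE -/(mon t) IH //.
  by rewrite mnmE !inordK.
have wEq : monomial_weight tab (mon s) = monomial_weight tab (mon s').
  apply/mnmP => i; by rewrite -(inord_val i) !wE ?E.
have [m1 [st1 [w1 D1]]] := std_reduction K red (mon s).
have [m2 [st2 [w2 D2]]] := std_reduction K red (mon s').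
have mE : m1 = m2 by apply: std_uniq => //; rewrite w1 w2.
have D0 F : ideal_gen (fun Q => Q \is 2.-homog /\ vanishing_ideal (toric_cone tab) Q) F ->
    F.@[v 0] = 0.
  apply: (ideal_gen_min (J := fun F => F.@[v 0] = 0)) => [|F1 F2 h1 h2|F1 F2 h|F1 [_ h]].
  - by rewrite meval0.
  - by rewrite mevalD h1 h2 addr0.
  - by rewrite mevalM h mulr0.
  exact: h.
rewrite -!monE; apply/eqP; rewrite -subr_eq0; apply/eqP.
have := D0 _ D1; have := D0 _ D2; rewrite !mevalB mE => /eqP h1 /eqP h2.
by move: h1 h2; rewrite !subr_eq0 => /eqP -> /eqP ->; rewrite subrr.
Qed.

End ToricLists.

(** ** Quadrics given by lists *)

Section QuadricLists.
Variables (K : numClosedFieldType) (n : nat).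

Definition quadric_of (s : seq (K * (nat * nat))) : {mpoly K[n.+1]} :=
  \sum_(t <- s) t.1 *: ('X_(inord t.2.1) * 'X_(inord t.2.2)).

Lemma quadric_of_homog s : quadric_of s \is 2.-homog.
Proof.
by apply: rpred_sum => t _; rewrite rpredZ // -mpolyXD dhomogX /= mdegD !mdeg1.
Qed.

Lemma quadric_of_eval s (v : 'I_n.+1 -> K) :
  (quadric_of s).@[v] = \sum_(t <- s) t.1 * (v (inord t.2.1) * v (inord t.2.2)).
Proof.
by rewrite raddf_sum; apply: eq_bigr => t _; rewrite /= mevalZ mevalM !mevalXU.
Qed.

Lemma ddir_quadric_of s (v u : 'I_n.+1 -> K) :
  ddir (quadric_of s) v u = \sum_(t <- s) t.1 *
    (u (inord t.2.1) * v (inord t.2.2) + v (inord t.2.1) * u (inord t.2.2)).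
Proof.
elim: s => [|t s IH]; first by rewrite /quadric_of !big_nil ddir0.
by rewrite /quadric_of !big_cons ddirD ddirZ ddirM !ddirX !mevalXU -/(quadric_of s) IH.
Qed.

End QuadricLists.

Definition all4 n (P : nat -> nat -> nat -> nat -> bool) : bool :=
  all (fun i => all (fun j => all (fun k => all (P i j k) (iota 0 n)) (iota 0 n))
    (iota 0 n)) (iota 0 n).

Lemma all4P n (P : nat -> nat -> nat -> nat -> bool) (i j k m : 'I_n) : all4 n P -> P i j k m.
Proof.
have h (x : 'I_n) : (x : nat) \in iota 0 n by rewrite mem_iota /= add0n.
by move=> /allP/(_ _ (h i))/allP/(_ _ (h j))/allP/(_ _ (h k))/allP/(_ _ (h m)).
Qed.

Definition all2 n (P : nat -> nat -> bool) : bool :=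
  all (fun i => all (P i) (iota 0 n)) (iota 0 n).

Lemma all2P n (P : nat -> nat -> bool) i j : all2 n P -> (i < n)%N -> (j < n)%N -> P i j.
Proof.
by move=> h hi hj; exact: (allnP (allnP h hi) hj).
Qed.

(** ** Independence of quadrics on a cone *)

Section Independence.
Variables (K : numClosedFieldType) (n p : nat) (tab ex : seq (nat * nat)) (i0 i1 i2 : nat).
Hypothesis ok : chart_ok n tab ex i0 i1 i2.
Variables (q : p.+1.-tuple {mpoly K[n.+1]}) (terms : nat -> seq (bool * (nat * nat))).
Hypothesis qE : forall k (v : 'rV[K]_n.+1), (k < p.+1)%N -> (tnth q (inord k)).@[v 0] =
  \sum_(t <- terms k) (-1) ^+ t.1 * (v 0 (inord t.2.1) * v 0 (inord t.2.2)).

Definition term_weight (t : bool * (nat * nat)) : seq nat :=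
  let e k := nth (0, 0)%N ex k in
  [:: (e t.2.1).1 + (e t.2.2).1; (e t.2.1).2 + (e t.2.2).2; (n <= t.2.1) + (n <= t.2.2)]%N.

Definition separated : bool :=
  let hd k := head (false, (0, 0)%N) (terms k) in
  all2 p.+1 (fun k k' => [seq t <- terms k' | term_weight t == term_weight (hd k)] ==
    if k == k' then [:: (false, (hd k).2)] else [::]) &&
  all (fun k => all (fun t => (t.2.1 <= n)%N && (t.2.2 <= n)%N) (terms k)) (iota 0 p.+1).

(** The monomials of weight equal to that of the first term of a quadric occur in no
    other quadric, and monomials of distinct weights are independent on the cone. *)
Lemma quadrics_independent (c : 'rV[K]_p.+1) : separated ->
  (forall v, toric_cone tab v -> \sum_k c 0 k * (tnth q k).@[v 0] = 0) -> c = 0.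
Proof.
move=> /andP[sep bound] h.
pose m (t : bool * (nat * nat)) : 'X_{1..3} := [multinom nth 0%N (term_weight t) i | i < 3].
have mE t t' : (m t == m t') = (term_weight t == term_weight t').
  apply/eqP/eqP => [/mnmP E|E]; last by rewrite /m E.
  by apply: (@eq_from_nth _ 0%N) => // i hi; have := E (Ordinal (hi : (i < 3)%N)); rewrite !mnmE.
have F0 : \sum_(k < p.+1) c 0 k *: \sum_(t <- terms k) (-1) ^+ t.1 *: 'X_[m t] = 0 :> {mpoly K[3]}.
  apply: mpoly_eval_eq0 => x; pose X i := x 0 (inord i).
  pose v : 'rV[K]_n.+1 := \row_k chart_coord n ex 1 (X 0%N) (X 1%N) (X 2%N) k.
  have Vv : toric_cone tab v.
    have [_ [l0 _ _] [e0 _ _] _ _] := chart_okP ok.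
    split; last by move=> i j i' j' /(chart_coord_relations ok) h'; rewrite !mxE h'.
    apply: contraTneq isT => E; have := congr1 (fun u : 'rV[K]_n.+1 => u 0 (inord i0)) E.
    by rewrite !mxE inordK 1?ltnW // /chart_coord l0 e0 !expr0 !mulr1 => /eqP; rewrite oner_eq0.
  rewrite -[RHS](h v Vv) raddf_sum; apply: eq_bigr => k _.
  rewrite /= mevalZ; congr (_ * _); rewrite -(inord_val k) qE // inord_val raddf_sum.
  rewrite big_seq [RHS]big_seq; apply: eq_bigr => t tk.
  have /andP[t1 t2] := allP (allnP bound (ltn_ord k)) _ tk.
  rewrite /= mevalZ mevalX !mxE !inordK // !(chart_coordE ok) !expr1n !mul1r; congr (_ * _).
  rewrite !big_ord_recl big_ord0 mulr1 !mnmE /= -/(X _).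
  have e i : x 0 i = X i by rewrite /X inord_val.
  by rewrite !e /= !exprD; ring.
apply/rowP => k; rewrite mxE; have := congr1 (mcoeff (m (head (false, (0, 0)%N) (terms k)))) F0.
rewrite raddf_sum mcoeff0 => E; rewrite -[RHS]E (bigD1 k) //=.
have coef k' : (\sum_(t <- terms k') (-1) ^+ t.1 *: 'X_[m t] : {mpoly K[3]})@_(m (head (false, (0, 0)%N) (terms k))) =
    \sum_(t <- [seq t <- terms k' | term_weight t == term_weight (head (false, (0, 0)%N) (terms k))]) (-1) ^+ t.1.
  rewrite raddf_sum [RHS]big_filter [RHS]big_mkcond; apply: eq_bigr => t _.
  by rewrite /= mcoeffZ mcoeffX mE; case: eqP; rewrite ?mulr1 ?mulr0.
rewrite mcoeffZ coef (eqP (all2P sep (ltn_ord k) (ltn_ord k))) eqxx big_seq1 mulr1.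
rewrite big1 ?addr0 // => k' kk'; rewrite mcoeffZ coef (eqP (all2P sep (ltn_ord k) (ltn_ord k'))).
by rewrite eq_sym (negPf (kk' : (k' : nat) != k)) big_nil mulr0.
Qed.

End Independence.

(** * The cone over the image of the product of two lines *)

Definition tab17 : seq (nat * nat) :=
  [:: (0, 0); (0, 1); (0, 2); (1, 0); (1, 1); (1, 2); (2, 0); (2, 1); (2, 2)]%N.

Definition pt17 k := nth (0, 0)%N tab17 k.

(** The triangulation of the square with all its diagonals in one direction. *)
Definition std17 (i j : nat) : bool :=
  let p := pt17 i in let p' := pt17 j in
  [|| (9 <= i)%N, (9 <= j)%N,
     [&& (p.1 <= p'.1 <= p.1.+1)%N & (p.2 <= p'.2 <= p.2.+1)%N] |
     [&& (p'.1 <= p.1 <= p'.1.+1)%N & (p'.2 <= p.2 <= p'.2.+1)%N]].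

Definition mu17 k := let p := pt17 k in
  (p.1 ^ 2 + p.2 ^ 2 + (maxn p.1 p.2 - minn p.1 p.2) ^ 2)%N.

Definition cells17 : seq (seq nat) :=
  [:: [:: 0; 1; 4]; [:: 0; 3; 4]; [:: 1; 2; 5]; [:: 1; 4; 5];
      [:: 3; 4; 7]; [:: 3; 6; 7]; [:: 4; 5; 8]; [:: 4; 7; 8]]%N.

Lemma red17 : reduction_ok 9 tab17 std17 mu17.
Proof. by vm_compute. Qed.

Lemma cells17_ok : cells_ok 9 std17 cells17.
Proof. by vm_compute. Qed.

Lemma std_uniq17 (mm mm' : 'X_{1..10}) :
  std_monomial 9 std17 (exponents (n := 9) mm) -> std_monomial 9 std17 (exponents (n := 9) mm') ->
  monomial_weight tab17 mm = monomial_weight tab17 mm' -> mm = mm'.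
Proof.
move=> /(std_cell cells17_ok)[c cc hc] /(std_cell cells17_ok)[c' cc' hc'] E.
have {}E k (k4 : (k < 4)%N) := congr1 (fun m : 'X_{1..4} => m (inord k)) E.
have := E 0%N isT; have := E 1%N isT; have := E 2%N isT; have := E 3%N isT.
rewrite !monomial_weightE //= !big_cons !big_nil /point_weight /=.
move=> E3 E2 E1 E0; apply: exponents_inj; move: hc hc' E0 E1 E2 E3.
move: (exponents (n := 9) mm) (exponents (n := 9) mm') => f g /=.
move: (f 0%N) (f 1%N) (f 2%N) (f 3%N) (f 4%N) (f 5%N) (f 6%N) (f 7%N) (f 8%N) (f 9%N).
move: (g 0%N) (g 1%N) (g 2%N) (g 3%N) (g 4%N) (g 5%N) (g 6%N) (g 7%N) (g 8%N) (g 9%N).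
move: cc cc'; rewrite !inE => cc cc'.
repeat match goal with H : is_true (_ || _) |- _ => move/orP: H => [H|H] end;
  rewrite (eqP cc) (eqP cc') /=; lia.
Qed.

(** ** Coordinate subspaces *)

Section CoordinateSubspace.
Variables (K : numClosedFieldType) (r p : nat) (idx : seq nat).
Hypotheses (sz : size idx = r.+1) (un : uniq idx) (bd : all (fun k => k < p.+1)%N idx).

Definition coord_mx : 'M[K]_(r.+1, p.+1) := \matrix_(i, k) ((k : nat) == nth 0%N idx i)%:R.

Lemma coord_proj (z : 'rV[K]_p.+1) i : (z *m coord_mx^T) 0 i = z 0 (inord (nth 0%N idx i)).
Proof.
have ib : (nth 0%N idx i < p.+1)%N by apply: (allP bd); rewrite mem_nth ?sz.
rewrite mxE (bigD1 (inord (nth 0%N idx i))) //= !mxE inordK // eqxx mulr1 big1 ?addr0 // => k ki.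
rewrite !mxE; case: eqP => [E|_]; last by rewrite mulr0.
by case/eqP: ki; apply/val_inj; rewrite /= inordK.
Qed.

Lemma coord_in (s : 'rV[K]_r.+1) i : (i < r.+1)%N ->
  (s *m coord_mx) 0 (inord (nth 0%N idx i)) = s 0 (inord i).
Proof.
move=> ir; have ib : (nth 0%N idx i < p.+1)%N by apply: (allP bd); rewrite mem_nth ?sz.
rewrite mxE (bigD1 (inord i)) //= mxE !inordK // eqxx mulr1 big1 ?addr0 // => j ji.
rewrite mxE inordK // nth_uniq ?sz // eq_sym; case: eqP => [E|_]; last by rewrite mulr0.
by case/eqP: ji; apply/val_inj; rewrite /= inordK.
Qed.

Lemma coord_out (s : 'rV[K]_r.+1) k : (k < p.+1)%N -> k \notin idx ->
  (s *m coord_mx) 0 (inord k) = 0.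
Proof.
move=> kp kn; rewrite mxE big1 // => i _; rewrite mxE inordK //.
case: eqP => [E|_]; last by rewrite mulr0.
by case/negP: kn; rewrite E mem_nth ?sz.
Qed.

Lemma coord_left : coord_mx *m coord_mx^T = 1%:M.
Proof.
apply/row_matrixP => i; rewrite row_mul row1; apply/rowP => j.
rewrite coord_proj [row _ _ _ _]mxE mxE inordK; last by apply: (allP bd); rewrite mem_nth ?sz.
by rewrite mxE eqxx /= nth_uniq ?sz // eq_sym.
Qed.

Lemma coord_delta w : (w < p.+1)%N -> w \notin idx ->
  (delta_mx 0 (inord w) : 'rV[K]_p.+1) *m coord_mx^T = 0.
Proof.
move=> wp wn; apply/rowP => i; rewrite coord_proj [RHS]mxE mxE eqxx /=.
rewrite -val_eqE /= !inordK //; last by apply: (allP bd); rewrite mem_nth ?sz.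
by case: eqP => // E; case/negP: wn; rewrite -E mem_nth ?sz.
Qed.

End CoordinateSubspace.

Lemma coord_mx2 (K : numClosedFieldType) p a b (x : 'rV[K]_2) k :
  (a < p.+1)%N -> (b < p.+1)%N -> (a != b) -> (k < p.+1)%N ->
  (x *m coord_mx K 1 p [:: a; b]) 0 (inord k) =
  if k == a then x 0 (inord 0) else if k == b then x 0 (inord 1) else 0.
Proof.
move=> ha hb ab hk.
have un : uniq [:: a; b] by rewrite /= inE ab.
have bd : all (fun k => k < p.+1)%N [:: a; b] by rewrite /= ha hb.
case: eqP => [->|ka]; first exact: (@coord_in K 1 p [:: a; b] erefl un bd x 0%N isT).
case: eqP => [->|kb]; first exact: (@coord_in K 1 p [:: a; b] erefl un bd x 1%N isT).
by rewrite (@coord_out K 1 p [:: a; b] erefl) // !inE; apply/negP => /orP[]/eqP.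
Qed.

Lemma pivot_delta (K : numClosedFieldType) p (i : 'I_p.+1) :
  pivot (delta_mx 0 i : 'rV[K]_p.+1) = i.
Proof.
rewrite /pivot; case: pickP => [j|/(_ i)]; rewrite mxE eqxx /=; last by rewrite eqxx oner_eq0.
by have [->|_] := eqVneq j i; rewrite // mulr0n eqxx.
Qed.

Lemma forall_ord n (P : 'I_n.+1 -> Prop) :
  (forall k, (k < n.+1)%N -> P (inord k)) -> forall k, P k.
Proof. by move=> h k; rewrite -(inord_val k); apply: h. Qed.

Definition veronese_pairs : seq (nat * nat) :=
  [:: (0, 0); (0, 1); (0, 2); (1, 1); (1, 2); (2, 2)]%N.

Lemma veronese_pairsE (K : numClosedFieldType) (t : 'rV[K]_3) r : (r < 6)%N ->
  veronese t 0 (inord r) = t 0 (inord (nth (0, 0)%N veronese_pairs r).1) *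
                           t 0 (inord (nth (0, 0)%N veronese_pairs r).2).
Proof.
move=> hr; rewrite mxE inordK //.
by do 6![case: r hr => [_|r hr]; first by rewrite /= /entry ?expr2].
Qed.

(** * The case of genus 17 *)

Section Genus17.
Variable K : numClosedFieldType.
Local Notation V := (@toric_cone K 9 tab17).

Definition pairs17 : seq (nat * nat) :=
  [:: (4, 4); (0, 0); (2, 2); (6, 6); (8, 8); (9, 9); (1, 1); (3, 3); (5, 5); (7, 7);
      (1, 9); (3, 9); (5, 9); (7, 9); (0, 4); (2, 4); (6, 4); (8, 4)]%N.

Definition pair17 k := nth (0, 0)%N pairs17 k.

Lemma quadrics17E k : (k < 18)%N ->
  tnth (quadrics17 K) (inord k) = 'X_(inord (pair17 k).1) * 'X_(inord (pair17 k).2).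
Proof.
move=> hk; rewrite (tnth_nth 0) inordK //.
by do 18![case: k hk => [_|k hk]; first by rewrite /= /y17 ?expr2].
Qed.

(** The first invariant quadric with the same restriction to the cone. *)
Definition lift17 (a b : nat) : nat :=
  find (fun k => same_weight 9 tab17 a b (pair17 k).1 (pair17 k).2) (iota 0 18).

Lemma pair17_lt k : ((pair17 k).1 < 10)%N /\ ((pair17 k).2 < 10)%N.
Proof.
have [hk|hk] := ltnP k 18; last by rewrite /pair17 nth_default.
by apply/andP; exact: (@allnP 18 (fun k => ((pair17 k).1 < 10) && ((pair17 k).2 < 10))%N k isT hk).
Qed.

Lemma pair17_parity k : odd (pair17 k).1 = odd (pair17 k).2.
Proof.
have [hk|hk] := ltnP k 18; last by rewrite /pair17 nth_default.
by apply/eqP; exact: (@allnP 18 (fun k => odd (pair17 k).1 == odd (pair17 k).2) k isT hk).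
Qed.

Lemma lift17P a b : (a < 10)%N -> (b < 10)%N -> odd a = odd b ->
  (lift17 a b < 18)%N /\
  same_weight 9 tab17 a b (pair17 (lift17 a b)).1 (pair17 (lift17 a b)).2.
Proof.
move=> ha hb /eqP ab; have : has (fun k => same_weight 9 tab17 a b (pair17 k).1 (pair17 k).2) (iota 0 18).
  have ok : all2 10 (fun a b => (odd a == odd b) ==>
    has (fun k => same_weight 9 tab17 a b (pair17 k).1 (pair17 k).2) (iota 0 18)) by vm_compute.
  by have := all2P ok ha hb; rewrite ab.
move=> h; have := nth_find 0%N h; have := h; rewrite has_find size_iota => lt.
by rewrite -/(lift17 a b) in lt *; rewrite nth_iota.
Qed.

Lemma quadric17_value k (v : 'rV[K]_10) : (k < 18)%N ->
  (tnth (quadrics17 K) (inord k)).@[v 0] =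
  v 0 (inord (pair17 k).1) * v 0 (inord (pair17 k).2).
Proof. by move=> hk; rewrite quadrics17E // mevalM !mevalXU. Qed.

Lemma lift17_value a b (v : 'rV[K]_10) : V v -> (a < 10)%N -> (b < 10)%N -> odd a = odd b ->
  v 0 (inord (pair17 (lift17 a b)).1) * v 0 (inord (pair17 (lift17 a b)).2) =
  v 0 (inord a) * v 0 (inord b).
Proof.
move=> [_ vr] ha hb ab; have [_ h] := lift17P ha hb ab.
by symmetry; apply: vr; rewrite !inordK ?(pair17_lt _).1 ?(pair17_lt _).2.
Qed.

Lemma tau17E (v : 'rV[K]_10) i : tau17 v 0 i = (-1) ^+ odd i * v 0 i.
Proof.
rewrite mxE; case: i => [[|[|[|[|[|[|[|[|[|[|i]]]]]]]]]] hi] //=;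
  by rewrite -signr_odd /= ?expr0 ?expr1 ?mul1r ?mulN1r.
Qed.

Lemma weight17_parity (i j i' j' : 'I_10) : same_weight 9 tab17 i j i' j' ->
  odd i (+) odd j = odd i' (+) odd j'.
Proof.
have ok : all4 10 (fun i j i' j' => same_weight 9 tab17 i j i' j' ==>
  (odd i (+) odd j == odd i' (+) odd j')) by vm_compute.
by move=> h; have := all4P i j i' j' ok; rewrite h => /eqP.
Qed.

Definition lift_row17 (a b : 'I_10) : 'rV[K]_18 := delta_mx 0 (inord (lift17 a b)).

Lemma lift_row17_value (a b : 'I_10) (v : 'rV[K]_10) : odd a = odd b -> V v ->
  \sum_k lift_row17 a b 0 k * (tnth (quadrics17 K) k).@[v 0] = v 0 a * v 0 b.
Proof.
move=> ab Vv; have [h18 _] := lift17P (ltn_ord a) (ltn_ord b) ab.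
rewrite (bigD1 (inord (lift17 a b))) //= mxE !eqxx mul1r quadric17_value //.
rewrite lift17_value // !inord_val big1 ?addr0 // => k ki.
by rewrite mxE (negPf ki) andbF mul0r.
Qed.

Lemma quadrics17_independent (c : 'rV[K]_18) :
  (forall v, V v -> \sum_k c 0 k * (tnth (quadrics17 K) k).@[v 0] = 0) -> c = 0.
Proof.
have ok : chart_ok 9 tab17 tab17 0 3 1 by vm_compute.
apply: (quadrics_independent ok (terms := fun k => [:: (false, pair17 k)])).
  by move=> k v hk; rewrite quadric17_value // big_seq1 mul1r.
by vm_compute.
Qed.

Lemma data17 : invariant_quadrics V (@tau17 K) (quadrics17 K) 1%:M (fun i => odd i) lift_row17.
Proof.
split.
- exact: unitmx1.
- by move=> v [].
- exact: toric_scale.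
- exact: toric_closed.
- by move=> F; apply: (toric_ideal _ red17 std_uniq17).
- by move=> v i; rewrite !mulmx1 tau17E.
- move=> v [v0 vr]; split.
    apply: contra_neq v0 => E; apply/rowP => i; have := congr1 (fun u : 'rV[K]_10 => u 0 i) E.
    by rewrite tau17E !mxE => /eqP; rewrite mulf_eq0 signr_eq0 => /eqP.
  move=> i j i' j' h; rewrite !tau17E mulrACA [RHS]mulrACA -!signr_addb (vr _ _ _ _ h).
  by rewrite (weight17_parity h).
- by apply: forall_ord => k hk; rewrite quadrics17E // -mpolyXD dhomogX /= mdegD !mdeg1.
- apply: forall_ord => k hk v; rewrite !quadric17_value // !tau17E mulrACA -signr_addb.
  rewrite !inordK ?(pair17_lt k).1 ?(pair17_lt k).2 // pair17_parity.
  by rewrite addbb mul1r.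
- by move=> a b ab v Vv; rewrite !mulmx1; apply: lift_row17_value.
exact: quadrics17_independent.
Qed.

End Genus17.

(** ** Points and equations of the threefold *)

Section Genus17Points.
Variable K : numClosedFieldType.
Local Notation V := (@toric_cone K 9 tab17).
Local Notation q := (quadrics17 K).
Local Notation phi := (poly_map q).
Local Notation W := (image_of V q).

Lemma phi17E (v : 'rV[K]_10) k : (k < 18)%N ->
  phi v 0 (inord k) = v 0 (inord (pair17 k).1) * v 0 (inord (pair17 k).2).
Proof. by move=> hk; rewrite phiE quadric17_value. Qed.

Lemma pair17_le k : all (fun i => i <= 9)%N [:: (pair17 k).1; (pair17 k).2].
Proof.
have [hk|hk] := ltnP k 18; last by rewrite /pair17 nth_default.
exact: (@allnP 18 (fun k => all (fun i => i <= 9)%N [:: (pair17 k).1; (pair17 k).2]) k isT hk).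
Qed.

Definition pair_list (s : seq nat) : seq nat :=
  flatten [seq [:: (pair17 k).1; (pair17 k).2] | k <- s].

(** Products of coordinates agree on the threefold if they have the same weight
    on the cone. *)
Definition same_product17 (a b c d : nat) : bool :=
  list_weight 9 tab17 (pair_list [:: a; b]) == list_weight 9 tab17 (pair_list [:: c; d]).

Definition binomial17 (a b c d : nat) : {mpoly K[18]} :=
  quadric_of 17 [:: (1, (a, b)); (-1, (c, d))].

Lemma binomial17_eval a b c d (z : 'rV[K]_18) : (binomial17 a b c d).@[z 0] =
  z 0 (inord a) * z 0 (inord b) - z 0 (inord c) * z 0 (inord d).
Proof. by rewrite quadric_of_eval !big_cons big_nil addr0 /= mul1r mulN1r. Qed.

Lemma binomial17_vanish a b c d : all (fun k => k < 18)%N [:: a; b; c; d] ->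
  same_product17 a b c d -> vanishing_ideal W (binomial17 a b c d).
Proof.
move=> /and5P[ha hb hc hd _] /eqP E; apply/(vanishingP (data17 K)) => v Vv.
rewrite binomial17_eval !phi17E //; apply/eqP; rewrite subr_eq0; apply/eqP.
have ok x y : all (fun k => k <= 9)%N (pair_list [:: x; y]).
  rewrite -[pair_list _]/([:: (pair17 x).1; (pair17 x).2] ++ [:: (pair17 y).1; (pair17 y).2]).
  by rewrite all_cat !pair17_le.
have := toric_products red17 std_uniq17 Vv (ok a b) (ok c d) E.
by rewrite !big_cons !big_nil !mulr1 !mulrA.
Qed.

Lemma binomial17_linear a b c d w (u : 'rV[K]_18) : (w < 18)%N ->
  all (fun k => k < 18)%N [:: a; b; c; d] -> u 0 (inord w) = 0 ->
  ddir (binomial17 a b c d) ((delta_mx 0 (inord w) : 'rV_18) 0) (u 0) =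
  (b == w)%:R * u 0 (inord a) + (a == w)%:R * u 0 (inord b) -
  ((d == w)%:R * u 0 (inord c) + (c == w)%:R * u 0 (inord d)).
Proof.
move=> hw /and5P[ha hb hc hd _] uw.
rewrite ddir_quadric_of !big_cons big_nil addr0 /= mul1r mulN1r !mxE !eqxx /=.
rewrite -!val_eqE /= !inordK //.
by rewrite !(mulrC (u 0 _)).
Qed.

Section AdaptedPoint.
Variables (r w : nat) (idx : seq nat).
Hypotheses (sz : size idx = r.+1) (un : uniq idx) (bd : all (fun k => k < 18)%N idx).
Hypotheses (hw : (w < 18)%N) (wn : w \notin idx).

(** Each coordinate outside the list is, up to quadratic terms, a product of
    two others. *)
Definition adapted_ok : bool :=
  all (fun k => [|| k \in idx, k == w |
    has (fun a => has (fun b => [&& a != w, b != w & same_product17 k w a b])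
      (iota 0 18)) (iota 0 18)]) (iota 0 18).

Hypothesis ok : adapted_ok.

Lemma adapted17 k : exists Q, [/\ Q \is 2.-homog, vanishing_ideal W Q &
  forall u : 'rV[K]_18, u 0 (pivot (delta_mx 0 (inord w) : 'rV[K]_18)) = 0 ->
    ddir Q ((delta_mx 0 (inord w) : 'rV[K]_18) 0) (u 0) =
    u 0 k - (u *m (coord_mx K r 17 idx)^T *m coord_mx K r 17 idx) 0 k].
Proof.
move: k; apply: forall_ord => k hk; rewrite pivot_delta.
have [kin|kn] := boolP (k \in idx).
  exists 0; split; [exact: rpred0 | by move=> z _; rewrite meval0 |] => u _.
  have ki : (index k idx < r.+1)%N by rewrite -sz index_mem.
  have := coord_in sz un bd (u *m (coord_mx K r 17 idx)^T) ki.
  by rewrite nth_index // => ->; rewrite coord_proj // inordK // nth_index // subrr ddir0.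
have E (u : 'rV[K]_18) : (u *m (coord_mx K r 17 idx)^T *m coord_mx K r 17 idx) 0 (inord k) = 0 by rewrite (coord_out sz).
have [-> {hk}|kw] := eqVneq k w.
  exists 0; split; [exact: rpred0 | by move=> z _; rewrite meval0 |] => u uw.
  by rewrite (coord_out sz) // uw subr0 ddir0.
have := allnP ok hk; rewrite (negPf kn) (negPf kw) !orFb.
case/hasP => a; rewrite mem_iota add0n => /andP[_ ha] /hasP[b]; rewrite mem_iota add0n => /andP[_ hb] /and3P[aw bw E'].
exists (binomial17 k w a b); split; [exact: quadric_of_homog | |move=> u uw].
  by apply: binomial17_vanish => //=; rewrite hk hw ha hb.
rewrite binomial17_linear //=; last by rewrite hk hw ha hb.
by rewrite eqxx (negPf kw) (negPf aw) (negPf bw) E !mul0r mul1r !addr0 subr0.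
Qed.

End AdaptedPoint.

(** A one-parameter subgroup moves a point of the cone along monomial arcs. *)
Lemma monomial_arc17 (v : 'rV[K]_10) (dg : nat -> nat) e (w T : 'rV[K]_18) :
  toric_relations tab17 (v 0) ->
  all4 10 (fun i j i' j' => same_weight 9 tab17 i j i' j' ==> (dg i + dg j == dg i' + dg j')%N) ->
  (0 < e)%N ->
  (forall k, (k < 18)%N -> let d := (dg (pair17 k).1 + dg (pair17 k).2)%N in
     [/\ (d == 0%N) || (e <= d)%N, w 0 (inord k) = if d == 0%N then phi v 0 (inord k) else 0 &
         T 0 (inord k) = if d == e then phi v 0 (inord k) else 0]) ->
  exists (e : nat) (A D : 'I_18 -> {poly K}),
  [/\ (0 < e)%N, forall k, A k = (w 0 k)%:P + 'X^e * D k, forall k, (D k).[0] = T 0 k &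
      forall t, (A (pivot w)).[t] != 0 -> W (\row_k (A k).[t])].
Proof.
move=> vr dgok e0 hk; pose d (k : 'I_18) := (dg (pair17 k).1 + dg (pair17 k).2)%N.
have {}hk k : [/\ (d k == 0%N) || (e <= d k)%N, w 0 k = if d k == 0%N then phi v 0 k else 0 &
         T 0 k = if d k == e then phi v 0 k else 0].
  by have := hk k (ltn_ord k); rewrite inord_val.
exists e, (fun k => phi v 0 k *: 'X^(d k)),
  (fun k => if d k == 0%N then 0 else phi v 0 k *: 'X^(d k - e)); split=> // [k|k|t].
- have [h1 -> _] := hk k; case: eqP h1 => [-> _|_ /= ek].
    by rewrite expr0 mulr0 addr0 alg_polyC.
  by rewrite add0r -scalerAr -exprD subnKC.
- have [h1 _ ->] := hk k; case: (d k =P 0%N) h1 => [-> _|_ /= ek].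
    by rewrite horner0 eq_sym gtn_eqF.
  rewrite hornerZ hornerXn expr0n subn_eq0; case: eqVneq => [->|dk]; first by rewrite leqnn mulr1.
  by rewrite leqNgt ltn_neqAle eq_sym dk ek mulr0.
set i0 := pivot w => At.
pose u : 'rV[K]_10 := \row_i (t ^+ dg i * v 0 i).
have E : \row_k (phi v 0 k *: 'X^(d k) : {poly K}).[t] = phi u.
  apply/rowP; apply: forall_ord => k k18; rewrite [LHS]mxE hornerZ hornerXn !phi17E // /d !inordK //.
  rewrite !mxE !inordK ?(pair17_lt k).1 ?(pair17_lt k).2 // exprD; move: (t ^+ _) (t ^+ _) => x y.
  by ring.
rewrite E; apply: (image_phi (data17 K)); split.
  apply: contraNneq At => u0; have := congr1 (fun z : 'rV[K]_18 => z 0 i0) E; rewrite mxE => ->.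
  by rewrite u0 -(scale0r 0) (phiZ (data17 K)) expr0n scale0r mxE.
move=> i j i' j' h; rewrite !mxE mulrACA [RHS]mulrACA -!exprD (vr _ _ _ _ h).
by have := all4P i j i' j' dgok; rewrite h => /eqP ->.
Qed.

End Genus17Points.

(** ** The quadruple points *)

Definition corner17 c := nth 0%N [:: 0; 2; 6; 8; 9]%N c.

Definition exponents17 c : seq (nat * nat) :=
  let p := pt17 (corner17 c) in
  [seq ((t.1 - p.1 + (p.1 - t.1))%N, (t.2 - p.2 + (p.2 - t.2))%N) | t <- tab17].

Definition neighbours17 c : seq nat :=
  let p := pt17 (corner17 c) in [:: 3 + p.2; 3 * p.1 + 1; 9]%N.

Definition veronese_index17 c : seq nat :=
  [seq lift17 (nth 0%N (neighbours17 c) p.1) (nth 0%N (neighbours17 c) p.2) | p <- veronese_pairs].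

Definition corner_degree17 c k : nat :=
  if (k < 9)%N then let t := nth (0, 0)%N (exponents17 c) k in (t.1 + t.2)%N else 1%N.

Definition corner17_ok c : bool :=
  let idx := veronese_index17 c in let nb := neighbours17 c in
  [&& chart_ok 9 tab17 (exponents17 c) (corner17 c) (nth 0%N nb 0) (nth 0%N nb 1),
      all (fun k => (k < 10)%N && odd k) nb,
      [&& uniq idx, all (fun k => k < 18)%N idx & c.+1 \notin idx],
      adapted_ok c.+1 idx,
      all4 10 (fun i j i' j' => same_weight 9 tab17 i j i' j' ==>
        (corner_degree17 c i + corner_degree17 c j == corner_degree17 c i' + corner_degree17 c j')%N) &
      all (fun k => let d := (corner_degree17 c (pair17 k).1 + corner_degree17 c (pair17 k).2)%N in
        [&& (d == 0%N) || (2 <= d)%N, (d == 0%N) == (k == c.+1) & (d == 2%N) == (k \in idx)]) (iota 0 18)].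

Lemma corner17_okP c : (c < 4)%N -> corner17_ok c.
Proof. by apply: allnP; vm_compute. Qed.

Section Genus17Corners.
Variable K : numClosedFieldType.
Local Notation V := (@toric_cone K 9 tab17).
Local Notation q := (quadrics17 K).
Local Notation phi := (poly_map q).
Local Notation W := (image_of V q).

Definition vertex17 c : 'rV[K]_10 := delta_mx 0 (inord (corner17 c)).
Definition point17 c : 'rV[K]_18 := delta_mx 0 (inord c.+1).

Lemma phi_vertex17 c : (c < 5)%N -> phi (vertex17 c) = point17 c.
Proof.
move=> c5; apply/rowP; apply: forall_ord => k k18; rewrite phi17E // !mxE !eqxx /=.
have c10 : (corner17 c < 10)%N by exact: (@allnP 5 (fun c => corner17 c < 10)%N c isT c5).
have c18 : (c.+1 < 18)%N by apply: leq_trans (_ : 6 <= 18)%N.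
rewrite -!val_eqE /= !inordK ?(pair17_lt k).1 ?(pair17_lt k).2 //.
rewrite -natrM mulnb; congr (_%:R).
have ok : all (fun c => all (fun k => ((pair17 k).1 == corner17 c) && ((pair17 k).2 == corner17 c) == (k == c.+1)) (iota 0 18)) (iota 0 5) by vm_compute.
by rewrite (eqP (allnP (allnP ok c5) k18)).
Qed.

Section Corner.
Variable c : nat.
Hypothesis c4 : (c < 4)%N.

Local Notation idx := (veronese_index17 c).
Local Notation nb := (neighbours17 c).

Let ok_chart : chart_ok 9 tab17 (exponents17 c) (corner17 c) (nth 0%N nb 0) (nth 0%N nb 1).
Proof. by case/and5P: (corner17_okP c4). Qed.

Let ok_nb i : (nth 0%N nb i < 10)%N.
Proof.
have [i3|i3] := ltnP i 3; last by rewrite nth_default.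
case/and5P: (corner17_okP c4) => _ /allP h _ _ _.
by have /andP[] := h _ (mem_nth 0%N (i3 : (i < size nb)%N)).
Qed.

Let ok_odd i : (i < 3)%N -> odd (nth 0%N nb i).
Proof.
move=> i3; case/and5P: (corner17_okP c4) => _ /allP h _ _ _.
by have /andP[] := h _ (mem_nth 0%N (i3 : (i < size nb)%N)).
Qed.

Let sz : size idx = 6%N. Proof. by []. Qed.
Let un : uniq idx. Proof. by case/and5P: (corner17_okP c4) => _ _ /and3P[]. Qed.
Let bd : all (fun k => k < 18)%N idx. Proof. by case/and5P: (corner17_okP c4) => _ _ /and3P[]. Qed.
Let wn : c.+1 \notin idx. Proof. by case/and5P: (corner17_okP c4) => _ _ /and3P[]. Qed.
Let ok_adapted : adapted_ok c.+1 idx. Proof. by case/and5P: (corner17_okP c4). Qed.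

Lemma vertex17_chart (al be x : K) : V (\row_k chart_coord 9 (exponents17 c) 1 al be x k).
Proof.
have [_ [l0 _ _] [e0 _ _] _ _] := chart_okP ok_chart.
split.
  apply: contraTneq isT => E; have := congr1 (fun u : 'rV[K]_10 => u 0 (inord (corner17 c))) E.
  rewrite !mxE inordK 1?ltnW // (chart_coordE ok_chart) l0 e0 leqNgt l0 !expr0 expr1n !mulr1.
  by move/eqP; rewrite oner_eq0.
by move=> i j i' j' /(chart_coord_relations ok_chart) h'; rewrite !mxE h'.
Qed.

Lemma veronese_index_value (v : 'rV[K]_10) r : V v -> (r < 6)%N ->
  phi v 0 (inord (nth 0%N idx r)) =
  veronese (\row_(i < 3) v 0 (inord (nth 0%N nb i))) 0 (inord r).
Proof.
move=> Vv r6; rewrite veronese_pairsE // (nth_map (0, 0)%N) //.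
have [h1 h2] : ((nth (0, 0)%N veronese_pairs r).1 < 3 /\ (nth (0, 0)%N veronese_pairs r).2 < 3)%N.
  by apply/andP; exact: (@allnP 6 (fun r => ((nth (0, 0) veronese_pairs r).1 < 3) && ((nth (0, 0) veronese_pairs r).2 < 3))%N r isT r6).
move: (nth _ _ r) h1 h2 => [a b] /= h1 h2.
have ab : odd (nth 0%N nb a) = odd (nth 0%N nb b) by rewrite !ok_odd.
have [l18 _] := lift17P (ok_nb a) (ok_nb b) ab.
by rewrite phi17E // lift17_value // !mxE !inordK.
Qed.

Local Notation B' := (coord_mx K 5 17 idx).

Let w_neq0 : point17 c != 0.
Proof.
apply: contraTneq isT => E; have := congr1 (fun u : 'rV[K]_18 => u 0 (inord c.+1)) E.
by rewrite !mxE !eqxx => /eqP; rewrite oner_eq0.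
Qed.

Lemma vertex17_cone : V (vertex17 c).
Proof.
have [_ [l0 l1 l2] [e0 _ _] _ _] := chart_okP ok_chart.
have l10 := ltnW l0 : (corner17 c < 10)%N.
have := vertex17_chart 0 0 0; congr (toric_cone _ _); apply/rowP => k; rewrite !mxE eqxx /=.
rewrite (chart_coordE ok_chart) expr1n mul1r -val_eqE /= inordK //.
have ok : all (fun c => all (fun k => (((9 <= k)%N + (nth (0, 0)%N (exponents17 c) k).1 + (nth (0, 0)%N (exponents17 c) k).2)%N == 0%N) == (k == corner17 c)) (iota 0 10)) (iota 0 4) by vm_compute.
rewrite -(eqP (allnP (allnP ok c4) (ltn_ord k))).
by rewrite !addn_eq0 !expr0n -!natrM !mulnb.
Qed.

Let Xw : W (point17 c).
Proof. by rewrite -phi_vertex17 1?ltnW //; apply: (image_phi (data17 K)); exact: vertex17_cone. Qed.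

Let w18 : (c.+1 < 18)%N. Proof. by apply: leq_trans (_ : 5 <= 18)%N. Qed.

Let BC' := coord_left K sz un bd.
Let wC' := coord_delta K sz bd w18 wn.

Lemma corner17_arcs (t : 'rV[K]_3) : exists (e : nat) (A D : 'I_18 -> {poly K}),
  [/\ (0 < e)%N, forall k, A k = (point17 c 0 k)%:P + 'X^e * D k,
      forall k, (D k).[0] = (veronese t *m B') 0 k &
      forall s, (A (pivot (point17 c))).[s] != 0 -> W (\row_k (A k).[s])].
Proof.
pose v : 'rV[K]_10 := \row_k chart_coord 9 (exponents17 c) 1 (t 0 (inord 0)) (t 0 (inord 1)) (t 0 (inord 2)) k.
have Vv : V v by exact: vertex17_chart.
have [_ [l0 l1 l2] [e0 e1 e2] _ _] := chart_okP ok_chart.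
case/and5P: (corner17_okP c4) => _ _ _ _ /andP[dgok dok].
apply: (monomial_arc17 (v := v) (e := 2) _ dgok) => // [|k k18 d]; first by case: Vv.
have /and3P[h1 /eqP h2 /eqP h3] := allnP dok k18; rewrite -/d in h1 h2 h3.
split=> //; rewrite ?h2 ?h3.
  rewrite [LHS]mxE eqxx -val_eqE /= !inordK //; case: eqP => [E|//].
  rewrite phi17E // E.
  have -> : pair17 c.+1 = (corner17 c, corner17 c).
    by apply/eqP; exact: (@allnP 4 (fun c => pair17 c.+1 == (corner17 c, corner17 c)) c isT c4).
  by rewrite /= mxE inordK 1?ltnW // /chart_coord l0 e0 !expr0 !mulr1.
case: ifP => [kin|kn]; last by rewrite (coord_out sz) ?kn.
have ki : (index k idx < 6)%N by have := kin; rewrite -index_mem sz.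
rewrite -{1 2}(nth_index 0%N kin) (coord_in sz un bd) // veronese_index_value //.
congr (veronese _ 0 _); apply/rowP; apply: ord3P; rewrite !mxE !inordK ?ok_nb //.
  by rewrite /chart_coord l1 e1 expr0 expr1 mulr1 mul1r.
by rewrite /chart_coord l2 e2 expr0 expr1 mulr1 mul1r.
Qed.

Let coordinates z : W z -> exists t, z *m B'^T = veronese t.
Proof.
move=> /(imageP (data17 K))[v Vv ->]; exists (\row_(i < 3) v 0 (inord (nth 0%N nb i))).
apply/rowP; apply: forall_ord => r r6.
by rewrite (coord_proj sz) // inordK // veronese_index_value.
Qed.

Let adapted := adapted17 K sz un bd w18 wn ok_adapted.

Lemma corner17_cone : cone_over_veronese (tangent_cone W (point17 c)).
Proof.
exact: (veronese_point_cone (@image_scale _ _ _ _ _) w_neq0 Xw BC' wC' adapted coordinates corner17_arcs).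
Qed.

Lemma corner17_multiplicity : multiplicity 3 W (point17 c) 4.
Proof.
exact: (veronese_point_multiplicity (@image_scale _ _ _ _ _) w_neq0 Xw BC' wC' adapted coordinates corner17_arcs).
Qed.

Lemma corner17_singular : singular_point 3 W (point17 c).
Proof.
exact: (veronese_point_singular (@image_scale _ _ _ _ _) w_neq0 Xw BC' wC' corner17_arcs).
Qed.

End Corner.
End Genus17Corners.

(** ** The sextuple point *)

Definition apex_index17 : seq nat := [:: 10; 11; 12; 13; 1; 2; 3; 4]%N.

(** The two coordinates that span, together with that of the corner, the plane
    of directions on the side of the corner. *)
Definition plane_index17 i : seq nat :=
  [seq index (lift17 (nth 0%N (neighbours17 i) j) 9) apex_index17 | j <- iota 0 2].

Definition plane_points17 i : seq nat :=
  nth [::] [:: [:: 1; 0]; [:: 2; 0]; [:: 1; 3]; [:: 2; 3]]%N i.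

Lemma plane_pointsE i : (i < 4)%N ->
  plane_index17 i = [:: nth 0%N (plane_points17 i) 0; nth 0%N (plane_points17 i) 1].
Proof.
by move=> i4; apply/eqP; apply: (@allnP 4 (fun i => plane_index17 i == [:: nth 0%N (plane_points17 i) 0; nth 0%N (plane_points17 i) 1])) i4.
Qed.

Definition plane_degree17 i k : nat :=
  if (k < 9)%N then (corner_degree17 i k).+1 else 0%N.

Definition plane17_ok i : bool :=
  let d k := (plane_degree17 i (pair17 k).1 + plane_degree17 i (pair17 k).2)%N in
  [&& uniq (plane_index17 i) && all (fun k => k < 4)%N (plane_index17 i),
      all4 10 (fun i1 j i' j' => same_weight 9 tab17 i1 j i' j' ==>
        (plane_degree17 i i1 + plane_degree17 i j == plane_degree17 i i' + plane_degree17 i j')%N),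
      all (fun k => [&& (d k == 0%N) || (2 <= d k)%N, (d k == 0%N) == (k == 5%N) &
        (d k == 2%N) == (k \in [:: i.+1; nth 0%N apex_index17 (nth 0%N (plane_index17 i) 0);
                                   nth 0%N apex_index17 (nth 0%N (plane_index17 i) 1)])]) (iota 0 18),
      all (fun r => nth 0%N apex_index17 (nth 0%N (plane_index17 i) r) ==
         lift17 (nth 0%N (neighbours17 i) r) 9) (iota 0 2) &
      all (fun m => (m \in plane_index17 i) || has (fun a => has (fun b =>
          [&& a \notin 5%N :: apex_index17, b != 5%N &
              same_product17 i.+1 (nth 0%N apex_index17 m) a b]) (iota 0 18)) (iota 0 18)) (iota 0 4)].

Lemma plane17_okP i : (i < 4)%N -> plane17_ok i.
Proof. by apply: allnP; vm_compute. Qed.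

Lemma corner_pairs17 : all2 4 (fun i j => (i == j) || has (fun a => has (fun b =>
  [&& a \notin 5%N :: apex_index17, b != 5%N & same_product17 i.+1 j.+1 a b]) (iota 0 18)) (iota 0 18)).
Proof. by vm_compute. Qed.

Definition apex_degree_ok (dg : nat -> nat) : bool :=
  all4 10 (fun i j i' j' => same_weight 9 tab17 i j i' j' ==> (dg i + dg j == dg i' + dg j')%N).

(** The degrees on an arc through the sextuple point: the leading terms of order
    [e] are coordinates of the list. *)
Definition apex_arc_ok (dg : nat -> nat) (e : nat) : bool :=
  all (fun k => let d := (dg (pair17 k).1 + dg (pair17 k).2)%N in
    [&& (d == 0%N) || (e <= d)%N, (d == 0%N) == (k == 5%N) & (d == e) ==> (k \in apex_index17)])
    (iota 0 18).

Section Genus17Apex.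
Variable K : numClosedFieldType.
Local Notation V := (@toric_cone K 9 tab17).
Local Notation q := (quadrics17 K).
Local Notation phi := (poly_map q).
Local Notation W := (image_of V q).
Local Notation idx := apex_index17.
Local Notation B' := (coord_mx K 7 17 idx : 'M[K]_(3.+1 + 4, 18)).
Local Notation N i := (coord_mx K 1 3 (plane_index17 i) : 'M[K]_(2, 3.+1)).

Lemma apex17_size : size idx = 8%N. Proof. by []. Qed.
Lemma apex17_uniq : uniq idx. Proof. by []. Qed.
Lemma apex17_bound : all (fun k => k < 18)%N idx. Proof. by []. Qed.
Lemma apex17_notin : 5%N \notin idx. Proof. by []. Qed.
Lemma apex17_ok : adapted_ok 5 idx. Proof. by vm_compute. Qed.

Lemma plane17_size i : size (plane_index17 i) = 2%N. Proof. by []. Qed.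
Lemma plane17_uniq i : (i < 4)%N -> uniq (plane_index17 i).
Proof. by case/plane17_okP/and5P => /andP[]. Qed.
Lemma plane17_bound i : (i < 4)%N -> all (fun k => k < 4)%N (plane_index17 i).
Proof. by case/plane17_okP/and5P => /andP[]. Qed.

Lemma apex17_neq0 : point17 K 4 != 0.
Proof.
apply: contraTneq isT => E; have := congr1 (fun u : 'rV[K]_18 => u 0 (inord 5)) E.
by rewrite !mxE !eqxx => /eqP; rewrite oner_eq0.
Qed.

Lemma apex17_cone : V (vertex17 K 4).
Proof.
have ok : chart_ok 9 tab17 tab17 0 3 1 by vm_compute.
split.
  apply: contraTneq isT => E; have := congr1 (fun u : 'rV[K]_10 => u 0 (inord 9)) E.
  by rewrite !mxE !eqxx => /eqP; rewrite oner_eq0.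
have := chart_coord_relations ok (0 : K) 0 0 1; congr (toric_relations tab17 _).
apply: funext => k; rewrite mxE eqxx /= -val_eqE /= inordK // /chart_coord.
case: ltnP => [k9|k9]; first by rewrite !mul0r ltn_eqF.
by rewrite eqn_leq k9 -ltnS ltn_ord.
Qed.

Lemma apex17_in : W (point17 K 4).
Proof. by rewrite -phi_vertex17 //; apply: (image_phi (data17 K)); exact: apex17_cone. Qed.

Lemma apex17_left : B' *m (coord_mx K 7 17 idx)^T = 1%:M.
Proof. exact: (coord_left K apex17_size apex17_uniq apex17_bound). Qed.

Lemma apex17_kernel : point17 K 4 *m (coord_mx K 7 17 idx)^T = 0.
Proof. exact: (coord_delta K apex17_size apex17_bound (isT : 5 < 18)%N apex17_notin). Qed.

Definition apex17_adapted := adapted17 K apex17_size apex17_uniq apex17_bound (isT : 5 < 18)%N apex17_notin apex17_ok.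

Lemma apex_entry (o c : 'rV[K]_4) m : (m < 8)%N ->
  (row_mx o c *m B') 0 (inord (nth 0%N idx m)) =
  if (m < 4)%N then o 0 (inord m) else c 0 (inord (m - 4)).
Proof.
move=> m8; rewrite (coord_in apex17_size apex17_uniq apex17_bound) //; case: ifP => m4.
  have -> : inord m = lshift 4 (inord m) :> 'I_(3.+1 + 4) by apply/val_inj; rewrite /= !inordK.
  exact: row_mxEl.
have m4' : (4 <= m)%N by rewrite leqNgt m4.
have -> : inord m = rshift 3.+1 (inord (m - 4)) :> 'I_(3.+1 + 4).
  by apply/val_inj; rewrite /= !inordK ?subnKC // ltn_subLR.
exact: row_mxEr.
Qed.

Lemma apex_entry0 (o c : 'rV[K]_4) k : (k < 18)%N -> k \notin idx ->
  (row_mx o c *m B') 0 (inord k) = 0.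
Proof. exact: (coord_out apex17_size). Qed.

Definition apex17_equation (f : 'rV[K]_4 -> 'rV[K]_4 -> K) := exists Q, [/\ Q \is 2.-homog,
  vanishing_ideal W Q, forall u : 'rV[K]_18, u 0 (pivot (point17 K 4)) = 0 ->
    ddir Q (point17 K 4 0) (u 0) = 0 &
  forall o c, Q.@[(row_mx o c *m B') 0] = f o c].

Lemma apex_binomial k m a b : (k < 8)%N -> (m < 8)%N -> (a < 18)%N -> (b < 18)%N ->
  a \notin 5%N :: idx -> b != 5%N -> same_product17 (nth 0%N idx k) (nth 0%N idx m) a b ->
  apex17_equation (fun o c => (row_mx o c *m B') 0 (inord (nth 0%N idx k)) *
                       (row_mx o c *m B') 0 (inord (nth 0%N idx m))).
Proof.
move=> hk hm ha hb aidx b5 E; exists (binomial17 K (nth 0%N idx k) (nth 0%N idx m) a b).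
have [k18 k5] : (nth 0%N idx k < 18)%N /\ nth 0%N idx k != 5%N.
  by split; [apply: (allP apex17_bound); rewrite mem_nth | apply/eqP => E5; move: apex17_notin; rewrite -E5 mem_nth].
have [m18 m5] : (nth 0%N idx m < 18)%N /\ nth 0%N idx m != 5%N.
  by split; [apply: (allP apex17_bound); rewrite mem_nth | apply/eqP => E5; move: apex17_notin; rewrite -E5 mem_nth].
move: aidx; rewrite inE negb_or => /andP[a5 aidx].
have lt : all (fun k => k < 18)%N [:: nth 0%N idx k; nth 0%N idx m; a; b] by rewrite /= k18 m18 ha hb.
split; [exact: quadric_of_homog | exact: binomial17_vanish | move=> u | move=> o c].
  rewrite pivot_delta => u0; rewrite binomial17_linear // (negPf k5) (negPf m5) (negPf a5) (negPf b5).
  by rewrite !mul0r !addr0 subr0.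
by rewrite binomial17_eval [X in _ - X * _]apex_entry0 // mul0r subr0.
Qed.

Lemma equation_eq f g : (forall o c, f o c = g o c) -> apex17_equation f -> apex17_equation g.
Proof. by move=> fg [Q [h1 h2 h3 h4]]; exists Q; split=> // o c; rewrite h4 fg. Qed.

Lemma equation_sum (I : finType) (u : I -> K) (f : I -> 'rV[K]_4 -> 'rV[K]_4 -> K) :
  (forall i, u i != 0 -> apex17_equation (f i)) -> apex17_equation (fun o c => \sum_i u i * f i o c).
Proof.
move=> h; have /choice[Q hQ] i : exists Q, u i != 0 -> [/\ Q \is 2.-homog,
  vanishing_ideal W Q, forall z : 'rV[K]_18, z 0 (pivot (point17 K 4)) = 0 ->
    ddir Q (point17 K 4 0) (z 0) = 0 &
  forall o c, Q.@[(row_mx o c *m B') 0] = f i o c].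
  have [u0|ui] := eqVneq (u i) 0; first by exists 0 => ui; case/eqP: ui.
  by have [Q hQ] := h i ui; exists Q.
exists (\sum_i u i *: Q i); split.
- apply: rpred_sum => i _; have [->|/hQ[h1 _ _ _]] := eqVneq (u i) 0; first by rewrite scale0r rpred0.
  exact: rpredZ.
- move=> z Wz; rewrite raddf_sum big1 // => i _; rewrite /= mevalZ.
  have [->|/hQ[_ h2 _ _]] := eqVneq (u i) 0; first by rewrite mul0r.
  by rewrite h2 // mulr0.
- move=> z z0; rewrite ddir_sum big1 // => i _; rewrite ddirZ.
  have [->|/hQ[_ _ h3 _]] := eqVneq (u i) 0; first by rewrite mul0r.
  by rewrite h3 // mulr0.
move=> o c; rewrite raddf_sum; apply: eq_bigr => i _; rewrite /= mevalZ.
have [->|/hQ[_ _ _ ->]] := eqVneq (u i) 0; by rewrite ?mul0r.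
Qed.

Lemma apex_equations0 F : F = quadric_form K -> apex17_equation (fun o _ => F.@[o 0]).
Proof.
move=> ->; exists (binomial17 K 10 13 11 12); split.
- exact: quadric_of_homog.
- by apply: binomial17_vanish => //; vm_compute.
- by move=> u; rewrite pivot_delta => u0; rewrite binomial17_linear //= !mul0r !addr0 subr0.
move=> o c; rewrite binomial17_eval quadric_formE.
have e := @apex_entry o c; have e0 := e 0%N isT; have e1 := e 1%N isT.
have e2 := e 2%N isT; have e3 := e 3%N isT; rewrite /= in e0 e1 e2 e3.
by rewrite e0 e1 e2 e3.
Qed.

Lemma apex_equations1 (i j : 'I_4) : i != j -> apex17_equation (fun _ c => c 0 i * c 0 j).
Proof.
move=> ij; have := all2P corner_pairs17 (ltn_ord i) (ltn_ord j).
rewrite -val_eqE in ij; rewrite (negPf ij) orFb.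
case/hasP => a; rewrite mem_iota add0n => /andP[_ ha] /hasP[b]; rewrite mem_iota add0n => /andP[_ hb].
case/and3P => a5 b5 E; have lt (k : 'I_4) : (4 + k < 8)%N by rewrite ltn_add2l.
have idxE (k : 'I_4) : nth 0%N idx (4 + k) = k.+1 by case: k => [[|[|[|[|]]]]].
have := @apex_binomial (4 + i) (4 + j) a b (lt i) (lt j) ha hb a5 b5; rewrite !idxE => /(_ E).
by apply: equation_eq => o c; rewrite -!idxE !apex_entry //= !addKn !inord_val.
Qed.

Lemma apex_equations2 (i : 'I_4) (u : 'cV[K]_4) : N i *m u = 0 ->
  apex17_equation (fun o c => c 0 i * (o *m u) 0 0).
Proof.
move=> Nu; apply: (@equation_eq (fun o c => \sum_m u m 0 * (o 0 m * c 0 i))) => [o c|].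
  by rewrite mxE mulr_sumr; apply: eq_bigr => m _; ring.
apply: equation_sum => m um.
have mn : (m : nat) \notin plane_index17 i.
  apply: contra um => mi; have r2 : (index (m : nat) (plane_index17 i) < 2)%N by have := mi; rewrite -index_mem plane17_size.
  have := congr1 (fun x : 'cV[K]_2 => x (inord (index (m : nat) (plane_index17 i))) 0) Nu.
  rewrite !mxE (bigD1 m) //= mxE inordK // nth_index // eqxx mul1r big1 => [|k km].
    by rewrite addr0 => ->.
  by rewrite mxE inordK // nth_index // (negPf (km : (k : nat) != m)) mul0r.
have /and5P[_ _ _ _ h] := plane17_okP (ltn_ord i); have := allnP h (ltn_ord m).
rewrite (negPf mn) orFb.
case/hasP => a; rewrite mem_iota add0n => /andP[_ ha] /hasP[b]; rewrite mem_iota add0n => /andP[_ hb].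
case/and3P => a5 b5 E; have lt : (4 + i < 8)%N by rewrite ltn_add2l.
have idxE : nth 0%N idx (4 + i) = i.+1 by case: (i) => [[|[|[|[|]]]]].
have m8 : (m < 8)%N by apply: ltn_trans (ltn_ord m) _.
have := @apex_binomial (4 + i) m a b lt m8 ha hb a5 b5; rewrite !idxE => /(_ E).
apply: equation_eq => o c; rewrite -idxE !apex_entry //= addKn ltn_ord !inord_val.
by rewrite mulrC.
Qed.

(** ** Arcs through the sextuple point *)

Lemma apex_row0 (o c : 'rV[K]_4) (f : nat -> K) (on : pred nat) :
  (forall k, (k < 18)%N -> on k -> k \in idx) ->
  (forall m, (m < 8)%N -> (if on (nth 0%N idx m) then f (nth 0%N idx m) else 0) =
     if (m < 4)%N then o 0 (inord m) else c 0 (inord (m - 4))) ->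
  forall k, (k < 18)%N -> (row_mx o c *m B') 0 (inord k) = if on k then f k else 0.
Proof.
move=> onP fP k k18; have [kin|kn] := boolP (k \in idx); last first.
  by rewrite apex_entry0 //; case: ifP => // /(onP k k18); rewrite (negPf kn).
have m8 : (index k idx < 8)%N by have := kin; rewrite -index_mem.
by rewrite -{1}(nth_index 0%N kin) apex_entry // -fP // nth_index.
Qed.

Definition arc17 (s : 'rV[K]_(3.+1 + 4)) := exists (e : nat) (A D : 'I_18 -> {poly K}),
  [/\ (0 < e)%N, forall k, A k = (point17 K 4 0 k)%:P + 'X^e * D k,
      forall k, (D k).[0] = (s *m B') 0 k &
      forall t, (A (pivot (point17 K 4))).[t] != 0 -> W (\row_k (A k).[t])].

Lemma apex17_arc (v : 'rV[K]_10) dg e (o c : 'rV[K]_4) :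
  toric_relations tab17 (v 0) -> v 0 (inord 9) = 1 ->
  apex_degree_ok dg -> (0 < e)%N ->
  apex_arc_ok dg e ->
  (forall m, (m < 8)%N -> let k := nth 0%N idx m in
     (if (dg (pair17 k).1 + dg (pair17 k).2 == e)%N then
        v 0 (inord (pair17 k).1) * v 0 (inord (pair17 k).2) else 0) =
     if (m < 4)%N then o 0 (inord m) else c 0 (inord (m - 4))) ->
  arc17 (row_mx o c).
Proof.
move=> vr v9 dgok e0 dok hm; apply: (monomial_arc17 vr dgok e0) => k k18 d.
have /and3P[d0 /eqP d1 d2] := allnP dok k18; rewrite -/d in d0 d1 d2.
have dd k' : (k' < 18)%N -> (dg (pair17 k').1 + dg (pair17 k').2 == e)%N -> k' \in idx.
  by move=> k18'; have /and3P[_ _ /implyP] := allnP dok k18'.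
clear dok dgok; split=> //.
  rewrite d1 [LHS]mxE eqxx -val_eqE /= !inordK //; case: eqP => [->|//].
  by rewrite phi17E // v9 mulr1.
apply: (apex_row0 (f := fun k => phi v 0 (inord k))
  (on := fun k => (dg (pair17 k).1 + dg (pair17 k).2 == e)%N)) => // m m8.
by rewrite -hm // phi17E //; apply: (allP apex17_bound); exact: mem_nth.
Qed.

(** Scaling all the coordinates except the free one gives arcs in the
    directions of the quadric. *)
Lemma apex17_arcs1 (o : 'rV[K]_4) : quadric_cone o /\ (forall i, o 0 i != 0) -> arc17 (row_mx o 0).
Proof.
rewrite /quadric_cone quadric_formE => -[Qo o0].
pose x i := o 0 (inord i); have x0 i : x i != 0 by exact: o0.
have ok : chart_ok 9 tab17 tab17 0 3 1 by vm_compute.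
pose be := sqrtC (x 2%N / x 1%N); have be2 : be ^+ 2 = x 2%N / x 1%N by rewrite sqrtCK.
have be0 : be != 0 by rewrite sqrtC_eq0 mulf_neq0 ?invr_eq0.
pose la := x 0%N / be; pose al := x 1%N / la.
have la0 : la != 0 by rewrite mulf_neq0 ?invr_eq0.
pose v : 'rV[K]_10 := \row_k chart_coord 9 tab17 la al be 1 k.
have vE a : (a < 10)%N -> v 0 (inord a) = chart_coord 9 tab17 la al be 1 a by move=> ha; rewrite mxE inordK.
have vr : toric_relations tab17 (v 0).
  by move=> i j i' j' /(chart_coord_relations ok) h; rewrite !mxE h.
clear ok; clearbody v.
have dgok : apex_degree_ok (fun k => (k < 9)%N : nat) by vm_compute.
have dok : apex_arc_ok (fun k => (k < 9)%N : nat) 1 by vm_compute.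
apply: (apex17_arc vr _ dgok _ dok); clear dgok dok => //; first by rewrite vE.
move=> m m8.
have e1 : la * al = x 1%N by rewrite mulrC /al divfK.
have e0 : la * be = x 0%N by rewrite /la divfK.
have e2 : la * al * be ^+ 2 = x 2%N by rewrite be2 e1 mulrC divfK.
have e3 : la * al ^+ 2 * be = x 3%N.
  have E : x 0%N * x 3%N = x 1%N * x 2%N by apply/eqP; rewrite -subr_eq0; apply/eqP.
  apply: (mulfI (x0 0%N)); rewrite E -e0 -e1 -e2; ring.
have xE i : o 0 (inord i) = x i by [].
have c0 i : (0 : 'rV[K]_4) 0 i = 0 by rewrite mxE.
clearbody x be la al.
case: m m8 => [|[|[|[|[|[|[|[|m]]]]]]]] m8 //=; rewrite ?c0 ?xE ?vE // /chart_coord /=.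
- by rewrite expr0 expr1 !mulr1.
- by rewrite expr0 expr1 !mulr1.
- by rewrite expr1 !mulr1.
by rewrite expr1 !mulr1.
Qed.

(** Near a corner, the corner coordinate has order 1 on the arc, and the
    neighbouring ones have order 2. *)
Lemma apex17_arcs2 (i : 'I_4) (x : 'rV[K]_2) g : g != 0 ->
  arc17 (row_mx (x *m N i) (g *: delta_mx 0 i)).
Proof.
move=> g0; have i4 := ltn_ord i.
pose ga := sqrtC g; have ga2 : ga ^+ 2 = g by rewrite sqrtCK.
have ga0 : ga != 0 by rewrite sqrtC_eq0.
have ok : chart_ok 9 tab17 (exponents17 i) (corner17 i) (nth 0%N (neighbours17 i) 0) (nth 0%N (neighbours17 i) 1).
  by case/and5P: (corner17_okP i4).
pose x0 := x 0 (inord 0); pose x1 := x 0 (inord 1).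
pose v : 'rV[K]_10 := \row_k chart_coord 9 (exponents17 i) ga (x0 / ga) (x1 / ga) 1 k.
have vE a : (a < 10)%N -> v 0 (inord a) = chart_coord 9 (exponents17 i) ga (x0 / ga) (x1 / ga) 1 a.
  by move=> ha; rewrite mxE inordK.
have vr : toric_relations tab17 (v 0).
  by move=> i1 j i' j' /(chart_coord_relations ok) h; rewrite !mxE h.
clear ok; clearbody v.
have dgok : apex_degree_ok (plane_degree17 i).
  by apply: (@allnP 4 (fun i => apex_degree_ok (plane_degree17 i))) i4; vm_compute.
have dok : apex_arc_ok (plane_degree17 i) 2.
  by apply: (@allnP 4 (fun i => apex_arc_ok (plane_degree17 i) 2)) i4; vm_compute.
apply: (apex17_arc vr _ dgok _ dok); clear dgok dok => //; first by rewrite vE.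
move=> m m8.
have xN k : (k < 4)%N -> (x *m N i) 0 (inord k) = if k == nth 0%N (plane_points17 i) 0 then x0
    else if k == nth 0%N (plane_points17 i) 1 then x1 else 0.
  by rewrite plane_pointsE //; apply: coord_mx2; move: i4; clear; case: (i : nat) => [|[|[|[|]]]].
have gd k : (g *: delta_mx 0 i : 'rV[K]_4) 0 k = if k == i then g else 0.
  by rewrite !mxE eqxx /=; case: eqP; rewrite ?mulr1 ?mulr0.
have h0' : ga * (x0 / ga) = x0 by rewrite mulrC divfK.
have h1' : ga * (x1 / ga) = x1 by rewrite mulrC divfK.
clearbody x0 x1 ga.
have gg : ga * ga = g by rewrite -ga2.
case: i i4 vE xN gd {vr} => [[|[|[|[|i']]]] hi] //= _ vE xN gd;
case: m m8 => [|[|[|[|[|[|[|[|m]]]]]]]] m8 //=; rewrite ?gd ?xN ?vE // -?val_eqE /= ?inordK //.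
all: by rewrite /chart_coord /= ?expr0 ?expr1 ?mulr1 ?h0' ?h1' ?gg.
Qed.

Lemma plane17_left (i : 'I_4) : N i *m (N i)^T = 1%:M.
Proof. by have i4 := ltn_ord i; exact: (coord_left K (plane17_size i) (plane17_uniq i4) (plane17_bound i4)). Qed.

Lemma plane17_lines (i : 'I_4) (x : 'rV[K]_2) : quadric_cone (x *m N i).
Proof.
have i4 := ltn_ord i; rewrite /quadric_cone quadric_formE.
have out k : (k < 4)%N -> k \notin plane_index17 i -> (x *m N i) 0 (inord k) = 0.
  exact: (coord_out (plane17_size i)).
have ok : all (fun i => (((0 \notin plane_index17 i) || (3 \notin plane_index17 i)) &&
    ((1 \notin plane_index17 i) || (2 \notin plane_index17 i)))%N) (iota 0 4) by vm_compute.
have /andP[h1 h2] := allnP ok i4; clear ok.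
have -> : (x *m N i) 0 (inord 0) * (x *m N i) 0 (inord 3) = 0.
  by case/orP: h1 => /out -> //; rewrite ?mul0r ?mulr0.
have -> : (x *m N i) 0 (inord 1) * (x *m N i) 0 (inord 2) = 0.
  by case/orP: h2 => /out -> //; rewrite ?mul0r ?mulr0.
by rewrite subrr.
Qed.

Lemma quadric_dense F : (forall o : 'rV[K]_4, quadric_cone o /\ (forall i, o 0 i != 0) -> F.@[o 0] = 0) ->
  ideal_gen (fun f => f = quadric_form K) F.
Proof. by move=> h; apply: quadric_cone_ideal => o h1 h2; apply: h. Qed.

Lemma quadric_form_vanish F (o : 'rV[K]_4) : F = quadric_form K -> quadric_cone o -> F.@[o 0] = 0.
Proof. by move=> ->. Qed.

Local Notation B := (cone_basis (point17 K 4) B').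

Definition apex17_surface : set 'rV[K]_17 := fun w =>
  (exists i, plane (plane_basis (point17 K 4) (fun i : 'I_4 => N i) B' i) w) \/
  quadric_surface (row_mx 1%:M 0 *m B) (quadric_form K) w.

Lemma apex17_surfaceE w : apex17_surface w <->
  (exists i, plane (plane_basis (point17 K 4) (fun i : 'I_4 => N i) B' i) w) \/
  (w != 0 /\ exists2 o : 'rV[K]_4, quadric_cone o & w = row_mx o 0 *m B).
Proof.
have E (o : 'rV[K]_4) : o *m (row_mx 1%:M 0 *m B) = row_mx o 0 *m B.
  by rewrite mulmxA mul_mx_row mulmx1 mulmx0.
split=> [[h|[w0 [o Qo wE]]]|[h|[w0 [o Qo wE]]]]; [by left | right | by left | right].
  by split=> //; exists o => //; rewrite wE E.
by split=> //; exists o => //; rewrite wE E.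
Qed.

Lemma apex17_multiplicity : multiplicity 3 W (point17 K 4) 6.
Proof.
apply: (four_planes_point_multiplicity (@image_scale _ _ _ _ _) apex17_neq0 apex17_in
  plane17_left plane17_lines quadric_dense quadric_form_vanish (fun o h => h.1)
  apex17_left apex17_kernel apex17_adapted apex_equations0 apex_equations1 apex_equations2
  apex17_arcs1 apex17_arcs2 _ _ (@quadric_hilbert K)) => //.
- exact: (planes_ideal apex17_neq0 apex17_left apex17_kernel apex17_surfaceE).
move=> d; have : (d.+1 * 'C(d, 1) = 2 * 'C(d.+1, 2))%N by rewrite mul_bin_diag.
by rewrite bin1; lia.
Qed.

Lemma apex17_tangent_cone : cone_over_four_planes_quadric (tangent_cone W (point17 K 4)).
Proof.
exists (plane_basis (point17 K 4) (fun i : 'I_4 => N i) B'), (row_mx 1%:M 0 *m B), (quadric_form K).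
split.
- split=> [i|i j]; first exact: (plane_basis_free apex17_neq0 plane17_left apex17_left apex17_kernel).
  exact: (plane_basis_inj apex17_neq0 apex17_left apex17_kernel).
- apply/row_freeP; exists (insertion (point17 K 4) *m (coord_mx K 7 17 idx)^T *m (col_mx 1%:M 0 : 'M[K]_(3.+1 + 4, 3.+1))).
  rewrite mulmxA -[_ *m B *m _]mulmxA (cone_basis_left apex17_neq0 apex17_left apex17_kernel).
  have E : row_mx (1%:M : 'M[K]_4) (0 : 'M[K]_4) *m col_mx (1%:M : 'M[K]_4) (0 : 'M[K]_4) = 1%:M.
    by rewrite mul_row_col mulmx1 mulmx0 addr0.
  rewrite mulmx1; exact: E.
- exact: quadric_form_irreducible.
apply: (four_planes_point_cone (@image_scale _ _ _ _ _) apex17_neq0 apex17_in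
  plane17_left quadric_dense quadric_form_vanish (fun o h => h.1)
  apex17_adapted apex_equations0 apex_equations1 apex_equations2
  apex17_arcs1 apex17_arcs2) => f.
exact: (planes_ideal apex17_neq0 apex17_left apex17_kernel apex17_surfaceE).
Qed.

Lemma apex17_singular : singular_point 3 W (point17 K 4).
Proof.
exact: (four_planes_point_singular (@image_scale _ _ _ _ _) apex17_neq0 apex17_in
  quadric_dense quadric_form_vanish apex17_left apex17_kernel apex17_arcs1 apex17_arcs2).
Qed.

End Genus17Apex.

(** ** The threefold of genus 17 *)

Section Genus17Theorem.
Variable K : numClosedFieldType.
Local Notation V := (@toric_cone K 9 tab17).

Lemma corner17_charts (v : 'rV[K]_10) c : (c < 4)%N -> v 0 (inord (corner17 c)) != 0 ->
  exists ex i0 i1 i2, chart_ok 9 tab17 ex i0 i1 i2 /\ v 0 (inord i0) != 0.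
Proof.
move=> c4 vc; case/and5P: (corner17_okP c4) => ok _ _ _ _.
by exists (exponents17 c), (corner17 c), (nth 0%N (neighbours17 c) 0), (nth 0%N (neighbours17 c) 1).
Qed.

(** The square of a coordinate at the middle of an edge or of the square is the
    product of the coordinates at opposite points. *)
Lemma corner17_zero (v : 'rV[K]_10) : V v ->
  (forall c, (c < 4)%N -> v 0 (inord (corner17 c)) = 0) -> forall k, (k < 9)%N -> v 0 (inord k) = 0.
Proof.
move=> Vv hc; have sq k a b : (k < 9)%N -> (a < 9)%N -> (b < 9)%N -> same_weight 9 tab17 k k a b ->
    v 0 (inord a) = 0 -> v 0 (inord k) = 0.
  move=> k9 a9 b9 h va; have := Vv.2 (inord k) (inord k) (inord a) (inord b).
  have k10 := ltnW k9; have a10 := ltnW a9; have b10 := ltnW b9.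
  rewrite !inordK // => /(_ h) /eqP.
  by rewrite va mul0r mulf_eq0 orbb => /eqP.
have v0 := hc 0%N isT; have v2 := hc 1%N isT; have v6 := hc 2%N isT; have v8 := hc 3%N isT.
rewrite /corner17 /= in v0 v2 v6 v8.
have v1 := sq 1%N 0%N 2%N isT isT isT isT v0.
have v3 := sq 3%N 0%N 6%N isT isT isT isT v0.
have v5 := sq 5%N 2%N 8%N isT isT isT isT v2.
have v7 := sq 7%N 6%N 8%N isT isT isT isT v6.
have v4 := sq 4%N 0%N 8%N isT isT isT isT v0.
by case=> [|[|[|[|[|[|[|[|[|k]]]]]]]]].
Qed.

Lemma V17_toric : @V17 K = V.
Proof.
have segreE (u u' : 'rV[K]_2) k : (k < 9)%N -> segre22 u u' 0 (inord k) =
    u 0 0 ^+ (pt17 k).1 * u 0 1 ^+ (2 - (pt17 k).1) * (u' 0 0 ^+ (pt17 k).2 * u' 0 1 ^+ (2 - (pt17 k).2)).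
  move=> k9; have k10 := ltnW k9; rewrite /segre22 mxE inordK // k9.
  have -> : (k %/ 3)%N = (pt17 k).1.
    by apply/eqP; exact: (@allnP 9 (fun k => (k %/ 3)%N == (pt17 k).1) k isT k9).
  by have -> : (k %% 3)%N = (pt17 k).2
    by apply/eqP; exact: (@allnP 9 (fun k => (k %% 3)%N == (pt17 k).2) k isT k9).
have vertexE : delta_mx 0 ord_max = delta_mx 0 (inord 9) :> 'rV[K]_10.
  by congr (delta_mx _ _); apply/val_inj; rewrite /= inordK.
apply: funext => w; apply: propext; split.
- move=> [w0 [y0 [y0' [u [u' [nu nu' /eqrVP[c c0 yE]]]]]] /sub_addsmxP[[x1 x2] /= wE]].
  split=> // i j i' j' h; pose a := x1 0 0 * c; pose b := x2 0 0.
  have {wE} wE k : (k < 10)%N -> w 0 (inord k) =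
      a ^+ (k < 9)%N * b ^+ (9 <= k)%N *
      (u 0 0 ^+ (pt17 k).1 * u 0 1 ^+ (2 * (k < 9)%N - (pt17 k).1) *
      (u' 0 0 ^+ (pt17 k).2 * u' 0 1 ^+ (2 * (k < 9)%N - (pt17 k).2))).
    move=> k10; rewrite wE yE [x1]mx11_scalar [x2]mx11_scalar !mul_scalar_mx scalerA -/a -/b vertexE.
    rewrite mxE [X in X + _]mxE [X in _ + X]mxE [delta_mx _ _ _ _]mxE eqxx -val_eqE /= !inordK //.
    case: (ltnP k 9) => k9.
      by rewrite segreE // expr1 expr0 mulr1 (ltn_eqF k9) mulr0 addr0.
    have -> : k = 9%N by apply/eqP; rewrite eqn_leq k9 andbT.
    by rewrite [segre22 _ _ _ _]mxE inordK // mulr0 add0r eqxx /= !(mulr1, mul1r, expr0, expr1).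
  move: h; rewrite -(inord_val i) -(inord_val j) -(inord_val i') -(inord_val j').
  rewrite !inordK // => h; rewrite !wE //.
  have ok2 : all4 10 (fun i j i' j' => same_weight 9 tab17 i j i' j' ==>
     [&& (9 <= i) + (9 <= j) == (9 <= i') + (9 <= j'),
         (i < 9) + (j < 9) == (i' < 9) + (j' < 9),
         (pt17 i).1 + (pt17 j).1 == (pt17 i').1 + (pt17 j').1,
         (pt17 i).2 + (pt17 j).2 == (pt17 i').2 + (pt17 j').2,
         (2 * (i < 9) - (pt17 i).1) + (2 * (j < 9) - (pt17 j).1) ==
         (2 * (i' < 9) - (pt17 i').1) + (2 * (j' < 9) - (pt17 j').1) &
         (2 * (i < 9) - (pt17 i).2) + (2 * (j < 9) - (pt17 j).2) ==
         (2 * (i' < 9) - (pt17 i').2) + (2 * (j' < 9) - (pt17 j').2)]%N) by vm_compute.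
  have := all4P i j i' j' ok2; clear ok2; rewrite h /=.
  case/and5P => /eqP h1 /eqP h2 /eqP h3 /eqP h4 /andP[/eqP h5 /eqP h6].
  transitivity (a ^+ ((i < 9) + (j < 9))%N * b ^+ ((9 <= i) + (9 <= j))%N *
    (u 0 0 ^+ ((pt17 i).1 + (pt17 j).1) * u 0 1 ^+ ((2 * (i < 9) - (pt17 i).1) + (2 * (j < 9) - (pt17 j).1))) *
    (u' 0 0 ^+ ((pt17 i).2 + (pt17 j).2) * u' 0 1 ^+ ((2 * (i < 9) - (pt17 i).2) + (2 * (j < 9) - (pt17 j).2)))).
    by rewrite !exprD; ring.
  by rewrite h1 h2 h3 h4 h5 h6 !exprD; ring.
move=> Vw; split; first exact: Vw.1.
have [c [c4 wc]] : exists c, (c < 4)%N /\ (w 0 (inord (corner17 c)) != 0 \/ forall k, (k < 9)%N -> w 0 (inord k) = 0).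
  have [h|h] := pselect (exists c, (c < 4)%N /\ w 0 (inord (corner17 c)) != 0).
    by have [c [c4 wc]] := h; exists c; split=> //; left.
  exists 0%N; split=> //; right; apply: corner17_zero => // c c4; apply/eqP/negPn/negP => wc.
  by apply: h; exists c.
have okc : chart_ok 9 tab17 (exponents17 c) (corner17 c) (nth 0%N (neighbours17 c) 0) (nth 0%N (neighbours17 c) 1).
  by case/and5P: (corner17_okP c4).
have [_ [l0 l1 l2] [e0 e1 e2] _ _] := chart_okP okc.
pose p := pt17 (corner17 c); pose la := w 0 (inord (corner17 c)).
pose al := w 0 (inord (nth 0%N (neighbours17 c) 0)) / la.
pose be := w 0 (inord (nth 0%N (neighbours17 c) 1)) / la.
pose u : 'rV[K]_2 := \row_j if (j == 0) == (p.1 == 0)%N then al else 1.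
pose u' : 'rV[K]_2 := \row_j if (j == 0) == (p.2 == 0)%N then be else 1.
have yE k : (k < 9)%N -> segre22 u u' 0 (inord k) =
    al ^+ (nth (0, 0)%N (exponents17 c) k).1 * be ^+ (nth (0, 0)%N (exponents17 c) k).2.
  move=> k9; rewrite segreE // !mxE /=.
  have ok3 : all2 9 (fun c k => (c < 4)%N ==>
     ((nth (0, 0)%N (exponents17 c) k).1 == if (pt17 (corner17 c)).1 == 0%N then (pt17 k).1 else 2 - (pt17 k).1)%N &&
     ((nth (0, 0)%N (exponents17 c) k).2 == if (pt17 (corner17 c)).2 == 0%N then (pt17 k).2 else 2 - (pt17 k).2)%N) by vm_compute.
  have := all2P ok3 (leq_trans c4 _) k9; clear ok3; rewrite c4 => /(_ isT)/andP[/eqP -> /eqP ->].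
  rewrite -/p; case: (p.1 == 0)%N; case: (p.2 == 0)%N; rewrite /= !expr1n ?mulr1 ?mul1r //.
have nz0 (x : 'rV[K]_2) : (exists j, x 0 j != 0) -> x != 0.
  by case=> j; apply: contra_neq => ->; rewrite mxE.
have nzu (x : K) (b : bool) : \row_(j < 2) (if (j == 0) == b then x else 1) != 0 :> 'rV[K]_2.
  apply: nz0; case: b; [exists 1 | exists 0]; by rewrite mxE /= oner_neq0.
exists (segre22 u u'); last first.
  have -> : w = la *: segre22 u u' + w 0 (inord 9) *: delta_mx 0 ord_max.
    apply/rowP; apply: forall_ord => k k10; rewrite vertexE.
    rewrite [RHS]mxE [X in X + _]mxE [X in _ + X]mxE [delta_mx _ _ _ _]mxE eqxx -val_eqE /= !inordK //.
    have [k9|k9] := ltnP k 9; last first.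
      have -> : k = 9%N by apply/eqP; rewrite eqn_leq k9 andbT.
      by rewrite [segre22 _ _ _ _]mxE inordK //= mulr0 add0r mulr1.
    rewrite (ltn_eqF k9) mulr0 addr0 yE // mulrA; case: wc => [wc|wc].
      rewrite (toric_chart okc Vw.2 wc) /chart_coord inordK // k9 //.
    by rewrite wc // /la wc // !mul0r.
  by apply: addmx_sub_adds; apply: scalemx_sub.
split.
  apply: contraTneq isT => E; have := congr1 (fun z : 'rV[K]_10 => z 0 (inord (corner17 c))) E.
  by rewrite yE // e0 !expr0 mulr1 mxE => /eqP; rewrite oner_eq0.
by exists u, u'; split; [exact: nzu | exact: nzu | exact: same_refl].
Qed.

Lemma join17 (i : 'I_5) (a b : K) : i != ord_max -> (a != 0) || (b != 0) ->
  V (a *: vertex17 K i + b *: vertex17 K (ord_max : 'I_5)).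
Proof.
set c : nat := i => im ab; have c4 : (c < 4)%N by rewrite ltn_neqAle -ltnS ltn_ord andbT.
case/and5P: (corner17_okP c4) => ok _ _ _ _.
have [_ [l0 _ _] [e0 _ _] _ _] := chart_okP ok; have l10 := ltnW l0 : (corner17 c < 10)%N.
have vE k : (k < 10)%N -> (a *: vertex17 K c + b *: vertex17 K 4) 0 (inord k) =
    a * (k == corner17 c)%:R + b * (k == 9%N)%:R.
  move=> k10; rewrite mxE [X in X + _]mxE [X in _ + X]mxE ![delta_mx _ _ _ _]mxE.
  by rewrite !eqxx -!val_eqE /= !inordK.
split.
  apply: contraTneq ab => E.
  have := congr1 (fun z : 'rV[K]_10 => z 0 (inord 9)) E.
  have := congr1 (fun z : 'rV[K]_10 => z 0 (inord (corner17 c))) E.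
  rewrite !vE // !eqxx (ltn_eqF l0) eq_sym (ltn_eqF l0) !mulr0 !mulr1 addr0 add0r !mxE => -> ->.
  by rewrite eqxx.
have := chart_coord_relations ok a 0 0 b; congr (toric_relations tab17 _).
apply: funext; apply: forall_ord => k k10; rewrite vE // inordK // /chart_coord.
have [k9|k9] := ltnP k 9; last first.
  have -> : k = 9%N by apply/eqP; rewrite eqn_leq k9 andbT.
  by rewrite eqxx [_ == corner17 c]eq_sym (ltn_eqF l0) mulr0 add0r mulr1.
have ok2 : all2 9 (fun c k => (c < 4)%N ==>
  (((nth (0, 0) (exponents17 c) k).1 + (nth (0, 0) (exponents17 c) k).2 == 0)%N == (k == corner17 c))) by vm_compute.
have := all2P ok2 (leq_trans c4 _) k9; clear ok2; rewrite c4 => /(_ isT)/eqP <-.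
by rewrite (ltn_eqF k9) mulr0 addr0 addn_eq0 !expr0n -mulrA -natrM mulnb.
Qed.

Lemma fixed17 (v : 'rV[K]_10) : V v ->
  (forall i : 'I_10, odd i -> (v *m 1%:M) 0 i = 0) \/
  (forall i : 'I_10, ~~ odd i -> (v *m 1%:M) 0 i = 0) ->
  exists i : 'I_5, (v == vertex17 K i)%MS.
Proof.
rewrite mulmx1 => Vv h.
have single c : (c < 5)%N -> (forall k, (k < 10)%N -> k != corner17 c -> v 0 (inord k) = 0) ->
    exists i : 'I_5, (v == vertex17 K i)%MS.
  move=> c5 hc; exists (Ordinal c5); apply/eqrVP; exists (v 0 (inord (corner17 c))).
    apply: contraNneq Vv.1 => v0; apply/eqP/rowP; apply: forall_ord => k k10.
    by rewrite [RHS]mxE; have [->//|kc] := eqVneq k (corner17 c); exact: hc.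
  have c10 : (corner17 c < 10)%N by exact: (@allnP 5 (fun c => corner17 c < 10)%N c isT c5).
  apply/rowP; apply: forall_ord => k k10; rewrite [RHS]mxE [X in _ * X]mxE eqxx -val_eqE /= !inordK //.
  by have [->|kc] := eqVneq k (corner17 c); rewrite ?mulr1 ?mulr0 //; exact: hc.
case: h => h; last first.
  apply: (single 4%N) => // k k10 k9; apply: corner17_zero => // [c c4|].
    apply: h; rewrite inordK; last by exact: (@allnP 5 (fun c => corner17 c < 10)%N c isT (leqW c4)).
    by exact: (@allnP 4 (fun c => ~~ odd (corner17 c)) c isT c4).
  by rewrite ltn_neqAle k9.
have [h'|h'] := pselect (exists c, (c < 4)%N /\ v 0 (inord (corner17 c)) != 0); last first.
  case/eqP: Vv.1; apply/rowP; apply: forall_ord => k k10; rewrite [RHS]mxE.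
  have [k9|k9] := ltnP k 9.
    apply: corner17_zero => // c c4; apply/eqP/negPn/negP => vc; apply: h'; by exists c.
  by apply: h; rewrite inordK //; have -> : k = 9%N by apply/eqP; rewrite eqn_leq k9 andbT.
have [c [c4 vc]] := h'; apply: (single c); first exact: leqW.
move=> k k10 kc; have [ko|ke] := boolP (odd k); first by apply: h; rewrite inordK.
have ok : all2 10 (fun c k => [|| ~~ (c < 4)%N, k == corner17 c, odd k | has (fun a => has (fun b =>
   odd a && same_weight 9 tab17 k (corner17 c) a b) (iota 0 10)) (iota 0 10)]) by vm_compute.
have := all2P ok (leq_trans c4 _) k10; clear ok; rewrite c4 (negPf kc) (negPf ke) !orFb => /(_ isT).
case/hasP => a; rewrite mem_iota add0n => /andP[_ ha] /hasP[b]; rewrite mem_iota add0n => /andP[_ hb].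
case/andP => ao hw; have c10 : (corner17 c < 10)%N by exact: (@allnP 5 (fun c => corner17 c < 10)%N c isT (leqW c4)).
have := Vv.2 (inord k) (inord (corner17 c)) (inord a) (inord b); rewrite !inordK // => /(_ hw).
by rewrite (h (inord a)) ?inordK // mul0r => /eqP; rewrite mulf_eq0 (negPf vc) orbF => /eqP.
Qed.

Lemma corner17_lt c : (c < 5)%N -> (corner17 c < 10)%N.
Proof. by move=> c5; exact: (@allnP 5 (fun c => corner17 c < 10)%N c isT c5). Qed.

Lemma tau_vertex17 c : (c < 5)%N -> tau17 (vertex17 K c) = (-1) ^+ odd (corner17 c) *: vertex17 K c.
Proof.
move=> c5; apply/rowP => k; rewrite tau17E [RHS]mxE !mxE eqxx /=.
by have [->|_] := eqVneq k (inord (corner17 c)); rewrite ?mulr0 // inordK // corner17_lt.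
Qed.

Lemma vertex17_inj (i j : 'I_5) : (vertex17 K i == vertex17 K j)%MS -> i = j.
Proof.
case/eqrVP => c _ /(congr1 (fun v : 'rV[K]_10 => v 0 (inord (corner17 i)))).
rewrite !mxE !eqxx -val_eqE /= !inordK ?corner17_lt //.
have ok : all2 5 (fun i j => (corner17 i == corner17 j) == (i == j)) by vm_compute.
rewrite (eqP (all2P ok (ltn_ord i) (ltn_ord j))); case: eqP => [ij _|_ /eqP]; first exact/val_inj.
by rewrite mulr0 oner_eq0.
Qed.

Lemma vertex17_in (i : 'I_5) : V (vertex17 K i).
Proof.
have [i4|i4] := ltnP i 4; first exact: vertex17_cone.
have -> : (i : nat) = 4%N by apply/eqP; rewrite eqn_leq i4 andbT -ltnS.
exact: apex17_cone.
Qed.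

Lemma charts17 (v : 'rV[K]_10) : V v -> (exists i : 'I_10, ~~ odd i /\ (v *m 1%:M) 0 i != 0) ->
  exists ex i0 i1 i2, chart_ok 9 tab17 ex i0 i1 i2 /\ v 0 (inord i0) != 0.
Proof.
move=> Vv [i [io vi]]; rewrite mulmx1 in vi.
have [[c [c4 vc]]|h] := pselect (exists c, (c < 4)%N /\ v 0 (inord (corner17 c)) != 0).
  exact: corner17_charts vc.
case/eqP: vi; rewrite -(inord_val i); apply: corner17_zero => // [c c4|].
  by apply/eqP/negPn/negP => vc; apply: h; exists c.
by rewrite ltn_neqAle -ltnS ltn_ord andbT; apply: contra io => /eqP ->.
Qed.

Lemma index_lt4 (i : 'I_5) : i != ord_max -> (i < 4)%N.
Proof. by rewrite ltn_neqAle -ltnS ltn_ord andbT. Qed.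

Lemma vertex17_even (i : 'I_5) : i != ord_max -> tau17 (vertex17 K i) = vertex17 K i.
Proof.
move=> /index_lt4 i4; rewrite tau_vertex17 1?ltnW // (_ : odd _ = false) ?scale1r //.
by apply/negbTE; exact: (@allnP 4 (fun c => ~~ odd (corner17 c)) i isT i4).
Qed.

Lemma vertex17_odd : tau17 (vertex17 K (ord_max : 'I_5)) = - vertex17 K (ord_max : 'I_5).
Proof. by rewrite tau_vertex17 //= expr1 scaleN1r. Qed.

Lemma vertex17_singular (i : 'I_5) :
  singular_point 3 (image_of V (quadrics17 K)) (poly_map (quadrics17 K) (vertex17 K i)).
Proof.
rewrite phi_vertex17 //; have [->|/index_lt4 i4] := eqVneq i ord_max; first exact: apex17_singular.
exact: corner17_singular.
Qed.

Lemma vertex17_cones : let W := image_of V (quadrics17 K) in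
  let P (i : 'I_5) := poly_map (quadrics17 K) (vertex17 K i) in
  (forall i, i != ord_max -> multiplicity 3 W (P i) 4 /\ cone_over_veronese (tangent_cone W (P i))) /\
  (multiplicity 3 W (P ord_max) 6 /\ cone_over_four_planes_quadric (tangent_cone W (P ord_max))).
Proof.
split=> [i /index_lt4 i4|]; rewrite phi_vertex17 //.
  by split; [exact: corner17_multiplicity | exact: corner17_cone].
by split; [exact: apex17_multiplicity | exact: apex17_tangent_cone].
Qed.

End Genus17Theorem.

(** * The cone over the sextic Del Pezzo surface *)

Definition tab13 : seq (nat * nat) :=
  [:: (0, 2); (0, 1); (2, 0); (1, 0); (2, 1); (1, 2); (1, 1)]%N.

(** The first six points in cyclic order around the seventh one. *)
Definition hex : seq nat := [:: 0; 1; 3; 2; 4; 5]%N.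

Definition hexpoint i : nat := nth 0%N hex (i %% 6).

Definition std13 (i j : nat) : bool :=
  let p := index i hex in let p' := index j hex in
  [|| i == j, (6 <= i)%N, (6 <= j)%N, (p.+1 %% 6 == p')%N | (p'.+1 %% 6 == p)%N].

Definition cells13 : seq (seq nat) := [seq [:: 6; hexpoint i; hexpoint i.+1]%N | i <- iota 0 6].

Lemma red13 : reduction_ok 7 tab13 std13 (fun k => (k < 6)%N : nat).
Proof. by vm_compute. Qed.

Lemma cells13_ok : cells_ok 7 std13 cells13.
Proof. by vm_compute. Qed.

Lemma std_uniq13 (mm mm' : 'X_{1..8}) :
  std_monomial 7 std13 (exponents (n := 7) mm) -> std_monomial 7 std13 (exponents (n := 7) mm') ->
  monomial_weight tab13 mm = monomial_weight tab13 mm' -> mm = mm'.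
Proof.
move=> /(std_cell cells13_ok)[c cc hc] /(std_cell cells13_ok)[c' cc' hc'] E.
have {}E k (k4 : (k < 4)%N) := congr1 (fun m : 'X_{1..4} => m (inord k)) E.
have := E 0%N isT; have := E 1%N isT; have := E 2%N isT; have := E 3%N isT.
rewrite !monomial_weightE //= !big_cons !big_nil /point_weight /=.
move=> E3 E2 E1 E0; apply: exponents_inj; move: hc hc' E0 E1 E2 E3.
move: (exponents (n := 7) mm) (exponents (n := 7) mm') => f g /=.
move: (f 0%N) (f 1%N) (f 2%N) (f 3%N) (f 4%N) (f 5%N) (f 6%N) (f 7%N).
move: (g 0%N) (g 1%N) (g 2%N) (g 3%N) (g 4%N) (g 5%N) (g 6%N) (g 7%N).
move: cc cc'; rewrite !inE => cc cc'.
repeat match goal with H : is_true (_ || _) |- _ => move/orP: H => [H|H] end;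
  rewrite (eqP cc) (eqP cc') /=; lia.
Qed.

(** A standard pair with the same weight. *)
Definition normal_pair13 (i j : nat) : nat * nat :=
  let p := index i hex in let p' := index j hex in
  if std13 i j then (minn i j, maxn i j)
  else if ((p + 3) %% 6 == p')%N then (6, 6)%N
  else if ((p + 2) %% 6 == p')%N then (hexpoint p.+1, 6)%N else (hexpoint p'.+1, 6)%N.

Section Toric13.
Variable K : numClosedFieldType.
Local Notation V := (@toric_cone K 7 tab13).

Definition hexagon_relations (x : nat -> K) : Prop := forall i, (i < 6)%N ->
  x (hexpoint i) * x (hexpoint i.+2) = x (hexpoint i.+1) * x 6%N /\
  x (hexpoint i) * x (hexpoint i.+3) = x 6%N * x 6%N.

Lemma hexagon_normal x i j : hexagon_relations x -> (i < 8)%N -> (j < 8)%N ->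
  x i * x j = x (normal_pair13 i j).1 * x (normal_pair13 i j).2.
Proof.
move=> h hi hj; have [] := h 0%N isT; have [] := h 1%N isT; have [] := h 2%N isT.
have [] := h 3%N isT; have [] := h 4%N isT; have [] := h 5%N isT.
rewrite /normal_pair13 /hexpoint /=; do 12!move=> ?; clear h.
by case: i hi => [|[|[|[|[|[|[|[|i]]]]]]]] // _; case: j hj => [|[|[|[|[|[|[|[|j]]]]]]]] // _;
  first [reflexivity | exact: mulrC | assumption | rewrite mulrC; assumption].
Qed.

(** The binomial relations of degree two follow from those between vertices of the
    hexagon at distance two or three. *)
Lemma hexagonP (v : 'rV[K]_8) : hexagon_relations (entry v) <-> toric_relations tab13 (v 0).
Proof.
split=> [h i j i' j' ww|h i i6]; last first.
  have ok : all (fun i =>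
     same_weight 7 tab13 (hexpoint i) (hexpoint i.+2) (hexpoint i.+1) 6 &&
     same_weight 7 tab13 (hexpoint i) (hexpoint i.+3) 6 6) (iota 0 6) by vm_compute.
  have lt k : (hexpoint k < 8)%N by apply: (@allP _ (fun k => k < 8)%N hex isT); rewrite mem_nth ?ltn_mod.
  have /andP[h1 h2] := allnP ok i6; clear ok.
  by split; apply: h; rewrite !inordK.
have ok : all4 8 (fun i j i' j' => same_weight 7 tab13 i j i' j' ==>
  (normal_pair13 i j == normal_pair13 i' j')) by vm_compute.
have := all4P i j i' j' ok; clear ok; rewrite ww => /eqP E.
have xE (k : 'I_8) : v 0 k = entry v k by rewrite /entry inord_val.
by rewrite !xE (hexagon_normal h) // E -(hexagon_normal h).
Qed.

Lemma hexagon_cone (v v' : 'rV[K]_8) : v' != 0 -> toric_relations tab13 (v 0) ->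
  (forall k, (k < 7)%N -> entry v' k = entry v k) -> V v'.
Proof.
move=> v'0 /hexagonP h E; split=> //; apply/hexagonP => i i6.
have lt k : (hexpoint k < 7)%N by apply: (@allP _ (fun k => k < 7)%N hex isT); rewrite mem_nth ?ltn_mod.
by rewrite !E //; exact: h.
Qed.

(** ** The cone over the closure of the image of the plane *)

Definition cubic_exponents (k : nat) : seq nat :=
  nth [::] [:: [:: 0; 2; 1]; [:: 0; 1; 2]; [:: 2; 0; 1]; [:: 1; 0; 2];
               [:: 2; 1; 0]; [:: 1; 2; 0]; [:: 1; 1; 1]]%N k.

(** The monomial at the vertex [i] of the hexagon is [u_a^2 u_b]; [u_c] is the
    remaining variable. *)
Definition vertex_variables (i : nat) : nat * nat * nat :=
  nth (0, 0, 0)%N [:: (1, 2, 0); (2, 1, 0); (0, 2, 1); (2, 0, 1); (0, 1, 2); (1, 0, 2)]%N i.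

Definition exponents13 (i : nat) : seq (nat * nat) :=
  let e k j := nth 0%N (cubic_exponents k) j in let: (a, b, c) := vertex_variables i in
  [seq ((e k b + e k c).-1, e k c) | k <- iota 0 7].

Definition neighbours13 (i : nat) : nat * nat :=
  let p := index i hex in
  if odd p then (hexpoint (p + 5), hexpoint p.+1) else (hexpoint p.+1, hexpoint (p + 5)).

Lemma chart13 i : (i < 6)%N ->
  chart_ok 7 tab13 (exponents13 i) i (neighbours13 i).1 (neighbours13 i).2.
Proof.
by apply: (@allnP 6 (fun i => chart_ok 7 tab13 (exponents13 i) i (neighbours13 i).1 (neighbours13 i).2)); vm_compute.
Qed.

Lemma cubics6E (u : 'rV[K]_3) k : (k < 7)%N -> entry (cubics6 u) k =
  entry u 0 ^+ nth 0%N (cubic_exponents k) 0 * entry u 1 ^+ nth 0%N (cubic_exponents k) 1 *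
  entry u 2 ^+ nth 0%N (cubic_exponents k) 2.
Proof.
move=> k7; have k8 := ltnW k7 : (k < 8)%N; rewrite {1}/entry mxE inordK //.
by case: k k7 {k8} => [|[|[|[|[|[|[|k]]]]]]] //= _; rewrite ?expr0 ?expr1 ?mul1r ?mulr1.
Qed.

Lemma cubics6_last (u : 'rV[K]_3) : entry (cubics6 u) 7 = 0.
Proof. by rewrite /entry mxE inordK. Qed.

Lemma cubics6_relations (u : 'rV[K]_3) : toric_relations tab13 (cubics6 u 0).
Proof.
apply/hexagonP => i; have e k := cubics6E u (k := k).
have e0 := e 0%N isT; have e1 := e 1%N isT; have e2 := e 2%N isT; have e3 := e 3%N isT.
have e4 := e 4%N isT; have e5 := e 5%N isT; have e6 := e 6%N isT; clear e.
rewrite /= in e0 e1 e2 e3 e4 e5 e6.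
by case: i => [|[|[|[|[|[|i]]]]]] // _; rewrite /hexpoint /= ?e0 ?e1 ?e2 ?e3 ?e4 ?e5 ?e6; split; ring.
Qed.

Lemma surfaceS6_relations (y : 'rV[K]_8) : surfaceS6 y -> toric_relations tab13 (y 0) /\ entry y 7 = 0.
Proof.
move=> [y0 hy]; split=> [i j i' j' h|].
  have := hy ('X_i * 'X_j - 'X_i' * 'X_j'); rewrite mevalB !mevalM !mevalXU => E.
  apply/eqP; rewrite -subr_eq0; apply/eqP/E => z [z0 [u u0 /eqrVP[c c0 zE]]].
  rewrite mevalB !mevalM !mevalXU zE; apply/eqP; rewrite subr_eq0; apply/eqP.
  have scE (k : 'I_8) : (c *: cubics6 u) 0 k = c * cubics6 u 0 k by rewrite mxE.
  by rewrite !scE mulrACA (cubics6_relations u h) [RHS]mulrACA.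
have := hy 'X_(inord 7); rewrite mevalXU; apply => z [z0 [u u0 /eqrVP[c c0 ->]]].
by rewrite mevalXU mxE -[_ 0 _]/(entry _ _) cubics6_last mulr0.
Qed.

Lemma vertex_cubic i be t : (i < 6)%N -> exists u : 'rV[K]_3, forall k, (k < 7)%N ->
  entry (cubics6 u) k =
  t * (t ^+ (nth (0, 0)%N (exponents13 i) k).1 * be ^+ (nth (0, 0)%N (exponents13 i) k).2).
Proof.
move=> i6; pose abc := vertex_variables i.
exists (\row_j if (j : nat) == abc.1.1 then 1 else if (j : nat) == abc.1.2 then t else t * be) => k k7.
rewrite cubics6E // /entry !mxE !inordK //.
case: i i6 @abc => [|[|[|[|[|[|i]]]]]] //= _;
  case: k k7 => [|[|[|[|[|[|[|k]]]]]]] //= _; rewrite ?expr1n; ring.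
Qed.

(** In the parameters (1, t, t be) of the plane the cubics are t times the
    coordinates of the chart; dividing by t extends this to t = 0. *)
Lemma chart_in_closure i (la al be : K) : (i < 6)%N -> la != 0 ->
  surfaceS6 (\row_(k < 8) chart_coord 7 (exponents13 i) la al be 0 k).
Proof.
move=> i6 la0; have i8 : (i < 8)%N by apply: ltn_trans i6 _.
have [_ [l0 _ _] [e0 _ _] _ _] := chart_okP (chart13 i6).
have val0 t : entry (\row_(k < 8) chart_coord 7 (exponents13 i) la t be 0 k) i = la.
  by rewrite /entry mxE inordK // /chart_coord l0 e0 !expr0 !mulr1.
have nz t : \row_(k < 8) chart_coord 7 (exponents13 i) la t be 0 k != 0.
  by apply: contra_neq la0 => E; rewrite -(val0 t) E /entry mxE.
split=> // F F0; pose e k := nth (0, 0)%N (exponents13 i) k.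
have [P [hP _]] := arc_deriv F (fun k : 'I_8 =>
  if (k < 7)%N then (la * be ^+ (e k).2) *: 'X^((e k).1) else 0).
have {}hP t : P.[t] = F.@[(\row_(k < 8) chart_coord 7 (exponents13 i) la t be 0 k) 0].
  rewrite hP; apply: meval_eq => k; rewrite mxE /chart_coord -/(e k); case: ifP => _; last by rewrite horner0.
  by rewrite hornerZ hornerXn mulrAC.
rewrite -hP; suff /eqP : P * 'X = 0.
  by rewrite mulf_eq0 polyX_eq0 orbF => /eqP ->; rewrite horner0.
apply: poly_eval_eq0 => t; rewrite hornerM hornerX.
have [->|t0] := eqVneq t 0; first by rewrite mulr0.
have [u uE] := vertex_cubic be t i6.
have E : \row_(k < 8) chart_coord 7 (exponents13 i) la t be 0 k = (la / t) *: cubics6 u.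
  apply/rowP; apply: forall_ord => k k8; rewrite [LHS]mxE [RHS]mxE -[cubics6 u 0 _]/(entry _ _) inordK //.
  rewrite /chart_coord; have [k7|k7] := ltnP k 7; first by rewrite uE // -/(e k) [RHS]mulrA divfK // mulrA.
  have -> : k = 7%N by apply/eqP; rewrite eqn_leq k7 andbT.
  by rewrite cubics6_last mulr0.
have u0 : cubics6 u != 0 by apply: contraNneq (nz t) => u0; rewrite E u0 scaler0.
rewrite hP F0 ?mul0r //; split=> //; exists u => //; apply/eqrVP; exists (la / t) => //.
by rewrite mulf_neq0 ?invr_eq0.
Qed.

Lemma vertex13 (v : 'rV[K]_8) : toric_relations tab13 (v 0) ->
  (exists2 i, (i < 6)%N & entry v i != 0) \/ (forall k, (k < 7)%N -> entry v k = 0).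
Proof.
move=> /hexagonP h; have [|h0] := pselect (exists2 i, (i < 6)%N & entry v i != 0); first by left.
right=> k k7; have {}h0 i : (i < 6)%N -> entry v i = 0.
  by move=> i6; apply/eqP/negPn/negP => vi; apply: h0; exists i.
have [|k6] := ltnP k 6; first exact: h0.
have -> : k = 6%N by apply/eqP; rewrite eqn_leq k6 andbT.
have [_ /eqP] := h 0%N isT; rewrite [entry v (hexpoint 0)]h0 // mul0r eq_sym mulf_eq0 orbb.
by move/eqP.
Qed.

Lemma V13_toric : @V13 K = V.
Proof.
have vertexE : delta_mx 0 ord_max = delta_mx 0 (inord 7) :> 'rV[K]_8.
  by congr (delta_mx _ _); apply/val_inj; rewrite /= inordK.
have sumE (y : 'rV[K]_8) a b k : (k < 8)%N ->
    entry (a *: y + b *: delta_mx 0 ord_max) k = a * entry y k + b * (k == 7%N)%:R.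
  move=> k8; rewrite /entry vertexE mxE [X in X + _]mxE [X in _ + X]mxE [delta_mx _ _ _ _]mxE.
  by rewrite eqxx -val_eqE /= !inordK.
apply: funext => w; apply: propext; split.
- move=> [w0 [y /surfaceS6_relations[yr y7] /sub_addsmxP[[x1 x2] /= wE]]].
  pose a := x1 0 0; pose v : 'rV[K]_8 := a *: y.
  apply: (@hexagon_cone v) => // [i j i' j' h|k k7].
    by rewrite !mxE mulrACA (yr _ _ _ _ h) [RHS]mulrACA.
  rewrite wE [x1]mx11_scalar [x2]mx11_scalar !mul_scalar_mx sumE; last exact: ltnW.
  by rewrite (ltn_eqF k7) mulr0 addr0 /v /entry mxE.
move=> Vw; split; first exact: Vw.1.
have [[i i6 wi]|w0] := vertex13 Vw.2; last first.
  exists (\row_(k < 8) chart_coord 7 (exponents13 0) 1 1 1 0 k).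
    by apply: chart_in_closure; rewrite ?oner_eq0.
  have -> : w = 0 *: (\row_(k < 8) chart_coord 7 (exponents13 0) 1 1 1 0 k) + entry w 7 *: delta_mx 0 ord_max.
    apply/rowP; apply: forall_ord => k k8; rewrite -![_ 0 (inord k)]/(entry _ k) sumE // mul0r add0r.
    have [k7|k7] := ltnP k 7; first by rewrite w0 // (ltn_eqF k7) mulr0.
    have -> : k = 7%N by apply/eqP; rewrite eqn_leq k7 andbT.
    by rewrite mulr1.
  by apply: addmx_sub_adds; apply: scalemx_sub.
pose ch := chart_coord 7 (exponents13 i) (entry w i) (entry w (neighbours13 i).1 / entry w i)
  (entry w (neighbours13 i).2 / entry w i).
exists (\row_(k < 8) ch 0 k); first exact: chart_in_closure.
have -> : w = 1 *: (\row_(k < 8) ch 0 k) + entry w 7 *: delta_mx 0 ord_max.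
  apply/rowP; apply: forall_ord => k k8; rewrite -![_ 0 (inord k)]/(entry _ k) sumE // mul1r.
  rewrite {1}/entry (toric_chart (chart13 i6) Vw.2 wi) [entry (\row_ _ _) _]mxE /ch /chart_coord inordK //.
  have [k7|k7] := ltnP k 7; first by rewrite (ltn_eqF k7) mulr0 addr0.
  have -> : k = 7%N by apply/eqP; rewrite eqn_leq k7 andbT.
  by rewrite mulr1 add0r /entry; congr (w 0 _); apply/val_inj; rewrite /= inordK.
by apply: addmx_sub_adds; apply: scalemx_sub.
Qed.

End Toric13.

(** ** Linear forms given by lists *)

Notation "c *z k" := (c%R, k%N) (at level 40, only parsing).

Section LinearForms.
Variable K : numClosedFieldType.

Definition form_val n (L : seq (K * nat)) (f : 'I_n.+1 -> K) : K :=
  \sum_(t <- L) t.1 * f (inord t.2).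

Definition form_row n (L : seq (K * nat)) : 'rV[K]_n.+1 :=
  \row_k \sum_(t <- L) t.1 * ((k : nat) == t.2)%:R.

Definition form_bound n (L : seq (K * nat)) : bool := all (fun t => t.2 < n.+1)%N L.

Lemma form_row_sum n L (f : 'I_n.+1 -> K) : form_bound n L ->
  \sum_k form_row n L 0 k * f k = form_val L f.
Proof.
move=> /allP ok; under eq_bigr do rewrite mxE mulr_suml.
rewrite exchange_big /form_val /= big_seq [RHS]big_seq; apply: eq_bigr => t tL.
rewrite (bigD1 (inord t.2)) //= inordK ?ok // eqxx mulr1 big1 ?addr0 // => k kt.
case: eqP => [E|_]; last by rewrite mulr0 mul0r.
by case/eqP: kt; apply/val_inj; rewrite /= inordK ?ok.
Qed.

Definition form_mx m n (L : seq (seq (K * nat))) : 'M[K]_(m.+1, n.+1) :=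
  \matrix_(i, j) form_row m (nth [::] L j) 0 i.

Lemma form_mxE m n L (u : 'rV[K]_m.+1) j : (j < n.+1)%N -> form_bound m (nth [::] L j) ->
  (u *m form_mx m n L) 0 (inord j) = form_val (nth [::] L j) (u 0).
Proof.
move=> jn ok; rewrite -form_row_sum // mxE; apply: eq_bigr => k _.
by rewrite mxE inordK // mulrC.
Qed.

Lemma mx_eq1 n (A : 'M[K]_n) : (forall u : 'rV[K]_n, u *m A = u) -> A = 1%:M.
Proof. by move=> h; apply/row_matrixP => i; rewrite rowE h row1. Qed.

Definition products_quadric n (s : seq (K * seq (K * nat) * seq (K * nat))) : {mpoly K[n.+1]} :=
  let form L := \sum_(t <- L) t.1 *: 'X_(inord t.2) in
  \sum_(t <- s) t.1.1 *: (form t.1.2 * form t.2).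

Lemma products_quadric_homog n s : products_quadric n s \is 2.-homog.
Proof.
have form L : (\sum_(t <- L) t.1 *: 'X_(inord t.2) : {mpoly K[n.+1]}) \is 1.-homog.
  by apply: rpred_sum => t _; rewrite rpredZ // dhomogX /= mdeg1.
by apply: rpred_sum => t _; rewrite rpredZ // -[2%N]/(1 + 1)%N dhomogM.
Qed.

Lemma products_quadric_eval n s (f : 'I_n.+1 -> K) : (products_quadric n s).@[f] =
  \sum_(t <- s) t.1.1 * (form_val t.1.2 f * form_val t.2 f).
Proof.
have form L : (\sum_(t <- L) t.1 *: 'X_(inord t.2) : {mpoly K[n.+1]}).@[f] = form_val L f.
  by rewrite raddf_sum; apply: eq_bigr => t _; rewrite /= mevalZ mevalXU.
by rewrite raddf_sum; apply: eq_bigr => t _; rewrite /= mevalZ mevalM !form.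
Qed.

Lemma ddir_products_quadric n s (v u : 'I_n.+1 -> K) : ddir (products_quadric n s) v u =
  \sum_(t <- s) t.1.1 * (form_val t.1.2 u * form_val t.2 v + form_val t.1.2 v * form_val t.2 u).
Proof.
have form L : (\sum_(t <- L) t.1 *: 'X_(inord t.2) : {mpoly K[n.+1]}).@[v] = form_val L v.
  by rewrite raddf_sum; apply: eq_bigr => t _; rewrite /= mevalZ mevalXU.
have dform L : ddir (\sum_(t <- L) t.1 *: 'X_(inord t.2) : {mpoly K[n.+1]}) v u = form_val L u.
  by rewrite ddir_sum; apply: eq_bigr => t _; rewrite ddirZ ddirX.
rewrite ddir_sum; apply: eq_bigr => t _; rewrite ddirZ ddirM !form !dform.
by rewrite [_ * form_val t.2 u]mulrC; congr (_ * (_ + _)); rewrite mulrC.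
Qed.

End LinearForms.

(** * The case of genus 13 *)

Definition z13 (A : comRingType) (x : nat -> A) : seq A :=
  [:: x 6%N ^+ 2; x 0%N ^+ 2 + x 2%N ^+ 2; x 1%N ^+ 2 + x 4%N ^+ 2; x 3%N ^+ 2 + x 5%N ^+ 2;
      (x 0%N + x 2%N) * x 6%N; (x 1%N + x 4%N) * x 6%N; (x 3%N + x 5%N) * x 6%N;
      x 0%N * x 1%N + x 2%N * x 4%N; x 2%N * x 3%N + x 0%N * x 5%N; x 1%N * x 3%N + x 4%N * x 5%N;
      (x 0%N - x 2%N) * x 7%N; (x 1%N - x 4%N) * x 7%N; (x 3%N - x 5%N) * x 7%N; x 7%N ^+ 2].

Definition terms13 (k : nat) : seq (bool * (nat * nat)) := let t a b := (false, (a, b)) in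
  nth [::] [:: [:: t 6 6]; [:: t 0 0; t 2 2]; [:: t 1 1; t 4 4]; [:: t 3 3; t 5 5];
    [:: t 0 6; t 2 6]; [:: t 1 6; t 4 6]; [:: t 3 6; t 5 6];
    [:: t 0 1; t 2 4]; [:: t 2 3; t 0 5]; [:: t 1 3; t 4 5];
    [:: t 0 7; (true, (2, 7))]; [:: t 1 7; (true, (4, 7))]; [:: t 3 7; (true, (5, 7))];
    [:: t 7 7]]%N k.

Section Genus13.
Variable K : numClosedFieldType.
Local Notation V := (@toric_cone K 7 tab13).
Local Notation h := (2^-1 : K).
Local Notation q := (4^-1 : K).

Lemma quadric13_value k (v : 'rV[K]_8) : (k < 14)%N ->
  (tnth (quadrics13 K) (inord k)).@[v 0] = nth 0 (z13 (entry v)) k.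
Proof.
move=> hk; rewrite (tnth_nth 0) inordK //.
by do 14![case: k hk => [_|k hk]; first by
  rewrite /= /x13 ?expr2 ?(mevalB, mevalD, mevalM, mevalXU)].
Qed.

Lemma terms13_value k (v : 'rV[K]_8) : (k < 14)%N ->
  nth 0 (z13 (entry v)) k = \sum_(t <- terms13 k) (-1) ^+ t.1 * (v 0 (inord t.2.1) * v 0 (inord t.2.2)).
Proof.
move=> hk; do 14![case: k hk => [_|k hk]; first by
  rewrite /= !big_cons big_nil /= -![v 0 _]/(entry v _); ring].
by [].
Qed.

(** The columns are the halves of the sums and of the differences of opposite
    coordinates, and the two other coordinates. *)
Definition halves13 : seq (seq (K * nat)) :=
  [:: [:: h *z 0; h *z 2]; [:: h *z 1; h *z 4]; [:: h *z 3; h *z 5];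
      [:: h *z 0; (- h) *z 2]; [:: h *z 1; (- h) *z 4]; [:: h *z 3; (- h) *z 5];
      [:: 1 *z 6]; [:: 1 *z 7]].

Definition halves_inv13 : seq (seq (K * nat)) :=
  [:: [:: 1 *z 0; 1 *z 3]; [:: 1 *z 1; 1 *z 4]; [:: 1 *z 0; (-1) *z 3]; [:: 1 *z 2; 1 *z 5];
      [:: 1 *z 1; (-1) *z 4]; [:: 1 *z 2; (-1) *z 5]; [:: 1 *z 6]; [:: 1 *z 7]].

Definition M13 : 'M[K]_8 := form_mx 7 7 halves13.

Lemma M13E (v : 'rV[K]_8) k : (k < 8)%N -> (v *m M13) 0 (inord k) =
  nth 0 [:: (entry v 0 + entry v 2) / 2; (entry v 1 + entry v 4) / 2; (entry v 3 + entry v 5) / 2;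
            (entry v 0 - entry v 2) / 2; (entry v 1 - entry v 4) / 2; (entry v 3 - entry v 5) / 2;
            entry v 6; entry v 7] k.
Proof.
move=> hk; rewrite form_mxE //; last by case: k hk => [|[|[|[|[|[|[|[|k]]]]]]]].
do 8![case: k hk => [_|k hk]; first by
  rewrite /form_val /= !big_cons big_nil /= -![v 0 _]/(entry v _); ring].
by [].
Qed.

Lemma M13_unit : M13 \in unitmx.
Proof.
suff h : M13 *m form_mx 7 7 halves_inv13 = 1%:M by case/mulmx1_unit: h.
apply: mx_eq1 => u; rewrite mulmxA; apply/rowP; apply: forall_ord => k hk.
rewrite form_mxE //; last by case: k hk => [|[|[|[|[|[|[|[|k]]]]]]]].
rewrite /form_val.
do 8![case: k hk => [_|k hk]; first by
  rewrite /= !big_cons big_nil /= !M13E //= -![u 0 _]/(entry u _); field].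
by [].
Qed.

Definition neg13 (i : 'I_8) : bool := (i : nat) \in [:: 3; 4; 5; 7]%N.

Definition tau_index (k : nat) : nat := nth 0%N [:: 2; 4; 0; 5; 1; 3; 6; 7]%N k.

Lemma tau13E (v : 'rV[K]_8) k : (k < 8)%N ->
  entry (tau13 v) k = (-1) ^+ (7 <= k)%N * entry v (tau_index k).
Proof.
move=> hk; rewrite {1}/entry mxE inordK //.
by do 8![case: k hk => [_|k hk]; first by rewrite /= ?expr0 ?expr1 ?mul1r ?mulN1r].
Qed.

Definition lift13 (a b : nat) : seq (K * nat) :=
  nth [::] (nth [::]
   [:: [:: [:: q *z 1; h *z 0]; [:: q *z 7; q *z 6]; [:: q *z 8; q *z 5]; [::]; [::]; [::]; [:: h *z 4]; [::]];
       [:: [:: q *z 7; q *z 6]; [:: q *z 2; h *z 0]; [:: q *z 9; q *z 4]; [::]; [::]; [::]; [:: h *z 5]; [::]];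
       [:: [:: q *z 8; q *z 5]; [:: q *z 9; q *z 4]; [:: q *z 3; h *z 0]; [::]; [::]; [::]; [:: h *z 6]; [::]];
       [:: [::]; [::]; [::]; [:: q *z 1; (- h) *z 0]; [:: q *z 7; (- q) *z 6]; [:: q *z 5; (- q) *z 8]; [::]; [:: h *z 10]];
       [:: [::]; [::]; [::]; [:: q *z 7; (- q) *z 6]; [:: q *z 2; (- h) *z 0]; [:: q *z 9; (- q) *z 4]; [::]; [:: h *z 11]];
       [:: [::]; [::]; [::]; [:: q *z 5; (- q) *z 8]; [:: q *z 9; (- q) *z 4]; [:: q *z 3; (- h) *z 0]; [::]; [:: h *z 12]];
       [:: [:: h *z 4]; [:: h *z 5]; [:: h *z 6]; [::]; [::]; [::]; [:: 1 *z 0]; [::]];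
       [:: [::]; [::]; [::]; [:: h *z 10]; [:: h *z 11]; [:: h *z 12]; [::]; [:: 1 *z 13]]] a) b.

Definition lift_row13 (a b : 'I_8) : 'rV[K]_14 := form_row 13 (lift13 a b).

Lemma hexagon_equations (v : 'rV[K]_8) : toric_relations tab13 (v 0) -> let x := entry v in
  [/\ x 0%N * x 2%N = x 6%N * x 6%N, x 1%N * x 4%N = x 6%N * x 6%N & x 3%N * x 5%N = x 6%N * x 6%N] /\
  [/\ x 0%N * x 3%N = x 1%N * x 6%N, x 1%N * x 2%N = x 3%N * x 6%N & x 3%N * x 4%N = x 2%N * x 6%N] /\
  [/\ x 2%N * x 5%N = x 4%N * x 6%N, x 4%N * x 0%N = x 5%N * x 6%N & x 5%N * x 1%N = x 0%N * x 6%N].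
Proof.
move/hexagonP => r x; have [a0 b0] := r 0%N isT; have [a1 b1] := r 1%N isT; have [a2 b2] := r 2%N isT.
by have [a3 _] := r 3%N isT; have [a4 _] := r 4%N isT; have [a5 _] := r 5%N isT.
Qed.

Lemma lift_row13_value (a b : 'I_8) (v : 'rV[K]_8) : neg13 a = neg13 b -> V v ->
  \sum_k lift_row13 a b 0 k * (tnth (quadrics13 K) k).@[v 0] = (v *m M13) 0 a * (v *m M13) 0 b.
Proof.
move=> ab [_ /hexagon_equations /=[[e1 e2 e3] [[e4 e5 e6] [e7 e8 e9]]]].
move: a b ab; apply: forall_ord => a ha; apply: forall_ord => b hb; rewrite /neg13 !inordK // => ab.
rewrite form_row_sum !inordK //; last first.
  by case: a ha ab => [|[|[|[|[|[|[|[|a]]]]]]]] //; case: b hb => [|[|[|[|[|[|[|[|b]]]]]]]].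
rewrite !M13E //; have z k := @quadric13_value k v.
move: e1 e2 e3 e4 e5 e6 e7 e8 e9 z; rewrite /z13.
move: (entry v 0) (entry v 1) (entry v 2) (entry v 3) (entry v 4) (entry v 5) (entry v 6) (entry v 7).
move=> x0 x1 x2 x3 x4 x5 x6 x7 e1 e2 e3 e4 e5 e6 e7 e8 e9 z.
case: a ha ab => [|[|[|[|[|[|[|[|a]]]]]]]] //= _; case: b hb => [|[|[|[|[|[|[|[|b]]]]]]]] //= _ _;
  rewrite /form_val !big_cons big_nil /= !z //=; clear z;
  first [by field: e1 e2 e3 | by field: e5 e8 | by field: e4 e7 | by field: e6 e9].
Qed.

Lemma quadrics13_independent (c : 'rV[K]_14) :
  (forall v, V v -> \sum_k c 0 k * (tnth (quadrics13 K) k).@[v 0] = 0) -> c = 0.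
Proof.
apply: (quadrics_independent (@chart13 0 isT) (terms := terms13)).
  by move=> k v hk; rewrite quadric13_value // terms13_value.
by vm_compute.
Qed.

Lemma data13 : invariant_quadrics V (@tau13 K) (quadrics13 K) M13 neg13 lift_row13.
Proof.
split.
- exact: M13_unit.
- by move=> v [].
- exact: toric_scale.
- exact: toric_closed.
- by move=> F; apply: (toric_ideal _ red13 std_uniq13).
- move=> v; apply: forall_ord => k hk; rewrite /neg13 inordK // !M13E // !tau13E //.
  do 8![case: k hk => [_|k hk]; first by rewrite /= ?expr0 ?expr1; ring].
  by [].
- move=> v [v0 /hexagonP vr]; split.
    apply: contra_neq v0 => E; apply/rowP; apply: forall_ord => k hk; rewrite [RHS]mxE.
    have hk' : (tau_index k < 8)%N by exact: (@allnP 8 (fun k => tau_index k < 8)%N k isT hk).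
    have kk : tau_index (tau_index k) = k by apply/eqP; exact: (@allnP 8 (fun k => tau_index (tau_index k) == k)%N k isT hk).
    have := tau13E v hk'; rewrite E kk [LHS]mxE => /eqP.
    by rewrite eq_sym mulf_eq0 signr_eq0 => /eqP.
  have [] := vr 0%N isT; have [] := vr 1%N isT; have [] := vr 2%N isT.
  have [] := vr 3%N isT; have [] := vr 4%N isT; have [] := vr 5%N isT.
  rewrite /hexpoint /=; do 12!move=> ?; apply/hexagonP => i.
  by case: i => [|[|[|[|[|[|i]]]]]] // _; rewrite /hexpoint /= !tau13E //= !expr0 !mul1r; split; assumption.
- apply: forall_ord => k hk; rewrite (tnth_nth 0) inordK //.
  have m2 (a b : nat) : ('X_(inord a) * 'X_(inord b) : {mpoly K[8]}) \is 2.-homog.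
    by rewrite -mpolyXD dhomogX /= mdegD !mdeg1.
  do 14![case: k hk => [_|k hk]; first by
    rewrite /= /x13 ?expr2 ?mulrDl ?mulNr ?(rpredD, rpredB) ?rpredN ?m2].
  by [].
- apply: forall_ord => k hk v; rewrite !quadric13_value //.
  have e j := @tau13E v j.
  do 14![case: k hk => [_|k hk]; first by rewrite /= !e //= ?expr0 ?expr1; ring].
  by [].
- by move=> a b ab v Vv; apply: lift_row13_value.
exact: quadrics13_independent.
Qed.

End Genus13.

(** ** Equations of the threefold *)

Section Genus13Points.
Variable K : numClosedFieldType.
Local Notation V := (@toric_cone K 7 tab13).
Local Notation phi := (poly_map (quadrics13 K)).
Local Notation W := (image_of V (quadrics13 K)).

Lemma phi13E (v : 'rV[K]_8) k : (k < 14)%N -> phi v 0 (inord k) = nth 0 (z13 (entry v)) k.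
Proof. by move=> hk; rewrite phiE quadric13_value. Qed.

(** The monomial parametrization is dominant, by [toric_ideal_dense]. *)
Lemma torus_vanishing (Q : {mpoly K[14]}) :
  (forall s a b u : K, Q.@[fun k : 'I_14 => nth 0 (z13 (fun j =>
    nth 0 [:: s * b ^+ 2; s * b; s * a ^+ 2; s * a; s * a ^+ 2 * b; s * a * b ^+ 2;
              s * a * b; u] j)) k] = 0) ->
  vanishing_ideal W Q.
Proof.
move=> h; apply/(vanishingP (data13 K)) => v Vv; rewrite -comp_phi.
have : ideal_gen (fun F => F \is 2.-homog /\ vanishing_ideal V F) (Q \mPo quadrics13 K).
  apply: (toric_ideal_dense red13 std_uniq13) => t.
  pose u : 'rV[K]_8 := \row_k 'X_[wt tab13 k].@[t 0].
  rewrite (_ : _.@[_] = (Q \mPo quadrics13 K).@[u 0]); last first.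
    by apply: meval_eq => k; rewrite mxE.
  rewrite comp_phi -[RHS](h (t 0 (inord 0)) (t 0 (inord 1)) (t 0 (inord 2)) (t 0 (inord 3))).
  apply: meval_eq; apply: forall_ord => k hk; rewrite phi13E // inordK //; congr nth.
  have uE j : (j < 8)%N -> entry u j = t 0 (inord 0) ^+ (j < 7)%N *
     t 0 (inord 1) ^+ (nth (0, 0)%N tab13 j).1 * t 0 (inord 2) ^+ (nth (0, 0)%N tab13 j).2 *
     t 0 (inord 3) ^+ (7 <= j)%N.
    move=> hj; rewrite /entry mxE mevalX !big_ord_recl big_ord0 mulr1 !mnmE /point_weight /= !inordK //.
    rewrite -!mulrA; congr (t 0 _ ^+ _ * (t 0 _ ^+ _ * (t 0 _ ^+ _ * t 0 _ ^+ _)));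
      by apply/val_inj; rewrite /= !inordK.
  have e0 := uE 0%N isT; have e1 := uE 1%N isT; have e2 := uE 2%N isT; have e3 := uE 3%N isT.
  have e4 := uE 4%N isT; have e5 := uE 5%N isT; have e6 := uE 6%N isT; have e7 := uE 7%N isT.
  rewrite /= in e0 e1 e2 e3 e4 e5 e6 e7.
  by rewrite /z13 /= e0 e1 e2 e3 e4 e5 e6 e7 !expr0 !expr1 !mulr1 !mul1r.
move/(ideal_gen_min (J := fun F => F.@[v 0] = 0)); apply=> [|F1 F2 h1 h2|F1 F2 h1|F1 [_ h1]].
- by rewrite meval0.
- by rewrite mevalD h1 h2 addr0.
- by rewrite mevalM h1 mulr0.
exact: h1.
Qed.

(** The first seven equations have independent linear parts at the quadruple points.
    At the quintuple point this holds for the next six, and the first three, the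
    seventh and the last six start with quadratic terms. *)
Definition equations13 : seq (seq (K * seq (K * nat) * seq (K * nat))) :=
  let z k : seq (K * nat) := [:: 1 *z k] in
  [:: [:: (1, z 4, z 4); (-1, [:: 1 *z 1; 2 *z 0], z 0)];
      [:: (1, z 5, z 5); (-1, [:: 1 *z 2; 2 *z 0], z 0)];
      [:: (1, z 6, z 6); (-1, [:: 1 *z 3; 2 *z 0], z 0)];
      [:: (4, [:: 1 *z 3; (-2) *z 0], z 0); (-1, [:: 1 *z 1; 2 *z 0], [:: 1 *z 2; (-2) *z 0]);
          (-1, [:: 1 *z 2; 2 *z 0], [:: 1 *z 1; (-2) *z 0]);
          (2, [:: 1 *z 7; 1 *z 6], [:: 1 *z 7; (-1) *z 6])];
      [:: (2, [:: 1 *z 5; (-1) *z 8], z 0); (-1, [:: 1 *z 7; (-1) *z 6], z 4);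
          (1, [:: 1 *z 1; (-2) *z 0], z 5)];
      [:: (2, [:: 1 *z 9; (-1) *z 4], z 0); (-1, [:: 1 *z 2; (-2) *z 0], z 4);
          (1, [:: 1 *z 7; (-1) *z 6], z 5)];
      [:: (2, z 12, z 0); (-1, z 4, z 11); (1, z 5, z 10)];
      [:: (1, [:: 1 *z 1; (-2) *z 0], z 13); (-1, z 10, z 10)];
      [:: (1, [:: 1 *z 2; (-2) *z 0], z 13); (-1, z 11, z 11)];
      [:: (1, [:: 1 *z 3; (-2) *z 0], z 13); (-1, z 12, z 12)];
      [:: (1, [:: 1 *z 7; (-1) *z 6], z 13); (-1, z 10, z 11)];
      [:: (1, [:: 1 *z 8; (-1) *z 5], z 13); (1, z 10, z 12)];
      [:: (1, [:: 1 *z 9; (-1) *z 4], z 13); (-1, z 11, z 12)];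
      [:: (1, z 4, z 5); (-1, [:: 1 *z 7; 1 *z 6], z 0)];
      [:: (1, z 4, z 6); (-1, [:: 1 *z 8; 1 *z 5], z 0)];
      [:: (1, z 5, z 6); (-1, [:: 1 *z 9; 1 *z 4], z 0)];
      [:: (1, z 4, z 12); (1, z 6, z 10); (-2, z 11, z 0)];
      [:: (1, z 6, z 11); (-1, z 5, z 12); (-2, z 10, z 0)];
      [:: (1, z 6, z 12); (1, z 4, z 10); (-1, z 5, z 11); (1, [:: 1 *z 7; (-1) *z 6], z 12)]].

Definition combination13 (L : seq (K * nat)) : {mpoly K[14]} :=
  \sum_(t <- L) t.1 *: products_quadric 13 (nth [::] equations13 t.2).

Lemma combination13_homog L : combination13 L \is 2.-homog.
Proof. by apply: rpred_sum => t _; rewrite rpredZ // products_quadric_homog. Qed.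

Lemma equations13_vanish i : vanishing_ideal W (products_quadric 13 (nth [::] equations13 i)).
Proof.
apply: torus_vanishing => s a b u; rewrite products_quadric_eval.
do 19![case: i => [|i]; first by
  rewrite /= !big_cons big_nil /form_val !big_cons !big_nil /= !inordK //=; ring].
by rewrite nth_default // big_nil.
Qed.

Lemma combination13_vanish L : vanishing_ideal W (combination13 L).
Proof.
move=> z Wz; rewrite raddf_sum big1_seq // => t _.
by rewrite /= mevalZ equations13_vanish // mulr0.
Qed.

Lemma combination13_eval L (f : 'I_14 -> K) : (combination13 L).@[f] = \sum_(t <- L) t.1 *
  \sum_(s <- nth [::] equations13 t.2) s.1.1 * (form_val s.1.2 f * form_val s.2 f).
Proof.
by rewrite raddf_sum; apply: eq_bigr => t _; rewrite /= mevalZ products_quadric_eval.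
Qed.

Lemma ddir_combination13 L (v u : 'I_14 -> K) : ddir (combination13 L) v u = \sum_(t <- L) t.1 *
  \sum_(s <- nth [::] equations13 t.2)
    s.1.1 * (form_val s.1.2 u * form_val s.2 v + form_val s.1.2 v * form_val s.2 u).
Proof.
by rewrite ddir_sum; apply: eq_bigr => t _; rewrite ddirZ ddir_products_quadric.
Qed.

(** ** Arcs *)

Lemma z13_horner (x : nat -> {poly K}) t k : (k < 14)%N ->
  (nth 0 (z13 x) k).[t] = nth 0 (z13 (fun i => (x i).[t])) k.
Proof.
move=> hk; do 14![case: k hk => [_|k hk]; first by rewrite /= !hornerE].
by [].
Qed.

Lemma arc13 (x : nat -> {poly K}) (w T : 'rV[K]_14) e : (0 < e)%N ->
  (forall t, hexagon_relations (fun k => (x k).[t])) ->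
  (forall k, (k < 14)%N -> forall j, (j < e)%N ->
     (nth 0 (z13 x) k)`_j = if j == 0%N then w 0 (inord k) else 0) ->
  (forall k, (k < 14)%N -> (nth 0 (z13 x) k)`_e = T 0 (inord k)) ->
  exists (e : nat) (A D : 'I_14 -> {poly K}),
  [/\ (0 < e)%N, forall k, A k = (w 0 k)%:P + 'X^e * D k, forall k, (D k).[0] = T 0 k &
      forall t, (A (pivot w)).[t] != 0 -> W (\row_k (A k).[t])].
Proof.
move=> e0 xr hw hT; exists e, (fun k : 'I_14 => nth 0 (z13 x) k), (fun k : 'I_14 => drop_poly e (nth 0 (z13 x) k)).
split=> // [|k|t At].
- apply: forall_ord => k hk; rewrite inordK // -{1}(poly_take_drop e (nth 0 (z13 x) k)) mulrC.
  congr (_ + _); apply/polyP => j; rewrite coef_take_poly coefC.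
  by case: ltnP => je; [rewrite hw | rewrite gtn_eqF // (leq_trans e0)].
- by rewrite horner_coef0 coef_drop_poly add0n -[in RHS](inord_val k) hT.
pose v : 'rV[K]_8 := \row_k (x k).[t].
have E : \row_k (nth 0 (z13 x) (k : 'I_14)).[t] = phi v.
  apply/rowP; apply: forall_ord => k hk; rewrite [LHS]mxE inordK // phi13E // z13_horner //.
  have vE j : (j < 8)%N -> entry v j = (x j).[t] by move=> hj; rewrite /entry mxE inordK.
  by rewrite /z13 !vE.
rewrite E; apply: (image_phi (data13 K)); split.
  apply: contraNneq At => v0; have := congr1 (fun z : 'rV[K]_14 => z 0 (pivot w)) E; rewrite mxE => ->.
  by rewrite v0 -(scale0r 0) (phiZ (data13 K)) expr0n scale0r mxE.
apply/hexagonP => i /(xr t).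
have lt k : (hexpoint k < 8)%N by apply: (@allP _ (fun k => k < 8)%N hex isT); rewrite mem_nth ?ltn_mod.
by rewrite /entry !mxE !inordK.
Qed.

(** The ratios of opposite vertices are (a / a')^2, (b / b')^2 and
    (b a' / (b' a))^2. *)
Definition hexagon13 (A : comRingType) (s0 s1 ka a a' b b' y : A) : seq A :=
  [:: ka * s0 * a ^+ 2 * (b * b'); ka * s1 * b ^+ 2 * (a * a'); ka * s0 * a' ^+ 2 * (b * b');
      ka * (s0 * s1) * b ^+ 2 * a' ^+ 2; ka * s1 * b' ^+ 2 * (a * a');
      ka * (s0 * s1) * b' ^+ 2 * a ^+ 2; ka * (a * a') * (b * b'); y].

Lemma hexagon13_relations (s0 s1 ka a a' b b' y : K) : s0 * s0 = 1 -> s1 * s1 = 1 ->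
  hexagon_relations (nth 0 (hexagon13 s0 s1 ka a a' b b' y)).
Proof.
move=> h0 h1 i; case: i => [|[|[|[|[|[|i]]]]]] // _; rewrite /hexpoint /=; split; ring: h0 h1.
Qed.

Lemma hexagon13_horner (s0 s1 ka a a' b b' y : {poly K}) t k :
  (nth 0 (hexagon13 s0 s1 ka a a' b b' y) k).[t] =
  nth 0 (hexagon13 s0.[t] s1.[t] ka.[t] a.[t] a'.[t] b.[t] b'.[t] y.[t]) k.
Proof.
do 8![case: k => [|k]; first by rewrite /= ?hornerE].
by rewrite !nth_default // horner0.
Qed.

Lemma coefM0 (P Q : {poly K}) : (P * Q)`_0 = P`_0 * Q`_0.
Proof. by rewrite coefM big_ord1. Qed.

Lemma coefM1 (P Q : {poly K}) : (P * Q)`_1 = P`_0 * Q`_1 + P`_1 * Q`_0.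
Proof. by rewrite coefM !big_ord_recl big_ord0 addr0. Qed.

Lemma coefM2 (P Q : {poly K}) : (P * Q)`_2 = P`_0 * Q`_2 + P`_1 * Q`_1 + P`_2 * Q`_0.
Proof. by rewrite coefM !big_ord_recl big_ord0 addr0 addrA. Qed.

End Genus13Points.

(** ** The quadruple points *)

Lemma pivot_first (K : fieldType) p (w : 'rV[K]_p.+1) : w 0 ord0 != 0 -> pivot w = ord0.
Proof.
by move=> w0; rewrite /pivot /pick /enum_mem -enumT enum_ordSl /=; case: ifP => // /negP h; case: h; exact/negP.
Qed.

Section Genus13Corners.
Variable K : numClosedFieldType.
Local Notation V := (@toric_cone K 7 tab13).
Local Notation phi := (poly_map (quadrics13 K)).
Local Notation W := (image_of V (quadrics13 K)).

Definition vertex13_list (s0 s1 : K) : seq K := [:: s0; s1; s0; s0 * s1; s1; s0 * s1; 1; 0].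
Definition point13_list (s0 s1 : K) : seq K :=
  [:: 1; 2; 2; 2; 2 * s0; 2 * s1; 2 * (s0 * s1); 2 * (s0 * s1); 2 * s1; 2 * s0; 0; 0; 0; 0].

Section Corner.
Variables s0 s1 : K.
Hypotheses (h0 : s0 * s0 = 1) (h1 : s1 * s1 = 1).
Local Notation q := (4^-1 : K).

Definition cornervertex13 : 'rV[K]_8 := \row_k nth 0 (vertex13_list s0 s1) k.
Definition corner13 : 'rV[K]_14 := \row_k nth 0 (point13_list s0 s1) k.

Definition corner13_coordinates : seq (seq (K * nat)) :=
  [:: [:: 1 *z 1; (-2) *z 0]; [:: 1 *z 7; (-1) *z 6]; [:: 1 *z 10]; [:: 1 *z 2; (-2) *z 0];
      [:: 1 *z 11]; [:: 1 *z 13]].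

(** The second order terms of the coordinates along the arcs [corner13_arcs], as
    functions of the Veronese coordinates. *)
Definition corner13_directions : seq (seq (K * nat)) :=
  let d4 := [:: (s0 * q) *z 0] in let d5 := [:: (s1 * q) *z 3] in
  let d6 := [:: (s0 * s1 * q) *z 0; (s0 * s1 * q) *z 3; (- 2^-1) *z 1] in
  [:: [::]; [:: 1 *z 0]; [:: 1 *z 3]; [:: 1 *z 0; 1 *z 3; (-2 * (s0 * s1)) *z 1];
      d4; d5; d6; (1 *z 1) :: d6; [:: (- s0) *z 1, s1 *z 0 & d5]; [:: s0 *z 3, (- s1) *z 1 & d4];
      [:: 1 *z 2]; [:: 1 *z 4]; [:: s0 *z 4; (- s1) *z 2]; [:: 1 *z 5]].

Definition corner13_equations : seq (seq (K * nat)) :=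
  let e4 := [:: (s0 * q) *z 0] in let e5 := [:: (s1 * q) *z 1] in
  let e6 := [:: (s0 * s1 * q) *z 2; (s0 * s1 / 16) *z 3] in
  [:: [::]; [::]; [::]; [:: q *z 3]; e4; e5; e6; e6; (- 2^-1) *z 4 :: e5; 2^-1 *z 5 :: e4;
      [::]; [::]; [:: 2^-1 *z 6]; [::]].

Local Notation C' := (form_mx 13 5 corner13_coordinates : 'M[K]_(14, 6)).
Local Notation B' := (form_mx 5 13 corner13_directions : 'M[K]_(6, 14)).

Lemma corner13_C (u : 'rV[K]_14) k : (k < 6)%N -> (u *m C') 0 (inord k) =
  nth 0 [:: entry u 1 - 2 * entry u 0; entry u 7 - entry u 6; entry u 10;
            entry u 2 - 2 * entry u 0; entry u 11; entry u 13] k.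
Proof.
move=> hk; rewrite form_mxE //; last by case: k hk => [|[|[|[|[|[|k]]]]]].
do 6![case: k hk => [_|k hk]; first by
  rewrite /form_val /= !big_cons big_nil /= -?[u 0 _]/(entry u _); ring].
by [].
Qed.

Lemma corner13_B (u : 'rV[K]_6) k : (k < 14)%N -> (u *m B') 0 (inord k) =
  form_val (nth [::] corner13_directions k) (u 0).
Proof.
move=> hk; rewrite form_mxE //.
by do 14![case: k hk => [_|k hk]; first by []].
Qed.

Lemma corner13_entry k : (k < 14)%N -> entry corner13 k = nth 0 (point13_list s0 s1) k.
Proof. by move=> hk; rewrite /entry mxE inordK. Qed.

Lemma corner13_pivot : pivot corner13 = ord0.
Proof. by apply: pivot_first; rewrite mxE oner_eq0. Qed.

Lemma corner13_neq0 : corner13 != 0.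
Proof.
apply: contraTneq isT => E; have := congr1 (fun u : 'rV[K]_14 => u 0 ord0) E.
by rewrite !mxE => /eqP; rewrite oner_eq0.
Qed.

Lemma cornervertex13_entry k : (k < 8)%N -> entry cornervertex13 k = nth 0 (vertex13_list s0 s1) k.
Proof. by move=> hk; rewrite /entry mxE inordK. Qed.

Lemma phi_corner13 : phi cornervertex13 = corner13.
Proof.
apply/rowP; apply: forall_ord => k hk; rewrite phi13E // -[RHS]/(entry _ _) corner13_entry //.
have e j := @cornervertex13_entry j.
do 14![case: k hk => [_|k hk]; first by rewrite /= !e //=; ring: h0 h1].
by [].
Qed.

Lemma cornervertex13_cone : V cornervertex13.
Proof.
split.
  apply: contraTneq isT => E; have := @cornervertex13_entry 6 isT.
  by rewrite E /entry mxE => /eqP; rewrite eq_sym oner_eq0.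
apply/hexagonP => i i6; have e j := @cornervertex13_entry j.
by case: i i6 => [|[|[|[|[|[|i]]]]]] // _; rewrite /hexpoint /= !e //=; split; ring: h0 h1.
Qed.

Lemma corner13_in : W corner13.
Proof. by rewrite -phi_corner13; apply: (image_phi (data13 K)); exact: cornervertex13_cone. Qed.

Lemma corner13_left : B' *m C' = 1%:M.
Proof.
apply: mx_eq1 => u; rewrite mulmxA; apply/rowP; apply: forall_ord => k hk.
rewrite corner13_C // /entry.
by do 6![case: k hk => [_|k hk]; first by
  rewrite /= !corner13_B //= /form_val !big_cons !big_nil /=; field].
Qed.

Lemma corner13_kernel : corner13 *m C' = 0.
Proof.
apply/rowP; apply: forall_ord => k hk; rewrite corner13_C // [RHS]mxE.
have e j := @corner13_entry j.
by do 6![case: k hk => [_|k hk]; first by rewrite /= !e //=; ring].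
Qed.

Lemma corner13_adapted k : exists Q, [/\ Q \is 2.-homog, vanishing_ideal W Q &
  forall u : 'rV[K]_14, u 0 (pivot corner13) = 0 ->
    ddir Q (corner13 0) (u 0) = u 0 k - (u *m C' *m B') 0 k].
Proof.
move: k; apply: forall_ord => k hk; exists (combination13 (nth [::] corner13_equations k)).
split; [exact: combination13_homog | exact: combination13_vanish |].
move=> u; rewrite corner13_pivot => u0; rewrite ddir_combination13 corner13_B //.
have {}u0 : entry u 0 = 0 by rewrite -u0 /entry; congr (u 0 _); apply/val_inj; rewrite /= inordK.
have cE j := @corner13_C u j; have wE j := @corner13_entry j.
rewrite -![u 0 (inord _)]/(entry u _).
do 14![case: k hk => [_|k hk]; first by
  rewrite /= ?big_cons ?big_nil /form_val ?big_cons ?big_nil /= ?big_cons ?big_nil /=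
    -?[corner13 0 _]/(entry corner13 _) -?[u 0 _]/(entry u _) ?cE ?wE //= ?u0; field: h0 h1].
by [].
Qed.

(** The combinations of coordinates are the products of the differences of opposite
    vertices and the last coordinate. *)
Lemma corner13_veronese z : W z -> exists t, z *m C' = veronese t.
Proof.
move=> /(imageP (data13 K))[v [_ /hexagon_equations /=[[e1 e2 e3] [[e4 e5 e6] [e7 e8 e9]]]] ->].
exists (\row_(i < 3) nth 0 [:: entry v 0 - entry v 2; entry v 1 - entry v 4; entry v 7] i).
apply/rowP; apply: forall_ord => r r6; rewrite corner13_C // veronese_pairsE //.
have pE k : (k < 14)%N -> entry (phi v) k = nth 0 (z13 (entry v)) k by exact: phi13E.
rewrite !mxE; do 6![case: r r6 => [_|r r6]; first by
  rewrite /= !pE //= !inordK //=;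
  first [ring: e1 | ring: e2 | ring: e5 e8]].
by [].
Qed.

(** The vertices of the hexagon are, up to order two, the exponentials of 2 al X,
    2 be X, 2 (be - al) X and their inverses, up to signs; the factor
    1 + (al^2 + be^2) X^2 cancels the second order term of the centre. *)
Definition exponential_hexagon (al be : K) (y : {poly K}) : nat -> {poly K} :=
  nth 0 (hexagon13 s0%:P s1%:P (1 + (al ^+ 2 + be ^+ 2) *: 'X^2) (1 + al *: 'X) (1 + (- al) *: 'X)
    (1 + be *: 'X) (1 + (- be) *: 'X) y).

Lemma exponential_hexagon_relations al be y t :
  hexagon_relations (fun k => (exponential_hexagon al be y k).[t]).
Proof.
move=> i i6; rewrite /exponential_hexagon !hexagon13_horner !hornerC.
exact: (hexagon13_relations _ _ _ _ _ _ h0 h1).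
Qed.

Lemma exponential_hexagon_coef al be y k : (k < 7)%N ->
  let h := exponential_hexagon al be y k in
  let s := nth 0 (vertex13_list s0 s1) k in
  let d := nth 0 [:: al; be; - al; be - al; - be; al - be; 0] k in
  [/\ h`_0 = s, h`_1 = 2 * s * d & h`_2 = 2 * s * d ^+ 2].
Proof.
rewrite /exponential_hexagon; set ka := 1 + _ *: 'X^2.
have lin c : [/\ (1 + c *: 'X : {poly K})`_0 = 1, (1 + c *: 'X : {poly K})`_1 = c &
    (1 + c *: 'X : {poly K})`_2 = 0].
  by split; rewrite coefD coef1 coefZ coefX /=; ring.
have [ka0 ka1 ka2] : [/\ ka`_0 = 1, ka`_1 = 0 & ka`_2 = al ^+ 2 + be ^+ 2].
  by split; rewrite coefD coef1 coefZ coefXn /=; ring.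
have [a0 a1 a2] := lin al; have [a0' a1' a2'] := lin (- al).
have [b0 b1 b2] := lin be; have [b0' b1' b2'] := lin (- be).
move: ka (1 + al *: 'X) (1 + (- al) *: 'X) (1 + be *: 'X) (1 + (- be) *: 'X) ka0 ka1 ka2 a0 a1 a2 a0' a1' a2' b0 b1 b2 b0' b1' b2'.
move=> ka a a' b b' ka0 ka1 ka2 a0 a1 a2 a0' a1' a2' b0 b1 b2 b0' b1' b2'.
move=> hk; do 7![case: k hk => [_|k hk]; first by
  rewrite /= ?expr2; split; rewrite !(coefM0, coefM1, coefM2) ?coefC /=
    ?(ka0, ka1, ka2, a0, a1, a2, a0', a1', a2', b0, b1, b2, b0', b1', b2'); ring].
by [].
Qed.

Lemma corner13_arcs (t : 'rV[K]_3) : exists (e : nat) (A D : 'I_14 -> {poly K}),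
  [/\ (0 < e)%N, forall k, A k = (corner13 0 k)%:P + 'X^e * D k,
      forall k, (D k).[0] = (veronese t *m B') 0 k &
      forall s, (A (pivot corner13)).[s] != 0 -> W (\row_k (A k).[s])].
Proof.
pose a := entry t 0; pose b := entry t 1; pose c := entry t 2.
pose al := s0 * a / 4; pose be := s1 * b / 4.
pose x := exponential_hexagon al be (c *: 'X).
have vE r : (r < 6)%N -> veronese t 0 (inord r) = nth 0 [:: a ^+ 2; a * b; a * c; b ^+ 2; b * c; c ^+ 2] r.
  by move=> r6; rewrite mxE inordK.
have x7 : [/\ (x 7)`_0 = 0, (x 7)`_1 = c & (x 7)`_2 = 0].
  by rewrite /x /=; split; rewrite coefZ coefX /=; ring.
have xE k : (k < 7)%N -> _ := @exponential_hexagon_coef al be (c *: 'X) k.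
have wE k : (k < 14)%N -> corner13 0 (inord k) = nth 0 (point13_list s0 s1) k by exact: corner13_entry.
have [y0 y1 y2] := x7; have [c00 c01 c02] := xE 0%N isT; have [c10 c11 c12] := xE 1%N isT.
have [c20 c21 c22] := xE 2%N isT; have [c30 c31 c32] := xE 3%N isT.
have [c40 c41 c42] := xE 4%N isT; have [c50 c51 c52] := xE 5%N isT; have [c60 c61 c62] := xE 6%N isT.
rewrite -/x /= in c00 c01 c02 c10 c11 c12 c20 c21 c22 c30 c31 c32 c40 c41 c42 c50 c51 c52 c60 c61 c62.
have al2 : al = s0 * a / 4 by []. have be2 : be = s1 * b / 4 by [].
apply: (arc13 (x := x) (e := 2)) => //.
- by move=> s; exact: exponential_hexagon_relations.
- move=> k hk j j2; rewrite wE //; clearbody x al be a b c.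
  case: j j2 => [|[|j]] // _ /=;
  do 14![case: k hk => [_|k hk]; first by
    rewrite /= ?expr2 ?(coefB, coefD, coefM0, coefM1)
      ?(c00, c01, c10, c11, c20, c21, c30, c31, c40, c41, c50, c51, c60, c61, y0, y1); ring: h0 h1];
  by [].
move=> k hk; rewrite corner13_B //; clearbody x.
do 14![case: k hk => [_|k hk]; first by
  rewrite /= /form_val ?big_cons ?big_nil /= ?vE //= ?expr2 ?(coefB, coefD, coefM2)
    ?(c00, c01, c02, c10, c11, c12, c20, c21, c22, c30, c31, c32, c40, c41, c42, c50, c51, c52, c60, c61, c62, y0, y1, y2)
    ?al2 ?be2; field: h0 h1].
by [].
Qed.

Lemma corner13_cone : cone_over_veronese (tangent_cone W corner13).
Proof.
exact: (veronese_point_cone (@image_scale _ _ _ _ _) corner13_neq0 corner13_in corner13_left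
  corner13_kernel corner13_adapted corner13_veronese corner13_arcs).
Qed.

Lemma corner13_multiplicity : multiplicity 3 W corner13 4.
Proof.
exact: (veronese_point_multiplicity (@image_scale _ _ _ _ _) corner13_neq0 corner13_in corner13_left
  corner13_kernel corner13_adapted corner13_veronese corner13_arcs).
Qed.

Lemma corner13_singular : singular_point 3 W corner13.
Proof.
exact: (veronese_point_singular (@image_scale _ _ _ _ _) corner13_neq0 corner13_in corner13_left
  corner13_kernel corner13_arcs).
Qed.

End Corner.
End Genus13Corners.

(** ** The quintuple point *)

Section Genus13Apex.
Variable K : numClosedFieldType.
Local Notation V := (@toric_cone K 7 tab13).
Local Notation phi := (poly_map (quadrics13 K)).
Local Notation W := (image_of V (quadrics13 K)).
Local Notation h := (2^-1 : K).

(** The signs of the corner with the given index. *)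
Definition sg0 (i : nat) : K := (-1) ^+ odd i.
Definition sg1 (i : nat) : K := (-1) ^+ odd i./2.

Lemma sg0_sq i : sg0 i * sg0 i = 1. Proof. by rewrite -expr2 sqrr_sign. Qed.
Lemma sg1_sq i : sg1 i * sg1 i = 1. Proof. by rewrite -expr2 sqrr_sign. Qed.

Definition apexvertex13 : 'rV[K]_8 := delta_mx 0 (inord 7).
Definition apex13 : 'rV[K]_14 := delta_mx 0 (inord 13).

Definition apex13_coordinates : seq (seq (K * nat)) :=
  let c i := [:: 4^-1 *z 0; (sg0 i / 8) *z 4; (sg1 i / 8) *z 5; (sg0 i * sg1 i / 8) *z 6] in
  [:: [:: 1 *z 10]; [:: 1 *z 11]; [:: 1 *z 12]; c 0%N; c 1%N; c 2%N; c 3%N].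

(** The last four rows are the quadruple points: the planes of the tangent cone are
    spanned by them and by lines in the plane of the first three rows. *)
Definition apex13_directions : seq (seq (K * nat)) :=
  let c f := [seq (2 * f i : K, i.+3) | i <- iota 0 4] in
  let c4 := c sg0 in let c5 := c sg1 in let c6 := c (fun i => sg0 i * sg1 i) in
  [:: [seq (1, i.+3) | i <- iota 0 4]; c (fun=> 1); c (fun=> 1); c (fun=> 1);
      c4; c5; c6; c6; c5; c4; [:: 1 *z 0]; [:: 1 *z 1]; [:: 1 *z 2]; [::]].

Definition apex13_equations : seq (seq (K * nat)) :=
  [:: [::]; [:: 1 *z 7]; [:: 1 *z 8]; [:: 1 *z 9]; [::]; [::]; [::];
      [:: 1 *z 10]; [:: 1 *z 11]; [:: 1 *z 12]].

Local Notation C' := (form_mx 13 6 apex13_coordinates : 'M[K]_(14, 2.+1 + 4)).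
Local Notation B' := (form_mx 6 13 apex13_directions : 'M[K]_(2.+1 + 4, 14)).
Local Notation N i := (form_mx 1 2 [:: [:: 1 *z 0]; [:: 1 *z 1]; [:: (- sg1 i) *z 0; (sg0 i) *z 1]] : 'M[K]_(2, 2.+1)).
Local Notation N' := (form_mx 2 1 [:: [:: 1 *z 0]; [:: 1 *z 1]] : 'M[K]_(2.+1, 2)).

Lemma sgE : [/\ (sg0 0 = 1) * (sg1 0 = 1), (sg0 1 = -1) * (sg1 1 = 1),
  (sg0 2 = 1) * (sg1 2 = -1) & (sg0 3 = -1) * (sg1 3 = -1)].
Proof. by []. Qed.

Lemma apex13_C (u : 'rV[K]_14) k : (k < 7)%N -> (u *m C') 0 (inord k) =
  let c (s s' : K) := (entry u 0 + s / 2 * entry u 4 + s' / 2 * entry u 5 + s * s' / 2 * entry u 6) / 4 in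
  nth 0 [:: entry u 10; entry u 11; entry u 12; c 1 1; c (-1) 1; c 1 (-1); c (-1) (-1)] k.
Proof.
move=> hk; rewrite form_mxE //; last by case: k hk => [|[|[|[|[|[|[|k]]]]]]].
have [[s00 s10] [s01 s11] [s02 s12] [s03 s13]] := sgE.
do 7![case: k hk => [_|k hk]; first by
  rewrite /form_val /= !big_cons big_nil /= -?[u 0 _]/(entry u _)
    ?(s00, s10, s01, s11, s02, s12, s03, s13); field].
by [].
Qed.

Lemma apex13_B (u : 'rV[K]_7) k : (k < 14)%N -> (u *m B') 0 (inord k) =
  let c i := u 0 (inord i.+3) in
  let s4 := 2 * (c 0%N - c 1%N + c 2%N - c 3%N) in
  let s5 := 2 * (c 0%N + c 1%N - c 2%N - c 3%N) in
  let s6 := 2 * (c 0%N - c 1%N - c 2%N + c 3%N) in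
  let s := (c 0%N + c 1%N + c 2%N + c 3%N) in
  nth 0 [:: s; 2 * s; 2 * s; 2 * s; s4; s5; s6; s6; s5; s4; u 0 (inord 0); u 0 (inord 1); u 0 (inord 2); 0] k.
Proof.
move=> hk; rewrite form_mxE //; last first.
  by do 14![case: k hk => [_|k hk]; first by []].
have [[s00 s10] [s01 s11] [s02 s12] [s03 s13]] := sgE.
do 14![case: k hk => [_|k hk]; first by
  rewrite /form_val /= ?big_cons big_nil /= ?(s00, s10, s01, s11, s02, s12, s03, s13); ring].
by [].
Qed.

Lemma row_mx13 (o : 'rV[K]_3) (c : 'rV[K]_4) i : (i < 4)%N -> (row_mx o c : 'rV[K]_7) 0 (inord i.+3) =
  c 0 (inord i).
Proof.
move=> i4.
have -> : inord i.+3 = rshift 3 (inord i) :> 'I_(3 + 4) by apply/val_inj; rewrite /= !inordK.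
exact: row_mxEr.
Qed.

Lemma row_mx13l (o : 'rV[K]_3) (c : 'rV[K]_4) i : (i < 3)%N ->
  (row_mx o c : 'rV[K]_7) 0 (inord i) = o 0 (inord i).
Proof.
move=> i3.
have -> : inord i = lshift 4 (inord i) :> 'I_(3 + 4).
  by apply/val_inj; rewrite /= !inordK // (leq_trans i3).
exact: row_mxEl.
Qed.

Lemma apex13_value (o : 'rV[K]_3) (c : 'rV[K]_4) k : (k < 14)%N ->
  entry (row_mx o c *m B') k =
  let s4 := 2 * (entry c 0 - entry c 1 + entry c 2 - entry c 3) in
  let s5 := 2 * (entry c 0 + entry c 1 - entry c 2 - entry c 3) in
  let s6 := 2 * (entry c 0 - entry c 1 - entry c 2 + entry c 3) in
  let s := entry c 0 + entry c 1 + entry c 2 + entry c 3 in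
  nth 0 [:: s; 2 * s; 2 * s; 2 * s; s4; s5; s6; s6; s5; s4; entry o 0; entry o 1; entry o 2; 0] k.
Proof. by move=> hk; rewrite /entry apex13_B //= !row_mx13 // !row_mx13l. Qed.

Lemma apex13_neq0 : apex13 != 0.
Proof.
apply: contraTneq isT => E; have := congr1 (fun u : 'rV[K]_14 => u 0 (inord 13)) E.
by rewrite !mxE !eqxx => /eqP; rewrite oner_eq0.
Qed.

Lemma delta_entry n a k : (k < n.+1)%N -> (a < n.+1)%N ->
  entry (delta_mx 0 (inord a) : 'rV[K]_n.+1) k = (k == a)%:R.
Proof. by move=> hk ha; rewrite /entry mxE eqxx -val_eqE /= !inordK. Qed.

Lemma phi_apex13 : phi apexvertex13 = apex13.
Proof.
apply/rowP; apply: forall_ord => k hk; rewrite phi13E // -[RHS]/(entry _ _) delta_entry //.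
do 14![case: k hk => [_|k hk]; first by rewrite /= !delta_entry //=; ring].
by [].
Qed.

Lemma apexvertex13_cone : V apexvertex13.
Proof.
split.
  apply: contraTneq isT => E; have := @delta_entry 7 7 7 isT isT.
  by rewrite -/apexvertex13 E /entry mxE eqxx => /eqP; rewrite eq_sym oner_eq0.
apply/hexagonP => i i6.
have lt k : (hexpoint k < 7)%N by apply: (@allP _ (fun k => k < 7)%N hex isT); rewrite mem_nth ?ltn_mod.
have x0 k : (k < 7)%N -> entry apexvertex13 k = 0 by move=> k7; rewrite delta_entry ?(ltn_eqF k7) // ltnW.
by rewrite !x0 // !mul0r.
Qed.

Lemma apex13_in : W apex13.
Proof. by rewrite -phi_apex13; apply: (image_phi (data13 K)); exact: apexvertex13_cone. Qed.

Lemma apex13_left : B' *m C' = 1%:M.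
Proof.
apply: mx_eq1 => u; rewrite mulmxA; apply/rowP; apply: forall_ord => k hk.
rewrite apex13_C // /entry.
by do 7![case: k hk => [_|k hk]; first by rewrite /= ?apex13_B //=; field].
Qed.

Lemma apex13_kernel : apex13 *m C' = 0.
Proof.
apply/rowP; apply: forall_ord => k hk; rewrite apex13_C // [RHS]mxE.
by do 7![case: k hk => [_|k hk]; first by rewrite /= !delta_entry //=; ring].
Qed.

Lemma apex13_pivot (u : 'rV[K]_14) : u 0 (pivot apex13) = entry u 13.
Proof. by rewrite pivot_delta. Qed.

Lemma apex13_adapted k : exists Q, [/\ Q \is 2.-homog, vanishing_ideal W Q &
  forall u : 'rV[K]_14, u 0 (pivot apex13) = 0 ->
    ddir Q (apex13 0) (u 0) = u 0 k - (u *m C' *m B') 0 k].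
Proof.
move: k; apply: forall_ord => k hk; exists (combination13 (nth [::] apex13_equations k)).
split; [exact: combination13_homog | exact: combination13_vanish |].
move=> u; rewrite apex13_pivot => u0; rewrite ddir_combination13 apex13_B //.
have cE j := @apex13_C u j; have wE j (hj : (j < 14)%N) : entry apex13 j = (j == 13%N)%:R by exact: delta_entry.
rewrite -![u 0 (inord _)]/(entry u _).
do 14![case: k hk => [_|k hk]; first by
  rewrite /= ?big_cons ?big_nil /form_val ?big_cons ?big_nil /= ?big_cons ?big_nil /=
    -?[apex13 0 _]/(entry apex13 _) -?[u 0 _]/(entry u _) ?cE ?wE //= ?u0; field].
by [].
Qed.

Definition apex13_equation (f : 'rV[K]_2.+1 -> 'rV[K]_4 -> K) := exists Q, [/\ Q \is 2.-homog,
  vanishing_ideal W Q, forall u : 'rV[K]_14, u 0 (pivot apex13) = 0 ->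
    ddir Q (apex13 0) (u 0) = 0 &
  forall o c, Q.@[(row_mx o c *m B') 0] = f o c].

(** The coordinate that does not vanish at the point occurs in none of these
    equations. *)
Lemma apex13_combination L f : all (fun t : K * nat => (t.2 <= 6)%N || (13 <= t.2)%N) L ->
  (forall o c, \sum_(t <- L) t.1 * \sum_(s <- nth [::] (equations13 K) t.2)
    s.1.1 * (form_val s.1.2 ((row_mx o c *m B') 0) * form_val s.2 ((row_mx o c *m B') 0)) = f o c) ->
  apex13_equation f.
Proof.
move=> /allP ok hf; exists (combination13 L).
split; [exact: combination13_homog | exact: combination13_vanish | move=> u u0 | move=> o c]; last first.
  by rewrite combination13_eval hf.
rewrite ddir_combination13 big1_seq // => t /andP[_ /ok].
have wE j (hj : (j < 14)%N) : entry apex13 j = (j == 13%N)%:R by exact: delta_entry.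
case: t => c i /=; rewrite -[RHS](mulr0 c) => hi; congr (_ * _).
do 19![case: i hi => [|i] hi; first by [|
  rewrite /= ?big_cons ?big_nil /form_val ?big_cons ?big_nil /=
    -?[apex13 0 _]/(entry apex13 _) ?wE //=; ring]].
by rewrite nth_default // big_nil.
Qed.

(** Each c_i is a quarter of z0 plus halves of z4, z5, z6 with the signs of the corner;
    the products of two of these for distinct corners lie in the span of the
    equations. *)
Lemma apex13_equations1 (i j : 'I_4) : i != j -> apex13_equation (fun _ c => c 0 i * c 0 j).
Proof.
move=> ij; pose s k i : K := nth 0 [:: sg0 i; sg1 i; sg0 i * sg1 i] k.
pose m k l : K := (s k i * s l j + s l i * s k j) / 64.
apply: (apex13_combination (L := [:: (s 0%N i * s 0%N j / 64) *z 0; (s 1%N i * s 1%N j / 64) *z 1;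
  (s 2%N i * s 2%N j / 64) *z 2; (m 0%N 1%N) *z 13; (m 0%N 2%N) *z 14; (m 1%N 2%N) *z 15])) => // o c.
have vE k := @apex13_value o c k; rewrite /= ?big_cons ?big_nil /form_val ?big_cons ?big_nil /= ?big_cons ?big_nil /=.
rewrite -![(row_mx o c *m B') 0 _]/(entry (row_mx o c *m B') _) !vE //= /m /s /=.
have ci (k : 'I_4) : c 0 k = entry c k by rewrite /entry inord_val.
rewrite !ci; clear ci vE.
have [[s00 s10] [s01 s11] [s02 s12] [s03 s13]] := sgE.
have : (i != j :> nat) by [].
case: i {m s ij} => [[|[|[|[|i]]]] hi] //; case: j => [[|[|[|[|j]]]] hj] //= _;
  rewrite ?(s00, s10, s01, s11, s02, s12, s03, s13); by field.
Qed.

Lemma apex13_NE i (x : 'rV[K]_2) : x *m N i =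
  \row_(k < 3) nth 0 [:: entry x 0; entry x 1; sg0 i * entry x 1 - sg1 i * entry x 0] k.
Proof.
apply/rowP; apply: forall_ord => k k3; rewrite form_mxE //; last by case: k k3 => [|[|[|k]]].
rewrite mxE inordK //; do 3![case: k k3 => [_|k k3]; first by
  rewrite /form_val /= !big_cons big_nil /= -![x 0 _]/(entry x _); ring].
by [].
Qed.

Lemma apex13_equations2 (i : 'I_4) (u : 'cV[K]_3) : N i *m u = 0 ->
  apex13_equation (fun o c => c 0 i * (o *m u) 0 0).
Proof.
move=> Nu; pose v k := u (inord k) 0.
have dot (o : 'rV[K]_3) : (o *m u) 0 0 = entry o 0 * v 0%N + entry o 1 * v 1%N + entry o 2 * v 2%N.
  rewrite mxE !big_ord_recl big_ord0 addr0 addrA /v /entry.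
  by congr (o 0 _ * u _ 0 + o 0 _ * u _ 0 + o 0 _ * u _ 0); apply/val_inj; rewrite /= inordK.
have rows (x : 'rV[K]_2) : entry x 0 * v 0%N + entry x 1 * v 1%N +
    (sg0 i * entry x 1 - sg1 i * entry x 0) * v 2%N = 0.
  have := congr1 (fun w : 'cV[K]_1 => w 0 0) (congr1 (mulmx x) Nu).
  rewrite mulmxA mulmx0 dot apex13_NE /entry !mxE !inordK //.
have v0 : v 0%N = sg1 i * v 2%N.
  have := rows (delta_mx 0 (inord 0)); rewrite !delta_entry //= => E.
  by apply/eqP; rewrite -subr_eq0; apply/eqP; rewrite -[RHS]E; ring.
have v1 : v 1%N = - sg0 i * v 2%N.
  have := rows (delta_mx 0 (inord 1)); rewrite !delta_entry //= => E.
  by apply/eqP; rewrite -subr_eq0; apply/eqP; rewrite -[RHS]E; ring.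
apply: (apex13_combination (L := [:: (v 2%N / 8) *z 6; (v 2%N * sg0 i / 8) *z 16;
  (- v 2%N * sg1 i / 8) *z 17; (v 2%N * sg0 i * sg1 i / 8) *z 18])) => // o c.
have vE k := @apex13_value o c k; rewrite /= ?big_cons ?big_nil /form_val ?big_cons ?big_nil /= ?big_cons ?big_nil /=.
rewrite -![(row_mx o c *m B') 0 _]/(entry (row_mx o c *m B') _) !vE //= dot v0 v1.
have -> : c 0 i = entry c i by rewrite /entry inord_val.
have [[s00 s10] [s01 s11] [s02 s12] [s03 s13]] := sgE.
clear rows dot Nu v0 v1; clearbody v.
case: i => [[|[|[|[|i]]]] hi] //=;
  rewrite -?[c 0 _]/(entry c _) ?(s00, s10, s01, s11, s02, s12, s03, s13); by field.
Qed.

End Genus13Apex.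

(** ** Arcs through the quintuple point *)

Section Genus13ApexCone.
Variable K : numClosedFieldType.
Local Notation V := (@toric_cone K 7 tab13).
Local Notation phi := (poly_map (quadrics13 K)).
Local Notation W := (image_of V (quadrics13 K)).
Local Notation w := (apex13 K).
Local Notation C' := (form_mx 13 6 (apex13_coordinates K) : 'M[K]_(14, 2.+1 + 4)).
Local Notation B' := (form_mx 6 13 (apex13_directions K) : 'M[K]_(2.+1 + 4, 14)).
Local Notation N i := (form_mx 1 2 [:: [:: 1 *z 0]; [:: 1 *z 1]; [:: (- sg1 K i) *z 0; (sg0 K i) *z 1]] : 'M[K]_(2, 2.+1)).
Local Notation N' := (form_mx 2 1 [:: [:: 1 *z 0]; [:: 1 *z 1]] : 'M[K]_(2.+1, 2)).

(** Heron's polynomial: 16 times the squared area of a triangle, up to sign, in the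
    squares of the side lengths. *)
Definition heron (A : comRingType) (a b c : A) : A :=
  a ^+ 2 + b ^+ 2 + c ^+ 2 - (a * b + a * c + b * c) *+ 2.

Definition apex13_generic (o : 'rV[K]_3) : Prop :=
  heron (entry o 0 ^+ 2) (entry o 1 ^+ 2) (entry o 2 ^+ 2) != 0.

Definition apex13_arc (s : 'rV[K]_(2.+1 + 4)) := exists (e : nat) (A D : 'I_14 -> {poly K}),
  [/\ (0 < e)%N, forall k, A k = (w 0 k)%:P + 'X^e * D k,
      forall k, (D k).[0] = (s *m B') 0 k &
      forall t, (A (pivot w)).[t] != 0 -> W (\row_k (A k).[t])].

Lemma hexagon_scale (x y : nat -> K) l : (forall k, (k < 7)%N -> x k = l * y k) ->
  hexagon_relations y -> hexagon_relations x.
Proof.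
move=> xy yr i i6; have [E1 E2] := yr i i6.
have lt k : (hexpoint k < 7)%N by apply: (@allP _ (fun k => k < 7)%N hex isT); rewrite mem_nth ?ltn_mod.
rewrite !xy //; move: E1 E2; move: (y _) (y _) (y _) (y _) (y _) => a b c d f E1 E2.
by split; rewrite mulrACA ?E1 ?E2 [RHS]mulrACA.
Qed.

Lemma apex13_entry k : (k < 14)%N -> w 0 (inord k) = (k == 13%N)%:R.
Proof. by move=> hk; exact: delta_entry. Qed.

(** The solution r = a b c e, with e^-2 the value of [heron], of the equations of a
    hexagon with differences a, b, c of opposite vertices. *)
Definition difference_hexagon (a b c e : K) : seq K :=
  let a2 := a ^+ 2 in let b2 := b ^+ 2 in let c2 := c ^+ 2 in
  let p0 := a * (b2 + c2 - a2) * e in let p1 := - b * (a2 + c2 - b2) * e in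
  let p2 := c * (a2 + b2 - c2) * e in
  [:: (p0 + a) / 2; (p1 + b) / 2; (p0 - a) / 2; (p2 + c) / 2; (p1 - b) / 2; (p2 - c) / 2; a * b * c * e].

Lemma difference_hexagon_relations a b c e : e ^+ 2 * heron (a ^+ 2) (b ^+ 2) (c ^+ 2) = 1 ->
  hexagon_relations (nth 0 (difference_hexagon a b c e)).
Proof.
move=> he; have {}he : a ^+ 4 * e ^+ 2 = 1 - e ^+ 2 * (heron (a ^+ 2) (b ^+ 2) (c ^+ 2) - a ^+ 4).
  by rewrite mulrBr he /heron; ring.
rewrite /heron in he.
by case=> [|[|[|[|[|[|i]]]]]] // _; rewrite /hexpoint /=; split; field: he.
Qed.

(** The last coordinate is 1 and the others have order one; the invariant quadrics
    of order one are the products of the last coordinate with the differences. *)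
Lemma apex13_arcs1 (o : 'rV[K]_3) : apex13_generic o -> apex13_arc (row_mx o 0).
Proof.
rewrite /apex13_generic; set a := entry o 0; set b := entry o 1; set c := entry o 2 => gen.
pose e := (sqrtC (heron (a ^+ 2) (b ^+ 2) (c ^+ 2)))^-1.
have he : e ^+ 2 * heron (a ^+ 2) (b ^+ 2) (c ^+ 2) = 1 by rewrite exprVn sqrtCK mulVf.
pose x k : {poly K} := if k == 7%N then 1 else (nth 0 (difference_hexagon a b c e) k)%:P * 'X.
have xr := difference_hexagon_relations he.
have xE k : (k < 7)%N -> x k = (nth 0 (difference_hexagon a b c e) k)%:P * 'X.
  by move=> k7; rewrite /x (ltn_eqF k7).
have x7 : x 7%N = 1 by [].
apply: (arc13 (x := x) (e := 1)) => // [t|k hk j|k hk].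
- by apply: (hexagon_scale (l := t)) xr => k k7; rewrite xE // !hornerE mulrC.
- rewrite ltnS leqn0 => /eqP ->; rewrite apex13_entry // eqxx.
  have X0 y : (y%:P * 'X : {poly K})`_0 = 0 by rewrite coefMX.
  by do 14![case: k hk => [_|k hk]; first by
    rewrite /= ?x7 ?xE ?expr2 ?(X0, coefB, coefD, coefM0) ?coef1 //=; ring].
rewrite -[RHS]/(entry _ k) apex13_value // -/a -/b -/c.
have X0 y : (y%:P * 'X : {poly K})`_0 = 0 by rewrite coefMX.
have X1 y : (y%:P * 'X : {poly K})`_1 = y by rewrite coefMX coefC.
have c0 i : entry (0 : 'rV[K]_4) i = 0 by rewrite /entry mxE.
clearbody x e a b c.
by do 14![case: k hk => [_|k hk]; first by
  rewrite /= ?c0 ?x7 ?xE ?expr2 ?(X0, X1, coefB, coefD, coefM1, coefM0) ?coef1 //=; field].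
Qed.

(** The vector of the corner times a multiple of X, perturbed to first order. *)
Lemma apex13_arcs2 (i : 'I_4) (x : 'rV[K]_2) g : g != 0 ->
  apex13_arc (row_mx (x *m N i) (g *: delta_mx 0 i)).
Proof.
move=> g0; pose ga := sqrtC g; have ga2 : g = ga * ga by rewrite -expr2 sqrtCK.
have ga0 : ga != 0 by rewrite sqrtC_eq0.
have h0 := sg0_sq K i; have h1 := sg1_sq K i.
pose a := entry x 0; pose b := entry x 1.
pose al := sg0 K i * a / (4 * ga); pose be := sg1 K i * b / (4 * ga).
pose ex := exponential_hexagon (sg0 K i) (sg1 K i) al be 0.
pose y k : {poly K} := if k == 7%N then 1 else (ga *: 'X) * ex k.
have xr := exponential_hexagon_relations h0 h1 al be 0.
have yE k : (k < 7)%N -> y k = (ga *: 'X) * ex k by move=> k7; rewrite /y (ltn_eqF k7).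
have y7 : y 7%N = 1 by [].
have yc k : (k < 7)%N -> [/\ (y k)`_0 = 0, (y k)`_1 = ga * nth 0 (vertex13_list (sg0 K i) (sg1 K i)) k &
    (y k)`_2 = ga * (2 * nth 0 (vertex13_list (sg0 K i) (sg1 K i)) k *
      nth 0 [:: al; be; - al; be - al; - be; al - be; 0] k)].
  move=> k7; have [e0 e1 e2] := exponential_hexagon_coef (sg0 K i) (sg1 K i) al be 0 k7.
  by rewrite yE // -scalerAl !coefZ !coefXM /= e0 e1; split=> //; rewrite mulr0.
have [c00 c01 c02] := yc 0%N isT; have [c10 c11 c12] := yc 1%N isT; have [c20 c21 c22] := yc 2%N isT.
have [c30 c31 c32] := yc 3%N isT; have [c40 c41 c42] := yc 4%N isT; have [c50 c51 c52] := yc 5%N isT.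
have [c60 c61 c62] := yc 6%N isT; clear yc.
rewrite /= in c00 c01 c02 c10 c11 c12 c20 c21 c22 c30 c31 c32 c40 c41 c42 c50 c51 c52 c60 c61 c62.
have [c70 c71 c72] : [/\ (y 7)`_0 = 1, (y 7)`_1 = 0 & (y 7)`_2 = 0] by rewrite y7 !coef1.
apply: (arc13 (x := y) (e := 2)) => // [t|k hk j j2|k hk].
- by apply: (hexagon_scale (l := (ga *: 'X).[t])) (xr t) => k k7; rewrite yE // hornerM.
- rewrite apex13_entry //; clear xr yE; clearbody y al be ex a b ga.
  by case: j j2 => [|[|j]] // _ /=;
  do 14![case: k hk => [_|k hk]; first by
    rewrite /= ?expr2 ?(coefB, coefD, coefM0, coefM1)
      ?(c00, c01, c10, c11, c20, c21, c30, c31, c40, c41, c50, c51, c60, c61, c70, c71); ring].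
rewrite -[RHS]/(entry _ k) apex13_value //.
have dE j : (j < 4)%N -> entry (g *: delta_mx 0 i : 'rV[K]_4) j = if j == i then ga * ga else 0.
  move=> j4; rewrite /entry !mxE eqxx -val_eqE /= inordK // ga2.
  by case: eqP; rewrite ?mulr1 ?mulr0.
have xN j : (j < 3)%N -> entry (x *m N i) j = nth 0 [:: a; b; sg0 K i * b - sg1 K i * a] j.
  by move=> j3; rewrite apex13_NE /entry mxE inordK.
have al2 : al = sg0 K i * a / (4 * ga) by [].
have be2 : be = sg1 K i * b / (4 * ga) by [].
rewrite !dE // !xN // /=.
have [S0 S4 S5 S6] : let e (j : nat) : K := if j == i then ga * ga else 0 in
    let s0 := sg0 K i in let s1 := sg1 K i in
    [/\ e 0%N + e 1%N + e 2%N + e 3%N = ga * ga, e 0%N - e 1%N + e 2%N - e 3%N = s0 * (ga * ga),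
        e 0%N + e 1%N - e 2%N - e 3%N = s1 * (ga * ga) & e 0%N - e 1%N - e 2%N + e 3%N = s0 * s1 * (ga * ga)].
  have [[s00 s10] [s01 s11] [s02 s12] [s03 s13]] := sgE K.
  by case: (i) => [[|[|[|[|j]]]] hj] //=; rewrite ?(s00, s10, s01, s11, s02, s12, s03, s13); split; ring.
rewrite /= in S0 S4 S5 S6; rewrite S0 S4 S5 S6.
clear xr yE xN dE S0 S4 S5 S6; clearbody y al be ex a b ga.
by do 14![case: k hk => [_|k hk]; first by
  rewrite /= ?expr2 ?(coefB, coefD, coefM2)
    ?(c00, c01, c02, c10, c11, c12, c20, c21, c22, c30, c31, c32, c40, c41, c42, c50, c51, c52, c60, c61, c62, c70, c71, c72)
    ?al2 ?be2; field: h0 h1].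
Qed.

(** ** The tangent cone *)

Lemma heron_dense F : (forall o : 'rV[K]_3, apex13_generic o -> F.@[o 0] = 0) ->
  ideal_gen (fun=> False) F.
Proof.
move=> h; pose X i : {mpoly K[3]} := 'X_(inord i).
have HE (o : 'rV[K]_3) : (heron (X 0 ^+ 2) (X 1 ^+ 2) (X 2 ^+ 2)).@[o 0] =
    heron (entry o 0 ^+ 2) (entry o 1 ^+ 2) (entry o 2 ^+ 2).
  by rewrite /heron !(mevalB, mevalD, mevalMn, mevalM, rmorphXn) /= !mevalXU.
have -> : F = 0; last exact: ideal_gen0.
apply: (mpoly_eval_dense (G := heron (X 0 ^+ 2) (X 1 ^+ 2) (X 2 ^+ 2))) => [|v]; last first.
  by rewrite HE; exact: h.
apply/eqP => H0; have := HE (const_mx 1); rewrite H0 meval0 /entry !mxE /heron => /esym/eqP.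
by rewrite (_ : _ - _ = -3%:R); [rewrite oppr_eq0 pnatr_eq0 | ring].
Qed.

Lemma planes13_left (i : 'I_4) : N i *m N' = 1%:M.
Proof.
apply: mx_eq1 => x; rewrite mulmxA; apply/rowP; apply: forall_ord => k k2.
rewrite form_mxE //; last by case: k k2 => [|[|k]].
rewrite apex13_NE /form_val; case: k k2 => [|[|k]] //= _;
  by rewrite big_cons big_nil mxE inordK //= mul1r addr0.
Qed.

Lemma surface13_hilbert d : reldim (fun F : {mpoly K[3]} => F \is d.-homog)
  (fun F => forall o : 'rV[K]_3, True -> F.@[o 0] = 0) 'C(d + 2, d).
Proof.
apply: reldim_eq (reldim_forms K 2 d) => F; split=> [->|h] //; first by move=> o _; rewrite meval0.
by apply: mpoly_eval_eq0 => o; exact: h.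
Qed.

Local Notation B := (cone_basis w B').
Local Notation PB i := (plane_basis w (fun i : 'I_4 => N i) B' i).

Definition five_planes13 (i : 'I_5) : 'M[K]_(3, 13) :=
  if unlift ord_max i is Some j then PB j else row_mx 1%:M 0 *m B.

Lemma five_planes13E u : (exists i, plane (five_planes13 i) u) <->
  (exists i : 'I_4, plane (PB i) u) \/
  (u != 0 /\ exists2 o : 'rV[K]_3, True & u = row_mx o 0 *m B).
Proof.
have E (o : 'rV[K]_3) : o *m (row_mx 1%:M 0 *m B) = row_mx o 0 *m B.
  by rewrite mulmxA mul_mx_row mulmx1 mulmx0.
split=> [[i hi]|[[i h]|[u0 [o _ uE]]]].
- move: hi; rewrite /five_planes13; case: unliftP => [j _ h|_ [u0 /submxP[o uE]]]; first by left; exists j.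
  by right; split=> //; exists o => //; rewrite uE E.
- by exists (lift ord_max i); rewrite /five_planes13 liftK.
exists ord_max; rewrite /five_planes13 unlift_none; split=> //.
by rewrite uE -E submxMl.
Qed.

Lemma five_planes13_distinct : distinct_planes five_planes13.
Proof.
have inj := @cone_basis_inj _ _ _ (apex13_neq0 K) _ _ _ (apex13_left K) (apex13_kernel K).
split=> [i|i j]; rewrite /five_planes13.
  case: unliftP => [j _|_].
    exact: (plane_basis_free (apex13_neq0 K) planes13_left (apex13_left K) (apex13_kernel K)).
  apply/row_freeP; exists (insertion w *m C' *m (col_mx 1%:M 0 : 'M[K]_(2.+1 + 4, 2.+1))).
  rewrite mulmxA -[_ *m B *m _]mulmxA (cone_basis_left (apex13_neq0 K) (apex13_left K) (apex13_kernel K)).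
  have E : row_mx (1%:M : 'M[K]_3) (0 : 'M[K]_(3, 4)) *m col_mx (1%:M : 'M[K]_3) (0 : 'M[K]_(4, 3)) = 1%:M.
    by rewrite mul_row_col mulmx1 mulmx0 addr0.
  rewrite mulmx1; exact: E.
have ne (k : 'I_4) : ~ (PB k <= row_mx 1%:M 0 *m B)%MS.
  move=> le; have := submx_trans (plane_basis_delta w _ B' k) le; case/submxP => y.
  rewrite [RHS]mulmxA mul_mx_row mulmx1 mulmx0 => /inj/eq_row_mx[_ /(congr1 (fun v : 'rV[K]_4 => v 0 k))] /eqP.
  by rewrite !mxE !eqxx oner_eq0.
case: unliftP => [k ->|->]; case: unliftP => [l ->|->] //.
- by move/(plane_basis_inj (apex13_neq0 K) (apex13_left K) (apex13_kernel K)) ->.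
- by case/andP => /ne.
- by case/andP => _ /ne.
Qed.

Lemma apex13_multiplicity : multiplicity 3 W w 5.
Proof.
apply: (four_planes_point_multiplicity (@image_scale _ _ _ _ _) (apex13_neq0 K) (apex13_in K)
  planes13_left (S0 := fun=> True) _ heron_dense _ (fun o h => I)
  (apex13_left K) (apex13_kernel K) (@apex13_adapted K) _ (@apex13_equations1 K) (@apex13_equations2 K)
  apex13_arcs1 apex13_arcs2 _ _ surface13_hilbert) => //.
- exact: (planes_ideal (apex13_neq0 K) (apex13_left K) (apex13_kernel K) five_planes13E).
move=> d; have := bin_sub (leq_addl d 2); rewrite addnK addn2 => ->.
have := mul_bin_diag d.+2 1; have := mul_bin_diag d.+1 1.
by rewrite !bin1; lia.
Qed.

Lemma apex13_tangent_cone : cone_over_five_planes (tangent_cone W w).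
Proof.
exists five_planes13; first exact: five_planes13_distinct.
apply: (four_planes_point_cone (@image_scale _ _ _ _ _) (apex13_neq0 K) (apex13_in K)
  planes13_left (S0 := fun=> True) heron_dense _ (fun o h => I)
  (@apex13_adapted K) _ (@apex13_equations1 K) (@apex13_equations2 K)
  apex13_arcs1 apex13_arcs2) => // f.
exact: (planes_ideal (apex13_neq0 K) (apex13_left K) (apex13_kernel K) five_planes13E).
Qed.

Lemma apex13_singular : singular_point 3 W w.
Proof.
exact: (four_planes_point_singular (@image_scale _ _ _ _ _) (apex13_neq0 K) (apex13_in K)
  (S0 := fun=> True) heron_dense _ (apex13_left K) (apex13_kernel K) apex13_arcs1 apex13_arcs2).
Qed.

End Genus13ApexCone.

(** ** The threefold of genus 13 *)

Section Genus13Theorem.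
Variable K : numClosedFieldType.
Local Notation V := (@toric_cone K 7 tab13).

Definition fixedpoint13 (i : nat) : 'rV[K]_8 :=
  if (i < 4)%N then cornervertex13 (sg0 K i) (sg1 K i) else apexvertex13 K.

Definition point13 (i : nat) : 'rV[K]_14 :=
  if (i < 4)%N then corner13 (sg0 K i) (sg1 K i) else apex13 K.

Lemma phi_fixedpoint13 i : poly_map (quadrics13 K) (fixedpoint13 i) = point13 i.
Proof.
rewrite /fixedpoint13 /point13; case: ifP => _; last exact: phi_apex13.
exact: phi_corner13 (sg0_sq K i) (sg1_sq K i).
Qed.

Lemma fixedpoint13_cone i : V (fixedpoint13 i).
Proof.
rewrite /fixedpoint13; case: ifP => _; last exact: apexvertex13_cone.
exact: cornervertex13_cone (sg0_sq K i) (sg1_sq K i).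
Qed.

Lemma tau_fixedpoint13 i : tau13 (fixedpoint13 i) = (-1) ^+ (4 <= i)%N *: fixedpoint13 i.
Proof.
apply/rowP; apply: forall_ord => k hk; rewrite -[LHS]/(entry _ _) tau13E // [RHS]mxE -[_ 0 (inord k)]/(entry _ k).
have hk' : (tau_index k < 8)%N by exact: (@allnP 8 (fun k => tau_index k < 8)%N k isT hk).
rewrite /fixedpoint13; have [i4|i4] := ltnP i 4.
  rewrite !cornervertex13_entry // expr0 mul1r.
  clear hk'; by do 8![case: k hk => [_|k hk]; first by rewrite /= ?expr0 ?expr1 ?mul1r ?mulr0].
rewrite !delta_entry // expr1.
by clear hk'; do 8![case: k hk => [_|k hk]; first by rewrite /= ?expr0 ?expr1 ?mul1r ?mulr0].
Qed.

Lemma sign_index (s0 s1 : K) : s0 ^+ 2 = 1 -> s1 ^+ 2 = 1 ->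
  exists2 i, (i < 4)%N & s0 = sg0 K i /\ s1 = sg1 K i.
Proof.
move=> /eqP; rewrite sqrf_eq1 => h0 /eqP; rewrite sqrf_eq1 => h1.
have [[s00 s10] [s01 s11] [s02 s12] [s03 s13]] := sgE K.
case/orP: h0 => /eqP ->; case/orP: h1 => /eqP ->.
- by exists 0%N; rewrite // s00 s10.
- by exists 2%N; rewrite // s02 s12.
- by exists 1%N; rewrite // s01 s11.
by exists 3%N; rewrite // s03 s13.
Qed.

Lemma fixed13 (v : 'rV[K]_8) : V v ->
  (forall i, neg13 i -> (v *m M13 K) 0 i = 0) \/ (forall i, ~~ neg13 i -> (v *m M13 K) 0 i = 0) ->
  exists i : 'I_5, (v == fixedpoint13 i)%MS.
Proof.
move=> Vv; have v0 := Vv.1; have /= [[e1 e2 e3] [[e4 e5 e6] [e7 e8 e9]]] := hexagon_equations Vv.2.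
have two : (2 : K) != 0 by rewrite pnatr_eq0.
have half (x : K) : x / 2 = 0 -> x = 0 by move/eqP; rewrite mulf_eq0 invr_eq0 (negPf two) orbF => /eqP.
case=> h.
- have hz k : (k < 8)%N -> k \in [:: 3; 4; 5; 7]%N -> (v *m M13 K) 0 (inord k) = 0.
    by move=> k8 kn; apply: h; rewrite /neg13 inordK.
  have := hz 3%N isT isT; have := hz 4%N isT isT; have := hz 5%N isT isT; have := hz 7%N isT isT.
  rewrite !M13E //= => x7 /half/eqP; rewrite subr_eq0 => /eqP x35 /half/eqP.
  rewrite subr_eq0 => /eqP x14 /half/eqP; rewrite subr_eq0 => /eqP x02; clear hz h.
  pose r := entry v 6.
  have r0 : r != 0.
    apply: contraNneq v0 => r0; apply/eqP/rowP; apply: forall_ord => k hk; rewrite [RHS]mxE -[LHS]/(entry v k).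
    have sq (x : K) : x * x = r * r -> x = 0.
      by move/eqP; rewrite r0 mulr0 mulf_eq0 orbb => /eqP.
    have x2 : entry v 2 = 0 by apply: sq; rewrite -{1}x02.
    have x4 : entry v 4 = 0 by apply: sq; rewrite -{1}x14.
    have x5 : entry v 5 = 0 by apply: sq; rewrite -{1}x35.
    by case: k hk => [|[|[|[|[|[|[|[|k]]]]]]]] // _; rewrite ?x02 ?x14 ?x35.
  have s_sq x : x * x = r * r -> (x / r) ^+ 2 = 1 by move=> E; rewrite expr2 mulrACA E -invfM divff ?mulf_neq0.
  have [i i4 [s0E s1E]] := @sign_index (entry v 0 / r) (entry v 1 / r)
    (s_sq _ (etrans (congr1 _ x02) e1)) (s_sq _ (etrans (congr1 _ x14) e2)).
  exists (Ordinal (leqW i4)); rewrite /fixedpoint13 /= i4 -s0E -s1E; apply/eqrVP; exists r => //.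
  have x3 : entry v 3 * r = entry v 0 * entry v 1 by rewrite -e5 -x02 mulrC.
  apply/rowP; apply: forall_ord => k hk; rewrite [RHS]mxE -![_ 0 (inord k)]/(entry _ k) cornervertex13_entry //.
  have x3' : entry v 3 = r * (entry v 0 / r * (entry v 1 / r)).
    by apply: (mulIf r0); rewrite x3; field.
  by do 8![case: k hk => [_|k hk]; first by
    rewrite /= -?x02 -?x14 -?x35 ?x7 ?mulr0 ?mulr1 -?x3' // mulrC divfK].
have hz k : (k < 8)%N -> k \notin [:: 3; 4; 5; 7]%N -> (v *m M13 K) 0 (inord k) = 0.
  by move=> k8 kn; apply: h; rewrite /neg13 inordK.
have := hz 0%N isT isT; have := hz 1%N isT isT; have := hz 2%N isT isT; have := hz 6%N isT isT.
rewrite !M13E //= => x6 /half/eqP; rewrite addr_eq0 => /eqP x35 /half/eqP.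
rewrite addr_eq0 => /eqP x14 /half/eqP; rewrite addr_eq0 => /eqP x02; clear hz h.
have sq (x y : K) : x = - y -> x * y = entry v 6 * entry v 6 -> y = 0.
  by move=> ->; rewrite x6 mulr0 mulNr => /eqP; rewrite oppr_eq0 mulf_eq0 orbb => /eqP.
have x2 := sq _ _ x02 e1; have x4 := sq _ _ x14 e2; have x5 := sq _ _ x35 e3.
rewrite x2 oppr0 in x02; rewrite x4 oppr0 in x14; rewrite x5 oppr0 in x35.
have vE k : (k < 8)%N -> entry v k = entry v 7 * (k == 7%N)%:R.
  by case: k => [|[|[|[|[|[|[|[|k]]]]]]]] //= _; rewrite ?mulr0 ?mulr1.
exists ord_max; rewrite /fixedpoint13 /=; apply/eqrVP; exists (entry v 7).
  apply: contraNneq v0 => x7; apply/eqP/rowP; apply: forall_ord => k hk.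
  by rewrite [RHS]mxE -[LHS]/(entry v k) vE // x7 mul0r.
apply/rowP; apply: forall_ord => k hk; rewrite [RHS]mxE -![_ 0 (inord k)]/(entry _ k) delta_entry //.
exact: vE.
Qed.

Lemma fixedpoint13_inj (i j : 'I_5) : (fixedpoint13 i == fixedpoint13 j)%MS -> i = j.
Proof.
case/eqrVP => c c0 E; have {}E k : entry (fixedpoint13 i) k = c * entry (fixedpoint13 j) k.
  by rewrite E /entry mxE.
have e0 := E 0%N; have e1 := E 1%N; have e6 := E 6%N; clear E; move: e0 e1 e6; rewrite /fixedpoint13.
have s1 (l : nat) : (-1 : K) ^+ l != 0 by rewrite signr_eq0.
case: (ltnP i 4) => hi; case: (ltnP j 4) => hj; rewrite ?cornervertex13_entry ?delta_entry //= ?mulr0.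
- move=> e0 e1; rewrite mulr1 => c1; rewrite -c1 !mul1r in e0 e1; apply/val_inj => /=.
  have ne : (1 : K) <> -1 by move/eqP; rewrite -subr_eq0 opprK -(natrD _ 1 1) pnatr_eq0.
  have ne' : (-1 : K) <> 1 by move=> /esym.
  move: (nat_of_ord i) (nat_of_ord j) hi hj e0 e1 => {}i {}j.
  have [[s00 s10] [s01 s11] [s02 s12] [s03 s13]] := sgE K.
  by case: i => [|[|[|[|i]]]] // _; case: j => [|[|[|[|j]]]] // _;
    rewrite ?(s00, s10, s01, s11, s02, s12, s03, s13).
- by move=> /eqP; rewrite (negPf (s1 _)).
- by move=> /esym/eqP; rewrite mulf_eq0 (negPf c0) (negPf (s1 _)).
by move=> _ _ _; apply/val_inj => /=; have := ltn_ord i; have := ltn_ord j; lia.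
Qed.

Lemma join13 (i : 'I_5) (a b : K) : i != ord_max -> (a != 0) || (b != 0) ->
  V (a *: fixedpoint13 i + b *: fixedpoint13 (ord_max : 'I_5)).
Proof.
move=> /index_lt4 i4 ab.
have vE k : (k < 8)%N -> entry (a *: fixedpoint13 i + b *: fixedpoint13 (ord_max : 'I_5)) k =
    a * entry (fixedpoint13 i) k + b * (k == 7%N)%:R.
  by move=> hk; rewrite -[in RHS](@delta_entry K 7 7) // /entry !mxE.
apply: (@hexagon_cone _ (a *: fixedpoint13 i)) => [|j k j' k' h|k hk].
- apply: contraTneq ab => E; have := vE 7%N isT; have := vE 6%N isT.
  rewrite E /fixedpoint13 i4 !cornervertex13_entry //= /entry !mxE !(mulr0, mulr1, addr0, add0r).
  by move=> <- <-; rewrite eqxx.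
- by rewrite !mxE mulrACA ((fixedpoint13_cone i).2 _ _ _ _ h) [RHS]mulrACA.
by rewrite vE 1?ltnW // (ltn_eqF hk) mulr0 addr0 /entry mxE.
Qed.

Lemma charts13 (v : 'rV[K]_8) : V v -> (exists i, ~~ neg13 i /\ (v *m M13 K) 0 i != 0) ->
  exists ex i0 i1 i2, chart_ok 7 tab13 ex i0 i1 i2 /\ v 0 (inord i0) != 0.
Proof.
move=> Vv [i [ni yi]]; have [[k k6 vk]|h] := vertex13 Vv.2.
  by exists (exponents13 k), k, (neighbours13 k).1, (neighbours13 k).2; split=> //; exact: chart13.
case/eqP: yi; move: i ni; apply: forall_ord => i hi; rewrite /neg13 inordK // M13E //.
by case: i hi => [|[|[|[|[|[|[|[|i]]]]]]]] //= _ _; rewrite !h // ?addr0 ?mul0r.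
Qed.

Lemma fixedpoint13_even (i : 'I_5) : i != ord_max -> tau13 (fixedpoint13 i) = fixedpoint13 i.
Proof. by move=> /index_lt4 i4; rewrite tau_fixedpoint13 leqNgt i4 scale1r. Qed.

Lemma fixedpoint13_odd : tau13 (fixedpoint13 (ord_max : 'I_5)) = - fixedpoint13 (ord_max : 'I_5).
Proof. by rewrite tau_fixedpoint13 expr1 scaleN1r. Qed.

Lemma point13_corner (i : 'I_5) : i != ord_max -> point13 i = corner13 (sg0 K i) (sg1 K i).
Proof. by move=> /index_lt4 i4; rewrite /point13 i4. Qed.

Lemma fixedpoint13_singular (i : 'I_5) :
  singular_point 3 (image_of V (quadrics13 K)) (poly_map (quadrics13 K) (fixedpoint13 i)).
Proof.
rewrite phi_fixedpoint13; have [->|im] := eqVneq i ord_max; first exact: apex13_singular.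
by rewrite point13_corner //; exact: corner13_singular (sg0_sq K i) (sg1_sq K i).
Qed.

Lemma fixedpoint13_cones : let W := image_of V (quadrics13 K) in
  let P (i : 'I_5) := poly_map (quadrics13 K) (fixedpoint13 i) in
  (forall i, i != ord_max -> multiplicity 3 W (P i) 4 /\ cone_over_veronese (tangent_cone W (P i))) /\
  (multiplicity 3 W (P ord_max) 5 /\ cone_over_five_planes (tangent_cone W (P ord_max))).
Proof.
split=> [i im|]; rewrite phi_fixedpoint13; last first.
  by split; [exact: apex13_multiplicity | exact: apex13_tangent_cone].
have h0 := sg0_sq K i; have h1 := sg1_sq K i; rewrite point13_corner //.
by split; [exact: corner13_multiplicity | exact: corner13_cone].
Qed.

End Genus13Theorem.

Theorem theorem1p5 (R : realType) (c : EF_case) :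
  let W := EF_threefold R[i] c in
  quotient_embedding (cone R[i] c) (involution R[i] c) (quadrics R[i] c) /\
  generated_by_quadrics (vanishing_ideal W) /\
  exists P : 'I_5 -> 'rV[R[i]]_(genus c).+1,
    (forall i j, (P i == P j)%MS -> i = j) /\
    (forall w, singular_point 3 W w <-> w != 0 /\ exists i, (w == P i)%MS) /\
    (forall w, singular_point 3 W w <->
       w != 0 /\ exists v, [/\ cone R[i] c v, (involution R[i] c v == v)%MS &
                               (w == poly_map (quadrics R[i] c) v)%MS]) /\
    ~ similar_points 3 W P /\
    (forall i, i != ord_max -> associated W (P ord_max) (P i)) /\
    (forall i j, i != ord_max -> j != ord_max -> ~ associated W (P i) (P j)) /\
    (forall i, i != ord_max -> multiplicity 3 W (P i) 4 /\
                               cone_over_veronese (tangent_cone W (P i))) /\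
    match c with
    | P13 => multiplicity 3 W (P ord_max) 5 /\
             cone_over_five_planes (tangent_cone W (P ord_max))
    | P17 => multiplicity 3 W (P ord_max) 6 /\
             cone_over_four_planes_quadric (tangent_cone W (P ord_max))
    end.
Proof.
case: c; rewrite /EF_threefold /= ?V13_toric ?V17_toric.
  exact: (five_points (data13 _) (fun i => fixedpoint13_cone _ i) (@fixedpoint13_even _)
    (@fixedpoint13_odd _) (@join13 _) (@fixedpoint13_inj _) (@fixed13 _) (@charts13 _)
    (@fixedpoint13_singular _) (@fixedpoint13_cones _)).
exact: (five_points (data17 _) (@vertex17_in _) (@vertex17_even _) (@vertex17_odd _) (@join17 _)
  (@vertex17_inj _) (@fixed17 _) (@charts17 _) (@vertex17_singular _) (@vertex17_cones _)).
Qed.
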